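(* Fix an integer weight $k\ge2$ and a congruence type $\rho$ for a finite index subgroup $\Gamma\subseteq\mathrm{SL}_2(\mathbb{Z})$ with a $\mathbb{Q}^{\mathrm{ab}}$-structure $V(\rho,\mathbb{Q}^{\mathrm{ab}})$. Let $P\in\mathbb{Q}$ be at least the Sturm bound for $k$ and $\rho$, i.e. such that the truncation map $\mathrm{fe}_P:\mathrm{M}_k(\rho)\to\mathrm{FE}_P(\mathbb{C})\otimes V(\rho)$ is injective. Then the algorithm described in the context terminates and outputs a basis of the image of $\mathrm{fe}_P:\mathrm{M}_k(\rho)\to\mathrm{FE}_P(\mathbb{C})\otimes V(\rho)$, and this basis is contained in $\mathrm{FE}_P(\mathbb{Q}^{\mathrm{ab}})\otimes V(\rho,\mathbb{Q}^{\mathrm{ab}})$.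
   Context: Notation: a congruence type of level $N$ is a finite-dimensional complex representation $\rho$ of $\Gamma$ with $\Gamma(N)\subseteq\ker\rho$, $N$ minimal. $\mathrm{M}_k(\rho)$ is the space of holomorphic $f:\mathbb{H}\to V(\rho)$ of moderate growth at all cusps with $(c\tau+d)^{-k}\rho(\gamma)^{-1}f(\gamma\tau)=f(\tau)$ for all $\gamma=\begin{pmatrix}a&b\\c&d\end{pmatrix}\in\Gamma$; its elements have Fourier expansions $\mathrm{fe}(f)=\sum_{n\in\mathbb{Q}}c(f;n)q^n$, $c(f;n)\in V(\rho)$, $q^n=e^{2\pi i n\tau}$. $\mathrm{FE}(R)=\bigcup_{M\ge1}R[[q^{1/M}]][q^{-1}]$ (Puiseux series) and $\mathrm{FE}_B(R)=\mathrm{FE}(R)/q^B\bigcup_M R[[q^{1/M}]]$; $\mathrm{fe}_P(f)=\sum_{n<P}c(f;n)q^n$. A $\mathbb{Q}^{\mathrm{ab}}$-structure is a $\rho$-stable $\mathbb{Q}^{\mathrm{ab}}$-subspace $V(\rho,\mathbb{Q}^{\mathrm{ab}})$ with $V(\rho)=V(\rho,\mathbb{Q}^{\mathrm{ab}})\otimes\mathbb{C}$. For $M\ge1$, $\rho_M=\mathrm{Ind}_{\Gamma_1(M)}^{\mathrm{SL}_2(\mathbb{Z})}\mathbb{1}$ with permutation basis $\mathfrak{e}_\gamma$ and dual basis $\mathfrak{e}^\vee_\gamma$ (giving $\mathbb{Q}^{\mathrm{ab}}$-structures); invariants $\mathrm{H}^0(\cdot,\mathbb{Q}^{\mathrm{ab}})$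 are $\Gamma$-invariants in these $\mathbb{Q}^{\mathrm{ab}}$-structures. $G_{k,M,c,d}$ are the Eisenstein series $\sum_{(c',d')\ne(0,0),(c',d')\equiv(c,d)\bmod M}(c'\tau+d')^{-k}$ (for weights $1,2$ by analytic continuation, in weight 2 the holomorphic modification). Let $\Phi(\mathfrak{e}^\vee_{\gamma_1}\otimes v)=G_{k,N,c_1,d_1}v$ and $\Phi(\mathfrak{e}^\vee_{\gamma_2}\otimes\mathfrak{e}^\vee_{\gamma_3}\otimes w)=G_{l,N_0,c_2,d_2}G_{k-l,N_0,c_3,d_3}w$, where $(c_i,d_i)$ is the bottom row of $\gamma_i^{-1}$, extended linearly (this maps invariants to $\mathrm{M}_k(\rho)$). Algorithm: (1) let $N$ be the level of $\rho$, choose $1\le l\le k-1$ and a positive integer $N_0$ with $N\mid N_0$ such that $\mathrm{M}_k(\rho)$ is spanned by $\Phi(\mathrm{H}^0(\rho_N^\vee\otimes\rho))+\Phi(\mathrm{H}^0(\rho_{N_0}^\vee\otimes\rho_{N_0}^\vee\otimes\rho))$ (such $N_0$ exists by a theorem of Raum–Xia), and replace $P$ by $\lceil PN\rceil/N$; (2) fix a basis $v_1,\dots,v_{\dim\rho}$ of $V(\rho,\mathbb{Q}^{\mathrm{ab}})$ and start with an empty matrix $M$ with $PN\dim\rho$ columns over $\mathbb{Q}^{\mathrm{ab}}$; (3) choose a basis $\mathcal{B}$ of $\mathrm{H}^0(\rho_N^\vee\otimes\rho,\mathbb{Q}^{\mathrm{ab}})\oplus\mathrm{H}^0(\rho_{N_0}^\vee\otimes\rho_{N_0}^\vee\otimes\rho,\mathbb{Q}^{\mathrm{ab}})$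 and a partition $\mathcal{B}=\mathcal{B}_1\sqcup\dots\sqcup\mathcal{B}_I$; (4) for $i=1,\dots,I$: for each $b\in\mathcal{B}_i$ compute the truncated expansion $f=\sum_jf_jv_j=\mathrm{fe}_P(\Phi(b))$ (by multiplying and adding truncated expansions of the Eisenstein series) and append the row of coefficients $c(f_j;n/N)$, $0\le n<NP$, $1\le j\le\dim\rho$, to $M$; then replace $M$ by its reduced row echelon form; if $\mathrm{rank}\,M=\dim\mathrm{M}_k(\rho)$, output, for each row of $M$, the truncated Fourier expansion with these coefficients, and stop. *)

(* Defs.v *)
From HB Require Import structures.
From mathcomp Require Import all_boot all_order all_algebra all_fingroup all_field.
From mathcomp Require Import all_classical all_reals all_analysis.
From mathcomp Require Import complex.

Set Implicit Arguments.
Unset Strict Implicit.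
Unset Printing Implicit Defensive.

Import Order.TTheory GRing.Theory Num.Theory numFieldNormedType.Exports.

Local Open Scope classical_set_scope.
Local Open Scope ring_scope.
Local Open Scope complex_scope.

(* R[i] packaged as a numClosedFieldType, so that it inherits the canonical
   topology of numeric fields; [derivable f z 1] is then complex
   differentiability of f : Cplx R -> Cplx R at z. *)
Definition Cplx (R : realType) : numClosedFieldType := R[i].

Section ComplexFunctions.
Variable R : realType.
Local Notation C := (Cplx R).

Definition upper := {z : C | 0 < complex.Im z}.

Definition cexp (z : C) : C :=
  (expR (complex.Re z))%:C * (cos (complex.Im z) +i* sin (complex.Im z)).

(* q^r = exp(2 pi i r tau) *)
Definition qpow (r : rat) (t : upper) : C :=
  cexp (2 * (pi : R)%:C * 'i * ratr r * val t).

Definition ext0 (g : upper -> C) (z : C) : C :=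
  if insub z is Some t then g t else 0.

Definition holomorphic d (f : upper -> 'cV[C]_d) :=
  forall (i : 'I_d) (t : upper), derivable (ext0 (fun s => f s i 0)) (val t) 1.

End ComplexFunctions.

(* The maximal abelian extension of the rationals inside C: the union of the
   images of all finite abelian extensions.  A splittingFieldType over rat is
   automatically Galois over rat. *)
Definition Qab (R : realType) : set (Cplx R) :=
  [set z | exists (L : splittingFieldType rat) (phi : {rmorphism L -> Cplx R}),
     abelian 'Gal({:L} / 1) /\ exists x : L, phi x = z].

Section LinearAlgebra.
Variable R : realType.
Local Notation C := (Cplx R).

(* b is a basis, over the subfield K of C, of the K-subspace S of W. *)
Definition basis_over (W : lmodType C) (K : set C) (S : set W) (b : seq W) :=
  [/\ forall i : 'I_(size b), S b`_i,
      forall w, S w -> exists2 a : 'I_(size b) -> C,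
        (forall i, K (a i)) & w = \sum_(i < size b) a i *: b`_i &
      forall a : 'I_(size b) -> C, (forall i, K (a i)) ->
        \sum_(i < size b) a i *: b`_i = 0 -> forall i, a i = 0].

(* Complex dimension; 0 by convention if S is not finite-dimensional. *)
Definition dimension (W : lmodType C) (S : set W) : nat :=
  xget 0%N [set n | exists2 b : seq W, basis_over setT S b & size b = n].

Definition is_rref (F : fieldType) r n (E : 'M[F]_(r, n)) :=
  exists p : 'I_r -> 'I_n,
    [/\ forall i j : 'I_r, (i < j)%N -> (p i < p j)%N,
        forall (i : 'I_r) (j : 'I_n), (j < p i)%N -> E i j = 0 &
        forall i k : 'I_r, E k (p i) = (k == i)%:R].

(* The reduced row echelon form of A without its zero rows. *)
Definition rref (F : fieldType) m n (A : 'M[F]_(m, n)) : 'M[F]_(\rank A, n) :=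
  xget 0 [set E : 'M[F]_(\rank A, n) | is_rref E /\ (E == A)%MS].

End LinearAlgebra.

Section SL2.

Definition SL2Z : set 'M[int]_2 := [set g | \det g = 1].

Definition is_subgroup (G : set 'M[int]_2) :=
  [/\ G `<=` SL2Z, G 1%:M, (forall g h, G g -> G h -> G (g *m h)) &
      forall g, G g -> G (invmx g)].

Definition ltrans (g : 'M[int]_2) (S : set 'M[int]_2) : set 'M[int]_2 :=
  [set g *m h | h in S].

Definition lcosets (G : set 'M[int]_2) : set (set 'M[int]_2) :=
  [set ltrans g G | g in SL2Z].

Definition finite_index (G : set 'M[int]_2) := finite_set (lcosets G).

(* Gamma(N) *)
Definition Gamma_pr (N : nat) : set 'M[int]_2 :=
  [set g | SL2Z g /\
     forall i j, (g i j = (1%:M : 'M[int]_2) i j %[mod N%:Z])%Z].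

(* Gamma_1(N) *)
Definition Gamma_1 (N : nat) : set 'M[int]_2 :=
  [set g | SL2Z g /\ [/\ (g ord0 ord0 = 1 %[mod N%:Z])%Z,
                          (g ord_max ord0 = 0 %[mod N%:Z])%Z &
                          (g ord_max ord_max = 1 %[mod N%:Z])%Z]].

(* Bottom row of g^-1 for a representative g of the coset S = g Gamma_1(N);
   modulo N it does not depend on g. *)
Definition brow (S : set 'M[int]_2) : int * int :=
  let g := invmx (xget 1%:M S) in (g 1 0, g 1 1).

End SL2.

Section CongruenceTypes.
Variables (R : realType) (d : nat).
Local Notation C := (Cplx R).
Local Notation V := 'cV[C]_d.
Variables (Gam : set 'M[int]_2) (rho : 'M[int]_2 -> 'M[C]_d).

Definition is_repr :=
  rho 1%:M = 1%:M /\
  forall g h, Gam g -> Gam h -> rho (g *m h) = rho g *m rho h.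

Definition trivial_on (N : nat) :=
  forall g, Gamma_pr N g -> Gam g /\ rho g = 1%:M.

Definition is_level (N : nat) :=
  [/\ (0 < N)%N, trivial_on N &
      forall M : nat, (0 < M)%N -> trivial_on M -> (N <= M)%N].

(* V0 (x) C = V is expressed by a Qab-basis of V0 that is a C-basis of V. *)
Definition Qab_structure (V0 : set V) :=
  [/\ [/\ V0 0, (forall u w, V0 u -> V0 w -> V0 (u + w)) &
          forall a w, Qab a -> V0 w -> V0 (a *: w)],
      forall g w, Gam g -> V0 w -> V0 (rho g *m w) &
      exists2 b : seq V, basis_over (@Qab R) V0 b & basis_over setT setT b].

Definition jfac (g : 'M[int]_2) (t : upper R) : C :=
  (g 1 0)%:~R * val t + (g 1 1)%:~R.

(* For g in SL2Z the quotient lies in the upper half plane, so the default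
   value of insubd is not used. *)
Definition mobius (g : 'M[int]_2) (t : upper R) : upper R :=
  insubd t (((g 0 0)%:~R * val t + (g 0 1)%:~R) / jfac g t).

Definition moderate_growth (k : nat) (f : upper R -> V) :=
  forall g, SL2Z g -> exists (A y0 : R) (a : nat), forall (i : 'I_d) (t : upper R),
    y0 <= complex.Im (val t) ->
    `| jfac g t ^- k * f (mobius g t) i 0 | <= (A * complex.Im (val t) ^+ a)%:C.

Definition Mk (k : nat) : set (upper R -> V) :=
  [set f | [/\ holomorphic f, moderate_growth k f &
     forall g, Gam g -> forall t,
       jfac g t ^- k *: (invmx (rho g) *m f (mobius g t)) = f t]].

End CongruenceTypes.

Section FourierExpansions.
Variables (R : realType) (d : nat).
Local Notation C := (Cplx R).
Local Notation V := 'cV[C]_d.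

(* Elements of FE(C) (x) V are coefficient functions rat -> V; [puiseux_in M m c]
   says that c lies in q^(-m) V[[q^(1/M)]]. *)
Definition puiseux_in (M m : nat) (c : rat -> V) :=
  (0 < M)%N /\
  forall r, c r != 0 -> exists j : nat, r = j%:R / M%:R - m%:R.

Definition is_fourier (f : upper R -> V) (c : rat -> V) :=
  exists M m : nat, puiseux_in M m c /\
    forall (t : upper R) (i : 'I_d),
      (fun J : nat => \sum_(j < J)
          c (j%:R / M%:R - m%:R) i 0 * qpow (j%:R / M%:R - m%:R) t : C)
        @ \oo --> (f t i 0 : C).

(* The expansion is unique when it exists. *)
Definition fe (f : upper R -> V) : rat -> V := xget 0 (is_fourier f).

(* A class in FE_P(C) (x) V = FE(C) (x) V / q^P ... is represented by its unique
   representative supported on exponents < P. *)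
Definition fe_trunc (P : rat) (f : upper R -> V) : rat -> V :=
  fun r => if r < P then fe f r else 0.

(* FE_P(K) (x)_K V0, for V0 a finite-dimensional space over K. *)
Definition FE_trunc (P : rat) (V0 : set V) : set (rat -> V) :=
  [set c | [/\ exists M m : nat, puiseux_in M m c,
               forall r, V0 (c r) & forall r, P <= r -> c r = 0]].

End FourierExpansions.

Section Eisenstein.
Variable R : realType.
Local Notation C := (Cplx R).

(* Summation over Z^2 by squares; only used for absolutely convergent series. *)
Definition lattice_sum (F : int -> int -> C) : C :=
  limn (fun n : nat => \sum_(i < n.*2.+1) \sum_(j < n.*2.+1)
          F (i%:Z - n%:Z) (j%:Z - n%:Z) : C).

Definition in_class (N : nat) (c d c' d' : int) : bool :=
  [&& (c', d') != (0, 0), (c' == c %[mod N%:Z])%Z & (d' == d %[mod N%:Z])%Z].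

(* Sum of (c' tau + d')^-k |c' tau + d'|^(-2s) over nonzero
   (c', d') = (c, d) mod N, absolutely convergent for k + 2 Re s > 2. *)
Definition hecke_sum (k N : nat) (c d : int) (t : upper R) (s : C) : C :=
  lattice_sum (fun c' d' =>
    let w : C := c'%:~R * val t + d'%:~R in
    if in_class N c d c' d'
    then w ^- k * cexp (- 2 * s * (ln (complex.Re `|w|))%:C) else 0).

(* Value at s = 0 of the analytic continuation of hecke_sum, which for k > 0 is
   entire in s. *)
Definition hecke_value (k N : nat) (c d : int) (t : upper R) : C :=
  xget (0 : C -> C) [set g : C -> C | (forall s : C, derivable g s 1) /\
    forall s : C, 2 < k%:R + 2 * complex.Re s -> g s = hecke_sum k N c d t s] 0.

(* In weight 2 the Hecke value is a holomorphic function minus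
   pi / (N^2 Im tau), whatever (c, d) is.  Subtracting the class (0, 0) gives the
   holomorphic modular modification N^-2 wp((c tau + d) / N; tau), where wp is the
   Weierstrass function of the lattice Z tau + Z (and 0 if (c, d) = 0 mod N). *)
Definition eisG (k N : nat) (c d : int) (t : upper R) : C :=
  if (k >= 3)%N then
    lattice_sum (fun c' d' =>
      if in_class N c d c' d' then (c'%:~R * val t + d'%:~R) ^- k else 0)
  else if k == 2%N then hecke_value 2 N c d t - hecke_value 2 N 0 0 t
  else hecke_value k N c d t.

End Eisenstein.

Section Invariants.
Variables (R : realType) (d : nat).
Local Notation C := (Cplx R).
Local Notation V := 'cV[C]_d.
Variables (Gam : set 'M[int]_2) (rho : 'M[int]_2 -> 'M[C]_d).

(* The dual basis vectors of rho_M are indexed by the cosets g Gamma_1(M), with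
   rho_M^dual(h) e_g = e_(h g).  An element sum_g e_g (x) x(g Gamma_1(M)) of
   rho_M^dual (x) rho is encoded by the function x, extended by 0 to all sets;
   elements of rho_M^dual (x) rho_M^dual (x) rho by functions of two cosets. *)
Definition tensor1 := set 'M[int]_2 -> V.
Definition tensor2 := (set 'M[int]_2 * set 'M[int]_2)%type -> V.

HB.instance Definition _ := GRing.Lmodule.on tensor1.
HB.instance Definition _ := GRing.Lmodule.on tensor2.

(* H^0(rho_M^dual (x) rho) with coefficients in U: U = setT for the complex
   invariants, U = V(rho, Qab) for the invariants in the Qab-structure. *)
Definition H0_1 (M : nat) (U : set V) : set tensor1 :=
  [set x | [/\ forall S, ~ lcosets (Gamma_1 M) S -> x S = 0,
               forall S, U (x S) &
               forall g, Gam g ->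
                 (fun S => rho g *m x (ltrans (invmx g) S)) = x]].

Definition H0_2 (M : nat) (U : set V) : set tensor2 :=
  [set y | [/\ forall S, ~ (lcosets (Gamma_1 M) `*` lcosets (Gamma_1 M)) S ->
                 y S = 0,
               forall S, U (y S) &
               forall g, Gam g ->
                 (fun S => rho g *m
                    y (ltrans (invmx g) S.1, ltrans (invmx g) S.2)) = y]].

Definition Phi1 (k M : nat) (x : tensor1) : upper R -> V := fun t =>
  \sum_(S \in lcosets (Gamma_1 M)) eisG k M (brow S).1 (brow S).2 t *: x S.

Definition Phi2 (k l M : nat) (y : tensor2) : upper R -> V := fun t =>
  \sum_(S \in lcosets (Gamma_1 M) `*` lcosets (Gamma_1 M))
    (eisG l M (brow S.1).1 (brow S.1).2 t *
     eisG (k - l) M (brow S.2).1 (brow S.2).2 t) *: y S.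

Definition H0sum (N N0 : nat) (U : set V) : set (tensor1 * tensor2) :=
  H0_1 N U `*` H0_2 N0 U.

Definition Phi (k l N N0 : nat) (b : tensor1 * tensor2) : upper R -> V :=
  Phi1 k N b.1 + Phi2 k l N0 b.2.

End Invariants.

Section Algorithm.
Variables (R : realType) (d : nat).
Local Notation C := (Cplx R).
Local Notation V := 'cV[C]_d.
Variables (Gam : set 'M[int]_2) (rho : 'M[int]_2 -> 'M[C]_d).
Variables (k l N N0 : nat) (P : rat) (v : d.-tuple V).

Definition roundP : rat := (Num.ceil (P * N%:R))%:~R / N%:R.

(* The number P N of exponents, for the rounded P; 0 if P is negative. *)
Definition nexp : nat := absz (Num.max 0 (Num.ceil (P * N%:R))).

Definition coords (w : V) : V := invmx (\matrix_(i, j) tnth v j i 0) *m w.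

Definition coef_row (b : tensor1 R d * tensor2 R d) : 'rV[C]_(nexp * d) :=
  let f := fe_trunc roundP (Phi k l N N0 b) in
  mxvec (\matrix_(n < nexp, j < d) coords (f (n%:R / N%:R)) j 0).

Definition row_expansion (E : 'rV[C]_(nexp * d)) : rat -> V := fun r =>
  \sum_(n < nexp | r == n%:R / N%:R) \sum_(j < d) vec_mx E n j *: tnth v j.

Fixpoint main_loop m (M : 'M[C]_(m, nexp * d))
    (Bs : seq (seq (tensor1 R d * tensor2 R d))) : option (seq (rat -> V)) :=
  if Bs is B :: Bs' then
    let M' := rref (col_mx M (\matrix_(i < size B) coef_row B`_i)) in
    if \rank M' == dimension (Mk Gam rho k)
    then Some [seq row_expansion (row i M') | i <- enum 'I_(\rank _)]
    else main_loop M' Bs'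
  else None.

(* Some out when the run stops with output out, None when the
   blocks are exhausted without the stopping condition having been met. *)
Definition algorithm Bs : option (seq (rat -> V)) :=
  main_loop (0 : 'M[C]_(0, nexp * d)) Bs.

End Algorithm.

(* Main.v *)
(* Up to the factor (2 pi i)^k, an Eisenstein series of weight k and level N is a
   power series in exp (2 pi i tau / N) with coefficients in Q^ab.  Hecke's
   analytic continuation is obtained by adding to the summand differences under
   lattice translations, whose sum vanishes, chosen so that the summand decays
   faster; in weights 1 and 2 the value at s = 0 is then an absolutely convergent
   lattice sum.  Summing by rows, each row is a rational polynomial in the
   cotangent, because of the partial fraction expansion of the latter.

   Hence Phi maps invariants over Q^ab to forms with coefficients in
   (2 pi i)^k V(rho, Q^ab).  Complex invariants are complex combinations of
   invariants over Q^ab, so the rows of the full coefficient matrix span the image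
   of M_k(rho), on which truncation is injective: the rank reaches dim M_k(rho) at
   the latest after the last block.  The reduced echelon basis of a space spanned
   by vectors over Q^ab has entries in Q^ab, and the factor (2 pi i)^k drops out. *)

Require Import Defs.
From HB Require Import structures.
From mathcomp Require Import all_boot all_order all_algebra all_fingroup all_field.
From mathcomp Require Import all_classical all_reals all_analysis.
From mathcomp Require Import complex.
From mathcomp Require Import ring lra.
From mathcomp Require Import zify.

Set Implicit Arguments.
Unset Strict Implicit.
Unset Printing Implicit Defensive.

Import Order.TTheory GRing.Theory Num.Theory numFieldNormedType.Exports.

Local Open Scope classical_set_scope.
Local Open Scope ring_scope.
Local Open Scope complex_scope.

(** * Complex norm and differentiability *)

(** [hecke_value] is the value at 0 of some entire function that agrees with the Hecke sum on a half
    plane. To identify it with a convergent series one needs uniqueness of analytic continuation and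
    holomorphy of sums of series; Cauchy's theorem on squares is developed for these two purposes.
    No contour integral is evaluated: the integral of 1/(s - z0) over a square only has to be
    nonzero. The Hecke summands involve the conjugate and the modulus of the lattice variable w, so
    they are not holomorphic in w. Derivatives relative to the real line give their Taylor
    expansions along a real direction. Coefficients are taken in an abstract set K, closed under the
    field operations and containing the roots of unity. It is instantiated with Q^ab for the
    rationality statement and with C for the expansions of arbitrary forms. Eisenstein series of
    level N0 have exponents with denominator N0, but the matrix only records exponents n/N.
    Invariance of a form under tau -> tau + N, together with uniqueness of expansions, shows that
    nothing is missed. *)

Section Norm.
Variable R : realType.
Local Notation C := (Cplx R).
Local Notation Re := complex.Re.
Local Notation Im := complex.Im.
Implicit Types (z w : C) (x y : R).

(** The norm of z is itself an element of C. It is real, so passing to its real part loses nothing,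
    and estimates can be made in the ordered field R. *)
Definition nrm z : R := Re `|z|.

Lemma nrmE z : `|z| = (nrm z)%:C.
Proof. by rewrite /nrm RRe_real ?normr_real. Qed.

Lemma nrm_sqrt z : nrm z = Num.sqrt (Re z ^+ 2 + Im z ^+ 2).
Proof. by rewrite /nrm normc_def. Qed.

Lemma nrm_ge0 z : 0 <= nrm z.
Proof. by rewrite nrm_sqrt sqrtr_ge0. Qed.

Lemma complex_inj : injective (real_complex R : R -> C).
Proof. by move=> x y []. Qed.

Lemma nrm0 : nrm 0 = 0.
Proof. by apply: complex_inj; rewrite -nrmE normr0. Qed.

Lemma nrm1 : nrm 1 = 1.
Proof. by apply: complex_inj; rewrite -nrmE normr1. Qed.

Lemma nrmM z w : nrm (z * w) = nrm z * nrm w.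
Proof. by apply: complex_inj; rewrite rmorphM /= -!nrmE normrM. Qed.

Lemma nrmV z : nrm z^-1 = (nrm z)^-1.
Proof. by apply: complex_inj; rewrite fmorphV /= -!nrmE normfV. Qed.

Lemma nrmN z : nrm (- z) = nrm z.
Proof. by apply: complex_inj; rewrite -!nrmE normrN. Qed.

Lemma nrmX z n : nrm (z ^+ n) = nrm z ^+ n.
Proof. by elim: n => [|n ih]; rewrite ?expr0 ?nrm1 // !exprS nrmM ih. Qed.

Lemma nrmD z w : nrm (z + w) <= nrm z + nrm w.
Proof. by rewrite -lecR rmorphD /= -!nrmE; exact: ler_normD. Qed.

Lemma nrmC z w : nrm (z - w) = nrm (w - z).
Proof. by rewrite -nrmN opprB. Qed.

Lemma nrmB z w : nrm (z - w) <= nrm z + nrm w.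
Proof. by rewrite -[nrm w]nrmN nrmD. Qed.

Lemma nrmB_ge z w : nrm z - nrm w <= nrm (z - w).
Proof. by rewrite lerBlDr -{1}(subrK w z) nrmD. Qed.

Lemma nrm_tri z w u : nrm (z - u) <= nrm (z - w) + nrm (w - u).
Proof. by have := nrmD (z - w) (w - u); rewrite addrA subrK. Qed.

Lemma nrm_eq0 z : (nrm z == 0) = (z == 0).
Proof. by rewrite -(inj_eq complex_inj) -nrmE normr_eq0. Qed.

Lemma nrm_gt0 z : (0 < nrm z) = (z != 0).
Proof. by rewrite lt0r nrm_ge0 nrm_eq0 andbT. Qed.

Lemma nrm_real x : nrm x%:C = `|x|.
Proof. by rewrite nrm_sqrt /= expr0n addr0 sqrtr_sqr. Qed.

Lemma nrm_nat n : nrm n%:R = n%:R.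
Proof. by rewrite -(rmorph_nat (real_complex R)) nrm_real normr_nat. Qed.

Lemma nrm_int (n : int) : nrm n%:~R = `|n|%:~R.
Proof. by rewrite -(rmorph_int (real_complex R)) nrm_real intr_norm. Qed.

Lemma nrm_i : nrm 'i = 1.
Proof. by rewrite nrm_sqrt /= expr0n add0r expr1n sqrtr1. Qed.

Lemma nrm_sum (I : Type) (r : seq I) (P : pred I) (F : I -> C) :
  nrm (\sum_(i <- r | P i) F i) <= \sum_(i <- r | P i) nrm (F i).
Proof.
elim/big_rec2: _ => [|i y1 y2 _ ih]; first by rewrite nrm0.
by apply: le_trans (nrmD _ _) _; rewrite lerD2l.
Qed.

Lemma ReD z w : Re (z + w) = Re z + Re w. Proof. by case: z; case: w. Qed.
Lemma ImD z w : Im (z + w) = Im z + Im w. Proof. by case: z; case: w. Qed.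
Lemma ReN z : Re (- z) = - Re z. Proof. by case: z. Qed.
Lemma ImN z : Im (- z) = - Im z. Proof. by case: z. Qed.
Lemma ReM z w : Re (z * w) = Re z * Re w - Im z * Im w.
Proof. by case: z; case: w. Qed.
Lemma ImM z w : Im (z * w) = Re z * Im w + Im z * Re w.
Proof. by case: z => a b; case: w => c d /=; rewrite addrC [b * c]mulrC [c * b]mulrC addrC. Qed.

Definition ReImE := (ReD, ImD, ReN, ImN, ReM, ImM).

Lemma cplxP z w : Re z = Re w -> Im z = Im w -> z = w.
Proof. by case: z => a b; case: w => c d /= -> ->. Qed.

Lemma Re_nat n : Re (n%:R : C) = n%:R.
Proof. by rewrite -(rmorph_nat (real_complex R)). Qed.
Lemma Im_nat n : Im (n%:R : C) = 0.
Proof. by rewrite -(rmorph_nat (real_complex R)). Qed.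
Lemma Re_int (n : int) : Re (n%:~R : C) = n%:~R.
Proof. by rewrite -(rmorph_int (real_complex R)). Qed.
Lemma Im_int (n : int) : Im (n%:~R : C) = 0.
Proof. by rewrite -(rmorph_int (real_complex R)). Qed.

Lemma nrm_Re z : `|Re z| <= nrm z.
Proof. by rewrite nrm_sqrt -sqrtr_sqr ler_wsqrtr // lerDl sqr_ge0. Qed.

Lemma nrm_Im z : `|Im z| <= nrm z.
Proof. by rewrite nrm_sqrt -sqrtr_sqr ler_wsqrtr // lerDr sqr_ge0. Qed.

Lemma nrm_ReIm z : nrm z <= `|Re z| + `|Im z|.
Proof.
have zE : z = (Re z)%:C + 'i * (Im z)%:C by exact: complexE.
by rewrite {1}zE; apply: le_trans (nrmD _ _) _; rewrite nrmM nrm_i mul1r !nrm_real.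
Qed.

Definition cj z : C := z^*.

Lemma nrmJ z : nrm (cj z) = nrm z.
Proof. by rewrite !nrm_sqrt /cj; case: z => a b /=; rewrite sqrrN. Qed.

Lemma cjD z w : cj (z + w) = cj z + cj w. Proof. exact: rmorphD. Qed.
Lemma cjM z w : cj (z * w) = cj z * cj w. Proof. exact: rmorphM. Qed.
Lemma cj_real x : cj x%:C = x%:C.
Proof. by rewrite /cj /=; apply: cplxP => //=; rewrite oppr0. Qed.
Lemma cj_eq0 z : (cj z == 0) = (z == 0). Proof. by rewrite -!nrm_eq0 nrmJ. Qed.
Lemma Re_cj z : Re (cj z) = Re z. Proof. by case: z. Qed.
Lemma Im_cj z : Im (cj z) = - Im z. Proof. by case: z. Qed.
Lemma mul_cj z : z * cj z = (nrm z ^+ 2)%:C.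
Proof.
rewrite nrm_sqrt sqr_sqrtr ?addr_ge0 ?sqr_ge0 //.
by apply: cplxP; rewrite !ReImE Re_cj Im_cj /= ; ring.
Qed.

Lemma nrm_le0 z : (forall e, 0 < e -> nrm z <= e) -> z = 0.
Proof.
move=> H; apply/eqP; rewrite -nrm_eq0; apply/negPn/negP => z0.
have zp : 0 < nrm z by rewrite lt0r z0 nrm_ge0.
by have := H (nrm z / 2) (divr_gt0 zp (ltr0Sn _ 1)); lra.
Qed.

Definition scvg (u : nat -> C) (l : C) :=
  forall e, 0 < e -> exists n0, forall n, (n0 <= n)%N -> nrm (u n - l) < e.

Lemma posC (e : C) : 0 < e -> exists2 x, 0 < x & e = x%:C.
Proof.
move=> e0; exists (Re e); last by rewrite RRe_real // gtr0_real.
by rewrite -ltcR RRe_real ?gtr0_real.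
Qed.

Lemma scvgP (u : nat -> C) (l : C) : (u @ \oo --> l) <-> scvg u l.
Proof.
split=> [/cvgrPdist_lt H e e0 | H].
  have /H [n0 _ Hn] : 0 < (e%:C : C) by rewrite ltcR.
  exists n0 => n le_n; have := Hn n le_n; rewrite /= nrmE ltcR.
  by rewrite nrmC.
apply/cvgrPdist_lt => e /posC [x x0 ->]; have [n0 Hn] := H _ x0.
exists n0 => // n le_n; rewrite /= nrmE ltcR nrmC; exact: Hn.
Qed.

Lemma scvg_lim (u : nat -> C) (l : C) : scvg u l -> limn u = l.
Proof. by move/scvgP => H; apply: cvg_lim. Qed.

Lemma scvg_uniq (u : nat -> C) (l l' : C) : scvg u l -> scvg u l' -> l = l'.
Proof. by move=> /scvg_lim <- /scvg_lim. Qed.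

End Norm.

Section EpsDerivative.
Variable K : numFieldType.

Lemma derivable_eps (f : K -> K) (x : K) : derivable f x 1 ->
  forall e, 0 < e -> exists2 d, 0 < d & forall y, `|y - x| < d ->
    `|f y - f x - 'D_1 f x * (y - x)| <= e * `|y - x|.
Proof.
move=> /[dup] dv /cvgrPdist_le H e e0; have := H _ e0.
move=> /nbhs_ballP [d /= d0 Hd]; exists d => // y yd.
have [->|yx] := eqVneq y x; first by rewrite !subrr mulr0 subrr normr0 mulr0.
have yx0 : y - x != 0 by rewrite subr_eq0.
have := Hd (y - x); rewrite /ball /= sub0r normrN => /(_ yd yx0).
rewrite /GRing.scale /= mulr1 subrK => Hy.
have -> : f y - f x - 'D_1 f x * (y - x) =
  ((y - x)^-1 * (f y - f x) - 'D_1 f x) * (y - x) by field.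
by rewrite normrM ler_pM2r ?normr_gt0 // distrC.
Qed.

Lemma eps_derivable (f : K -> K) (x l : K) :
  (forall e, 0 < e -> exists2 d, 0 < d & forall y, `|y - x| < d ->
    `|f y - f x - l * (y - x)| <= e * `|y - x|) -> derivable f x 1.
Proof.
move=> H; apply: cvgP (l) _; apply/cvgrPdist_le => e /H [d d0 Hd].
apply/nbhs_ballP; exists d => //= h; rewrite /ball /= sub0r normrN => hd h0.
have := Hd (h + x); rewrite addrK => /(_ hd) He; rewrite [h%:A]mulr1.
rewrite distrC -(ler_pM2r (_ : 0 < `|h|)) ?normr_gt0 // -normrM.
by rewrite mulrBl [_ *: _ * h]mulrC mulrA divff // mul1r.
Qed.

End EpsDerivative.

(** * Continuity and derivatives relative to a subset of the plane; the complex exponential *)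

Section Calculus.
Variable R : realType.
Local Notation C := (Cplx R).
Local Notation Re := complex.Re.
Local Notation Im := complex.Im.
Implicit Types (D : set C) (f g : C -> C) (z w l m : C).

Definition ccont D f z := forall e : R, 0 < e ->
  exists2 d : R, 0 < d & forall y, D y -> nrm (y - z) < d -> nrm (f y - f z) <= e.

(* Complex differentiability relative to a subset [D] of the plane: [setT] gives the
   holomorphic derivative, the real line the derivative in a real variable. *)
Definition cder D f z l := forall e : R, 0 < e ->
  exists2 d : R, 0 < d & forall y, D y -> nrm (y - z) < d ->
    nrm (f y - f z - l * (y - z)) <= e * nrm (y - z).

Definition Dre : set C := [set z | Im z = 0].

Lemma derivable_cder f z : derivable f z 1 <-> exists l, cder setT f z l.
Proof.
split=> [/derivable_eps H | [l H]].
  exists ('D_1 f z) => e e0; have [|_ /posC [d d0 ->] Hd] := H e%:C.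
    by rewrite ltcR.
  exists d => // y _ yd; have := Hd y; rewrite !nrmE ltcR => /(_ yd).
  by rewrite -rmorphM lecR.
apply: (@eps_derivable _ _ _ l) => _ /posC [e e0 ->]; have [d d0 Hd] := H _ e0.
exists d%:C; first by rewrite ltcR.
by move=> y; rewrite !nrmE ltcR => /(Hd _ I); rewrite -rmorphM lecR.
Qed.

Lemma cder_cont D f z l : cder D f z l -> ccont D f z.
Proof.
move=> H e e0; have [d d0 Hd] := H 1 ltr01.
have l1 : 0 < nrm l + 1 by rewrite ltr_wpDl ?nrm_ge0.
exists (Order.min d (e / (nrm l + 1))); first by rewrite lt_min d0 divr_gt0.
move=> y Dy; rewrite lt_min => /andP[yd ye]; have := Hd y Dy yd => Hy.
have := nrmD (f y - f z - l * (y - z)) (l * (y - z)); rewrite subrK nrmM.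
move: ye; rewrite ltr_pdivlMr //; nra.
Qed.

Lemma cder_ext D f g z l (r : R) : 0 < r ->
  (forall y, D y -> nrm (y - z) < r -> f y = g y) -> f z = g z ->
  cder D f z l -> cder D g z l.
Proof.
move=> r0 fg fgz H e e0; have [d d0 Hd] := H e e0.
exists (Order.min d r) => [|y Dy]; first by rewrite lt_min d0.
by rewrite lt_min => /andP[yd yr]; rewrite -fg // -fgz; exact: Hd.
Qed.

Lemma cder_cst D (c : C) z : cder D (fun=> c) z 0.
Proof. by move=> e e0; exists 1 => // y _ _; rewrite subrr mul0r subrr nrm0 mulr_ge0 ?nrm_ge0 ?ltW. Qed.

Lemma cder_id D z : cder D id z 1.
Proof. by move=> e e0; exists 1 => // y _ _; rewrite mul1r subrr nrm0 mulr_ge0 ?nrm_ge0 ?ltW. Qed.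

Lemma ccont_cst D (c : C) z : ccont D (fun=> c) z.
Proof. exact: cder_cont (cder_cst _ _ _). Qed.

Lemma ccont_id D z : ccont D id z.
Proof. exact: cder_cont (cder_id _ _). Qed.

Lemma ccontD D f g z : ccont D f z -> ccont D g z -> ccont D (fun y => f y + g y) z.
Proof.
move=> Hf Hg e e0; have e2 : 0 < e / 2 by rewrite divr_gt0.
have [a a0 Ha] := Hf _ e2; have [b b0 Hb] := Hg _ e2.
exists (Order.min a b) => [|y Dy]; first by rewrite lt_min a0.
rewrite lt_min => /andP[ya yb]; have := Ha y Dy ya; have := Hb y Dy yb.
rewrite opprD addrACA; have := nrmD (f y - f z) (g y - g z); lra.
Qed.

Lemma ccontM D f g z : ccont D f z -> ccont D g z -> ccont D (fun y => f y * g y) z.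
Proof.
move=> Hf Hg e e0.
have fp : 0 < nrm (f z) + 1 by rewrite ltr_wpDl ?nrm_ge0.
have gp : 0 < nrm (g z) + 1 by rewrite ltr_wpDl ?nrm_ge0.
have [a a0 Ha] := Hf (e / 2 / (nrm (g z) + 1)) ltac:(by rewrite !divr_gt0).
have [b b0 Hb] := Hg (Order.min 1 (e / 2 / (nrm (f z) + 1)))
   ltac:(by rewrite lt_min ltr01 !divr_gt0).
exists (Order.min a b) => [|y Dy]; first by rewrite lt_min a0.
rewrite lt_min => /andP[/(Ha y Dy) + /(Hb y Dy)].
rewrite le_min ler_pdivlMr // => h1 /andP[h2]; rewrite ler_pdivlMr // => h3.
have -> : f y * g y - f z * g z = (f y - f z) * g y + f z * (g y - g z) by ring.
have := nrmD ((f y - f z) * g y) (f z * (g y - g z)); rewrite !nrmM.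
have := nrmD (g y - g z) (g z); rewrite subrK.
have := nrm_ge0 (f y - f z); have := nrm_ge0 (g y - g z); nra.
Qed.

Lemma ccont_comp D f g z : ccont D f z -> ccont setT g (f z) ->
  ccont D (fun y => g (f y)) z.
Proof.
move=> Hf Hg e e0; have [d d0 Hd] := Hg e e0.
have [a a0 Ha] := Hf (d / 2) ltac:(by rewrite divr_gt0).
exists a => // y Dy ya; apply: Hd => //; have := Ha y Dy ya; lra.
Qed.

Lemma cderD D f g z l m : cder D f z l -> cder D g z m ->
  cder D (fun y => f y + g y) z (l + m).
Proof.
move=> Hf Hg e e0; have e2 : 0 < e / 2 by rewrite divr_gt0.
have [a a0 Ha] := Hf _ e2; have [b b0 Hb] := Hg _ e2.
exists (Order.min a b) => [|y Dy]; first by rewrite lt_min a0.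
rewrite lt_min => /andP[ya yb]; have := Ha y Dy ya; have := Hb y Dy yb.
have -> : f y + g y - (f z + g z) - (l + m) * (y - z) =
  (f y - f z - l * (y - z)) + (g y - g z - m * (y - z)) by ring.
have := nrmD (f y - f z - l * (y - z)) (g y - g z - m * (y - z)); lra.
Qed.

(** Carathéodory's form of the derivative: the slope, completed by the value l at z, is continuous
    there. The product and chain rules then reduce to continuity of products and composites. *)
Lemma caratheodory D f z l : cder D f z l ->
  exists phi, [/\ ccont D phi z, phi z = l & forall y, f y - f z = phi y * (y - z)].
Proof.
move=> H; exists (fun y => if y == z then l else (f y - f z) / (y - z)).
split=> [e e0||y]; rewrite ?eqxx //; last first.
  by case: eqVneq => [->|yz]; rewrite ?subrr ?mulr0 // mulfVK ?subr_eq0.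
have [d d0 Hd] := H e e0; exists d => // y Dy yd.
case: eqVneq => [_|yz]; first by rewrite subrr nrm0 ltW.
have yz0 : y - z != 0 by rewrite subr_eq0.
have := Hd y Dy yd; rewrite -{2}[l](mulfK yz0) -mulrBl nrmM nrmV.
by rewrite ler_pdivrMr ?nrm_gt0.
Qed.

Lemma caratheodoryV D f z phi : ccont D phi z ->
  (forall y, D y -> f y - f z = phi y * (y - z)) -> cder D f z (phi z).
Proof.
move=> H E e e0; have [d d0 Hd] := H e e0; exists d => // y Dy yd.
by rewrite E // -mulrBl nrmM ler_wpM2r ?nrm_ge0 ?Hd.
Qed.

Lemma cderM D f g z l m : cder D f z l -> cder D g z m ->
  cder D (fun y => f y * g y) z (l * g z + f z * m).
Proof.
move=> Hf Hg; have [p [pc <- pE]] := caratheodory Hf.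
have [q [qc <- qE]] := caratheodory Hg.
apply: (@caratheodoryV _ _ _ (fun y => p y * g y + f z * q y)) => [|y Dy].
  apply: ccontD; apply: ccontM => //; first exact: cder_cont Hg.
  exact: ccont_cst.
have -> : f y * g y - f z * g z = (f y - f z) * g y + f z * (g y - g z) by ring.
by rewrite pE qE; ring.
Qed.

Lemma cder_comp D f g z l m : cder D f z l -> cder setT g (f z) m ->
  cder D (fun y => g (f y)) z (m * l).
Proof.
move=> Hf Hg; have [p [pc <- pE]] := caratheodory Hf.
have [q [qc <- qE]] := caratheodory Hg.
apply: (@caratheodoryV _ _ _ (fun y => q (f y) * p y)) => [|y Dy]; last first.
  by rewrite qE pE mulrA.
by apply: ccontM => //; apply: ccont_comp => //; exact: cder_cont Hf.
Qed.

Lemma cder_eq D f z l l' : cder D f z l -> l = l' -> cder D f z l'.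
Proof. by move=> + <-. Qed.

Lemma cderZ D (c : C) f z l : cder D f z l -> cder D (fun y => c * f y) z (c * l).
Proof.
by move=> H; apply: cder_eq (cderM (cder_cst D c z) H) _; rewrite mul0r add0r.
Qed.

Lemma cderN D f z l : cder D f z l -> cder D (fun y => - f y) z (- l).
Proof.
move=> H; apply: cder_eq (cder_ext ltr01 _ _ (cderZ (-1) H)) _ => [y _ _||];
by rewrite mulN1r.
Qed.

Lemma cderB D f g z l m : cder D f z l -> cder D g z m ->
  cder D (fun y => f y - g y) z (l - m).
Proof. by move=> Hf Hg; apply: cderD => //; exact: cderN. Qed.

Lemma cder_invr z : z != 0 -> cder setT (fun y => y^-1) z (- z^-1 ^+ 2).
Proof.
move=> z0 e e0; have zp : 0 < nrm z by rewrite nrm_gt0.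
(* The first bound keeps |y| above |z|/2. The second makes the remainder (y - z)^2 / (z^2 y) at most
   e |y - z|. *)
exists (Order.min (nrm z / 2) (e * nrm z ^+ 3 / 2)).
  by rewrite lt_min !divr_gt0 // mulr_gt0 // exprn_gt0.
move=> y _; rewrite lt_min => /andP[y1 y2].
have yp : nrm z / 2 < nrm y by have := nrmB_ge z y; rewrite nrmC; lra.
have y0 : y != 0 by rewrite -nrm_gt0; apply: lt_trans yp; rewrite divr_gt0.
have -> : y^-1 - z^-1 - - z^-1 ^+ 2 * (y - z) = (y - z) ^+ 2 / (z ^+ 2 * y).
  by field; rewrite z0 y0.
rewrite nrmM nrmV nrmX nrmM nrmX ler_pdivrMr ?mulr_gt0 ?exprn_gt0 //; last first.
  by apply: lt_trans yp; rewrite divr_gt0.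
rewrite expr2 mulrAC ler_wpM2r ?nrm_ge0 // (le_trans (ltW y2)) //.
rewrite -mulrA ler_wpM2l ?(ltW e0) // exprS -mulrA mulrC -mulrA.
have z2 : 0 < nrm z ^+ 2 by rewrite exprn_gt0.
by rewrite ler_wpM2l ?(ltW z2) //; lra.
Qed.

Lemma cderV D f z l : f z != 0 -> cder D f z l ->
  cder D (fun y => (f y)^-1) z (- l * (f z)^-1 ^+ 2).
Proof.
by move=> fz H; apply: cder_eq (cder_comp H (cder_invr fz)) _; rewrite mulNr mulrC mulNr.
Qed.

Lemma ccontV D f z : f z != 0 -> ccont D f z -> ccont D (fun y => (f y)^-1) z.
Proof. by move=> fz H; apply: ccont_comp H (cder_cont (cder_invr fz)). Qed.

Lemma cderX D f z l n : cder D f z l ->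
  cder D (fun y => f y ^+ n) z (n%:R * f z ^+ n.-1 * l).
Proof.
move=> H; elim: n => [|n ih].
  by apply: cder_eq (cder_cst _ _ _) _; rewrite !mul0r.
apply: cder_eq (cder_ext ltr01 _ _ (cderM H ih)) _ => [y _ _||] /=; rewrite -?exprS //.
case: n {ih} => [|n]; first by rewrite expr0 !mul0r mulr0; ring.
by rewrite /= exprS -[n.+2%:R]natr1; ring.
Qed.

Lemma cder_sum D (I : Type) (r : seq I) (F : I -> C -> C) (l : I -> C) z :
  (forall i, cder D (F i) z (l i)) ->
  cder D (fun y => \sum_(i <- r) F i y) z (\sum_(i <- r) l i).
Proof.
move=> H; elim: r => [|i r ih].
  apply: cder_eq (cder_ext ltr01 _ _ (cder_cst D 0 z)) _ => [y _ _||];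
  by rewrite big_nil.
apply: cder_eq (cder_ext ltr01 _ _ (cderD (H i) ih)) _ => [y _ _||];
by rewrite big_cons.
Qed.

Lemma real_eps (f : R -> R) (x l : R) : is_derive x 1 f l ->
  forall e, 0 < e -> exists2 d, 0 < d & forall y, `|y - x| < d ->
    `|f y - f x - l * (y - x)| <= e * `|y - x|.
Proof. by case=> dv <-; exact: derivable_eps. Qed.

Lemma cder_Dre (f : R -> R) (x l : R) : is_derive x 1 f l ->
  cder Dre (fun z => (f (Re z))%:C) x%:C l%:C.
Proof.
move=> H e e0; have [d d0 Hd] := real_eps H e0; exists d => // -[y y'] /= y0.
rewrite /Dre /= in y0; rewrite {}y0.
have -> : (y +i* 0 : C) - x%:C = (y - x)%:C by rewrite rmorphB.
by rewrite -rmorphM -!rmorphB !nrm_real; exact: Hd.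
Qed.

Lemma cexp0 : cexp (0 : C) = 1.
Proof. by rewrite /cexp /= expR0 cos0 sin0 mul1r. Qed.

Lemma cexpD z w : cexp (z + w) = cexp z * cexp w.
Proof.
apply: cplxP; rewrite /cexp !ReImE /= expRD cosD sinD; ring.
Qed.

Lemma nrm_cexp z : nrm (cexp z) = expR (Re z).
Proof.
rewrite /cexp nrmM nrm_real ger0_norm ?expR_ge0 // nrm_sqrt /= cos2Dsin2 sqrtr1.
by rewrite mulr1.
Qed.

Lemma cexp_neq0 z : cexp z != 0.
Proof. by rewrite -nrm_gt0 nrm_cexp expR_gt0. Qed.

Lemma cexpN z : cexp (- z) = (cexp z)^-1.
Proof.
by apply: (mulIf (cexp_neq0 z)); rewrite -cexpD addNr cexp0 mulVf ?cexp_neq0.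
Qed.

Lemma cexpMn z n : cexp (z *+ n) = cexp z ^+ n.
Proof. by elim: n => [|n ih]; rewrite ?mulr0n ?cexp0 // mulrS exprS cexpD ih. Qed.

Lemma cder_cexp0 : cder setT (@cexp R) 0 1.
Proof.
move=> e e0.
(* The error terms [B0] to [B4] below add up to at most 9 e1 |z|, the coefficient 3 coming from the
   bound on the real exponential; hence e1 <= e/10 is enough. *)
have [e1 [e10 e1e e11]] : exists e1 : R, [/\ 0 < e1, 10 * e1 <= e & e1 <= 1].
  exists (Order.min 1 (e / 10)); split; rewrite ?lt_min ?ltr01 ?divr_gt0 ?ge_min ?lexx //.
  have : Order.min 1 (e / 10) <= e / 10 by rewrite ge_min lexx orbT.
  lra.
have [a a0 Ha] := real_eps (is_derive_expR 0) e10.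
have [b b0 Hb] := real_eps (is_derive_cos 0) e10.
have [c c0 Hc] := real_eps (is_derive_sin 0) e10.
exists (Order.min (Order.min a b) (Order.min c e1)).
  by rewrite !lt_min a0 b0 c0 e10.
move=> [x y] _; rewrite subr0 cexp0 !lt_min mul1r -andbA => /and4P[ya yb yc ye].
set z : C := (x +i* y) in ya yb yc ye *.
have xz : `|x| <= nrm z := nrm_Re z. have yz : `|y| <= nrm z := nrm_Im z.
have := Ha x; have := Hb y; have := Hc y.
rewrite !subr0 expR0 cos0 sin0 oppr0 mul0r !mul1r !subr0 addr0.
move=> /(_ (le_lt_trans yz yc)) h1 /(_ (le_lt_trans yz yb)) h2.
move=> /(_ (le_lt_trans xz ya)) h3.
apply: le_trans (nrm_ReIm _) _; rewrite /cexp /z !ReImE /=.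
have ex3 : expR x <= 3.
  have := ler_norm (expR x - 1 - x); have := ler_norm x; move: h3 ye; nra.
have ex0 := expR_ge0 x.
have -> : expR x * cos y - 0 * sin y - 1 - x = (expR x - 1 - x) + expR x * (cos y - 1) by ring.
have -> : expR x * sin y + 0 * cos y - 0 - y =
  expR x * (sin y - y) + (expR x - 1 - x) * y + x * y by ring.
have A1 := ler_normD (expR x - 1 - x) (expR x * (cos y - 1)).
have A2 := ler_normD (expR x * (sin y - y) + (expR x - 1 - x) * y) (x * y).
have A3 := ler_normD (expR x * (sin y - y)) ((expR x - 1 - x) * y).
rewrite !normrM (ger0_norm ex0) in A1 A2 A3.
have n0 := nrm_ge0 z; rewrite -/z in n0 *.
have B1 : expR x * `|cos y - 1| <= 3 * (e1 * nrm z).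
  by apply: ler_pM => //; apply: le_trans h2 _; rewrite ler_wpM2l // ltW.
have B2 : expR x * `|sin y - y| <= 3 * (e1 * nrm z).
  by apply: ler_pM => //; apply: le_trans h1 _; rewrite ler_wpM2l // ltW.
have B0 : `|expR x - 1 - x| <= e1 * nrm z.
  by apply: le_trans h3 _; rewrite ler_wpM2l // ltW.
have B3 : `|expR x - 1 - x| * `|y| <= (e1 * nrm z) * 1.
  by apply: ler_pM => //; lra.
have B4 : `|x| * `|y| <= nrm z * e1 by apply: ler_pM => //; lra.
have B5 : 10 * e1 * nrm z <= e * nrm z by rewrite ler_wpM2r.
apply: le_trans (lerD A1 (le_trans A2 (lerD A3 (lexx _)))) _.
have n1 : 0 <= e1 * nrm z by rewrite mulr_ge0 // ltW.
move: B0 B1 B2 B3 B4 B5 n1; clear; lra.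
Qed.

Lemma cder_cexp z : cder setT (@cexp R) z (cexp z).
Proof.
have H : cder setT (fun y => y - z) z 1.
  by apply: cder_eq (cderB (cder_id _ _) (cder_cst _ _ _)) _; rewrite subr0.
have H0 : cder setT (@cexp R) (z - z) 1 by rewrite subrr; exact: cder_cexp0.
apply: cder_eq (cder_ext ltr01 _ _ (cderZ (cexp z) (cder_comp H H0))) _ => [y _ _||].
- by rewrite -cexpD addrC subrK.
- by rewrite subrr cexp0 mulr1.
by rewrite !mulr1.
Qed.

Lemma cder_exp D f z l : cder D f z l -> cder D (fun y => cexp (f y)) z (cexp (f z) * l).
Proof. by move=> H; apply: cder_comp H (cder_cexp _). Qed.

End Calculus.

(** * Cousin's lemma for squares *)

Section Cousin.
Variable R : realType.
Variable P : R -> R -> R -> Prop.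
Hypothesis Psplit : forall x y h, 0 < h -> P x y h -> P (x + h) y h ->
  P x (y + h) h -> P (x + h) (y + h) h -> P x y (h + h).

Let step (p : R * R * R) : R * R * R :=
  let: (x, y, r) := p in let h := r / 2 in
  if `[< ~ P x y h >] then (x, y, h) else
  if `[< ~ P (x + h) y h >] then (x + h, y, h) else
  if `[< ~ P x (y + h) h >] then (x, y + h, h) else (x + h, y + h, h).

(** [P x y r] speaks of the square with lower left corner (x, y) and side r. If it fails, it fails
    on one of the four quarters; the nested failing quarters shrink to a point (a, b), where the
    local hypothesis contradicts a late failure. The lemma serves the mean value inequality,
    Goursat's theorem and boundedness on squares. *)
Lemma cousin (x0 y0 r0 : R) : 0 < r0 ->
  (forall a b, x0 <= a <= x0 + r0 -> y0 <= b <= y0 + r0 ->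
    exists2 d, 0 < d & forall x y r, 0 < r < d -> x <= a <= x + r ->
      y <= b <= y + r -> x0 <= x -> x + r <= x0 + r0 ->
      y0 <= y -> y + r <= y0 + r0 -> P x y r) ->
  P x0 y0 r0.
Proof.
move=> r00 loc; apply: contrapT => nP.
pose p n := iter n step (x0, y0, r0).
pose X n := (p n).1.1; pose Y n := (p n).1.2; pose r n := (p n).2.
have inv n : [/\ ~ P (X n) (Y n) (r n), r n = r0 / 2 ^+ n,
    X n <= X n.+1, X n.+1 + r n.+1 <= X n + r n & Y n <= Y n.+1 /\ Y n.+1 + r n.+1 <= Y n + r n].
  suff H m : ~ P (X m) (Y m) (r m) /\ r m = r0 / 2 ^+ m.
    have [nPn rn] := H n; have rp : 0 < r n by rewrite rn divr_gt0 ?exprn_gt0.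
    rewrite /X /Y /r in nPn rn rp *; rewrite /p iterS -/(p n).
    case: (p n) nPn rn rp => [[x y] s] /= nPn rn rp.
    by do 3?[case: asboolP => _ /=; first by split=> //; lra]; split=> //; lra.
  elim: m => [|m [nPm rm]]; first by rewrite /r /= expr0 divr1.
  have rp : 0 < r m by rewrite rm divr_gt0 ?exprn_gt0.
  have -> : r0 / 2 ^+ m.+1 = r m / 2 by rewrite rm exprS; field; rewrite expf_neq0.
  rewrite /X /Y /r in nPm rm rp *; rewrite /p iterS -/(p m).
  case: (p m) nPm rm rp => [[x y] s] /= nPm rm rp.
  case: asboolP => [//|/contrapT P1]; case: asboolP => [//|/contrapT P2].
  case: asboolP => [//|/contrapT P3]; split=> // P4; apply: nPm.
  by rewrite [s]splitr; apply: Psplit => //; rewrite divr_gt0.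
(* Nested intervals: the supremum of the left ends lies in all of them. *)
have mono (Z : nat -> R) : (forall n, Z n <= Z n.+1) ->
    (forall n, Z n.+1 + r n.+1 <= Z n + r n) ->
    exists a, forall n, Z n <= a <= Z n + r n.
  move=> Z1 Z2.
  have A n m : Z n <= Z (n + m)%N /\ Z (n + m)%N + r (n + m)%N <= Z n + r n.
    elim: m => [|m [i1 i2]]; first by rewrite addn0.
    by rewrite addnS; split; [exact: le_trans i1 _ | exact: le_trans (Z2 _) _].
  have rp m : 0 < r m by have [_ -> _ _ _] := inv m; rewrite divr_gt0 ?exprn_gt0.
  have ub n : ubound (range Z) (Z n + r n).
    move=> _ [m _ <-]; have [mn|nm] := leqP m n.
      have [h _] := A m (n - m)%N; rewrite subnKC // in h.
      by have := rp n; lra.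
    have [_ h] := A n (m - n)%N; rewrite subnKC ?(ltnW nm) // in h.
    by have := rp m; lra.
  have ne : range Z !=set0 by exists (Z 0%N), 0%N.
  exists (sup (range Z)) => n; apply/andP; split.
    by apply: ub_le_sup; [exists (Z 0%N + r 0%N); exact: ub | exists n].
  by apply: sup_le_ub => //; exact: ub.
have [a Ha] := mono X (fun n => let: And5 _ _ h _ _ := inv n in h)
  (fun n => let: And5 _ _ _ h _ := inv n in h).
have [b Hb] := mono Y (fun n => let: And5 _ _ _ _ (conj h _) := inv n in h)
  (fun n => let: And5 _ _ _ _ (conj _ h) := inv n in h).
have [d d0 Hd] := loc a b (Ha 0%N) (Hb 0%N).
have [n rn] : exists n, r n < d.
  have [n Hn] : exists n : nat, r0 / d < n%:R.
    by exists (Num.bound (r0 / d)); rewrite archi_boundP // divr_ge0 ?ltW.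
  exists n; have [_ -> _ _ _] := inv n.
  rewrite ltr_pdivrMr ?exprn_gt0 // mulrC -ltr_pdivrMr //; apply: lt_trans Hn _.
  by rewrite -natrX ltr_nat ltn_expl.
have [nP' rn' _ _ _] := inv n; apply: nP'.
have rp : 0 < r n by rewrite rn' divr_gt0 ?exprn_gt0.
have out m : [/\ x0 <= X m, X m + r m <= x0 + r0, y0 <= Y m & Y m + r m <= y0 + r0].
  elim: m => [|m [h1 h2 h3 h4]]; first by rewrite /X /Y /r /=.
  have [_ _ i1 i2 [i3 i4]] := inv m.
  split; [exact: le_trans h1 _ | exact: le_trans i2 _ | exact: le_trans h3 _ | exact: le_trans i4 _].
by have [h1 h2 h3 h4] := out n; apply: Hd => //; rewrite rp.
Qed.

End Cousin.

(** * Mean value inequalities of first and second order *)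

Section MeanValue.
Variable R : realType.
Local Notation C := (Cplx R).
Local Notation Re := complex.Re.

(** Near each point the increment of f is at most K + e' times the length, and such bounds add up
    when an interval is cut in two. Cousin's lemma makes the bound global; e' is arbitrary. *)
Lemma mvi (f : C -> C) (l : R -> C) (a b K : R) : a <= b ->
  (forall x, a <= x <= b -> cder (@Dre R) f x%:C (l x)) ->
  (forall x, a <= x <= b -> nrm (l x) <= K) ->
  nrm (f b%:C - f a%:C) <= K * (b - a).
Proof.
rewrite le_eqVlt => /predU1P[-> _ _|ab fl lK]; first by rewrite !subrr nrm0 mulr0.
apply/ler_addgt0Pl => e e0; pose e' := e / (b - a).
have ba : 0 < b - a by rewrite subr_gt0.
have e'0 : 0 < e' by rewrite divr_gt0.
have -> : e + K * (b - a) = (K + e') * (b - a) by rewrite mulrDl /e' divfK ?gt_eqF // addrC.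
(* The property ignores y: a square stands for its horizontal side. *)
pose P (x y r : R) := nrm (f (x + r)%:C - f x%:C) <= (K + e') * r.
suff: P a 0 (b - a) by rewrite /P [a + _]addrC subrK.
apply: (@cousin _ (fun x y r => P x y r)) => // [x y h h0 P1 P2 _ _|u v Hu _].
  have := nrm_tri (f (x + (h + h))%:C) (f (x + h)%:C) (f x%:C).
  by rewrite /P -addrA in P1 P2 *; lra.
rewrite addrC subrK in Hu.
have [d d0 Hd] := fl u Hu _ e'0; exists d => // x y r /andP[r0 rd] /andP[xu ux] _ _ _ _ _.
have loc t : `|t - u| < d -> nrm (f t%:C - f u%:C) <= (K + e') * `|t - u|.
  move=> tu; have := Hd t%:C; rewrite -rmorphB nrm_real => /(_ (erefl _) tu) h.
  have := nrmD (f t%:C - f u%:C - l u * (t - u)%:C) (l u * (t - u)%:C).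
  rewrite subrK nrmM nrm_real; have := lK u Hu => h1.
  have h2 : nrm (l u) * `|t - u| <= K * `|t - u| by rewrite ler_wpM2r.
  by rewrite mulrDl; lra.
have h1 := loc (x + r); have h2 := loc x.
rewrite ger0_norm in h1; last by lra.
rewrite distrC ger0_norm in h2; last by lra.
have i1 := h1 ltac:(lra); have i2 := h2 ltac:(lra).
have := nrm_tri (f (x + r)%:C) (f u%:C) (f x%:C); rewrite [nrm (f u%:C - f x%:C)]nrmC.
rewrite /P => i3; have -> : (K + e') * r = (K + e') * (x + r - u) + (K + e') * (u - x) by ring.
lra.
Qed.

Lemma cmvi (f : C -> C) (l : C -> C) (z h : C) (K : R) :
  (forall t : R, 0 <= t <= 1 -> cder setT f (z + t%:C * h) (l (z + t%:C * h))) ->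
  (forall t : R, 0 <= t <= 1 -> nrm (l (z + t%:C * h)) <= K) ->
  nrm (f (z + h) - f z) <= K * nrm h.
Proof.
move=> fl lK; have := @mvi (fun y => f (z + y * h)) (fun t => l (z + t%:C * h) * h) 0 1 (K * nrm h) ler01.
rewrite mul1r mul0r addr0 subr0 mulr1; apply=> x Hx; last first.
  by rewrite nrmM ler_wpM2r ?nrm_ge0 ?lK.
have inn : cder (@Dre R) (fun y => z + y * h) x%:C h.
  apply: cder_eq (cderD (cder_cst _ _ _) (cderM (cder_id _ _) (cder_cst _ h _))) _.
  by ring.
exact: cder_comp inn (fl x Hx).
Qed.

(** The first-order inequality is used twice: on l, and on y -> f y - l z * (y - z), whose
    derivative is l y - l z. This gives K instead of the optimal K/2, which does not matter for the
    applications. *)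
Lemma cmvi2 (f l l2 : C -> C) (z h : C) (K : R) :
  (forall t : R, 0 <= t <= 1 -> cder setT f (z + t%:C * h) (l (z + t%:C * h))) ->
  (forall t : R, 0 <= t <= 1 -> cder setT l (z + t%:C * h) (l2 (z + t%:C * h))) ->
  (forall t : R, 0 <= t <= 1 -> nrm (l2 (z + t%:C * h)) <= K) ->
  nrm (f (z + h) - f z - l z * h) <= K * nrm h ^+ 2.
Proof.
move=> fl ll lK.
have := @cmvi (fun y => f y - l z * (y - z)) (fun y => l y - l z) z h (K * nrm h).
have -> : f (z + h) - f z - l z * h =
  f (z + h) - l z * (z + h - z) - (f z - l z * (z - z)) by ring.
rewrite expr2 mulrA; apply=> t Ht.
  apply: cder_eq (cderB (fl t Ht) (cderZ (l z) (cderB (cder_id _ _) (cder_cst _ z _)))) _.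
  by rewrite subr0 mulr1.
have /andP[t0 t1] := Ht.
have := @cmvi l l2 z (t%:C * h) K.
have K0 : 0 <= K by apply: le_trans (nrm_ge0 _) (lK 0 _); rewrite lexx ler01.
rewrite nrmM nrm_real (ger0_norm t0) => /(_ _ _) H; apply: le_trans (H _ _) _.
- move=> s /andP[s0 s1]; rewrite mulrA -rmorphM; apply: ll.
  by rewrite mulr_ge0 // mulr_ile1.
- move=> s /andP[s0 s1]; rewrite mulrA -rmorphM; apply: lK.
  by rewrite mulr_ge0 // mulr_ile1.
by rewrite ler_wpM2l // ler_piMl ?nrm_ge0.
Qed.

End MeanValue.

(** * Unordered sums *)

Section Sums.
Variable R : realType.
Local Notation C := (Cplx R).
Local Notation Re := complex.Re.
Local Notation Im := complex.Im.

(** Limit along the finite subsets of the index set, without any enumeration, so that reindexing and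
    grouping are direct. It amounts to absolute convergence, by [absum_hasSum] and
    [hasSum_absum]. *)
Definition hasSum (I : eqType) (f : I -> C) (l : C) := forall e : R, 0 < e ->
  exists A : seq I, forall B, uniq B -> {subset A <= B} ->
    nrm (\sum_(i <- B) f i - l) <= e.

Definition absum (I : eqType) (g : I -> R) :=
  exists M : R, forall B, uniq B -> \sum_(i <- B) g i <= M.

Section One.
Variable I : eqType.
Implicit Types (f g : I -> C) (l m : C) (h : I -> R) (A B : seq I).

Lemma big_subset (T : nmodType) (F : I -> T) A B : uniq A -> uniq B -> {subset A <= B} ->
  \sum_(i <- B) F i = \sum_(i <- A) F i + \sum_(i <- B | i \notin A) F i.
Proof.
move=> uA uB sAB; rewrite (bigID (mem A)) /=; congr (_ + _).
rewrite -big_filter; apply: perm_big; apply: uniq_perm => //; first exact: filter_uniq.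
by move=> i; rewrite mem_filter; case: (boolP (i \in A)) => //= /sAB.
Qed.

Lemma hasSum_unique f l m : hasSum f l -> hasSum f m -> l = m.
Proof.
move=> Hl Hm; apply/eqP; rewrite -subr_eq0; apply/eqP/nrm_le0 => e e0.
have e2 : 0 < e / 2 by rewrite divr_gt0.
have [A HA] := Hl _ e2; have [B HB] := Hm _ e2.
have sA : {subset A <= undup (A ++ B)} by move=> i iA; rewrite mem_undup mem_cat iA.
have sB : {subset B <= undup (A ++ B)} by move=> i iB; rewrite mem_undup mem_cat iB orbT.
have := HA _ (undup_uniq _) sA; have := HB _ (undup_uniq _) sB.
set S := \sum_(_ <- _) _; have := nrm_tri l S m; rewrite [nrm (l - S)]nrmC; lra.
Qed.

Lemma hasSum_ext f g l : (forall i, f i = g i) -> hasSum f l -> hasSum g l.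
Proof. by move=> fg; have -> : f = g by exact: funext. Qed.

Lemma hasSumD f g l m : hasSum f l -> hasSum g m -> hasSum (fun i => f i + g i) (l + m).
Proof.
move=> Hl Hm e e0; have e2 : 0 < e / 2 by rewrite divr_gt0.
have [A HA] := Hl _ e2; have [B HB] := Hm _ e2; exists (A ++ B) => D uD sD.
have sA : {subset A <= D} by move=> i iA; rewrite sD // mem_cat iA.
have sB : {subset B <= D} by move=> i iB; rewrite sD // mem_cat iB orbT.
have := HA _ uD sA; have := HB _ uD sB; rewrite big_split /= opprD addrACA.
have := nrmD (\sum_(i <- D) f i - l) (\sum_(i <- D) g i - m); lra.
Qed.

Lemma hasSumZ (c : C) f l : hasSum f l -> hasSum (fun i => c * f i) (c * l).
Proof.
move=> H e e0; have c1 : 0 < nrm c + 1 by rewrite ltr_wpDl ?nrm_ge0.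
have [A HA] := H (e / (nrm c + 1)) ltac:(by rewrite divr_gt0); exists A => B uB sB.
have := HA B uB sB; rewrite -mulr_sumr -mulrBr nrmM ler_pdivlMr //.
have := nrm_ge0 (\sum_(i <- B) f i - l); nra.
Qed.

Lemma hasSumN f l : hasSum f l -> hasSum (fun i => - f i) (- l).
Proof.
by move/(hasSumZ (-1)); rewrite mulN1r; apply: hasSum_ext => i; rewrite mulN1r.
Qed.

Lemma hasSumB f g l m : hasSum f l -> hasSum g m -> hasSum (fun i => f i - g i) (l - m).
Proof. by move=> Hf Hg; apply: hasSumD => //; exact: hasSumN. Qed.

Lemma hasSum_fin f A : uniq A -> (forall i, i \notin A -> f i = 0) ->
  hasSum f (\sum_(i <- A) f i).
Proof.
move=> uA f0 e e0; exists A => B uB sB; rewrite (big_subset _ uA) //.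
have -> : \sum_(i <- B | i \notin A) f i = 0 by exact: big1.
by rewrite addr0 subrr nrm0 ltW.
Qed.

Lemma hasSum0 : hasSum (fun _ : I => 0) 0.
Proof. by have := @hasSum_fin (fun _ => 0) [::] isT (fun _ _ => erefl); rewrite big_nil. Qed.

Lemma hasSum_sum (J : Type) (r : seq J) (F : J -> I -> C) (l : J -> C) :
  (forall j, hasSum (F j) (l j)) ->
  hasSum (fun i => \sum_(j <- r) F j i) (\sum_(j <- r) l j).
Proof.
move=> H; elim: r => [|j r ih].
  by rewrite big_nil; apply: hasSum_ext hasSum0 => i; rewrite big_nil.
by rewrite big_cons; apply: hasSum_ext (hasSumD (H j) ih) => i; rewrite big_cons.
Qed.

Lemma absum_le h h' : (forall i, h i <= h' i) -> absum h' -> absum h.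
Proof.
by move=> le [M HM]; exists M => B uB; apply: le_trans (HM B uB); exact: ler_sum.
Qed.

Lemma absumZ (c : R) h : 0 <= c -> absum h -> absum (fun i => c * h i).
Proof.
move=> c0 [M HM]; exists (c * M) => B uB; rewrite -mulr_sumr ler_wpM2l //; exact: HM.
Qed.

Lemma absumD h h' : absum h -> absum h' -> absum (fun i => h i + h' i).
Proof.
move=> [M HM] [M' HM']; exists (M + M') => B uB.
by rewrite big_split /= lerD ?HM ?HM'.
Qed.

Lemma absum_cofin h h' A : (forall i, 0 <= h' i) -> (forall i, i \notin A -> h i <= h' i) ->
  absum h' -> absum h.
Proof.
move=> h0 le [M HM]; exists (\sum_(i <- undup A) `|h i| + M) => B uB.
rewrite (bigID (mem A)) /= lerD //.
  apply: (@le_trans _ _ (\sum_(i <- B | i \in A) `|h i|)).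
    by apply: ler_sum => i _; exact: ler_norm.
  rewrite -[X in X <= _]big_filter [X in _ <= X](@big_subset _ _ [seq i <- B | i \in A]) ?filter_uniq ?undup_uniq //.
    by rewrite lerDl sumr_ge0.
  by move=> i; rewrite mem_filter mem_undup => /andP[].
apply: le_trans (HM B uB); rewrite [X in _ <= X](bigID (mem A)) /= -[X in X <= _]add0r.
by rewrite lerD ?sumr_ge0 //; apply: ler_sum.
Qed.

Section Nonneg.
Variable h : I -> R.
Hypotheses (h0 : forall i, 0 <= h i) (hs : absum h).

Lemma absum_tail (e : R) : 0 < e -> exists2 A, uniq A &
  forall B, uniq B -> (forall i, i \in B -> i \notin A) -> \sum_(i <- B) h i <= e.
Proof.
move=> e0; have [M HM] := hs.
pose S := [set x | exists2 B, uniq B & x = \sum_(i <- B) h i].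
have Ss : has_sup S.
  split; first by exists (\sum_(i <- [::]) h i), [::].
  by exists M => _ [B uB ->]; exact: HM.
have [_ [A uA ->] HA] := sup_adherent e0 Ss; exists A => // B uB dB.
have : S (\sum_(i <- A ++ B) h i).
  exists (A ++ B) => //; rewrite cat_uniq uA uB andbT /=.
  by apply/hasPn => i iB; exact: dB.
by move/(ub_le_sup Ss.2); rewrite big_cat /=; lra.
Qed.

Lemma absum_real : exists l : R, hasSum (fun i => (h i)%:C) l%:C.
Proof.
have [M HM] := hs; pose S := [set x | exists2 B, uniq B & x = \sum_(i <- B) h i].
have Ss : has_sup S.
  split; first by exists (\sum_(i <- [::]) h i), [::].
  by exists M => _ [B uB ->]; exact: HM.
exists (sup S) => e e0; have [_ [A uA ->] HA] := sup_adherent e0 Ss.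
exists A => B uB sB; rewrite -rmorph_sum -rmorphB nrm_real distrC.
have SB : \sum_(i <- B) h i <= sup S by apply: (ub_le_sup Ss.2); exists B.
rewrite ger0_norm ?subr_ge0 // (big_subset _ uA uB sB).
have : 0 <= \sum_(i <- B | i \notin A) h i by exact: sumr_ge0.
lra.
Qed.

End Nonneg.

(** A real function g with |g| <= |f| is the difference of the nonnegative summable functions g +
    |f| and |f|. This applies to the real and the imaginary part of f. *)
Lemma absum_hasSum f : absum (fun i => nrm (f i)) -> exists l, hasSum f l.
Proof.
move=> H; have dom (g : I -> R) : (forall i, `|g i| <= nrm (f i)) ->
    exists l : R, hasSum (fun i => (g i)%:C) l%:C.
  move=> gf.
  have [||a Ha] := @absum_real (fun i => g i + nrm (f i)).
  - by move=> i; have := gf i; rewrite ler_norml => /andP[]; lra.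
  - apply: absum_le (absumD H H) => i; rewrite lerD2r.
    by apply: le_trans (ler_norm _) _.
  have [||b Hb] := @absum_real (fun i => nrm (f i)) => //; first by move=> i; exact: nrm_ge0.
  exists (a - b); rewrite rmorphB; apply: hasSum_ext (hasSumB Ha Hb) => i.
  by rewrite rmorphD /= addrK.
have [a Ha] := dom (fun i => Re (f i)) (fun i => nrm_Re _).
have [b Hb] := dom (fun i => Im (f i)) (fun i => nrm_Im _).
exists (a%:C + 'i * b%:C); apply: hasSum_ext (hasSumD Ha (hasSumZ 'i Hb)) => i.
by rewrite [RHS]complexE.
Qed.

(** The finite set A depends only on the majorant h, so the error bound is uniform in any parameter
    on which f depends. This is the uniform convergence used in [weierstrass]. *)
Lemma hasSum_dom f l h A (e : R) : (forall i, nrm (f i) <= h i) -> hasSum f l ->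
  (forall B, uniq B -> (forall i, i \in B -> i \notin A) -> \sum_(i <- B) h i <= e) ->
  forall B, uniq B -> {subset A <= B} -> nrm (\sum_(i <- B) f i - l) <= e.
Proof.
move=> fh Hl HA B uB sB; apply/ler_addgt0Pl => e' e'0.
have [D HD] := Hl _ e'0; pose D' := undup (B ++ D).
have sBD : {subset B <= D'} by move=> i iB; rewrite mem_undup mem_cat iB.
have sDD : {subset D <= D'} by move=> i iB; rewrite mem_undup mem_cat iB orbT.
have := HD _ (undup_uniq _) sDD; rewrite (big_subset _ uB (undup_uniq _) sBD).
set s := \sum_(i <- B) _; set t := \sum_(i <- _ | _) _ => h1.
have h2 : nrm t <= e.
  apply: le_trans (nrm_sum _ _ _) _; rewrite -big_filter.
  apply: le_trans (HA [seq i <- undup (B ++ D) | i \notin B] _ _).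
  - by apply: ler_sum => i _; exact: fh.
  - by rewrite filter_uniq ?undup_uniq.
  - by move=> i; rewrite mem_filter => /andP[iB _]; apply: contra iB => /sB.
have -> : s - l = (s + t - l) - t by ring.
by apply: le_trans (nrmB _ _) _; rewrite lerD.
Qed.

Lemma hasSum_bound f l (M : R) : hasSum f l ->
  (forall B, uniq B -> \sum_(i <- B) nrm (f i) <= M) -> nrm l <= M.
Proof.
move=> Hl HM; have := @hasSum_dom f l (fun i => nrm (f i)) [::] M (fun i => lexx _) Hl.
move=> /(_ (fun B uB _ => HM B uB) [::] isT (fun _ => id)).
by rewrite big_nil sub0r nrmN.
Qed.

Lemma hasSum_exhaust f l (E : nat -> seq I) : (forall n, uniq (E n)) ->
  (forall i, exists n0, forall n, (n0 <= n)%N -> i \in E n) ->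
  hasSum f l -> scvg (fun n => \sum_(i <- E n) f i) l.
Proof.
move=> uE HE Hl e e0; have [A HA] := Hl (e / 2) ltac:(by rewrite divr_gt0).
have [n0 Hn] : exists n0, forall n, (n0 <= n)%N -> {subset A <= E n}.
  elim: A {HA} => [|i A [n1 H1]]; first by exists 0%N.
  have [n2 H2] := HE i; exists (maxn n1 n2) => n; rewrite geq_max => /andP[le1 le2] j.
  by rewrite inE => /predU1P[->|/(H1 n le1)]; rewrite ?H2.
exists n0 => n le; have := HA _ (uE n) (Hn n le); lra.
Qed.

End One.

Lemma hasSum_sigma (I J : eqType) (f : I * J -> C) (r : I -> C) l :
  (forall i, hasSum (fun j => f (i, j)) (r i)) -> hasSum f l -> hasSum r l.
Proof.
move=> Hr Hl e e0; have e2 : 0 < e / 2 by rewrite divr_gt0.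
have [A HA] := Hl _ e2; exists (map fst A) => B uB sB.
have e3 : 0 < e / 2 / (size B).+1%:R by rewrite !divr_gt0.
have [Aj HAj] := choice (fun i => Hr i _ e3).
(* The rectangle B x B' contains A and at the same time approximates each row sum over B; the
   tolerance per row was divided by the number of rows. *)
pose B' := undup (map snd A ++ flatten [seq Aj i | i <- B]).
have uB' : uniq B' by exact: undup_uniq.
have h1 : nrm (\sum_(p <- allpairs pair B B') f p - l) <= e / 2.
  apply: HA; first by rewrite allpairs_uniq // => -[a b] [c d] _ _ [-> ->].
  move=> [i j] ijA; apply/allpairsP; exists (i, j); split => //=.
    by apply: sB; apply/mapP; exists (i, j).
  by rewrite mem_undup mem_cat; apply/orP; left; apply/mapP; exists (i, j).
rewrite big_allpairs_dep /= in h1.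
have h2 : nrm (\sum_(i <- B) \sum_(j <- B') f (i, j) - \sum_(i <- B) r i) <= e / 2.
  rewrite -sumrB; apply: le_trans (nrm_sum _ _ _) _.
  apply: (@le_trans _ _ (\sum_(i <- B) (e / 2 / (size B).+1%:R))).
    rewrite big_seq [X in _ <= X]big_seq; apply: ler_sum => i iB; apply: HAj => // j jA.
    rewrite mem_undup mem_cat; apply/orP; right; apply/flattenP; exists (Aj i) => //.
    by apply/mapP; exists i.
  rewrite big_const_seq count_predT iter_addr_0.
  move: (e / 2) e2 => c c0; rewrite -[_ *+ size B]mulr_natr mulrAC ler_pdivrMr //.
  by rewrite ler_wpM2l ?(ltW c0) // ler_nat.
set s := \sum_(i <- B) \sum_(j <- B') f (i, j) in h1 h2.
have := nrm_tri (\sum_(i <- B) r i) s l; rewrite [nrm (_ - s)]nrmC; lra.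
Qed.

Lemma hasSum_fiber (I J : eqType) (f : I -> C) (p : I -> J) (F : J -> seq I) l :
  (forall j, uniq (F j)) -> (forall i j, (i \in F j) = (p i == j)) ->
  hasSum f l -> hasSum (fun j => \sum_(i <- F j) f i) l.
Proof.
move=> uF FE Hl e e0; have [A HA] := Hl _ e0; exists (map p A) => B uB sB.
have -> : \sum_(j <- B) \sum_(i <- F j) f i = \sum_(i <- flatten [seq F j | j <- B]) f i.
  by rewrite big_flatten big_map.
apply: HA => [|i iA].
  elim: B uB {sB} => [|j B ih] //= /andP[jB uB]; rewrite cat_uniq uF ih // andbT.
  apply/hasPn => i /flattenP[_ /mapP[k kB ->]]; rewrite /= !FE => /eqP ->.
  by apply: contra jB => /eqP <-.
apply/flattenP; exists (F (p i)); last by rewrite FE.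
by apply/map_f/sB/map_f.
Qed.

Section Reindex.
Variables (I J : eqType) (phi : I -> J) (psi : J -> I).
Hypothesis phiK : cancel phi psi.

Lemma hasSum_reindex (f : J -> C) l : (forall j, f j != 0 -> phi (psi j) = j) ->
  hasSum (fun i => f (phi i)) l -> hasSum f l.
Proof.
move=> f0 Hl e e0; have [A HA] := Hl _ e0; exists (map phi A) => B uB sB.
pose B' := map psi [seq j <- B | phi (psi j) == j].
have injp : {in [seq j <- B | phi (psi j) == j] &, injective psi}.
  by move=> j j'; rewrite !mem_filter => /andP[/eqP <- _] /andP[/eqP <- _]; rewrite !phiK => ->.
have := HA B'; rewrite map_inj_in_uniq // filter_uniq // => /(_ isT).
rewrite big_map big_filter (eq_bigr f) => [|j /eqP -> //].
have -> : \sum_(j <- B | phi (psi j) == j) f j = \sum_(j <- B) f j.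
  rewrite [RHS](bigID (fun j => phi (psi j) == j)) /= [X in _ = _ + X]big1 ?addr0 // => j jj.
  by apply/eqP; apply: contraNT jj => /f0/eqP.
apply=> i iA; apply/mapP; exists (phi i); last by rewrite phiK.
by rewrite mem_filter phiK eqxx; apply/sB/map_f.
Qed.

Lemma hasSum_reindexV (f : J -> C) l : (forall j, f j != 0 -> phi (psi j) = j) ->
  hasSum f l -> hasSum (fun i => f (phi i)) l.
Proof.
move=> f0 Hl e e0; have [A HA] := Hl _ e0.
exists (map psi [seq j <- A | phi (psi j) == j]) => B uB sB.
have up : uniq (map phi B) by rewrite map_inj_uniq //; exact: can_inj phiK.
pose D := undup (map phi B ++ A).
have sBD : {subset map phi B <= D} by move=> i iB; rewrite mem_undup mem_cat iB.
have sAD : {subset A <= D} by move=> i iB; rewrite mem_undup mem_cat iB orbT.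
have := HA D (undup_uniq _) sAD; rewrite (big_subset _ up (undup_uniq _) sBD).
rewrite [X in _ + X - _]big_seq_cond [X in _ + X - _]big1 => [|j /andP[]].
  by rewrite addr0 big_map.
rewrite mem_undup mem_cat => /orP[->//|jA jB]; apply/eqP; apply: contraNT jB => /f0 jE.
rewrite -jE map_f //; apply: sB; apply/mapP; exists j => //.
by rewrite mem_filter jE eqxx.
Qed.

Lemma absum_reindex (h : J -> R) : absum h -> absum (fun i => h (phi i)).
Proof.
move=> [M HM]; exists M => B uB; have := HM (map phi B).
by rewrite big_map map_inj_uniq; [apply | exact: can_inj phiK].
Qed.

End Reindex.

Lemma absum_prod (I J : eqType) (g : I -> R) (h : J -> R) :
  (forall i, 0 <= g i) -> (forall j, 0 <= h j) -> absum g -> absum h ->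
  absum (fun p : I * J => g p.1 * h p.2).
Proof.
move=> g0 h0 [M HM] [N HN]; exists (M * N) => B uB.
pose B1 := undup (map fst B); pose B2 := undup (map snd B).
have u12 : uniq (allpairs pair B1 B2).
  by rewrite allpairs_uniq ?undup_uniq // => -[a b] [c d] _ _ [-> ->].
have sB : {subset B <= allpairs pair B1 B2}.
  move=> [i j] ijB; apply/allpairsP; exists (i, j); rewrite /= !mem_undup; split=> //.
    by apply/mapP; exists (i, j).
  by apply/mapP; exists (i, j).
apply: (@le_trans _ _ (\sum_(p <- allpairs pair B1 B2) g p.1 * h p.2)).
  by rewrite [X in _ <= X](big_subset _ uB) // lerDl sumr_ge0 // => i _; rewrite mulr_ge0.
rewrite big_allpairs_dep /=; under eq_bigr do rewrite -mulr_sumr.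
rewrite -mulr_suml ler_pM ?sumr_ge0 ?HM ?HN ?undup_uniq //.
Qed.

Lemma absum_nat (g : nat -> R) (M : R) : (forall n, 0 <= g n) ->
  (forall n, \sum_(0 <= i < n) g i <= M) -> absum g.
Proof.
move=> g0 HM; exists M => B uB; apply: le_trans (HM (\max_(i <- B) i).+1).
rewrite [X in _ <= X](big_subset _ uB) ?iota_uniq //; first by rewrite lerDl sumr_ge0.
by move=> i iB; rewrite mem_iota /= subn0 add0n ltnS (@leq_bigmax_seq _ _ _ id).
Qed.

Lemma absum_int (g : nat -> R) : (forall n, 0 <= g n) -> absum g ->
  absum (fun z : int => g `|z|%N).
Proof.
move=> g0 [M HM]; exists (M + M) => B uB; rewrite (bigID (fun z : int => 0 <= z)) /=.
have aux (P : pred int) : {in P &, injective (fun z : int => `|z|%N)} ->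
    \sum_(i <- B | P i) g `|i|%N <= M.
  move=> inj; rewrite -big_filter -(big_map (fun z : int => `|z|%N) xpredT g); apply: HM.
  rewrite map_inj_in_uniq ?filter_uniq // => x y; rewrite !mem_filter.
  by move=> /andP[Px _] /andP[Py _]; exact: inj.
by apply: lerD; apply: aux => x y; rewrite -!topredE /=; lia.
Qed.

Lemma absum_geo (x : R) : 0 <= x < 1 -> absum (fun n => x ^+ n).
Proof.
move=> /andP[x0 x1]; apply: (@absum_nat _ (1 - x)^-1) => n; first exact: exprn_ge0.
have x1' : 0 < 1 - x by rewrite subr_gt0.
rewrite -[X in _ <= X]mul1r ler_pdivlMr // mulrC big_mkord.
have -> : (1 - x) * \sum_(i < n) x ^+ i = 1 - x ^+ n.
  by have := subrX1 x n => h; rewrite -opprB -[RHS]opprB h mulNr.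
by rewrite gerBl exprn_ge0.
Qed.

(** With d = q - 1, the inequality d (n+2)^-q <= (n+1)^-d - (n+2)^-d bounds the sum by a telescoping
    one. It follows from ln (n+2) - ln (n+1) >= 1/(n+2) and exp x >= 1 + x. *)
Lemma absum_power (q : R) : 1 < q -> absum (fun n : nat => expR (- q * ln n.+1%:R)).
Proof.
move=> q1; pose d := q - 1; have d0 : 0 < d by rewrite subr_gt0.
pose t (n : nat) := expR (- d * ln n.+1%:R).
have step (n : nat) : d * expR (- q * ln n.+2%:R) <= t n - t n.+1.
  have n1 : 0 < (n.+1%:R : R) by []. have n2 : 0 < (n.+2%:R : R) by [].
  have tE : t n = t n.+1 * expR (d * (ln n.+2%:R - ln n.+1%:R)).
    by rewrite /t -expRD; congr expR; ring.
  have lE : ln n.+2%:R - ln n.+1%:R >= (n.+2%:R : R)^-1.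
    rewrite -[ln n.+1%:R]opprK opprK -ln_div ?posrE // -[X in _ <= X]opprK -lnV ?posrE ?divr_gt0 //.
    rewrite invf_div; set y := _ / _; have y0 : 0 < y by rewrite divr_gt0.
    have yE : y = 1 - n.+2%:R^-1 by apply: (mulIf (lt0r_neq0 n2)); rewrite divfK ?lt0r_neq0 // mulrBl mulVf ?lt0r_neq0 // mul1r -[n.+2%:R]natr1 addrK.
    have := le_ln1Dx (_ : -1 < y - 1); rewrite addrCA subrr addr0.
    clearbody y; have yy : -1 < y - 1 by lra.
    move: yE; set v := _^-1 => yE; clearbody v.
    by move=> /(_ yy); lra.
  have qE : expR (- q * ln n.+2%:R) = t n.+1 * (n.+2%:R)^-1.
    rewrite /t -[X in _ * X^-1](lnK (_ : (n.+2%:R : R) \is Num.pos)) ?posrE // -expRN -expRD.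
    by congr expR; rewrite /d; ring.
  rewrite tE qE; have tp : 0 < t n.+1 by exact: expR_gt0.
  rewrite mulrCA -[X in _ - X]mulr1 -mulrBr ler_wpM2l ?(ltW tp) //.
  have := expR_ge1Dx (d * (ln n.+2%:R - ln n.+1%:R)).
  have : d * (n.+2%:R)^-1 <= d * (ln n.+2%:R - ln n.+1%:R) by rewrite ler_wpM2l // ltW.
  by move: (d * _) (d * _) => u v h1 h2; rewrite lerBrDr addrC (le_trans _ h2) // lerD2l.
have bound n : d * \sum_(0 <= i < n) expR (- q * ln i.+2%:R) <= t 0%N - t n.
  elim: n => [|n ih]; first by rewrite big_nil mulr0 subrr.
  by rewrite big_nat_recr //= mulrDr; have := step n; lra.
apply: (@absum_nat _ (1 + d^-1)) => [n|[|n]]; first exact: expR_ge0.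
  by rewrite big_nil; rewrite addr_ge0 ?invr_ge0 // ltW.
rewrite big_nat_recl //= ln1 mulr0 expR0 lerD2l -[X in _ <= X]mul1r ler_pdivlMr // mulrC.
apply: le_trans (bound n) _; rewrite {1}/t ln1 mulr0 expR0.
by have := expR_ge0 (- d * ln n.+1%:R); rewrite -/(t n); lra.
Qed.

Lemma hasSum_nat (f : nat -> C) l : hasSum f l -> scvg (fun n => \sum_(j < n) f j) l.
Proof.
move=> H; have := hasSum_exhaust (E := fun n => iota 0 n) (fun n => iota_uniq _ _) _ H.
have -> : (fun n => \sum_(i <- iota 0 n) f i) = (fun n => \sum_(j < n) f j).
  by apply: funext => n; rewrite -(big_mkord xpredT f) /index_iota subn0.
by apply=> i; exists i.+1 => n; rewrite mem_iota.
Qed.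

Lemma lattice_sum_hasSum (F : int -> int -> C) l :
  hasSum (fun p : int * int => F p.1 p.2) l -> lattice_sum F = l.
Proof.
move=> H; apply: scvg_lim.
pose S n := [seq i%:Z - n%:Z | i <- iota 0 n.*2.+1].
pose E n := allpairs pair (S n) (S n).
have uS n : uniq (S n) by rewrite map_inj_uniq ?iota_uniq // => x y; lia.
have memS n (z : int) : (`|z| <= n)%N -> z \in S n.
  move=> zn; apply/mapP; exists (absz (z + n%:Z)); last by lia.
  by rewrite mem_iota; lia.
have uE n : uniq (E n) by rewrite allpairs_uniq // => -[a b] [c d] _ _ [-> ->].
have := hasSum_exhaust uE _ H.
have -> : (fun n => \sum_(i <- E n) F i.1 i.2) =
  (fun n => \sum_(i < n.*2.+1) \sum_(j < n.*2.+1) F (i%:Z - n%:Z) (j%:Z - n%:Z)).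
  apply: funext => n; rewrite big_allpairs_dep big_map.
  rewrite -[iota 0 _]/(index_iota 0 n.*2.+1) big_mkord; apply: eq_bigr => i _.
  by rewrite big_map -[iota 0 _]/(index_iota 0 n.*2.+1) big_mkord.
apply=> -[a b]; exists (maxn `|a| `|b|)%N => n; rewrite geq_max => /andP[an bn].
by apply/allpairsP; exists (a, b); rewrite !memS.
Qed.

Lemma hasSum_mul (I J : eqType) (f : I -> C) (g : J -> C) l m :
  absum (fun i => nrm (f i)) -> absum (fun j => nrm (g j)) ->
  hasSum f l -> hasSum g m -> hasSum (fun p : I * J => f p.1 * g p.2) (l * m).
Proof.
move=> af ag Hf Hg.
have [|t Ht] := @absum_hasSum _ (fun p : I * J => f p.1 * g p.2).
  apply: absum_le (absum_prod (fun i => nrm_ge0 _) (fun i => nrm_ge0 _) af ag) => p.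
  by rewrite nrmM.
suff <- : t = l * m by [].
apply: hasSum_unique (hasSum_sigma (fun i => hasSumZ (f i) Hg) Ht) _.
by rewrite mulrC; apply: hasSum_ext (hasSumZ m Hf) => i; rewrite mulrC.
Qed.

End Sums.

(** * Cauchy's theorem on squares *)

Section SegmentIntegral.
Variable R : realType.
Local Notation C := (Cplx R).
Local Notation Re := complex.Re.
Local Notation Im := complex.Im.
Local Notation mu := (@lebesgue_measure R).
Implicit Types (g : R -> C) (a b : R).

Definition rcont g a b := forall t, a <= t <= b -> forall e : R, 0 < e ->
  exists2 d : R, 0 < d & forall u : R, `|u - t| < d -> nrm (g u - g t) <= e.

Definition rint (f : R -> R) a b : R := \int[mu]_(x in `[a, b]) f x.

Definition cint g a b : C :=
  locked ((rint (fun t => Re (g t)) a b)%:C + 'i * (rint (fun t => Im (g t)) a b)%:C).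

Lemma rcont_int (p : C -> R) g a b : (forall z w, `|p z - p w| <= nrm (z - w)) ->
  rcont g a b -> mu.-integrable `[a, b] (EFin \o (fun t => p (g t))).
Proof.
move=> pp H; apply: continuous_compact_integrable; first exact: segment_compact.
apply: continuous_in_subspaceT => t; rewrite inE /= in_itv /= => tab.
apply/cvgrPdist_le => e e0; have [d d0 Hd] := H t tab e e0.
apply/nbhs_ballP; exists d => //= u; rewrite /ball /= distrC => /Hd h.
by rewrite distrC; apply: le_trans (pp _ _) h.
Qed.

Lemma Re_lip z w : `|Re z - Re w| <= nrm (z - w :> C).
Proof. by rewrite -ReN -ReD nrm_Re. Qed.
Lemma Im_lip z w : `|Im z - Im w| <= nrm (z - w :> C).
Proof. by rewrite -ImN -ImD nrm_Im. Qed.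

Lemma intRe g a b : rcont g a b -> mu.-integrable `[a, b] (EFin \o (fun t => Re (g t))).
Proof. by move=> H; apply: (@rcont_int (fun z => Re z)) H => z w; exact: Re_lip. Qed.
Lemma intIm g a b : rcont g a b -> mu.-integrable `[a, b] (EFin \o (fun t => Im (g t))).
Proof. by move=> H; apply: (@rcont_int (fun z => Im z)) H => z w; exact: Im_lip. Qed.

Lemma Re_cint g a b : Re (cint g a b) = rint (fun t => Re (g t)) a b.
Proof. by rewrite /cint -lock !ReImE /= ; ring. Qed.
Lemma Im_cint g a b : Im (cint g a b) = rint (fun t => Im (g t)) a b.
Proof. by rewrite /cint -lock !ReImE /= ; ring. Qed.

Lemma rint_ext (f h : R -> R) a b : (forall t, a <= t <= b -> f t = h t) -> rint f a b = rint h a b.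
Proof. by move=> fh; apply: eq_Rintegral => t; rewrite inE /= in_itv /= => /fh. Qed.

Lemma cint_ext g h a b : (forall t, a <= t <= b -> g t = h t) -> cint g a b = cint h a b.
Proof.
move=> gh; apply: cplxP; rewrite ?Re_cint ?Im_cint; apply: rint_ext => t tab;
by rewrite gh.
Qed.

Lemma rcontZ (c : C) g a b : rcont g a b -> rcont (fun t => c * g t) a b.
Proof.
move=> Hg t tab e e0; have c1 : 0 < nrm c + 1 by rewrite ltr_wpDl ?nrm_ge0.
have [d d0 Hd] := Hg t tab (e / (nrm c + 1)) ltac:(by rewrite divr_gt0).
exists d => // u /Hd; rewrite -mulrBr nrmM ler_pdivlMr //.
have := nrm_ge0 (g u - g t); nra.
Qed.

Lemma cintD g h a b : rcont g a b -> rcont h a b ->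
  cint (fun t => g t + h t) a b = cint g a b + cint h a b.
Proof.
move=> Hg Hh; apply: cplxP; rewrite !ReImE ?Re_cint ?Im_cint /rint.
  rewrite -RintegralD //; [|exact: intRe|exact: intRe].
  by apply: rint_ext => t _; rewrite ReD.
rewrite -RintegralD //; [|exact: intIm|exact: intIm].
by apply: rint_ext => t _; rewrite ImD.
Qed.

Lemma cintZ (c : C) g a b : rcont g a b -> cint (fun t => c * g t) a b = c * cint g a b.
Proof.
move=> Hg; have mI : measurable (`[a, b]%classic : set R) by [].
have iZ (x : R) (f : R -> R) : mu.-integrable `[a, b] (EFin \o f) ->
    mu.-integrable `[a, b] (EFin \o (fun t => x * f t)) by exact: integrableZl.
have iR := intRe Hg; have iI := intIm Hg.
apply: cplxP; rewrite !ReImE ?Re_cint ?Im_cint /rint -!RintegralZl //.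
  rewrite -RintegralB //; [|exact: iZ|exact: iZ].
  by apply: eq_Rintegral => t _; rewrite !ReImE.
rewrite -RintegralD //; [|exact: iZ|exact: iZ].
by apply: eq_Rintegral => t _; rewrite !ReImE.
Qed.

Lemma cintB g h a b : rcont g a b -> rcont h a b ->
  cint (fun t => g t - h t) a b = cint g a b - cint h a b.
Proof.
move=> Hg Hh; have := cintD Hg (rcontZ (-1) Hh); rewrite (cintZ _ Hh) mulN1r => <-.
by apply: cint_ext => t _; rewrite mulN1r.
Qed.

Lemma rint_cst (x : R) a b : a <= b -> rint (fun=> x) a b = x * (b - a).
Proof.
move=> ab; rewrite /rint Rintegral_cst //= lebesgue_measure_itv /= lte_fin.
by move: ab; rewrite le_eqVlt => /predU1P[->|->] //=; rewrite ltxx subrr.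
Qed.

Lemma cint_cst (c : C) a b : a <= b -> cint (fun=> c) a b = c * (b - a)%:C.
Proof.
by move=> ab; apply: cplxP; rewrite !ReImE ?Re_cint ?Im_cint rint_cst //=; ring.
Qed.

Lemma cst_integrable (x : R) a b : mu.-integrable `[a, b] (EFin \o (fun=> x)).
Proof.
apply: continuous_compact_integrable; first exact: segment_compact.
by apply: continuous_in_subspaceT => t _; exact: cvg_cst.
Qed.

Lemma rint_bound (p : C -> R) g a b (M : R) : (forall z w, `|p z - p w| <= nrm (z - w)) ->
  p 0 = 0 -> a <= b -> rcont g a b ->
  (forall t, a <= t <= b -> nrm (g t) <= M) -> `|rint (fun t => p (g t)) a b| <= M * (b - a).
Proof.
move=> pp p0 ab Hg gM; have iP := rcont_int pp Hg.
apply: le_trans (le_normr_Rintegral _ iP) _ => //.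
rewrite -(rint_cst M ab); apply: le_Rintegral => //.
- exact: (integrable_norm iP).
- exact: cst_integrable.
move=> t /=; rewrite in_itv /= => /gM; apply: le_trans.
by have := pp (g t) 0; rewrite p0 !subr0.
Qed.

(** Real and imaginary parts are estimated separately, whence the factor 2. The exact constant does
    not matter later. *)
Lemma cint_bound g a b (M : R) : a <= b -> rcont g a b ->
  (forall t, a <= t <= b -> nrm (g t) <= M) -> nrm (cint g a b) <= 2 * M * (b - a).
Proof.
move=> ab Hg gM; apply: le_trans (nrm_ReIm _) _; rewrite Re_cint Im_cint.
have := @rint_bound (fun z => Re z) _ _ _ _ (fun z w => Re_lip z w) erefl ab Hg gM.
have := @rint_bound (fun z => Im z) _ _ _ _ (fun z w => Im_lip z w) erefl ab Hg gM.
lra.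
Qed.

Lemma Im_cint_ge g a b (m : R) : a <= b -> rcont g a b ->
  (forall t, a <= t <= b -> m <= Im (g t)) -> m * (b - a) <= Im (cint g a b).
Proof.
move=> ab Hg gm; rewrite Im_cint -rint_cst //; apply: le_Rintegral => //.
- exact: cst_integrable.
- exact: intIm.
Qed.

Lemma rint_cat (f : R -> R) a c b : a <= c -> c <= b ->
  mu.-integrable `[a, b] (EFin \o f) -> rint f a b = rint f a c + rint f c b.
Proof.
move=> ac cb fi; rewrite /rint; have := @Rintegral_itvB R f (BLeft a) (BRight b) c fi.
rewrite !bnd_simp => /(_ ac cb) /eqP; rewrite subr_eq => /eqP ->.
rewrite addrC; congr (_ + _); rewrite Rintegral_itv_obnd_cbnd //.
by apply: (integrableS _ _ _ fi) => //; apply: subset_itvScc; rewrite bnd_simp.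
Qed.

Lemma cint_cat g a c b : a <= c -> c <= b -> rcont g a b ->
  cint g a b = cint g a c + cint g c b.
Proof.
move=> ac cb Hg; apply: cplxP; rewrite !ReImE ?Re_cint ?Im_cint; apply: rint_cat => //.
  exact: intRe.
exact: intIm.
Qed.

End SegmentIntegral.

(** * Boundary integrals of rectangles and Goursat's theorem *)

Section Rectangles.
Variable R : realType.
Local Notation C := (Cplx R).
Local Notation Re := complex.Re.
Local Notation Im := complex.Im.
Implicit Types (f g : C -> C) (a b c d : R).

Definition pt (x y : R) : C := x +i* y.

Definition inR a b c d (z : C) := (a <= Re z <= b) && (c <= Im z <= d).

Definition onB a b c d (z : C) :=
  inR a b c d z && [|| Re z == a, Re z == b, Im z == c | Im z == d].

Definition bcont f a b c d := forall z, onB a b c d z -> ccont setT f z.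

Definition hseg f a b y := cint (fun t => f (pt t y)) a b.
Definition vseg f x c d := cint (fun t => f (pt x t)) c d.

(** The boundary is run through counterclockwise; on the vertical sides dz = i dt. *)
Definition rect f a b c d : C :=
  locked (hseg f a b c - hseg f a b d + 'i * (vseg f b c d - vseg f a c d)).

Lemma hcont f a b y : (forall t, a <= t <= b -> ccont setT f (pt t y)) ->
  rcont (fun t => f (pt t y)) a b.
Proof.
move=> H t tab e e0; have [r r0 Hr] := H t tab e e0; exists r => // u ut.
apply: Hr => //; have -> : pt u y - pt t y = (u - t)%:C by apply: cplxP; rewrite /= ?subrr.
by rewrite nrm_real.
Qed.

Lemma vcont f x c d : (forall t, c <= t <= d -> ccont setT f (pt x t)) ->
  rcont (fun t => f (pt x t)) c d.
Proof.
move=> H t tab e e0; have [r r0 Hr] := H t tab e e0; exists r => // u ut.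
apply: Hr => //; have -> : pt x u - pt x t = 'i * (u - t)%:C.
  by apply: cplxP; rewrite !ReImE /=; ring.
by rewrite nrmM nrm_i mul1r nrm_real.
Qed.

Section Boundary.
Variables (a b c d : R).
Hypotheses (ab : a <= b) (cd : c <= d).

Lemma onB_sides : [/\ forall t, a <= t <= b -> onB a b c d (pt t c),
  forall t, a <= t <= b -> onB a b c d (pt t d),
  forall t, c <= t <= d -> onB a b c d (pt b t) &
  forall t, c <= t <= d -> onB a b c d (pt a t)].
Proof.
by split=> t H; rewrite /onB /inR /= H !lexx ?ab ?cd ?eqxx ?orbT.
Qed.

Lemma bcont_sides f : bcont f a b c d ->
  [/\ rcont (fun t => f (pt t c)) a b, rcont (fun t => f (pt t d)) a b,
      rcont (fun t => f (pt b t)) c d & rcont (fun t => f (pt a t)) c d].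
Proof.
have [h1 h2 h3 h4] := onB_sides; move=> H.
by split; [apply: hcont | apply: hcont | apply: vcont | apply: vcont] => t /[dup] ? ?; apply: H; auto.
Qed.

Lemma rectD f g : bcont f a b c d -> bcont g a b c d ->
  rect (fun z => f z + g z) a b c d = rect f a b c d + rect g a b c d.
Proof.
move=> /bcont_sides[f1 f2 f3 f4] /bcont_sides[g1 g2 g3 g4].
by rewrite /rect -!lock /hseg /vseg !cintD //; ring.
Qed.

Lemma rectZ (k : C) f : bcont f a b c d ->
  rect (fun z => k * f z) a b c d = k * rect f a b c d.
Proof. by move=> /bcont_sides[f1 f2 f3 f4]; rewrite /rect -!lock /hseg /vseg !cintZ //; ring. Qed.

Lemma rect_ext f g : (forall z, onB a b c d z -> f z = g z) ->
  rect f a b c d = rect g a b c d.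
Proof.
have [h1 h2 h3 h4] := onB_sides; move=> H; rewrite /rect -!lock /hseg /vseg.
by congr (_ - _ + _ * (_ - _)); apply: cint_ext => t ?; apply: H; auto.
Qed.

Lemma bcontD f g : bcont f a b c d -> bcont g a b c d -> bcont (fun z => f z + g z) a b c d.
Proof. by move=> Hf Hg z zB; apply: ccontD; [exact: Hf | exact: Hg]. Qed.

Lemma bcontM f g : bcont f a b c d -> bcont g a b c d -> bcont (fun z => f z * g z) a b c d.
Proof. by move=> Hf Hg z zB; apply: ccontM; [exact: Hf | exact: Hg]. Qed.

Lemma bcont_cst (k : C) : bcont (fun=> k) a b c d.
Proof. by move=> z _; exact: ccont_cst. Qed.

Lemma rectB f g : bcont f a b c d -> bcont g a b c d ->
  rect (fun z => f z - g z) a b c d = rect f a b c d - rect g a b c d.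
Proof.
move=> Hf Hg; have Hg' := bcontM (bcont_cst (-1)) Hg.
rewrite -mulN1r -rectZ // -rectD //; by apply: rect_ext => z _; rewrite mulN1r.
Qed.

Lemma rect_bound f (M : R) : bcont f a b c d -> (forall z, onB a b c d z -> nrm (f z) <= M) ->
  nrm (rect f a b c d) <= 4 * M * ((b - a) + (d - c)).
Proof.
have [h1 h2 h3 h4] := onB_sides; move=> /bcont_sides[f1 f2 f3 f4] HM; rewrite /rect -lock.
have i1 := cint_bound ab f1 (fun t ht => HM _ (h1 t ht)).
have i2 := cint_bound ab f2 (fun t ht => HM _ (h2 t ht)).
have i3 := cint_bound cd f3 (fun t ht => HM _ (h3 t ht)).
have i4 := cint_bound cd f4 (fun t ht => HM _ (h4 t ht)).
rewrite /hseg /vseg; apply: le_trans (nrmD _ _) _; rewrite nrmM nrm_i mul1r.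
have := nrmB (cint (fun t => f (pt t c)) a b) (cint (fun t => f (pt t d)) a b).
have := nrmB (cint (fun t => f (pt b t)) c d) (cint (fun t => f (pt a t)) c d).
lra.
Qed.

(** The values of an affine function on opposite sides differ by a constant, and the contributions
    of the two pairs of sides cancel. No primitive is involved. *)
Lemma rect_affine (k l : C) : rect (fun z => k + l * z) a b c d = 0.
Proof.
have cf : bcont (fun z => k + l * z) a b c d.
  by move=> z _; apply: ccontD; [exact: ccont_cst | apply: ccontM; [exact: ccont_cst | exact: ccont_id]].
have [f1 f2 f3 f4] := bcont_sides cf.
rewrite /rect -lock /hseg /vseg -!cintB //.
rewrite (@cint_ext _ _ (fun=> l * 'i * (c - d)%:C)); last first.
  by move=> t _; apply: cplxP; rewrite !ReImE /=; ring.
rewrite [X in _ + _ * X](@cint_ext _ _ (fun=> l * (b - a)%:C)); last first.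
  by move=> t _; apply: cplxP; rewrite !ReImE /=; ring.
by rewrite !cint_cst // !rmorphB /=; ring.
Qed.

End Boundary.

Lemma inR_onB a b c d z : onB a b c d z -> inR a b c d z.
Proof. by case/andP. Qed.

Lemma rect_splitx f a m b c d : a <= m -> m <= b -> c <= d ->
  bcont f a m c d -> bcont f m b c d ->
  rect f a b c d = rect f a m c d + rect f m b c d.
Proof.
move=> am mb cd H1 H2; rewrite /rect -!lock /hseg.
have K y : y = c \/ y = d -> rcont (fun t => f (pt t y)) a b.
  move=> yE; apply: hcont => t /andP[ta tb].
  have [tm|/ltW mt] := leP t m; [apply: H1 | apply: H2];
    by case: yE => ->; rewrite /onB /inR /= ?ta ?tb ?tm ?mt !lexx ?cd eqxx ?orbT.
rewrite (cint_cat am mb (K c _)); last by left.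
rewrite (cint_cat am mb (K d _)); last by right.
by ring.
Qed.

Lemma rect_splity f a b c m d : a <= b -> c <= m -> m <= d ->
  bcont f a b c m -> bcont f a b m d ->
  rect f a b c d = rect f a b c m + rect f a b m d.
Proof.
move=> ab cm md H1 H2; rewrite /rect -!lock /vseg.
have K x : x = a \/ x = b -> rcont (fun t => f (pt x t)) c d.
  move=> xE; apply: vcont => t /andP[tc td].
  have [tm|/ltW mt] := leP t m; [apply: H1 | apply: H2];
    by case: xE => ->; rewrite /onB /inR /= ?tc ?td ?tm ?mt !lexx ?ab eqxx ?orbT.
rewrite (cint_cat cm md (K a _)); last by left.
rewrite (cint_cat cm md (K b _)); last by right.
by ring.
Qed.

Lemma nrm_inR a b c d (p z : C) : inR a b c d p -> inR a b c d z ->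
  nrm (z - p) <= (b - a) + (d - c).
Proof.
move=> /andP[/andP[p1 p2] /andP[p3 p4]] /andP[/andP[z1 z2] /andP[z3 z4]].
by apply: le_trans (nrm_ReIm _) _; rewrite !ReImE lerD // ler_norml; apply/andP; split; lra.
Qed.

Lemma nrmD4 (p q s t : C) (m : R) : nrm p <= m -> nrm q <= m -> nrm s <= m ->
  nrm t <= m -> nrm (p + q + s + t) <= 4 * m.
Proof.
have := nrmD (p + q + s) t; have := nrmD (p + q) s; have := nrmD p q; lra.
Qed.

(** The bound e r^2 on a piece of relative side r is additive under quartering, so by Cousin's lemma
    it has to be shown for small pieces only. There f differs from an affine function, whose
    integral is 0, by an arbitrarily small multiple of the side. *)
Lemma goursat f a b c d : a < b -> c < d ->
  (forall z, inR a b c d z -> exists l, cder setT f z l) -> rect f a b c d = 0.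
Proof.
move=> ab cd fd; pose w := b - a; pose h := d - c.
have w0 : 0 < w by rewrite subr_gt0. have h0 : 0 < h by rewrite subr_gt0.
apply: nrm_le0 => e e0.
(* The rectangle is parametrized by the unit square, because Cousin's lemma subdivides squares. *)
pose X x := a + x * w; pose Y y := c + y * h.
pose Q (x y r : R) := [/\ 0 <= x, 0 <= y, x + r <= 1 & y + r <= 1] ->
  nrm (rect f (X x) (X (x + r)) (Y y) (Y (y + r))) <= e * r ^+ 2.
have inside x y r z : 0 < r -> [/\ 0 <= x, 0 <= y, x + r <= 1 & y + r <= 1] ->
    inR (X x) (X (x + r)) (Y y) (Y (y + r)) z -> inR a b c d z.
  move=> r0 [x0 y0 xr yr] /andP[/andP[z1 z2] /andP[z3 z4]].
  have k1 : 0 <= x * w by rewrite mulr_ge0 // ltW.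
  have k2 : 0 <= y * h by rewrite mulr_ge0 // ltW.
  have k3 : (x + r) * w <= 1 * w by rewrite ler_wpM2r // ltW.
  have k4 : (y + r) * h <= 1 * h by rewrite ler_wpM2r // ltW.
  move: z1 z2 z3 z4 k1 k2 k3 k4; rewrite /X /Y /w /h /inR.
  by move=> *; apply/andP; split; apply/andP; split; lra.
have fc z : inR a b c d z -> ccont setT f z by move=> /fd[l /cder_cont].
have Xm x y : x <= y -> X x <= X y by move=> xy; rewrite lerD2l ler_wpM2r // ltW.
have Ym x y : x <= y -> Y x <= Y y by move=> xy; rewrite lerD2l ler_wpM2r // ltW.
suff /(_ _) : Q 0 0 1.
  rewrite /X /Y !add0r !mul0r !mul1r !addr0 /w /h [a + _]addrC [c + _]addrC !subrK.
  by rewrite expr1n mulr1; apply; split; rewrite ?lexx.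
apply: cousin => // [x y r r0 Q1 Q2 Q3 Q4 [x0 y0 xr yr]|u v /andP[u0 u1] /andP[v0 v1]].
  have bc x' y' : x' = x \/ x' = x + r -> y' = y \/ y' = y + r ->
      bcont f (X x') (X (x' + r)) (Y y') (Y (y' + r)).
    move=> xE yE z /inR_onB zR; apply/fc/(@inside x' y' r z) => //.
    by clear - xE yE x0 y0 xr yr r0; case: xE => ->; case: yE => ->; split; lra.
  have l1 : X x <= X (x + r) by apply: Xm; rewrite lerDl ltW.
  have l2 : X (x + r) <= X (x + r + r) by apply: Xm; rewrite lerDl ltW.
  have l3 : Y y <= Y (y + r) by apply: Ym; rewrite lerDl ltW.
  have l4 : Y (y + r) <= Y (y + r + r) by apply: Ym; rewrite lerDl ltW.
  have bl x' : x' = x \/ x' = x + r -> bcont f (X x') (X (x' + r)) (Y y) (Y (y + (r + r))).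
    move=> xE z /inR_onB /andP[zx /andP[zy1 zy2]]; apply: fc.
    have [zm|/ltW mz] := leP (Im z) (Y (y + r)).
      apply: (@inside x' y r) => //; first by clear - xE x0 y0 xr yr r0; case: xE => ->; split; lra.
      by rewrite /inR zx zy1 zm.
    apply: (@inside x' (y + r) r) => //; first by clear - xE x0 y0 xr yr r0; case: xE => ->; split; lra.
    by rewrite /inR zx mz -addrA zy2.
  rewrite (@rect_splitx f (X x) (X (x + r))) //; [| by rewrite -addrA in l2 | | |].
  - rewrite (@rect_splity f (X x) _ (Y y) (Y (y + r))) //; [|by rewrite addrA | apply: bc; auto | rewrite addrA; apply: bc; auto].
    rewrite (@rect_splity f (X (x + r)) _ (Y y) (Y (y + r))) //; [|by rewrite addrA | by rewrite addrA|rewrite addrA; apply: bc; auto | rewrite !addrA; apply: bc; auto].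
    have q1 := Q1 ltac:(by clear - x0 y0 xr yr r0; split; lra).
    have q2 := Q2 ltac:(by clear - x0 y0 xr yr r0; split; lra).
    have q3 := Q3 ltac:(by clear - x0 y0 xr yr r0; split; lra).
    have q4 := Q4 ltac:(by clear - x0 y0 xr yr r0; split; lra).
    rewrite !addrA in q1 q2 q3 q4 *.
    have -> : e * (r + r) ^+ 2 = 4 * (e * r ^+ 2) by ring.
    exact: nrmD4.
  - by apply: Ym; lra.
  - by apply: bl; left.
  - by have := bl (x + r); rewrite -addrA; apply; right.
rewrite !add0r in u1 v1.
pose p := pt (X u) (Y v).
have pR : inR a b c d p.
  have k1 : 0 <= u * w by rewrite mulr_ge0 // ltW.
  have k2 : 0 <= v * h by rewrite mulr_ge0 // ltW.
  have k3 : u * w <= 1 * w by rewrite ler_wpM2r // ltW.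
  have k4 : v * h <= 1 * h by rewrite ler_wpM2r // ltW.
  move: k1 k2 k3 k4; rewrite /p /X /Y /w /h /inR /=.
  by move=> *; apply/andP; split; apply/andP; split; lra.
have [l fl] := fd p pR; pose s := w + h; have s0 : 0 < s by rewrite addr_gt0.
(* A small piece has width plus height s r. An integrand of size e / (4 s^2) times s r thus
   contributes at most 4 (e / (4 s^2)) (s r) (s r) = e r^2 in [rect_bound]. *)
have e1 : 0 < e / (4 * s ^+ 2) by rewrite divr_gt0 // mulr_gt0 // exprn_gt0.
have [dl dl0 Hd] := fl _ e1; exists (dl / s); first by rewrite divr_gt0.
move=> x y r /andP[r0 rd] /andP[xu ux] /andP[yv vy] _ _ _ _ xyr.
have pr : inR (X x) (X (x + r)) (Y y) (Y (y + r)) p by rewrite /inR /= !Xm // !Ym.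
have wr : X (x + r) - X x + (Y (y + r) - Y y) = s * r by rewrite /X /Y /s; ring.
have xx : X x <= X (x + r) by apply: Xm; lra.
have yy : Y y <= Y (y + r) by apply: Ym; lra.
pose g z := (f p - l * p) + l * z.
have gc : bcont g (X x) (X (x + r)) (Y y) (Y (y + r)).
  by move=> z _; apply: ccontD; [exact: ccont_cst | apply: ccontM; [exact: ccont_cst | exact: ccont_id]].
have fb : bcont f (X x) (X (x + r)) (Y y) (Y (y + r)).
  by move=> z /inR_onB zR; apply/fc/(inside _ _ _ _ _ _ zR).
have := rectB xx yy fb gc; rewrite (rect_affine xx yy) subr0 => <-.
have fgb : bcont (fun z => f z - g z) (X x) (X (x + r)) (Y y) (Y (y + r)).
  move=> z zB; apply: ccontD; first exact: fb.
  apply: ccont_comp (gc z zB) _; exact: cder_cont (cderN (cder_id _ _)).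
apply: le_trans (@rect_bound _ _ _ _ xx yy _ (e / (4 * s ^+ 2) * (s * r)) fgb _) _.
  move=> z /inR_onB zR; have zp := nrm_inR pr zR; rewrite wr in zp.
  have -> : f z - g z = f z - f p - l * (z - p) by rewrite /g; ring.
  apply: le_trans (Hd z I _) _.
    by apply: le_lt_trans zp _; rewrite mulrC -ltr_pdivlMr.
  by rewrite ler_wpM2l // ltW.
rewrite wr; have -> : 4 * (e / (4 * s ^+ 2) * (s * r)) * (s * r) = e * r ^+ 2.
  by field; rewrite gt_eqF.
by [].
Qed.

Lemma square_bounded f x0 y0 r0 : 0 < r0 ->
  (forall z, inR x0 (x0 + r0) y0 (y0 + r0) z -> ccont setT f z) ->
  exists M : R, forall z, inR x0 (x0 + r0) y0 (y0 + r0) z -> nrm (f z) <= M.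
Proof.
move=> r00 fc.
pose Q (x y r : R) := exists M : R, forall z, inR x (x + r) y (y + r) z -> nrm (f z) <= M.
suff : Q x0 y0 r0 by [].
apply: cousin => // [x y h h0 [M1 H1] [M2 H2] [M3 H3] [M4 H4]|u v Hu Hv].
  exists (Order.max (Order.max M1 M2) (Order.max M3 M4)) => z.
  rewrite !le_max /inR => /andP[/andP[z1 z2] /andP[z3 z4]].
  have [a1|/ltW a1] := leP (Re z) (x + h); have [a2|/ltW a2] := leP (Im z) (y + h).
  - by rewrite H1 // /inR z1 a1 z3 a2.
  - by rewrite H3 ?orbT // /inR z1 a1 a2 -addrA z4.
  - by rewrite H2 ?orbT // /inR a1 -addrA z2 z3 a2.
  - by rewrite H4 ?orbT // /inR a1 a2 -!addrA z2 z4.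
have pR : inR x0 (x0 + r0) y0 (y0 + r0) (pt u v) by rewrite /inR /= Hu Hv.
have [d d0 Hd] := fc _ pR 1 ltr01; exists (d / 2); first by rewrite divr_gt0.
move=> x y r /andP[r1 r2] xu yv _ _ _ _; exists (nrm (f (pt u v)) + 1) => z zR.
have /nrm_inR : inR x (x + r) y (y + r) (pt u v) by rewrite /inR /= xu yv.
move=> /(_ _ zR) zp; have := Hd z I; have := nrmB_ge (f z) (f (pt u v)).
by move=> h1 /(_ _) h2; have := h2 ltac:(lra); lra.
Qed.

End Rectangles.

(** * Cauchy's formula, the identity theorem and Weierstrass' theorem on series *)

Section Cauchy.
Variable R : realType.
Local Notation C := (Cplx R).
Local Notation Re := complex.Re.
Local Notation Im := complex.Im.
Implicit Types (f g : C -> C) (a b c d : R) (z w : C).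

Lemma inv_cj z : z^-1 = cj z * ((nrm z ^+ 2)^-1)%:C.
Proof.
have [->|z0] := eqVneq z 0; first by rewrite invr0 /cj rmorph0 mul0r.
apply: (mulfI z0); rewrite mulrA mul_cj divff // -rmorphM divff //.
by rewrite expf_neq0 // nrm_eq0.
Qed.

Lemma Re_inv z : Re z^-1 = Re z / nrm z ^+ 2.
Proof. by rewrite inv_cj !ReImE Re_cj /= mulr0 subr0. Qed.

Lemma Im_inv z : Im z^-1 = - Im z / nrm z ^+ 2.
Proof. by rewrite inv_cj !ReImE Im_cj /= mulr0 add0r. Qed.

Section Interior.
Variables (a b c d : R) (z0 : C).
Hypotheses (ax : a < Re z0) (xb : Re z0 < b) (cy : c < Im z0) (yd : Im z0 < d).

Lemma onB_neq a' b' c' d' z : a' < Re z0 < b' -> c' < Im z0 < d' -> onB a' b' c' d' z -> z != z0.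
Proof.
move=> /andP[h1 h2] /andP[h3 h4] /andP[_ H]; apply/eqP => zE; move: H; rewrite zE.
by rewrite (gt_eqF h1) (lt_eqF h2) (gt_eqF h3) (lt_eqF h4).
Qed.

Lemma interior_le : a <= b /\ c <= d.
Proof. by split; [exact: ltW (lt_trans ax xb) | exact: ltW (lt_trans cy yd)]. Qed.

(** The region between the two boundaries is cut into a left, a right, a lower and an upper strip,
    none of which contains z0, so that each contributes 0 by [goursat]. *)
Lemma rect_hole f (e : R) : 0 < e -> a < Re z0 - e -> Re z0 + e < b ->
  c < Im z0 - e -> Im z0 + e < d ->
  (forall z, inR a b c d z -> z != z0 -> exists l, cder setT f z l) ->
  rect f a b c d = rect f (Re z0 - e) (Re z0 + e) (Im z0 - e) (Im z0 + e).
Proof.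
move=> e0 ae eb ce ed fd; set x1 := Re z0 - e; set x2 := Re z0 + e.
set y1 := Im z0 - e; set y2 := Im z0 + e.
have [e1 e2] : x1 < Re z0 < x2 /\ y1 < Im z0 < y2.
  by rewrite /x1 /x2 /y1 /y2 !ltrBlDr !ltrDl e0.
have /andP[e11 e12] := e1. have /andP[e21 e22] := e2.
have sub a' b' c' d' z : a <= a' -> b' <= b -> c <= c' -> d' <= d ->
    inR a' b' c' d' z -> inR a b c d z.
  move=> s1 s2 s3 s4 /andP[/andP[i1 i2] /andP[i3 i4]].
  by rewrite /inR (le_trans s1 i1) (le_trans i2 s2) (le_trans s3 i3) (le_trans i4 s4).
have B a' b' c' d' : a <= a' -> b' <= b -> c <= c' -> d' <= d ->
    a' < Re z0 < b' -> c' < Im z0 < d' -> bcont f a' b' c' d'.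
  move=> s1 s2 s3 s4 i1 i2 z zB; have [l /cder_cont] := fd z (sub _ _ _ _ _ s1 s2 s3 s4 (inR_onB zB)) (onB_neq i1 i2 zB).
  by [].
have G a' b' c' d' : a <= a' -> b' <= b -> c <= c' -> d' <= d -> a' < b' -> c' < d' ->
    (forall z, inR a' b' c' d' z -> z != z0) ->
    bcont f a' b' c' d' /\ rect f a' b' c' d' = 0.
  move=> s1 s2 s3 s4 ab' cd' nz; split.
    by move=> z /inR_onB zR; have [l /cder_cont] := fd z (sub _ _ _ _ _ s1 s2 s3 s4 zR) (nz z zR).
  by apply: goursat => // z zR; apply: fd (nz z zR); exact: sub zR.
have lx : x1 < x2 by exact: lt_trans e11 e12.
have ly : y1 < y2 by exact: lt_trans e21 e22.
have cd : c < d by exact: lt_trans cy yd.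
have [B1 G1] : bcont f a x1 c d /\ rect f a x1 c d = 0.
  apply: G => //; first by apply: ltW; exact: lt_trans lx eb.
  move=> z /andP[/andP[_ i] _]; apply/eqP => zE; move: i.
  by rewrite zE leNgt e11.
have [B2 G2] : bcont f x2 b c d /\ rect f x2 b c d = 0.
  apply: G => //; first by apply: ltW; exact: lt_trans ae lx.
  move=> z /andP[/andP[i _] _]; apply/eqP => zE; move: i.
  by rewrite zE leNgt e12.
have [B3 G3] : bcont f x1 x2 c y1 /\ rect f x1 x2 c y1 = 0.
  apply: G; rewrite ?(ltW ae) ?(ltW eb) ?lexx //; first by apply: ltW; exact: lt_trans ly ed.
  move=> z /andP[_ /andP[_ i]]; apply/eqP => zE; move: i.
  by rewrite zE leNgt e21.
have [B4 G4] : bcont f x1 x2 y2 d /\ rect f x1 x2 y2 d = 0.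
  apply: G; rewrite ?(ltW ae) ?(ltW eb) ?lexx //; first by apply: ltW; exact: lt_trans ce ly.
  move=> z /andP[_ /andP[i _]]; apply/eqP => zE; move: i.
  by rewrite zE leNgt e22.
have x1b : x1 < b by exact: lt_trans lx eb.
have y1d : y1 < d by exact: lt_trans ly ed.
rewrite (@rect_splitx _ f a x1 b) ?(ltW ae) ?(ltW x1b) ?(ltW cd) // ?G1 ?add0r; last first.
  by apply: B; rewrite ?(ltW ae) ?lexx ?e11 ?xb ?cy ?yd.
rewrite (@rect_splitx _ f x1 x2 b) ?(ltW lx) ?(ltW eb) ?(ltW cd) // ?G2 ?addr0; last first.
  by apply: B; rewrite ?(ltW ae) ?(ltW eb) ?lexx ?e1 ?cy ?yd.
rewrite (@rect_splity _ f x1 x2 c y1 d) ?(ltW lx) ?(ltW ce) ?(ltW y1d) // ?G3 ?add0r; last first.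
  by apply: B; rewrite ?(ltW ae) ?(ltW eb) ?(ltW ce) ?lexx ?e1 ?e21 ?yd.
rewrite (@rect_splity _ f x1 x2 y1 y2 d) ?(ltW lx) ?(ltW ly) ?(ltW ed) // ?G4 ?addr0 //.
by apply: B; rewrite ?(ltW ae) ?(ltW eb) ?(ltW ce) ?(ltW ed) ?e1 ?e2.
Qed.

(** Removable singularity: the contour is shrunk to a square of half side e around z0, inside the
    disc where f is bounded, and [rect_bound] gives 4 M (2e + 2e) = 16 M e. *)
Lemma cauchy_zero f (M dl : R) : 0 < dl ->
  (forall z, inR a b c d z -> z != z0 -> exists l, cder setT f z l) ->
  (forall z, nrm (z - z0) < dl -> nrm (f z) <= M) -> rect f a b c d = 0.
Proof.
move=> dl0 fd fM; apply: nrm_le0 => eta eta0.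
have M0 : 0 <= M by apply: le_trans (nrm_ge0 (f z0)) (fM z0 _); rewrite subrr nrm0.
have [e [e0 [e1 e2 e3 e4] e5 e6]] : exists e : R, [/\ 0 < e,
    [/\ a < Re z0 - e, Re z0 + e < b, c < Im z0 - e & Im z0 + e < d],
    2 * e < dl & 16 * M * e <= eta].
  pose q := eta / (16 * M + 1).
  have q0 : 0 < q by rewrite divr_gt0 // ltr_wpDl // mulr_ge0.
  have qM : 16 * M * q <= eta.
    by rewrite /q mulrA ler_pdivrMr ?ltr_wpDl ?mulr_ge0 // mulrC ler_wpM2l ?(ltW eta0) ?lerDl.
  pose m := Order.min (Order.min (Order.min (Re z0 - a) (b - Re z0)) (Order.min (Im z0 - c) (d - Im z0))) (Order.min dl q).
  have m0 : 0 < m by rewrite !lt_min !subr_gt0 ax xb cy yd dl0 q0.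
  have : m <= m by []. rewrite {2}/m !le_min -!andbA => /and5P[m1 m2 m3 m4 /andP[m5 m6]].
  clearbody m; exists (m / 3); split; [by rewrite divr_gt0 | by split; lra | by lra|].
  apply: le_trans qM; rewrite ler_wpM2l ?mulr_ge0 //; lra.
rewrite (rect_hole e0) //.
have ie : forall z, onB (Re z0 - e) (Re z0 + e) (Im z0 - e) (Im z0 + e) z -> z != z0.
  by move=> z; apply: onB_neq; rewrite ltrBlDr !ltrDl e0.
have ab' : Re z0 - e <= Re z0 + e by lra.
have cd' : Im z0 - e <= Im z0 + e by lra.
have bc : bcont f (Re z0 - e) (Re z0 + e) (Im z0 - e) (Im z0 + e).
  move=> z zB; have zn := ie z zB; move: zB => /inR_onB /andP[/andP[i1 i2] /andP[i3 i4]].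
  have [|l /cder_cont //] := fd z _ zn.
  by apply/andP; split; apply/andP; split; lra.
apply: le_trans (rect_bound (M := M) ab' cd' bc _) _ => [z /inR_onB /andP[/andP[i1 i2] /andP[i3 i4]]|].
  apply: fM; apply: le_lt_trans (nrm_ReIm _) _; rewrite !ReImE.
  have : `|Re z - Re z0| <= e by rewrite ler_norml; apply/andP; split; lra.
  have : `|Im z - Im z0| <= e by rewrite ler_norml; apply/andP; split; lra.
  lra.
apply: le_trans e6; lra.
Qed.

Lemma bcont_inv : bcont (fun s => (s - z0)^-1) a b c d.
Proof.
move=> z zB; apply: ccontV; first by rewrite subr_eq0; apply: onB_neq zB; rewrite ?ax ?cy.
exact: cder_cont (cderB (cder_id _ _) (cder_cst _ _ _)).
Qed.

(** The difference of the integrands is (f s - f z0) / (s - z0), which stays bounded near z0, so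
    [cauchy_zero] applies. The integral of 1/(s - z0) is left as a factor; all that is used of it is
    that it is nonzero, by [wind_pos]. *)
Lemma cauchy f : (forall z, inR a b c d z -> exists l, cder setT f z l) ->
  rect (fun s => f s * (s - z0)^-1) a b c d = f z0 * rect (fun s => (s - z0)^-1) a b c d.
Proof.
move=> fd; have [ab cd] := interior_le.
have bi := bcont_inv.
have bf : bcont f a b c d by move=> z /inR_onB /fd[l /cder_cont].
have z0R : inR a b c d z0 by rewrite /inR !ltW.
rewrite -rectZ //; apply/eqP; rewrite -subr_eq0 -rectB //; last first.
- by apply: bcontM => //; exact: bcont_cst.
- exact: bcontM.
have [l Hl] := fd z0 z0R.
have [phi [pc pl pE]] := caratheodory Hl.
have [dl dl0 Hdl] := pc 1 ltr01.
apply/eqP; apply: (@cauchy_zero _ (nrm l + 1) dl) => // z.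
  move=> zR zz; have [m Hm] := fd z zR.
  have zz0 : z - z0 != 0 by rewrite subr_eq0.
  have Hi := @cderV _ setT (fun y => y - z0) z _ zz0 (cderB (cder_id setT z) (cder_cst setT z0 z)).
  by eexists; apply: cderB; [apply: cderM Hm Hi | apply: cderZ Hi].
move=> zd; rewrite -mulrBl pE; have [->|zz] := eqVneq z z0.
  by rewrite subrr mulr0 mul0r nrm0 addr_ge0 ?nrm_ge0.
rewrite mulfK ?subr_eq0 //; have := Hdl z I zd; rewrite pl.
have := nrmB_ge (phi z) l; lra.
Qed.

(** The argument of s - z0 increases along the boundary: each side contributes a nonnegative
    imaginary part, and on the right-hand side the integrand has a positive lower bound. *)
Lemma wind_pos : 0 < Im (rect (fun s => (s - z0)^-1) a b c d).
Proof.
have [ab cd] := interior_le; have bi := bcont_inv.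
have [f1 f2 f3 f4] := bcont_sides ab cd bi; have [h1 h2 h3 h4] := onB_sides ab cd.
rewrite /rect -lock /hseg /vseg mulrBr -!cintZ // -[X in _ - X + _]mul1r -mulNr -cintZ //.
rewrite -[X in _ + (_ - X)]mul1r -[X in _ + (_ + X)]mulNr -cintZ; last exact: rcontZ.
rewrite !ReImE.
have D0 : 0 < b - a + (d - c).
  by rewrite addr_gt0 // subr_gt0; [exact: lt_trans ax xb | exact: lt_trans cy yd].
have p1 : 0 * (b - a) <= Im (cint (fun t => (pt t c - z0)^-1) a b).
  apply: Im_cint_ge => // t _; rewrite Im_inv divr_ge0 ?sqr_ge0 // !ReImE oppr_ge0 subr_le0 ltW //.
have p2 : 0 * (b - a) <= Im (cint (fun t => -1 * (pt t d - z0)^-1) a b).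
  apply: Im_cint_ge => //; first exact: rcontZ.
  move=> t _; rewrite mulN1r !ReImE Im_inv mulNr opprK divr_ge0 ?sqr_ge0 // !ReImE subr_ge0 ltW //.
have p3 : (b - Re z0) / (b - a + (d - c)) ^+ 2 * (d - c) <= Im (cint (fun t => 'i * (pt b t - z0)^-1) c d).
  apply: Im_cint_ge => //; first exact: rcontZ.
  move=> t tcd; have := h3 t tcd => tB.
  have -> x : Im ('i * x : C) = Re x by rewrite !ReImE /=; ring.
  rewrite Re_inv !ReImE /=.
  rewrite ler_wpM2l ?subr_ge0 ?(ltW xb) // lef_pV2 ?posrE ?exprn_gt0 //; last first.
    by rewrite nrm_gt0 subr_eq0; apply: onB_neq tB; rewrite ?ax ?cy.
  rewrite ler_pXn2r ?nnegrE ?nrm_ge0 ?(ltW D0) //.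
  by apply: (nrm_inR _ (inR_onB tB)); rewrite /inR !ltW.
have p4 : 0 * (d - c) <= Im (cint (fun t => -1 * ('i * (pt a t - z0)^-1)) c d).
  apply: Im_cint_ge => //; first by apply: rcontZ; exact: rcontZ.
  move=> t _; have -> x : Im (-1 * ('i * x) : C) = - Re x by rewrite !ReImE /=; ring.
  by rewrite Re_inv !ReImE -mulNr divr_ge0 ?sqr_ge0 //= oppr_ge0 subr_le0 ltW.
have p5 : 0 < (b - Re z0) / (b - a + (d - c)) ^+ 2 * (d - c).
  by rewrite !mulr_gt0 ?invr_gt0 ?exprn_gt0 ?subr_gt0 //; exact: lt_trans cy yd.
move: p1 p2 p3 p4 p5; rewrite !mul0r; lra.
Qed.

End Interior.

Definition csq f z0 r := rect f (Re z0 - r) (Re z0 + r) (Im z0 - r) (Im z0 + r).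
Definition sq z0 (r : R) z := inR (Re z0 - r) (Re z0 + r) (Im z0 - r) (Im z0 + r) z.
Definition sqB z0 (r : R) z := onB (Re z0 - r) (Re z0 + r) (Im z0 - r) (Im z0 + r) z.

Lemma sqE z0 r z : sq z0 r z = (`|Re (z - z0)| <= r) && (`|Im (z - z0)| <= r).
Proof.
rewrite /sq /inR !ReImE !ler_norml; apply/idP/idP => /andP[/andP[h1 h2] /andP[h3 h4]];
by apply/andP; split; apply/andP; split; lra.
Qed.

Lemma sq_nrm z0 r z : nrm (z - z0) <= r -> sq z0 r z.
Proof. by move=> H; rewrite sqE (le_trans (nrm_Re _) H) (le_trans (nrm_Im _) H). Qed.

Lemma sqB_ge z0 r z : sqB z0 r z -> r <= nrm (z - z0).
Proof.
move=> /andP[_ /or4P[] /eqP E].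
- by have := nrm_Re (z - z0); rewrite !ReImE E ler_norml; lra.
- by have := nrm_Re (z - z0); rewrite !ReImE E ler_norml; lra.
- by have := nrm_Im (z - z0); rewrite !ReImE E ler_norml; lra.
- by have := nrm_Im (z - z0); rewrite !ReImE E ler_norml; lra.
Qed.

Lemma sq_bounded f z0 r : 0 < r -> (forall z, sq z0 r z -> ccont setT f z) ->
  exists2 M : R, 0 <= M & forall z, sq z0 r z -> nrm (f z) <= M.
Proof.
move=> r0 fc; have E x : x - r + (r + r) = x + r :> R by ring.
have [|z zR|M HM] := @square_bounded _ f (Re z0 - r) (Im z0 - r) (r + r); first by rewrite addr_gt0.
  by apply: fc; rewrite !E in zR.
exists M => [|z zR]; last by apply: HM; rewrite !E.
apply: le_trans (nrm_ge0 (f z0)) (HM z0 _); rewrite !E.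
by have : sq z0 r z0 by apply: sq_nrm; rewrite subrr nrm0 ltW.
Qed.

(** With J the integral of 1/(s - z0), the constant is 16/|J|: on the boundary |s - z0| >= r, and
    width plus height is 4r, so [rect_bound] gives 4 (M/r) (4r) = 16 M. *)
Lemma cauchy_estimate z0 r : 0 < r -> exists2 K : R, 0 < K & forall f (M : R),
  (forall z, sq z0 r z -> exists l, cder setT f z l) ->
  (forall z, sqB z0 r z -> nrm (f z) <= M) -> nrm (f z0) <= K * M.
Proof.
move=> r0; have [i1 i2 i3 i4] : [/\ Re z0 - r < Re z0, Re z0 < Re z0 + r,
    Im z0 - r < Im z0 & Im z0 < Im z0 + r] by split; lra.
have wp := wind_pos i1 i2 i3 i4; set J := rect _ _ _ _ _ in wp.
have Jp : 0 < nrm J by apply: lt_le_trans wp (le_trans (ler_norm _) (nrm_Im _)).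
exists (16 / nrm J); first by rewrite divr_gt0.
move=> f M fd fM; have := cauchy i1 i2 i3 i4 fd; rewrite -/J => E.
have [ab cd] := interior_le i1 i2 i3 i4.
rewrite mulrAC ler_pdivlMr // -nrmM -E.
apply: le_trans (rect_bound (M := M / r) ab cd _ _) _.
- apply: bcontM; first by move=> z /inR_onB /fd [l /cder_cont].
  exact: bcont_inv.
- move=> z zB; rewrite nrmM nrmV; apply: ler_pM; rewrite ?nrm_ge0 ?invr_ge0 ?nrm_ge0 ?fM //.
  by have rz := sqB_ge zB; rewrite lef_pV2 ?posrE //; exact: lt_le_trans rz.
have -> : Re z0 + r - (Re z0 - r) + (Im z0 + r - (Im z0 - r)) = 4 * r by ring.
by have -> : 4 * (M / r) * (4 * r) = 16 * M by field; rewrite gt_eqF.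
Qed.

(* The weight exp (n (z + z^2 / 2r)) has modulus 1 at the centre, but is
   exponentially small on the part of the boundary where [h] may be nonzero. *)
Lemma identity_local (h : C -> C) z0 r : 0 < r ->
  (forall z, sq z0 r z -> exists l, cder setT h z l) ->
  (forall z, sq z0 r z -> r / 4 < Re (z - z0) -> h z = 0) -> h z0 = 0.
Proof.
move=> r0 hd hz; have [K K0 HK] := cauchy_estimate z0 r0.
have [z zR|M M0 HM] := @sq_bounded h z0 r r0; first by have [l /cder_cont] := hd z zR.
pose W (n : nat) z := cexp (n%:R * ((z - z0) + (z - z0) ^+ 2 * ((2 * r)^-1)%:C)).
have bound n : nrm (h z0) <= K * (M * expR (- (n%:R * (r / 5)))).
  have := HK (fun z => h z * W n z) (M * expR (- (n%:R * (r / 5)))).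
  rewrite /W subrr expr0n mul0r addr0 mulr0 cexp0 mulr1; apply=> z zR.
    have [l Hl] := hd z zR; have Hz := cderB (cder_id setT z) (cder_cst setT z0 z).
    eexists; apply: cderM Hl (cder_exp _); apply: cderZ.
    by apply: cderD Hz (cderM (cderX 2 Hz) (cder_cst _ _ _)).
  have zs := inR_onB zR; rewrite nrmM.
  have [lt|le] := ltP (r / 4) (Re (z - z0)).
    by rewrite (hz z zs lt) nrm0 mul0r mulr_ge0 ?expR_ge0.
  apply: ler_pM; rewrite ?nrm_ge0 ?HM // nrm_cexp ler_expR.
  have -> x : Re (n%:R * x : C) = n%:R * Re x by rewrite !ReImE Re_nat Im_nat mul0r subr0.
  rewrite -mulrN ler_wpM2l ?ler0n // !ReImE /=.
  have := zs; rewrite -/(sq z0 r z) sqE !ler_norml => /andP[/andP[x1 x2] /andP[y1 y2]].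
  rewrite !ReImE in le x1 x2 y1 y2 *.
  set x := Re z + - Re z0 in le x1 x2 *; set y := Im z + - Im z0 in y1 y2 *.
  rewrite mulr0 subr0 -/x -/y; set v := (2 * r)^-1.
  have rv : r * v = 1 / 2 by rewrite /v; field; rewrite gt_eqF.
  have v0 : 0 < v by rewrite invr_gt0 mulr_gt0.
  (* The exponent has real part ((x + r)^2 - y^2 - r^2) / 2r. On the horizontal sides y^2 = r^2 and
     x <= r/4 make it at most -7r/32; on the left side, x = -r, it is at most -r/2; the right side
     is excluded by x <= r/4. So -r/5 is a common bound. *)
  suff H : (x + r) ^+ 2 - y ^+ 2 <= 25 / 16 * r ^+ 2 - r ^+ 2 \/ (x = - r).
    case: H => [H|xE].
      have : ((x + r) ^+ 2 - y ^+ 2) * v <= (25 / 16 * r ^+ 2 - r ^+ 2) * v by rewrite ler_wpM2r // ltW.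
      have -> : ((x + r) ^+ 2 - y ^+ 2) * v = (x * x - y * y) * v + 2 * x * (r * v) + r * (r * v) by ring.
      have -> : (25 / 16 * r ^+ 2 - r ^+ 2) * v = 9 / 16 * r * (r * v) by field.
      rewrite rv; move: r0; clear; lra.
    rewrite xE; have : 0 <= y * y * v by rewrite mulr_ge0 ?(ltW v0) // -expr2 sqr_ge0.
    have -> : (- r * - r - y * y) * v = r * (r * v) - y * y * v by ring.
    rewrite rv; move: r0; clear; lra.
  move: zR => /andP[_ /or4P[] /eqP E].
  - by right; rewrite /x E; ring.
  - by exfalso; move: le; rewrite /x E; clear - r0; lra.
  - left; have -> : y = - r by rewrite /y E; ring.
    rewrite sqrrN lerD2r; have -> : 25 / 16 * r ^+ 2 = (5 / 4 * r) ^+ 2 by field.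
    by rewrite ler_pXn2r ?nnegrE //; clear - le x1 r0; lra.
  - left; have -> : y = r by rewrite /y E; ring.
    rewrite lerD2r; have -> : 25 / 16 * r ^+ 2 = (5 / 4 * r) ^+ 2 by field.
    by rewrite ler_pXn2r ?nnegrE //; clear - le x1 r0; lra.
apply: nrm_le0 => e e0.
pose n := Num.bound (K * M / (e * (r / 5))); apply: le_trans (bound n) _.
have r5 : 0 < r / 5 by rewrite divr_gt0.
have nb : K * M / (e * (r / 5)) < n%:R.
  by rewrite archi_boundP // divr_ge0 // ?mulr_ge0 ?(ltW K0) // ltW.
rewrite expRN mulrA ler_pdivrMr ?expR_gt0 //.
move: nb; rewrite ltr_pdivrMr ?mulr_gt0 // => nb; apply: le_trans (ltW nb) _.
rewrite mulrCA ler_wpM2l ?(ltW e0) //; apply: le_trans (expR_ge1Dx _); lra.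
Qed.

Lemma pow_small (x e : R) : 0 < e -> exists n : nat, x * (9 / 10) ^+ n < e.
Proof.
move=> e0; have B n : 1 + n%:R / 9 <= (10 / 9 : R) ^+ n.
  elim: n => [|n ih]; first by rewrite mul0r addr0 expr0.
  rewrite exprS -natr1; have n0 : 0 <= n%:R :> R by exact: ler0n.
  have : 10 / 9 * (1 + n%:R / 9) <= 10 / 9 * (10 / 9) ^+ n :> R by rewrite ler_wpM2l //; lra.
  lra.
have [x0|x0] := leP x 0.
  by exists 0%N; rewrite expr0 mulr1; exact: le_lt_trans e0.
pose n := Num.bound (9 * x / e); exists n.
have nb : 9 * x / e < n%:R by rewrite archi_boundP // divr_ge0 ?mulr_ge0 // ltW.
have -> : (9 / 10 : R) = (10 / 9)^-1 by rewrite invf_div.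
rewrite exprVn ltr_pdivrMr ?exprn_gt0 ?divr_gt0 //.
rewrite ltr_pdivrMr // in nb.
have := ler_wpM2l (ltW e0) (B n); lra.
Qed.

(** If h vanishes for Re > a + g, the local statement extends this to Re > a + 9g/10. Iterating, the
    abscissa of vanishing converges to a. *)
Lemma identity_halfplane (h : C -> C) (a b : R) :
  (forall z, a < Re z -> exists l, cder setT h z l) ->
  (forall z, b < Re z -> h z = 0) -> forall z, a < Re z -> h z = 0.
Proof.
move=> hd hb z az; have [ba|ab] := leP b a; first by apply: hb; exact: le_lt_trans ba az.
have step n : forall w, a + (b - a) * (9 / 10) ^+ n < Re w -> h w = 0.
  elim: n => [|n ih] w wn; first by apply: hb; move: wn; rewrite expr0 mulr1; lra.
  set g := (b - a) * (9 / 10) ^+ n in ih.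
  have g0 : 0 < g by rewrite mulr_gt0 ?exprn_gt0 ?subr_gt0 //; lra.
  have wg : a + 9 / 10 * g < Re w.
    by apply: le_lt_trans wn; rewrite /g exprS; lra.
  (* A point that lies more than a quarter of this radius to the right of w satisfies Re - a >
     (9/8)(Re w - a) > (81/80) g, so h is already known to vanish there. *)
  apply: (@identity_local h w ((Re w - a) / 2)); first by lra.
    move=> y; rewrite sqE !ReImE ler_norml => /andP[/andP[y1 y2] _]; apply: hd; lra.
  by move=> y _; rewrite !ReImE => yw; apply: ih; lra.
have [n Hn] := @pow_small (b - a) (Re z - a) ltac:(by rewrite subr_gt0).
by apply: (step n); lra.
Qed.

(** Differentiation under the integral sign, for f merely continuous, from the identity 1/(s - w) -
    1/(s - z0) - (w - z0)/(s - z0)^2 = (w - z0)^2 / ((s - z0)^2 (s - w)). On the boundary the last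
    fraction is at most 2/r^3 times |w - z0|^2 when |w - z0| < r/2. *)
Lemma cauchy_int_der f z0 r : 0 < r -> (forall z, sq z0 r z -> ccont setT f z) ->
  exists l, cder setT (fun z => csq (fun s => f s * (s - z)^-1) z0 r) z0 l.
Proof.
move=> r0 fc.
have [M M0 HM] := sq_bounded r0 fc.
have ab : Re z0 - r <= Re z0 + r by lra.
have cd : Im z0 - r <= Im z0 + r by lra.
have ci z w : nrm (w - z0) < r -> sqB z0 r z -> ccont setT (fun s => (s - w)^-1) z.
  move=> wr zB; apply: ccontV; last exact: cder_cont (cderB (cder_id _ _) (cder_cst _ _ _)).
  rewrite subr_eq0; apply/eqP => zw; have := sqB_ge zB; rewrite zw; lra.
have fb : bcont f (Re z0 - r) (Re z0 + r) (Im z0 - r) (Im z0 + r) by move=> z /inR_onB /fc.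
have bi w : nrm (w - z0) < r -> bcont (fun s => (s - w)^-1) (Re z0 - r) (Re z0 + r) (Im z0 - r) (Im z0 + r).
  by move=> wr z zB; exact: ci.
have z0r : nrm (z0 - z0) < r by rewrite subrr nrm0.
exists (csq (fun s => f s * (s - z0)^-1 * (s - z0)^-1) z0 r) => e e0.
pose K := 4 * (M * (2 / r ^+ 3)) * (4 * r).
have K0 : 0 <= K by rewrite !mulr_ge0 ?invr_ge0 ?exprn_ge0 ?(ltW r0).
exists (Order.min (r / 2) (e / (K + 1))).
  by rewrite lt_min !divr_gt0 // ltr_wpDl.
move=> w _; rewrite lt_min => /andP[w1 w2].
have wr : nrm (w - z0) < r by lra.
have B0 := bcontM fb (bi _ z0r). have B1 := bcontM fb (bi _ wr).
have B2 := bcontM B0 (bi _ z0r).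
rewrite /csq -rectB // -[X in _ - X]mulrC -rectZ // -rectB //; first last.
- exact: bcontM (bcont_cst _) B2.
- by apply: bcontD => // z zB; apply: ccont_comp (B0 z zB) (cder_cont (cderN (cder_id _ _))).
have E : (fun z => f z * (z - w)^-1 - f z * (z - z0)^-1 - (w - z0) * (f z * (z - z0)^-1 * (z - z0)^-1))
  = (fun z => f z * (z - w)^-1 - f z * (z - z0)^-1 - (w - z0) * (f z * (z - z0)^-1 * (z - z0)^-1)) by [].
apply: le_trans (rect_bound (M := M * (2 / r ^+ 3) * nrm (w - z0) ^+ 2) ab cd _ _) _.
- move=> z zB; apply: ccontD.
    by apply: ccontD; [exact: B1 | apply: ccont_comp (B0 z zB) (cder_cont (cderN (cder_id _ _)))].
  apply: ccont_comp (cder_cont (cderN (cder_id _ _))).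
  by apply: ccontM; [exact: ccont_cst | exact: B2].
- move=> z zB; have rz := sqB_ge zB; have zs := inR_onB zB.
  have zw : r / 2 <= nrm (z - w).
    have := nrm_tri z w z0; lra.
  have n0 : z - z0 != 0 by rewrite -nrm_gt0; exact: lt_le_trans r0 rz.
  have nw : z - w != 0 by rewrite -nrm_gt0; apply: lt_le_trans zw; rewrite divr_gt0.
  have -> : f z * (z - w)^-1 - f z * (z - z0)^-1 - (w - z0) * (f z * (z - z0)^-1 * (z - z0)^-1)
    = f z * ((z - z0)^-1 ^+ 2 * (z - w)^-1) * (w - z0) ^+ 2.
    by field; rewrite n0 nw.
  rewrite nrmM nrmX ler_wpM2r ?exprn_ge0 ?nrm_ge0 // nrmM.
  apply: ler_pM; rewrite ?nrm_ge0 ?HM // nrmM nrmX !nrmV.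
  have -> : 2 / r ^+ 3 = (r^-1) ^+ 2 * (r / 2)^-1 by field; rewrite gt_eqF.
  have r2 : 0 < r / 2 by rewrite divr_gt0.
  apply: ler_pM; rewrite ?exprn_ge0 ?invr_ge0 ?nrm_ge0 //.
    by rewrite ler_pXn2r ?nnegrE ?invr_ge0 ?nrm_ge0 ?(ltW r0) // lef_pV2 ?posrE //; exact: lt_le_trans r0 rz.
  by rewrite lef_pV2 ?posrE //; exact: lt_le_trans r2 zw.
have -> : Re z0 + r - (Re z0 - r) + (Im z0 + r - (Im z0 - r)) = 4 * r by ring.
have -> : 4 * (M * (2 / r ^+ 3) * nrm (w - z0) ^+ 2) * (4 * r) = K * nrm (w - z0) * nrm (w - z0) by rewrite /K; ring.
rewrite ler_wpM2r ?nrm_ge0 //; move: w2; rewrite ltr_pdivlMr ?ltr_wpDl //.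
have := nrm_ge0 (w - z0); clear - K0; nra.
Qed.

(** Cauchy's formula passes from the partial sums to S by uniform convergence: the Cauchy integral
    of S at z equals S z * J z, where J is that of the constant 1. Both integrals are differentiable
    at z0 and J does not vanish, so S, their quotient, is differentiable. *)
Lemma weierstrass (T : eqType) (F : T -> C -> C) (S : C -> C) (h : T -> R) z0 r : 0 < r ->
  (forall i z, sq z0 r z -> exists l, cder setT (F i) z l) ->
  (forall i z, sq z0 r z -> nrm (F i z) <= h i) -> absum h ->
  (forall z, sq z0 r z -> hasSum (fun i => F i z) (S z)) ->
  exists l, cder setT S z0 l.
Proof.
move=> r0 Fd Fh ah FS; pose r2 := r / 2; have r20 : 0 < r2 by rewrite divr_gt0.
have z00 : sq z0 r z0 by apply: sq_nrm; rewrite subrr nrm0 ltW.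
have h0 i : 0 <= h i by apply: le_trans (nrm_ge0 _) (Fh i z0 z00).
have sub z y : sq z0 r2 z -> nrm (y - z) <= r2 -> sq z0 r y.
  rewrite !sqE => /andP[z1 z2] yz.
  have -> : y - z0 = (y - z) + (z - z0) by ring.
  rewrite !ReImE; have a1 := le_trans (nrm_Re (y - z)) yz; have a2 := le_trans (nrm_Im (y - z)) yz.
  rewrite !ReImE in z1 z2 a1 a2; apply/andP; split.
    by apply: le_trans (ler_normD _ _) _; rewrite /r2 in z1 a1; lra.
  by apply: le_trans (ler_normD _ _) _; rewrite /r2 in z2 a2; lra.
have sub0 z : sq z0 r2 z -> sq z0 r z by move=> zs; apply: (sub z z zs); rewrite subrr nrm0 ltW.
have Sc z : sq z0 r2 z -> ccont setT S z.
  move=> zs e e0; have e3 : 0 < e / 3 by rewrite divr_gt0.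
  have [A uA HA] := absum_tail ah e3.
  have [L HL] : exists L, cder setT (fun y => \sum_(i <- A) F i y) z L.
    have [L HL] := choice (fun i => Fd i z (sub0 z zs)).
    by exists (\sum_(i <- A) L i); apply: cder_sum.
  have [dl dl0 Hdl] := cder_cont HL e3.
  exists (Order.min dl r2); first by rewrite lt_min dl0.
  move=> y _; rewrite lt_min => /andP[y1 y2]; have ys := sub z y zs (ltW y2).
  have k1 := hasSum_dom (fun i => Fh i y ys) (FS y ys) HA uA (fun i => id).
  have k2 := hasSum_dom (fun i => Fh i z (sub0 z zs)) (FS z (sub0 z zs)) HA uA (fun i => id).
  have k3 := Hdl y I y1.
  set sy := \sum_(i <- A) F i y in k1 k3; set sz := \sum_(i <- A) F i z in k2 k3.
  have -> : S y - S z = (sy - sz) - (sy - S y) + (sz - S z) by ring.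
  have := nrmD (sy - sz - (sy - S y)) (sz - S z); have := nrmB (sy - sz) (sy - S y); lra.
have S1 : forall z, sq z0 r2 z -> ccont setT (fun=> 1 : C) z by move=> z _; exact: ccont_cst.
have [lS HS] := cauchy_int_der r20 Sc; have [lJ HJ] := cauchy_int_der r20 S1.
pose J z := csq (fun s => 1 * (s - z)^-1) z0 r2.
have ab : Re z0 - r2 <= Re z0 + r2 by lra.
have cd : Im z0 - r2 <= Im z0 + r2 by lra.
have ins z : nrm (z - z0) < r2 -> [/\ Re z0 - r2 < Re z, Re z < Re z0 + r2, Im z0 - r2 < Im z & Im z < Im z0 + r2].
  move=> zr; have := le_lt_trans (nrm_Re _) zr; have := le_lt_trans (nrm_Im _) zr.
  by rewrite !ReImE !ltr_norml => /andP[? ?] /andP[? ?]; split; lra.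
have JE z : J z = rect (fun s => (s - z)^-1) (Re z0 - r2) (Re z0 + r2) (Im z0 - r2) (Im z0 + r2).
  by apply: rect_ext => // s _; rewrite mul1r.
have J0 z : nrm (z - z0) < r2 -> J z != 0.
  move=> /ins [i1 i2 i3 i4]; rewrite JE; apply/eqP => E.
  by have := wind_pos i1 i2 i3 i4; rewrite E ltxx.
have main z : nrm (z - z0) < r2 -> csq (fun s => S s * (s - z)^-1) z0 r2 = S z * J z.
  move=> zr; have [i1 i2 i3 i4] := ins z zr.
  have zs : sq z0 r z by apply: sub0; apply: sq_nrm; exact: ltW.
  have bi := bcont_inv i1 i2 i3 i4.
  have Sb : bcont S (Re z0 - r2) (Re z0 + r2) (Im z0 - r2) (Im z0 + r2) by move=> y /inR_onB /Sc.
  apply/eqP; rewrite -subr_eq0; apply/eqP/nrm_le0 => e e0.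
  pose t := r2 - nrm (z - z0); have t0 : 0 < t by rewrite subr_gt0.
  pose K := 4 * (t^-1) * (4 * r2) + nrm (J z) + 1.
  have K0 : 0 < K by rewrite ltr_wpDl // addr_ge0 ?nrm_ge0 // !mulr_ge0 ?invr_ge0 ?ltW.
  have eK : 0 < e / K by rewrite divr_gt0.
  have [A uA HA] := absum_tail ah eK.
  pose sA y := \sum_(i <- A) F i y.
  have FdA y : sq z0 r2 y -> exists l, cder setT sA y l.
    move=> ys; have [L HL] := choice (fun i => Fd i y (sub0 y ys)).
    by exists (\sum_(i <- A) L i); apply: cder_sum.
  have cA := cauchy i1 i2 i3 i4 FdA; rewrite -JE in cA.
  have AS y : sq z0 r y -> nrm (sA y - S y) <= e / K.
    by move=> ys; have := hasSum_dom (fun i => Fh i y ys) (FS y ys) HA uA (fun i => id).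
  have sAb : bcont sA (Re z0 - r2) (Re z0 + r2) (Im z0 - r2) (Im z0 + r2).
    by move=> y /inR_onB /FdA [l /cder_cont].
  have b1 := bcontM Sb bi; have b2 := bcontM sAb bi.
  have -> : csq (fun s => S s * (s - z)^-1) z0 r2 - S z * J z =
     (csq (fun s => S s * (s - z)^-1) z0 r2 - csq (fun s => sA s * (s - z)^-1) z0 r2) + (sA z - S z) * J z.
    by rewrite /csq cA; ring.
  rewrite /csq -rectB //.
  have q1 := AS z zs.
  have q2 : nrm (rect (fun s => S s * (s - z)^-1 - sA s * (s - z)^-1) (Re z0 - r2) (Re z0 + r2) (Im z0 - r2) (Im z0 + r2)) <= 4 * (e / K * t^-1) * (4 * r2).
    apply: le_trans (rect_bound (M := e / K * t^-1) ab cd _ _) _.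
    - by apply: bcontD => // y yB; apply: ccont_comp (b2 y yB) (cder_cont (cderN (cder_id _ _))).
    - move=> y yB; rewrite -mulrBl nrmM nrmV; apply: ler_pM; rewrite ?invr_ge0 ?nrm_ge0 //.
        by rewrite nrmC; apply: AS; apply: sub0; exact: inR_onB yB.
      have yr := sqB_ge yB; have ty : t <= nrm (y - z) by rewrite /t; have := nrm_tri y z z0; lra.
      by rewrite lef_pV2 ?posrE //; exact: lt_le_trans t0 ty.
    by have -> : Re z0 + r2 - (Re z0 - r2) + (Im z0 + r2 - (Im z0 - r2)) = 4 * r2 by ring.
  apply: le_trans (nrmD _ _) _; rewrite nrmM.
  have q3 : nrm (sA z - S z) * nrm (J z) <= e / K * nrm (J z) by rewrite ler_wpM2r ?nrm_ge0.
  apply: le_trans (lerD q2 q3) _.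
  have -> : 4 * (e / K * t^-1) * (4 * r2) + e / K * nrm (J z) = e / K * (K - 1) by rewrite /K; ring.
  rewrite mulrAC ler_pdivrMr // ler_wpM2l ?(ltW e0) //; lra.
have z0r : nrm (z0 - z0) < r2 by rewrite subrr nrm0.
eexists; apply: cder_ext r20 _ _ (cderM HS (cderV (J0 z0 z0r) HJ)).
- by move=> y _ yr /=; rewrite main // mulfK // J0.
- by rewrite /= main // mulfK // J0.
Qed.

End Cauchy.

(** * Analytic continuation of Hecke sums *)

Section Symbols.
Variable R : realType.
Local Notation C := (Cplx R).
Local Notation Re := complex.Re.
Local Notation Im := complex.Im.

Lemma ccont_compW (D D' : set C) (f g : C -> C) z : ccont D f z ->
  (forall y, D y -> D' (f y)) -> ccont D' g (f z) -> ccont D (fun y => g (f y)) z.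
Proof.
move=> Hf DD Hg e e0; have [d d0 Hd] := Hg e e0.
have [a a0 Ha] := Hf (d / 2) ltac:(by rewrite divr_gt0).
exists a => // y Dy ya; apply: Hd; first exact: DD.
have := Ha y Dy ya; lra.
Qed.

Lemma cder_compW (D D' : set C) (f g : C -> C) z l m : cder D f z l ->
  (forall y, D y -> D' (f y)) -> cder D' g (f z) m -> cder D (fun y => g (f y)) z (m * l).
Proof.
move=> Hf DD Hg; have [p [pc <- pE]] := caratheodory Hf.
have [q [qc <- qE]] := caratheodory Hg.
apply: (@caratheodoryV _ _ _ _ (fun y => q (f y) * p y)) => [|y Dy]; last first.
  by rewrite qE pE mulrA.
by apply: ccontM => //; apply: ccont_compW DD qc; exact: cder_cont Hf.
Qed.

Lemma cder_horner (D : set C) (p : {poly C}) z : cder D (fun y => p.[y]) z p^`().[z].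
Proof.
elim/poly_ind: p => [|p c ih].
  by rewrite deriv0 horner0; apply: cder_ext ltr01 _ _ (cder_cst _ 0 _) => [y _ _|]; rewrite horner0.
rewrite derivD derivM derivX derivC addr0 mulr1 !hornerE.
apply: cder_eq (cder_ext ltr01 _ _ (cderD (cderM ih (cder_id _ _)) (cder_cst _ c _))) _.
- by move=> y _ _; rewrite !hornerE.
- by rewrite !hornerE.
- by rewrite mulr1 addr0 addrC.
Qed.

(* The symbol w^-a wbar^(1-b) |w|^(-2s); it vanishes at w = 0. *)
Definition symb (a b : nat) (w s : C) : C :=
  cj w * w^-1 ^+ a * (cj w)^-1 ^+ b * cexp (- 2 * s * (ln (nrm w))%:C).

(** The real power |w|^q, for w nonzero. *)
Definition pw (w : C) (q : R) : R := expR (q * ln (nrm w)).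

Lemma symb0 a b s : symb a b 0 s = 0.
Proof. by rewrite /symb /cj rmorph0 !mul0r. Qed.

Lemma pwD w p q : pw w (p + q) = pw w p * pw w q.
Proof. by rewrite /pw mulrDl expRD. Qed.

Lemma pw_gt0 w q : 0 < pw w q. Proof. exact: expR_gt0. Qed.

Lemma pw1 w : w != 0 -> pw w 1 = nrm w.
Proof. by move=> w0; rewrite /pw mul1r lnK // posrE nrm_gt0. Qed.

Lemma pwN_nat w n : w != 0 -> pw w (- n%:R) = (nrm w)^-1 ^+ n.
Proof.
move=> w0; elim: n => [|n ih]; first by rewrite /pw oppr0 mul0r expR0 expr0.
by rewrite -natr1 opprD pwD ih [pw w (- 1)]/pw mulN1r expRN lnK ?posrE ?nrm_gt0 // exprS mulrC.
Qed.

Lemma nrm_symb a b w s : w != 0 ->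
  nrm (symb a b w s) = pw w (1 - a%:R - b%:R - 2 * Re s).
Proof.
move=> w0; rewrite /symb nrmM nrm_cexp 2!nrmM !nrmX !nrmV nrmJ !pwD pw1 // !pwN_nat //.
congr (_ * _); rewrite /pw; congr expR.
rewrite !ReImE /= !mulr0 !subr0 -mulNr; congr (_ * _).
ring.
Qed.

Lemma pw_comp (u w : C) (q Q : R) : 0 < nrm w -> nrm w / 2 <= nrm u -> nrm u <= 2 * nrm w ->
  `|q| <= Q -> pw u q <= expR (Q * ln 2) * pw w q.
Proof.
move=> w0 h1 h2 qQ; have u0 : 0 < nrm u by apply: lt_le_trans h1; rewrite divr_gt0.
rewrite /pw -expRD ler_expR -lerBlDr -mulrBr.
apply: le_trans (ler_norm _) _; rewrite normrM; apply: ler_pM => //.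
have l1 : ln (nrm u) <= ln 2 + ln (nrm w) by rewrite -lnM ?posrE // ler_ln ?posrE ?mulr_gt0.
have l2 : ln (nrm w) <= ln 2 + ln (nrm u).
  by rewrite -lnM ?posrE // ler_ln ?posrE ?mulr_gt0 //; lra.
by rewrite ler_norml; apply/andP; split; lra.
Qed.

(** The derivative of [symb a b] in the real direction mu: since the symbol is w^(-a-s) times
    wbar^(1-b-s), the first term comes from d/dw and the second from d/dwbar. Each raises a or b by
    one and so gains a factor of size 1/|w|. *)
Definition dsymb a b (mu w s : C) : C :=
  (- a%:R - s) * mu * symb a.+1 b w s + (1 - b%:R - s) * cj mu * symb a b.+1 w s.

Lemma cderXV (D : set C) f z l n : f z != 0 -> cder D f z l ->
  cder D (fun y => (f y)^-1 ^+ n) z (- n%:R * l * (f z)^-1 * (f z)^-1 ^+ n).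
Proof.
move=> fz H; apply: cder_eq (cderX n (cderV fz H)) _.
case: n => [|n]; first by rewrite !mul0r oppr0 !mul0r.
by rewrite /= !exprS; ring.
Qed.

Lemma ln_nrm2 (y : C) : y != 0 -> (ln (nrm y ^+ 2))%:C = 2 * (ln (nrm y))%:C :> C.
Proof. by move=> y0; rewrite lnXn ?nrm_gt0 // mulr2n rmorphD /=; ring. Qed.

Lemma symb_der a b (w mu s : C) (x : R) : w + x%:C * mu != 0 ->
  cder (@Dre R) (fun z => symb a b (w + z * mu) s) x%:C (dsymb a b mu (w + x%:C * mu) s).
Proof.
move=> A0; set A := w + x%:C * mu in A0 *.
have cjE y : Dre y -> cj (w + y * mu) = cj w + y * cj mu.
  by move=> yr; rewrite cjD cjM; congr (_ + _ * _); apply: cplxP; rewrite ?Re_cj ?Im_cj // yr oppr0.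
(* For real z the conjugate of w + z mu equals the affine function [fB z], and |w + z mu|^2 equals
   [fA z * fB z]. So the relative derivative follows from the rules for holomorphic functions and
   the real logarithm. *)
pose fA (z : C) := w + z * mu; pose fB z := cj w + z * cj mu.
have DA : cder (@Dre R) fA x%:C mu.
  by apply: cder_eq (cderD (cder_cst _ _ _) (cderM (cder_id _ _) (cder_cst _ mu _))) _; ring.
have DB : cder (@Dre R) fB x%:C (cj mu).
  by apply: cder_eq (cderD (cder_cst _ _ _) (cderM (cder_id _ _) (cder_cst _ (cj mu) _))) _; ring.
have BE : fB x%:C = cj A by rewrite /A cjE.
have AE : fA x%:C = A by [].
have B0 : fB x%:C != 0 by rewrite BE cj_eq0.
have DN := cderM DA DB.
have NE y : Dre y -> fA y * fB y = (nrm (fA y) ^+ 2)%:C.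
  by move=> yr; rewrite /fB -cjE // mul_cj.
have N0 : 0 < nrm A ^+ 2 by rewrite exprn_gt0 // nrm_gt0.
have DL : cder (@Dre R) (fun z => (ln (Re (fA z * fB z)))%:C) x%:C
    ((nrm A ^+ 2)^-1%:C * (mu * fB x%:C + fA x%:C * cj mu)).
  apply: (@cder_compW _ (@Dre R) _ (fun y => (ln (Re y))%:C) _ _ _ DN) => [y yr|]; first by rewrite NE.
  by rewrite NE //; apply: cder_Dre; exact: is_derive1_ln.
have DE := cder_exp (cderZ (- s) DL).
have := cderM (cderM (cderM DB (cderXV a (_ : fA x%:C != 0) DA)) (cderXV b B0 DB)) DE.
move=> /(_ A0) H; apply: cder_eq (cder_ext ltr01 _ _ H) _.
- move=> y yr _; rewrite /symb /fB -!cjE // -/(fA y).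
  have [->|fy] := eqVneq (fA y) 0; first by rewrite /cj rmorph0 !mul0r.
  congr (_ * cexp _); have -> : fA y * cj (fA y) = (nrm (fA y) ^+ 2)%:C by exact: mul_cj.
  by rewrite [Re _]/= ln_nrm2 //; ring.
- rewrite /symb BE AE; congr (_ * cexp _).
  by rewrite mul_cj [Re _]/= ln_nrm2 //; ring.
have L2 : (ln (Re (fA x%:C * fB x%:C)))%:C = 2 * (ln (nrm A))%:C.
  by rewrite NE // [Re _]/= ln_nrm2.
rewrite L2 BE AE; have cA0 : cj A != 0 by rewrite cj_eq0.
have -> : ((nrm A ^+ 2)^-1)%:C = A^-1 * (cj A)^-1.
  by rewrite fmorphV /= -mul_cj invfM.
have -> : - s * (2 * (ln (nrm A))%:C) = - 2 * s * (ln (nrm A))%:C by ring.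
rewrite /dsymb /symb !exprS; set X := cexp _; set P := A^-1 ^+ a; set Q := (cj A)^-1 ^+ b.
field; by rewrite A0 cA0.
Qed.

(** Induction on the number m of coefficients: the derivative of a remainder is a combination of the
    shorter remainders for (a+1, b) and (a, b+1), which already have the required size, and [mvi]
    integrates the bound. The condition 2 X |mu| <= |w| keeps |w + x mu| comparable to |w|; K is
    uniform for |s| <= S. *)
Lemma taylor m (X S : R) (mu : C) : 0 <= X -> 0 <= S -> forall a b,
  exists2 K : R, 0 <= K & forall s w, nrm s <= S -> 0 < nrm w -> 2 * (X * nrm mu) <= nrm w ->
  exists p : {poly C}, [/\ (size p <= m)%N, ((0 < m)%N -> p`_0 = symb a b w s),
    ((1 < m)%N -> p`_1 = dsymb a b mu w s) &
    forall x : R, 0 <= x <= X -> nrm (symb a b (w + x%:C * mu) s - p.[x%:C]) <=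
      K * pw w (1 - a%:R - b%:R - m%:R - 2 * Re s)].
Proof.
move=> X0 S0.
have near w (x : R) : 0 < nrm w -> 2 * (X * nrm mu) <= nrm w -> 0 <= x <= X ->
    [/\ nrm w / 2 <= nrm (w + x%:C * mu), nrm (w + x%:C * mu) <= 2 * nrm w & w + x%:C * mu != 0].
  move=> w0 wX /andP[x0 xX].
  have xm : nrm (x%:C * mu) <= nrm w / 2.
    rewrite nrmM nrm_real ger0_norm //.
    have : x * nrm mu <= X * nrm mu by rewrite ler_wpM2r ?nrm_ge0.
    lra.
  have h1 : nrm w / 2 <= nrm (w + x%:C * mu).
    by have := nrmB_ge w (- (x%:C * mu)); rewrite opprK nrmN; lra.
  split=> //; first by apply: le_trans (nrmD _ _) _; lra.
  by rewrite -nrm_gt0; apply: lt_le_trans h1; rewrite divr_gt0.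
elim: m => [|m ih] a b.
  exists (expR ((1 + a%:R + b%:R + 2 * S) * ln 2)); first exact: expR_ge0.
  move=> s w sS w0 wX; exists 0; split; rewrite ?size_poly0 // => x xX.
  have [n1 n2 n3] := near w x w0 wX xX.
  rewrite horner0 subr0 nrm_symb // mulr0n subr0; apply: pw_comp => //.
  have rs : `|Re s| <= S := le_trans (nrm_Re s) sS.
  have a0 : 0 <= a%:R :> R by []. have b0 : 0 <= b%:R :> R by [].
  by rewrite ler_norml; move: rs; rewrite ler_norml => /andP[r1 r2]; apply/andP; split; lra.
have [K1 K10 H1] := ih a.+1 b; have [K2 K20 H2] := ih a b.+1.
pose c1 := (a%:R + S) * nrm mu; pose c2 := (1 + b%:R + S) * nrm mu.
have c10 : 0 <= c1 by rewrite mulr_ge0 ?nrm_ge0 // addr_ge0.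
have c20 : 0 <= c2 by rewrite mulr_ge0 ?nrm_ge0 // !addr_ge0.
exists ((c1 * K1 + c2 * K2) * X); first by rewrite mulr_ge0 // addr_ge0 // mulr_ge0.
move=> s w sS w0 wX; have w00 : w != 0 by rewrite -nrm_gt0.
have [p1 [s1 p10 _ e1]] := H1 s w sS w0 wX; have [p2 [s2 p20 _ e2]] := H2 s w sS w0 wX.
pose C1 := (- a%:R - s) * mu; pose C2 := (1 - b%:R - s) * cj mu.
pose p := C1 *: p1 + C2 *: p2.
have sp : (size p <= m)%N.
  apply: leq_trans (size_polyD _ _) _; rewrite geq_max.
  by rewrite !(leq_trans (size_scale_leq _ _)).
(* The primitive of p with constant term the value at x = 0. *)
pose q := (symb a b w s)%:P + 'X * \poly_(i < m) (p`_i / i.+1%:R).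
have qd : q^`() = p.
  apply/polyP => i; rewrite coef_deriv coefD coefC coefXM /= coef_poly add0r.
  case: ltnP => im; last by rewrite mul0rn nth_default // (leq_trans sp).
  by rewrite -[_ *+ i.+1]mulr_natr divfK // pnatr_eq0.
exists q; split.
- apply: leq_trans (size_polyD _ _) _; rewrite geq_max (leq_trans (size_polyC_leq1 _)) //=.
  have [->|nz] := eqVneq (\poly_(i < m) (p`_i / i.+1%:R)) 0; first by rewrite mulr0 size_poly0.
  by rewrite mulrC size_mulX // ltnS size_poly.
- by move=> _; rewrite coefD coefC coefXM addr0.
- move=> m0; rewrite coefD coefC coefXM coef_poly /= -ltnS m0 add0r divr1 coefD !coefZ.
  by rewrite p10 // p20.
move=> x xX; have /andP[x0 xX'] := xX.
pose H z := symb a b (w + z * mu) s - q.[z].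
have H0 : H 0%:C = 0 by rewrite /H mul0r addr0 horner_coef0 coefD coefC coefXM addr0 subrr.
set B := pw w _.
have := @mvi _ H (fun y => dsymb a b mu (w + y%:C * mu) s - p.[y%:C]) 0 x ((c1 * K1 + c2 * K2) * B) x0.
rewrite H0 subr0 subr0 => HH; apply: le_trans (HH _ _) _.
- move=> y /andP[y0 yx]; have yX : 0 <= y <= X by rewrite y0 (le_trans yx).
  have [_ _ n3] := near w y w0 wX yX.
  by apply: cderB; [exact: symb_der | rewrite -qd; exact: cder_horner].
- move=> y /andP[y0 yx]; have yX : 0 <= y <= X by rewrite y0 (le_trans yx).
  have -> : dsymb a b mu (w + y%:C * mu) s - p.[y%:C] =
     C1 * (symb a.+1 b (w + y%:C * mu) s - p1.[y%:C]) + C2 * (symb a b.+1 (w + y%:C * mu) s - p2.[y%:C]).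
    by rewrite /dsymb /p hornerD !hornerZ /C1 /C2; ring.
  apply: le_trans (nrmD _ _) _; rewrite !nrmM mulrDl; apply: lerD.
    rewrite -[X in _ <= X]mulrA; apply: ler_pM; rewrite ?nrm_ge0 ?mulr_ge0 ?nrm_ge0 //.
      rewrite ler_wpM2r ?nrm_ge0 //; apply: le_trans (nrmB _ _) _.
      by rewrite nrmN nrm_nat lerD2l.
    apply: le_trans (e1 y yX) _; rewrite ler_wpM2l // /B le_eqVlt; apply/orP; left.
    by apply/eqP; congr pw; rewrite -![_.+1%:R]natr1; ring.
  rewrite -[X in _ <= X]mulrA; apply: ler_pM; rewrite ?nrm_ge0 ?mulr_ge0 ?nrm_ge0 //.
    rewrite nrmJ ler_wpM2r ?nrm_ge0 //; apply: le_trans (nrmB _ _) _.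
    by rewrite lerD //; apply: le_trans (nrmB _ _) _; rewrite nrm1 nrm_nat.
  apply: le_trans (e2 y yX) _; rewrite ler_wpM2l // /B le_eqVlt; apply/orP; left.
  by apply/eqP; congr pw; rewrite -![_.+1%:R]natr1; ring.
rewrite mulrAC ler_wpM2r ?(ltW (pw_gt0 _ _)) //.
by rewrite ler_wpM2l // addr_ge0 // mulr_ge0.
Qed.

(** The weights solve a Vandermonde system at the nodes 0, ..., m-1. They extract the derivative at
    0 from finitely many values, exactly on polynomials of degree below m: a derivative is replaced
    by a finite difference. *)
Lemma interpolation m : exists beta : 'I_m -> C, forall p : {poly C}, (size p <= m)%N ->
  \sum_(j < m) beta j * p.[j%:R] = p`_1.
Proof.
pose V : 'M[C]_m := Vandermonde m (\row_(j < m) (j%:R : C)).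
have Vu : V \in unitmx.
  rewrite unitmxE det_Vandermonde unitfE; apply/prodf_neq0 => i _.
  apply/prodf_neq0 => j ij; rewrite !mxE subr_eq0 eqr_nat; apply: contraTneq ij => ->.
  by rewrite ltnn.
pose bt := invmx V *m \col_(i < m) ((i == 1 :> nat)%:R : C).
exists (fun j => bt j 0) => p sp.
have VE (i : 'I_m) : \sum_(j < m) j%:R ^+ i * bt j 0 = (i == 1 :> nat)%:R.
  have := mulKVmx Vu (\col_(i < m) ((i == 1 :> nat)%:R : C)) => /matrixP /(_ i 0).
  by rewrite !mxE => <-; apply: eq_bigr => j _; rewrite !mxE.
under eq_bigr => j _ do rewrite (horner_coef_wide _ sp) mulr_sumr.
rewrite exchange_big /=.
under eq_bigr => i _.
  under eq_bigr => j _ do rewrite mulrCA [bt j 0 * _]mulrC.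
  rewrite -mulr_sumr VE; over.
rewrite -(big_mkord xpredT (fun i => p`_i * (i == 1)%:R)) /=.
have [m1|m1] := ltnP 1 m.
  rewrite (bigD1_seq 1%N) ?mem_index_iota ?m1 ?iota_uniq //= mulr1 big1_seq ?addr0 //.
  by move=> i /andP[/negPf -> _]; rewrite mulr0.
rewrite big1_seq; first by rewrite nth_default // (leq_trans sp).
move=> i; rewrite mem_index_iota /= => im; suff -> : (i == 1%N) = false by rewrite mulr0.
by apply/negbTE; rewrite neq_ltn; apply/orP; left; exact: leq_trans im m1.
Qed.

End Symbols.

(** * Convergence and holomorphy of sums over a lattice *)

Section Lattice.
Variable R : realType.
Local Notation C := (Cplx R).
Local Notation Re := complex.Re.
Local Notation Im := complex.Im.
Variables (t : upper R) (N : nat).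
Hypothesis N0 : (0 < N)%N.
Let tau : C := val t.

Definition lam (p : int * int) : C := N%:R * (p.1%:~R * val t + p.2%:~R).

Definition lwt (q : R) (p : int * int) : R :=
  expR (- q * ln (`|p.1|%N.+1%:R)) * expR (- q * ln (`|p.2|%N.+1%:R)).

Lemma lwt_ge0 q p : 0 <= lwt q p.
Proof. by rewrite mulr_ge0 ?expR_ge0. Qed.

Lemma lwt_absum q : 1 < q -> absum (lwt q).
Proof.
move=> q1; have h := absum_int (fun n => expR_ge0 _) (absum_power q1).
exact (absum_prod (fun i => expR_ge0 _) (fun i => expR_ge0 _) h h).
Qed.

Lemma lam_ge : exists2 k : R, 0 < k & forall p, k * (maxn `|p.1|%N `|p.2|%N)%:R <= nrm (lam p).
Proof.
have y0 : 0 < Im tau := valP t.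
set y := Im tau in y0; pose T := nrm tau; have T0 : 0 <= T := nrm_ge0 _.
pose K := y^-1 + 1 + T / y.
have K0 : 0 < K by rewrite ltr_wpDr ?divr_ge0 ?(ltW y0) // ltr_wpDl // invr_ge0 ltW.
exists K^-1; rewrite ?invr_gt0 // => p; rewrite mulrC ler_pdivrMr //.
set n := nrm _; have n0 : 0 <= n := nrm_ge0 _.
have N1 : 1 <= N%:R :> R by rewrite ler1n.
pose a : R := (`|p.1|%N)%:R; pose b : R := (`|p.2|%N)%:R.
have aE : `|(p.1%:~R : R)| = a by rewrite -intr_norm /a natr_absz.
have bE : nrm (p.2%:~R : C) = b by rewrite nrm_int /b natr_absz.
have aE' : nrm (p.1%:~R : C) = a by rewrite nrm_int /a natr_absz.
have h1 : N%:R * a * y <= n.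
  have := nrm_Im (lam p); rewrite -/n /lam !ReImE Re_nat Im_nat Re_int Im_int Im_int.
  rewrite mul0r !addr0 mul0r addr0 -/tau -/y normrM normr_nat normrM aE (gtr0_norm y0).
  by rewrite mulrA.
have h2 : N%:R * b <= n + N%:R * a * T.
  have -> : N%:R * b = nrm (lam p - N%:R * p.1%:~R * tau).
    by rewrite /lam -/tau mulrDr mulrA addrAC subrr add0r nrmM nrm_nat bE.
  by apply: le_trans (nrmB _ _) _; rewrite -/n !nrmM nrm_nat aE'.
have a0 : 0 <= a by []. have b0 : 0 <= b by [].
have h3 : N%:R * a <= n * y^-1 by rewrite ler_pdivlMr.
have h4 : N%:R * a * T <= n * y^-1 * T by rewrite ler_wpM2r.
have h5 : a <= N%:R * a by rewrite ler_peMl.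
have h6 : b <= N%:R * b by rewrite ler_peMl.
have h7 : 0 <= n * (T / y) by rewrite mulr_ge0 ?divr_ge0 // ltW.
have h8 : 0 <= n * y^-1 by rewrite mulr_ge0 ?invr_ge0 // ltW.
have -> : n * K = n * y^-1 + n + n * (T / y) by rewrite /K; ring.
have e1 : n * y^-1 * T = n * (T / y) by ring.
have [m1|m1] := leqP `|p.1|%N `|p.2|%N.
  by rewrite -/b; move: h2 h4 h6 h8; rewrite e1; lra.
by rewrite -/a; move: h3 h5 h7; lra.
Qed.

(** Up to a constant, |lam p| bounds both |p.1| + 1 and |p.2| + 1. Thus |lam p|^-2q is dominated by
    a product of one-variable weights, summable as soon as 2q > 2. *)
Lemma lam_pw (q : R) : 0 < q ->
  exists2 K : R, 0 <= K & forall p, lam p != 0 -> pw (lam p) (- (2 * q)) <= K * lwt q p.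
Proof.
move=> q0; have [k k0 Hk] := lam_ge.
exists (expR (- (2 * q) * ln (k / 2))); first exact: expR_ge0.
move=> p l0; set a := `|p.1|%N; set b := `|p.2|%N; have := Hk p; rewrite -/a -/b => Hp.
have m1 : (0 < maxn a b)%N.
  rewrite lt0n; apply: contra l0 => /eqP m0; have : (a == 0%N) && (b == 0%N) by lia.
  by rewrite !absz_eq0 => /andP[/eqP p1 /eqP p2]; rewrite /lam p1 p2 mul0r addr0 mulr0.
have k2 : 0 < k / 2 by rewrite divr_gt0.
have n0 : 0 < nrm (lam p) by rewrite nrm_gt0.
rewrite /pw /lwt -/a -/b -!expRD ler_expR.
suff : 2 * ln (k / 2) + ln a.+1%:R + ln b.+1%:R <= 2 * ln (nrm (lam p)).
  move=> H; have := ler_wpM2l (ltW q0) H; lra.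
have a1 : 0 < a.+1%:R :> R by []. have b1 : 0 < b.+1%:R :> R by [].
have dbl (x : R) : 0 < x -> 2 * ln x = ln (x * x) by move=> x0; rewrite lnM ?posrE //; ring.
rewrite !dbl // -!lnM ?posrE ?mulr_gt0 // ler_ln ?posrE ?mulr_gt0 //.
have f1 : k / 2 * a.+1%:R <= nrm (lam p).
  apply: le_trans Hp; rewrite -mulrA ler_wpM2l ?(ltW k0) // mulrC ler_pdivrMr // -natrM ler_nat; lia.
have f2 : k / 2 * b.+1%:R <= nrm (lam p).
  apply: le_trans Hp; rewrite -mulrA ler_wpM2l ?(ltW k0) // mulrC ler_pdivrMr // -natrM ler_nat; lia.
have -> : k / 2 * (k / 2) * a.+1%:R * b.+1%:R = (k / 2 * a.+1%:R) * (k / 2 * b.+1%:R) by ring.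
by apply: ler_pM => //; rewrite mulr_ge0 // ltW.
Qed.

Lemma lam_finite (W : R) : exists A : seq (int * int), forall p, p \notin A -> W <= nrm (lam p).
Proof.
have [k k0 Hk] := lam_ge; pose M := Num.bound (`|W| / k).
have HM : `|W| / k < M%:R by rewrite archi_boundP // divr_ge0 ?normr_ge0 // ltW.
pose L := [seq i%:Z - M%:Z | i <- iota 0 M.*2.+1].
have memL (z : int) : (`|z| <= M)%N -> z \in L.
  move=> zn; apply/mapP; exists (absz (z + M%:Z)); last by lia.
  by rewrite mem_iota; lia.
exists (allpairs pair L L) => p pA; have := Hk p; set m := maxn _ _ => Hp.
have mM : (M < m)%N.
  rewrite ltnNge; apply: contra pA => le; apply/allpairsP; exists p; split; last by case: p {Hp le m}.
    by apply: memL; apply: leq_trans le; exact: leq_maxl.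
  by apply: memL; apply: leq_trans le; exact: leq_maxr.
apply: le_trans (ler_norm W) _; apply: le_trans Hp.
rewrite mulrC -ler_pdivrMr //; apply: le_trans (ltW HM) _; rewrite ler_nat; exact: ltnW.
Qed.

(** Terms entire in s that decay like |lam p|^-(c + 2 Re s), uniformly for bounded s and for all but
    finitely many p. The lattice sum then converges when c + 2 Re s > 2; a larger c means a larger
    half plane. *)
Definition lsum_ok (f : int * int -> C -> C) (c : R) :=
  (forall p s, exists l, cder setT (f p) s l) /\
  forall S : R, 0 <= S -> exists K W : R, 0 <= K /\ forall s p, nrm s <= S -> W <= nrm (lam p) ->
    nrm (f p s) <= K * pw (lam p) (- (c + 2 * Re s)).

Lemma lsum_ok_dom f c s0 : lsum_ok f c -> 2 < c + 2 * Re s0 ->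
  exists h : int * int -> R, absum h /\
  forall p s, sq s0 ((c + 2 * Re s0 - 2) / 4) s -> nrm (f p s) <= h p.
Proof.
move=> [fd fb] c2; set r := _ / 4; have r0 : 0 < r by rewrite divr_gt0 // subr_gt0.
have S0 : 0 <= nrm s0 + 2 * r by rewrite addr_ge0 ?nrm_ge0 // mulr_ge0 // ltW.
have [K [W [K0 HKW]]] := fb _ S0.
(* On the square of half side r the exponent c + 2 Re s is at least (2 + 4r) - 2r = 2q. *)
pose q := 1 + r; have q1 : 1 < q by rewrite ltrDl.
have [|K' K'0 HK'] := @lam_pw q; first by exact: lt_trans q1.
have [A HA] := lam_finite (Order.max W 1).
have [M HM] : exists M : int * int -> R, forall p s, sq s0 r s -> nrm (f p s) <= M p.
  have ex p : exists M : R, forall s, sq s0 r s -> nrm (f p s) <= M.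
    have [s _|M _ HM] := @sq_bounded _ (f p) s0 r r0; last by exists M.
    by have [l /cder_cont] := fd p s.
  by have [M HM] := choice ex; exists M.
exists (fun p => if p \in A then M p else K * (K' * lwt q p)); split.
  apply: (@absum_cofin _ _ _ (fun p => K * (K' * lwt q p)) A).
  - by move=> p; rewrite !mulr_ge0 ?lwt_ge0.
  - by move=> p /negPf ->.
  - by apply: absumZ => //; apply: absumZ => //; exact: lwt_absum.
move=> p s ss; case: ifPn => [_|pA]; first exact: HM.
have := HA p pA; rewrite ge_max => /andP[Wl l1].
have l0 : lam p != 0 by rewrite -nrm_gt0; exact: lt_le_trans l1.
have sS : nrm s <= nrm s0 + 2 * r.
  have := nrmD s0 (s - s0); rewrite addrC subrK => h; apply: le_trans h _; rewrite lerD2l.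
  move: ss; rewrite sqE => /andP[h1 h2]; apply: le_trans (nrm_ReIm _) _; lra.
apply: le_trans (HKW s p sS Wl) _; rewrite ler_wpM2l //.
apply: le_trans (HK' p l0); rewrite ler_expR ler_wpM2r ?ln_ge0 // lerN2.
move: ss; rewrite sqE !ReImE ler_norml => /andP[/andP[h1 _] _].
by rewrite /q /r in h1 *; lra.
Qed.

Lemma lattice_hol f c : lsum_ok f c -> exists G : C -> C, forall s, 2 < c + 2 * Re s ->
  [/\ absum (fun p => nrm (f p s)), hasSum (fun p => f p s) (G s) & exists l, cder setT G s l].
Proof.
move=> ok; pose G s := xget 0 [set l | hasSum (fun p => f p s) l]; exists G.
have H1 s : 2 < c + 2 * Re s -> absum (fun p => nrm (f p s)).
  move=> cs; have [h [ah Hh]] := lsum_ok_dom ok cs; apply: absum_le ah => p.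
  by apply: Hh; apply: sq_nrm; rewrite subrr nrm0 divr_ge0 // subr_ge0 ltW.
have H2 s : 2 < c + 2 * Re s -> hasSum (fun p => f p s) (G s).
  by move=> /H1 /absum_hasSum [l Hl]; apply: (@xgetPex _ 0 [set l | hasSum (fun p => f p s) l]); exists l.
move=> s cs; split; [exact: H1 | exact: H2 |].
have [h [ah Hh]] := lsum_ok_dom ok cs; set r := _ / 4 in Hh.
have r0 : 0 < r by rewrite divr_gt0 // subr_gt0.
apply: (@weierstrass _ _ f G h s r r0) => // [p z _|z]; first by case: ok.
rewrite sqE !ReImE ler_norml => /andP[/andP[h1 _] _]; apply: H2.
by rewrite /r in h1; lra.
Qed.

Lemma symb_entire a b (w s : C) : exists l, cder setT (symb a b w) s l.
Proof.
eexists; rewrite /symb; apply: cderM (cder_cst _ _ _) (cder_exp _).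
apply: cder_eq (cder_ext ltr01 _ _ (cderZ (- 2 * (ln (nrm w))%:C) (cder_id _ _))) _.
- by move=> y _ _ /=; ring.
- by rewrite /=; ring.
- by [].
Qed.

Lemma symb_ok a b u : lsum_ok (fun p s => symb a b (lam p + u) s) (a%:R + b%:R - 1).
Proof.
split=> [p s|S S0]; first exact: symb_entire.
(* With no coefficients the polynomial is 0, and the estimate just compares the symbol at
   [lam p + u] with a power of |lam p|. *)
have [K K0 HK] := taylor 0 u ler01 S0 a b.
exists K, (2 * nrm u + 1); split=> // s p sS lW.
have u0 := nrm_ge0 u.
have [| |q [sq _ _ Hq]] := HK s (lam p) sS; rewrite ?mul1r; [by lra| by lra|].
have q0 : q = 0 by apply/eqP; rewrite -size_poly_leq0.
have := Hq 1; rewrite q0 horner0 subr0 mul1r => /(_ _) H; apply: le_trans (H _) _.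
  by rewrite ler01 lexx.
rewrite ler_wpM2l // le_eqVlt; apply/orP; left; apply/eqP; congr pw; ring.
Qed.

End Lattice.

(** * Continuation of a Hecke sum by finite differences *)

Section Hecke.
Variable R : realType.
Local Notation C := (Cplx R).
Local Notation Re := complex.Re.
Local Notation Im := complex.Im.
Variables (t : upper R) (N : nat).
Hypothesis N0 : (0 < N)%N.
Local Notation tau := (val t).
Local Notation lam := (lam t N).

Lemma lam_shift (p : int * int) (i j : int) :
  lam (p.1 + i, p.2 + j) = lam p + N%:R * (i%:~R * tau + j%:~R).
Proof. by rewrite /lam /= !intrD; ring. Qed.

Lemma hasSum_shift (f : C -> C) u l (i j : int) :
  hasSum (fun p => f (lam p + u)) l ->
  hasSum (fun p => f (lam p + N%:R * (i%:~R * tau + j%:~R) + u)) l.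
Proof.
move=> H; pose phi (p : int * int) := (p.1 + i, p.2 + j); pose psi (p : int * int) := (p.1 - i, p.2 - j).
have phiK : cancel phi psi by move=> [a b]; rewrite /phi /psi /= !addrK.
have psiK : cancel psi phi by move=> [a b]; rewrite /phi /psi /= !subrK.
have := hasSum_reindexV phiK (fun j _ => psiK j) H.
by apply: hasSum_ext => p; rewrite /phi lam_shift.
Qed.

Variable k : nat.
Hypothesis k0 : (0 < k)%N.

(** This is 2 i N^2 Im tau, the determinant of the lattice directions N tau and N together with
    their conjugates. *)
Definition D0 : C := N%:R * tau * cj N%:R - N%:R * cj (N%:R * tau).

Lemma cj_nat n : cj (n%:R : C) = n%:R. Proof. exact: rmorph_nat. Qed.

Lemma D0_neq0 : D0 != 0.
Proof.
apply/eqP => /(congr1 (@complex.Im R)); rewrite /D0 cjM cj_nat !ReImE Re_nat Im_nat Re_cj Im_cj /=.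
have y0 : 0 < Im tau := valP t.
have N1 : 0 < N%:R :> R by rewrite ltr0n.
have : 0 < N%:R * Im tau * N%:R by rewrite !mulr_gt0.
lra.
Qed.

(** In N tau times the derivative of [symb k 0] along N, minus N times that along N tau, the d/dw
    terms cancel and (1 - s) D0 [symb k 1] remains. With the weights beta these derivatives become
    differences under lattice translations, which sum to 0, while the first term of theta cancels
    their leading part. So theta decays faster by m - 1 powers than [symb k 1], yet has the same
    lattice sum up to the factor (s - 1) D0. *)
Definition theta m (beta : 'I_m -> C) u (p : int * int) (s : C) : C :=
  (s - 1) * D0 * symb k 1 (lam p + u) s +
  \sum_(j < m) beta j * (N%:R * tau * symb k 0 (lam p + u + j%:R * N%:R) s
                         - N%:R * symb k 0 (lam p + u + j%:R * (N%:R * tau)) s).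

Lemma theta_ok m (beta : 'I_m -> C) u : (1 < m)%N ->
  (forall p : {poly C}, (size p <= m)%N -> \sum_(j < m) beta j * p.[j%:R] = p`_1) ->
  lsum_ok t N (theta beta u) (k%:R - 1 + m%:R).
Proof.
move=> m1 Hb; split=> [p s|S S0].
  have [l1 Hl1] := symb_entire k 1 (lam p + u) s.
  have A1 := choice (fun j : 'I_m => symb_entire k 0 (lam p + u + j%:R * N%:R) s).
  have A2 := choice (fun j : 'I_m => symb_entire k 0 (lam p + u + j%:R * (N%:R * tau)) s).
  have [l2 Hl2] := A1; have [l3 Hl3] := A2.
  eexists; apply: cderD.
    apply: cderM Hl1; apply: cderM (cder_cst _ _ _).
    exact: cderB (cder_id _ _) (cder_cst _ _ _).
  apply: cder_sum => j; apply: cderZ; exact: cderB (cderZ _ (Hl2 j)) (cderZ _ (Hl3 j)).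
pose X : R := m%:R; have X0 : 0 <= X by [].
set mu1 : C := N%:R; set mu2 : C := N%:R * tau.
have [K1 K10 H1] := taylor m mu1 X0 S0 k 0.
have [K2 K20 H2] := taylor m mu2 X0 S0 k 0.
pose Q : R := 1 + k%:R + m%:R + 2 * S.
pose B := \sum_(j < m) nrm (beta j) * (nrm mu2 * K1 + nrm mu1 * K2).
have B0 : 0 <= B by apply: sumr_ge0 => j _; rewrite mulr_ge0 ?nrm_ge0 // addr_ge0 // mulr_ge0 ?nrm_ge0.
have u0 := nrm_ge0 u; have n1 := nrm_ge0 mu1; have n2 := nrm_ge0 mu2.
have x1 : 0 <= X * nrm mu1 by rewrite mulr_ge0. have x2 : 0 <= X * nrm mu2 by rewrite mulr_ge0.
exists (B * expR (Q * ln 2)), (2 * nrm u + 4 * (X * nrm mu1) + 4 * (X * nrm mu2) + 1).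
split; first by rewrite mulr_ge0 ?expR_ge0.
move=> s p sS lW; set w := lam p + u.
have w1 : nrm (lam p) / 2 <= nrm w.
  by have := nrmB_ge (lam p) (- u); rewrite opprK nrmN -/w; lra.
have w2 : nrm w <= 2 * nrm (lam p) by apply: le_trans (nrmD _ _) _; lra.
have w0 : 0 < nrm w by lra.
have [|p1 [sz1 _ d1 e1]] := H1 s w sS w0; first by lra.
have [|p2 [sz2 _ d2 e2]] := H2 s w sS w0; first by lra.
(* Subtracting the Taylor polynomials introduces, by the choice of beta, precisely the two
   derivatives at 0, and these account for the first term of theta. Only remainders of order m are
   left. *)
have E : theta beta u p s = \sum_(j < m) beta j *
   (mu2 * (symb k 0 (w + j%:R * mu1) s - p1.[j%:R]) - mu1 * (symb k 0 (w + j%:R * mu2) s - p2.[j%:R])).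
  under [RHS]eq_bigr => j _.
    have -> : beta j * (mu2 * (symb k 0 (w + j%:R * mu1) s - p1.[j%:R]) - mu1 * (symb k 0 (w + j%:R * mu2) s - p2.[j%:R]))
      = beta j * (mu2 * symb k 0 (w + j%:R * mu1) s - mu1 * symb k 0 (w + j%:R * mu2) s)
        + (mu1 * (beta j * p2.[j%:R]) - mu2 * (beta j * p1.[j%:R])) by ring.
    over.
  rewrite big_split /= sumrB -!mulr_sumr !Hb // (d1 m1) (d2 m1) addrC; congr (_ + _).
  by rewrite /dsymb /D0 -/mu1 -/mu2 -/w; ring.
rewrite E {E}; clearbody mu1 mu2; apply: le_trans (nrm_sum _ _ _) _.
apply: (@le_trans _ _ (B * pw w (1 - k%:R - m%:R - 2 * Re s))).
  rewrite /B mulr_suml; apply: ler_sum => j _; rewrite nrmM -mulrA ler_wpM2l ?nrm_ge0 //.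
  have jX : 0 <= (j%:R : R) <= X by rewrite ler0n ler_nat ltnW.
  have := e1 _ jX; have := e2 _ jX; rewrite rmorph_nat subr0 => f2 f1.
  apply: le_trans (nrmB _ _) _; rewrite !nrmM mulrDl -!mulrA lerD // ler_wpM2l ?nrm_ge0 //.
rewrite -mulrA ler_wpM2l //.
have -> : - (k%:R - 1 + m%:R + 2 * Re s) = 1 - k%:R - m%:R - 2 * Re s by ring.
apply: pw_comp => //; first by lra.
have rs : `|Re s| <= S := le_trans (nrm_Re s) sS.
have k0' : 0 <= k%:R :> R by [].
by rewrite /Q ler_norml; move: rs; rewrite ler_norml => /andP[r1 r2]; apply/andP; split; lra.
Qed.

Lemma theta_sum m (beta : 'I_m -> C) u s l1 l0 : \sum_(j < m) beta j = 0 ->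
  hasSum (fun p => symb k 1 (lam p + u) s) l1 -> hasSum (fun p => symb k 0 (lam p + u) s) l0 ->
  hasSum (fun p => theta beta u p s) ((s - 1) * D0 * l1).
Proof.
move=> b0 H1 H0.
have -> : (s - 1) * D0 * l1 = (s - 1) * D0 * l1 + \sum_(j < m) beta j * (N%:R * tau * l0 - N%:R * l0).
  by rewrite -mulr_suml b0 mul0r addr0.
apply: hasSumD; first exact: hasSumZ.
apply: hasSum_sum => j; apply: hasSumZ; apply: hasSumB; apply: hasSumZ.
  have := hasSum_shift (f := fun w => symb k 0 w s) 0 j%:Z H0.
  by apply: hasSum_ext => p; congr symb; rewrite mul0r add0r -pmulrn; ring.
have := hasSum_shift (f := fun w => symb k 0 w s) j%:Z 0 H0.
by apply: hasSum_ext => p; congr symb; rewrite addr0 -pmulrn; ring.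
Qed.

(** The sum of theta converges on a half plane that grows with m; divided by (s - 1) D0 it continues
    the sum S. For different m these continuations agree by the identity theorem, and together they
    give an entire function. *)
Lemma symb_sum_cont u : exists g : C -> C, (forall s, exists l, cder setT g s l) /\
  forall s, 2 < k%:R + 2 * Re s -> hasSum (fun p => symb k 1 (lam p + u) s) (g s).
Proof.
have k1 : 1 <= k%:R :> R by rewrite ler1n.
have [S HS] := lattice_hol N0 (symb_ok t N k 1 u).
have [S0 HS0] := lattice_hol N0 (symb_ok t N k 0 u).
have HS' s : 2 < k%:R + 2 * Re s -> hasSum (fun p => symb k 1 (lam p + u) s) (S s) /\ exists l, cder setT S s l.
  by move=> h; have [_ h1 h2] := HS s ltac:(lra).
have HT m : exists T : C -> C, (1 < m)%N -> (forall s, 2 < k%:R - 1 + m%:R + 2 * Re s -> exists l, cder setT T s l) /\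
    forall s, 2 < k%:R + 2 * Re s -> T s = (s - 1) * D0 * S s.
  have [m1|] := ltnP 1 m; last by exists (fun=> 0).
  have [beta Hb] := interpolation R m.
  have [T HTm] := lattice_hol N0 (theta_ok u m1 Hb); exists T => _.
  have b0 : \sum_(j < m) beta j = 0.
    transitivity (\sum_(j < m) beta j * (1 : {poly C}).[j%:R]).
      by apply: eq_bigr => j _; rewrite hornerE mulr1.
    by rewrite Hb ?size_poly1 ?(ltnW m1) // coef1.
  have m2 : 2 <= m%:R :> R by rewrite ler_nat.
  split=> [s hs|s hs]; first by have [_ _] := HTm s hs.
  have D z : (2 - k%:R) / 2 < Re z -> exists l, cder setT (fun s => T s - (s - 1) * D0 * S s) z l.
    move=> hz; have [_ _ [l1 H1]] := HTm z ltac:(lra); have [_ [l2 H2]] := HS' z ltac:(lra).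
    eexists; apply: cderB H1 (cderM (cderM (cderB (cder_id _ _) (cder_cst _ _ _)) (cder_cst _ _ _)) H2).
  apply/eqP; rewrite -subr_eq0; apply/eqP.
  (* The sum of theta can be split only where [symb k 0] is summable too, so the two sides are first
     compared for Re > 2; the identity theorem extends this to the whole half plane of convergence
     of S. *)
  apply: (@identity_halfplane _ (fun s => T s - (s - 1) * D0 * S s) ((2 - k%:R) / 2) 2 D); last by lra.
  move=> z hz; have [_ h1 _] := HTm z ltac:(lra); have [h2 _] := HS' z ltac:(lra).
  have [_ h3 _] := HS0 z ltac:(lra).
  by rewrite (hasSum_unique h1 (theta_sum b0 h2 h3)) subrr.
have [T HTT] := choice HT.
have cons m m' s : (1 < m)%N -> (1 < m')%N -> 2 < k%:R - 1 + m%:R + 2 * Re s ->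
    2 < k%:R - 1 + m'%:R + 2 * Re s -> T m s = T m' s.
  move=> m1 m1' h h'; have [d1 e1] := HTT m m1; have [d2 e2] := HTT m' m1'.
  have := @identity_halfplane _ (fun s => T m s - T m' s) (Order.max ((3 - k%:R - m%:R) / 2) ((3 - k%:R - m'%:R) / 2)) 1.
  move=> /(_ _ _ s) H; apply/eqP; rewrite -subr_eq0; apply/eqP; apply: H.
  - move=> z; rewrite gt_max => /andP[z1 z2].
    have [l1 H1] := d1 z ltac:(lra); have [l2 H2] := d2 z ltac:(lra).
    by exists (l1 - l2); exact: cderB.
  - by move=> z z1; rewrite e1 ?e2 ?subrr //; lra.
  - by rewrite gt_max; apply/andP; split; lra.
(* Large enough for the series of order M s to converge at s with a margin, hence also on a
   neighbourhood of s. *)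
pose M (s : C) := (Num.bound (`|Re s| * 2 + 5)).+2.
have MP s : 5 + `|Re s| * 2 < (M s)%:R.
  have : `|Re s| * 2 + 5 < (Num.bound (`|Re s| * 2 + 5))%:R :> R by rewrite archi_boundP // addr_ge0 // mulr_ge0.
  by rewrite /M -2!natr1; lra.
have MR s : 5 < k%:R - 1 + (M s)%:R + 2 * Re s.
  by have := MP s; have := ler_norm (- Re s); rewrite normrN; lra.
(* The division is harmless: the second branch has Re s <= (2 - k)/2 <= 1/2, so the zero of s - 1
   lies in the region where S itself converges. *)
pose G s := if 2 < k%:R + 2 * Re s then S s else T (M s) s / ((s - 1) * D0).
exists G; split; last by move=> s hs; rewrite /G hs; case: (HS' s hs).
move=> s; have [hs|hs] := boolP (2 < k%:R + 2 * Re s).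
  have [_ [l Hl]] := HS' s hs; exists l.
  apply: cder_ext (_ : 0 < (k%:R + 2 * Re s - 2) / 2) _ _ Hl; first by rewrite divr_gt0 // subr_gt0.
    move=> y _ ys; have := le_lt_trans (nrm_Re _) ys; rewrite !ReImE ltr_norml => /andP[h _].
    by rewrite /G ifT //; lra.
  by rewrite /G hs.
have hs' : k%:R + 2 * Re s <= 2 by rewrite leNgt.
have MRs := MR s; have [d1 e1] := HTT (M s) isT; have [l Hl] := d1 s ltac:(lra).
have Re1 : Re (1 : C) = 1 by [].
have neq y : Re y < 1 -> (y - 1) * D0 != 0.
  move=> y1; rewrite mulf_neq0 ?D0_neq0 // subr_eq0; apply/eqP => yE.
  by move: y1; rewrite yE Re1 ltxx.
have s1 : Re s < 1 by lra.
have Dd : cder setT (fun y => (y - 1) * D0) s ((1 - 0) * D0 + (s - 1) * 0).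
  exact: cderM (cderB (cder_id _ _) (cder_cst _ _ _)) (cder_cst _ _ _).
have Dv := @cderV _ setT (fun y => (y - 1) * D0) s _ (neq s s1) Dd.
have r4 : 0 < 1 / 4 :> R by lra.
eexists; apply: cder_ext r4 _ _ (cderM Hl Dv).
  move=> y _ ys; have := le_lt_trans (nrm_Re _) ys; rewrite !ReImE ltr_norml => /andP[h1 h2].
  have y1 : Re y < 1 by lra.
  rewrite /G; case: ifP => hy; first by rewrite e1 // mulrC mulKf // neq.
  have MRy := MR y.
  by congr (_ / _); apply: cons => //; lra.
by rewrite /G (negPf hs).
Qed.

Definition uvec (c d : int) : C := c%:~R * tau + d%:~R.

(** The symbol with b = 1 is w^-k |w|^(-2s) for w nonzero and vanishes at w = 0, which is the pair
    that [in_class] excludes. So the sum over the class runs over a full translate of the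
    lattice. *)
Lemma hecke_sum_hasSum (c d : int) s l :
  hasSum (fun p => symb k 1 (lam p + uvec c d) s) l -> hecke_sum k N c d t s = l.
Proof.
move=> H; apply: lattice_sum_hasSum.
have NZ : N%:Z != 0 by lia.
pose phi (p : int * int) := (N%:Z * p.1 + c, N%:Z * p.2 + d).
pose psi (p : int * int) := ((p.1 - c) %/ N%:Z, (p.2 - d) %/ N%:Z)%Z.
have phiK : cancel phi psi by move=> [a b]; rewrite /phi /psi /= !addrK !mulKz.
apply: (hasSum_reindex phiK) => [[a b] /=|].
  case: ifP => [|_ /eqP //]; rewrite /in_class => /and3P[_ /eqP h1 /eqP h2] _.
  rewrite /phi /psi /=; congr (_, _).
    by rewrite mulrC divzK ?subrK // -eqz_mod_dvd; apply/eqP.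
  by rewrite mulrC divzK ?subrK // -eqz_mod_dvd; apply/eqP.
apply: hasSum_ext H => -[a b] /=.
have -> : (N%:Z * a + c)%:~R * tau + (N%:Z * b + d)%:~R = lam (a, b) + uvec c d.
  by rewrite /lam /uvec /= !intrD !intrM -!pmulrn; ring.
have -> : in_class N c d (N%:Z * a + c) (N%:Z * b + d) = ((N%:Z * a + c, N%:Z * b + d) != (0, 0)).
  by rewrite /in_class ![N%:Z * _]mulrC !modzMDl !eqxx !andbT.
case: ifPn => [ne|/negPn /eqP [e1 e2]]; last first.
  rewrite (_ : lam (a, b) + uvec c d = 0) ?symb0 //.
  have -> : lam (a, b) + uvec c d = (N%:Z * a + c)%:~R * tau + (N%:Z * b + d)%:~R.
    by rewrite /lam /uvec /= !intrD !intrM -!pmulrn; ring.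
  by rewrite e1 e2 mul0r addr0.
rewrite /symb; congr (_ * _); rewrite expr1 exprVn.
set w := lam _ + _; have [->|w0] := eqVneq w 0; last by rewrite mulrAC divff ?mul1r // cj_eq0.
by rewrite /cj rmorph0 !mul0r expr0n; case: (k) k0 => //= n _; rewrite invr0.
Qed.

(** [hecke_value] evaluates a chosen continuation; g is that choice, legitimate because
    [symb_sum_cont] shows that a continuation exists. *)
Lemma hecke_valueP (c d : int) : exists g : C -> C, [/\ forall s, exists l, cder setT g s l,
  forall s, 2 < k%:R + 2 * Re s -> hasSum (fun p => symb k 1 (lam p + uvec c d) s) (g s) &
  hecke_value k N c d t = g 0].
Proof.
have [g [gd gS]] := symb_sum_cont (uvec c d).
set P := [set h : C -> C | (forall s : C, derivable h s 1) /\
    forall s : C, 2 < k%:R + 2 * Re s -> h s = hecke_sum k N c d t s].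
have Pg : P g.
  split=> s; first by apply/derivable_cder.
  by move=> hs; rewrite (hecke_sum_hasSum (gS s hs)).
have [hd hS] : P (xget (0 : C -> C) P) by apply: xgetPex; exists g.
exists (xget (0 : C -> C) P); split=> // s; first by apply/derivable_cder.
by move=> hs; rewrite hS // (hecke_sum_hasSum (gS s hs)); exact: gS.
Qed.

End Hecke.

(** * Eisenstein series as absolutely convergent sums, weight by weight *)

Section EisensteinSums.
Variable R : realType.
Local Notation C := (Cplx R).
Local Notation Re := complex.Re.
Local Notation Im := complex.Im.
Variables (t : upper R) (N : nat).
Hypothesis N0 : (0 < N)%N.
Local Notation tau := (val t).
Local Notation lam := (lam t N).
Local Notation uvec := (uvec t).

Lemma symb_s0 k (w : C) : (0 < k)%N -> symb k 1 w 0 = w^-1 ^+ k.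
Proof.
move=> k0; rewrite /symb expr1 mulr0 mul0r cexp0 mulr1.
have [->|w0] := eqVneq w 0; last by rewrite mulrAC divff ?mul1r // cj_eq0.
by rewrite /cj rmorph0 !mul0r invr0 expr0n; case: k k0.
Qed.

Lemma uvec00 : uvec 0 0 = 0. Proof. by rewrite /uvec mul0r addr0. Qed.

Lemma eisG_sum3 k (c d : int) : (2 < k)%N ->
  absum (fun p => nrm ((lam p + uvec c d)^-1 ^+ k)) /\
  hasSum (fun p => (lam p + uvec c d)^-1 ^+ k) (eisG k N c d t).
Proof.
move=> k3; have k0 : (0 < k)%N by exact: leq_trans k3.
have [G HG] := lattice_hol N0 (symb_ok t N k 1 (uvec c d)).
have k3' : 3 <= k%:R :> R by rewrite ler_nat.
have [|a h _] := HG 0; first by rewrite mulr0 addr0; lra.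
have E : (fun p => symb k 1 (lam p + uvec c d) 0) = (fun p => (lam p + uvec c d)^-1 ^+ k).
  by apply: funext => p; rewrite symb_s0.
split; first by apply: absum_le a => p; rewrite symb_s0.
rewrite E in h; suff -> : eisG k N c d t = G 0 by [].
rewrite -E in h; rewrite -(hecke_sum_hasSum N0 k0 h) /eisG k3 /hecke_sum; congr lattice_sum.
apply: funext => a'; apply: funext => b'; case: ifP => // _.
by rewrite mulr0 mul0r cexp0 mulr1.
Qed.

(** The difference of the terms for (c, d) and (0, 0) decays like |lam p|^-(3 + 2 Re s), by Taylor's
    formula with one coefficient. Its sum is therefore holomorphic for Re s > -1/2 and there equals
    the difference of the two continuations. *)
Lemma eisG_sum2 (c d : int) :
  absum (fun p => nrm ((lam p + uvec c d)^-1 ^+ 2 - (lam p)^-1 ^+ 2)) /\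
  hasSum (fun p => (lam p + uvec c d)^-1 ^+ 2 - (lam p)^-1 ^+ 2) (eisG 2 N c d t).
Proof.
pose V p s := symb 2 1 (lam p + uvec c d) s - symb 2 1 (lam p) s.
have ok : lsum_ok t N V 3.
  split=> [p s|S S0].
    have [l1 H1] := symb_entire 2 1 (lam p + uvec c d) s.
    have [l2 H2] := symb_entire 2 1 (lam p) s.
    by exists (l1 - l2); exact: cderB.
  have [K K0 HK] := taylor 1 (uvec c d) ler01 S0 2 1.
  exists K, (2 * nrm (uvec c d) + 1); split=> // s p sS lW.
  have u0 := nrm_ge0 (uvec c d).
  have [| |q [sq q0 _ Hq]] := HK s (lam p) sS; rewrite ?mul1r; [by lra| by lra|].
  have := Hq 1; rewrite mul1r ler01 lexx => /(_ isT).
  rewrite (size1_polyC sq) hornerC q0 // => H; apply: le_trans H _.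
  rewrite ler_wpM2l // le_eqVlt; apply/orP; left; apply/eqP; congr pw; ring.
have [G HG] := lattice_hol N0 ok.
have [g [gd gS gE]] := @hecke_valueP _ t N N0 2 isT c d.
have [g0 [g0d g0S g0E]] := @hecke_valueP _ t N N0 2 isT 0 0.
have -> : eisG 2 N c d t = G 0.
  rewrite /eisG /= gE g0E; apply/eqP; rewrite -subr_eq0; apply/eqP.
  apply: (@identity_halfplane _ (fun s => g s - g0 s - G s) (-1 / 2) 0) => [z hz|z hz|].
  - have [l1 H1] := gd z; have [l2 H2] := g0d z; have [_ _ [l3 H3]] := HG z ltac:(lra).
    by exists (l1 - l2 - l3); apply: cderB H3; exact: cderB.
  - have [_ h _] := HG z ltac:(lra).
    have h1 := gS z ltac:(lra); have h2 := g0S z ltac:(lra).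
    rewrite (hasSum_unique h (hasSumB h1 (_ : hasSum (fun p => symb 2 1 (lam p) z) (g0 z)))) ?subrr //.
    by apply: hasSum_ext h2 => p; rewrite uvec00 addr0.
  - by rewrite /=; lra.
have [|a h _] := HG 0; first by rewrite mulr0 addr0; lra.
split; first by apply: absum_le a => p; rewrite /V !symb_s0.
by apply: hasSum_ext h => p; rewrite /V !symb_s0.
Qed.

Definition frac (c : int) : C := (c%:~R / N%:R : R)%:C.

Definition comb1 (c d : int) (f : C -> C) (w : C) : C :=
  f (w + uvec c d) - (1 - frac c - frac d) * f w - frac c * f (w + N%:R * tau)
  - frac d * f (w + N%:R).

(* Subtracting the affine interpolation of 1/w at three lattice points makes the
   weight one series absolutely convergent. *)
Lemma eisG_sum1 (c d : int) :
  absum (fun p => nrm (comb1 c d (fun w => w^-1) (lam p))) /\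
  hasSum (fun p => comb1 c d (fun w => w^-1) (lam p)) (eisG 1 N c d t).
Proof.
set a := frac c; set b := frac d.
have NR : (N%:R : R) != 0 by rewrite pnatr_eq0 -lt0n.
have uE : uvec c d = a * (N%:R * tau) + b * N%:R.
  have fE e : frac e * N%:R = e%:~R :> C.
    by rewrite /frac -(rmorph_nat (real_complex R)) -rmorphM divfK // rmorph_int.
  by rewrite mulrA /a /b !fE.
have cu : cj (uvec c d) = a * cj (N%:R * tau) + b * cj N%:R.
  by rewrite uE cjD !cjM !cj_real.
pose V p s := comb1 c d (symb 1 1 ^~ s) (lam p).
have ok : lsum_ok t N V 3.
  split=> [p s|S S0].
    have [l1 H1] := symb_entire 1 1 (lam p + uvec c d) s.
    have [l2 H2] := symb_entire 1 1 (lam p) s.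
    have [l3 H3] := symb_entire 1 1 (lam p + N%:R * tau) s.
    have [l4 H4] := symb_entire 1 1 (lam p + N%:R) s.
    eexists; exact: cderB (cderB (cderB H1 (cderZ _ H2)) (cderZ _ H3)) (cderZ _ H4).
  have [K1 K10 HK1] := taylor 2 (uvec c d) ler01 S0 1 1.
  have [K2 K20 HK2] := taylor 2 (N%:R * tau) ler01 S0 1 1.
  have [K3 K30 HK3] := taylor 2 (N%:R : C) ler01 S0 1 1.
  have u1 := nrm_ge0 (uvec c d); have u2 := nrm_ge0 (N%:R * tau); have u3 := nrm_ge0 (N%:R : C).
  exists (K1 + nrm a * K2 + nrm b * K3), (2 * nrm (uvec c d) + 2 * nrm (N%:R * tau) + 2 * nrm (N%:R : C) + 1).
  split; first by rewrite !addr_ge0 // mulr_ge0 ?nrm_ge0.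
  move=> s p sS lW; set w := lam p in lW *; have w0 : 0 < nrm w by lra.
  have ev (q : {poly C}) : (size q <= 2)%N -> q.[1%:C] = q`_0 + q`_1.
    move=> sq; rewrite (horner_coef_wide _ sq) big_ord_recl big_ord1 /= expr0 mulr1 expr1.
    by rewrite rmorph1 mulr1.
  have [|q1 [s1 z1 d1 e1]] := HK1 s w sS w0; first by rewrite mul1r; lra.
  have [|q2 [s2 z2 d2 e2]] := HK2 s w sS w0; first by rewrite mul1r; lra.
  have [|q3 [s3 z3 d3 e3]] := HK3 s w sS w0; first by rewrite mul1r; lra.
  have i01 : 0 <= (1 : R) <= 1 by rewrite ler01 lexx.
  have := e1 1 i01; have := e2 1 i01; have := e3 1 i01.
  rewrite !ev // z1 // z2 // z3 // d1 // d2 // d3 // !mul1r.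
  have -> : 1 - 1 - 1 - 2 - 2 * Re s = - (3 + 2 * Re s) by ring.
  set B := pw _ _ => f3 f2 f1.
  have -> : V p s = (symb 1 1 (w + uvec c d) s - (symb 1 1 w s + dsymb 1 1 (uvec c d) w s))
     - a * (symb 1 1 (w + N%:R * tau) s - (symb 1 1 w s + dsymb 1 1 (N%:R * tau) w s))
     - b * (symb 1 1 (w + N%:R) s - (symb 1 1 w s + dsymb 1 1 N%:R w s)).
    (* The derivative is linear over R in the direction, and [uvec c d] is the combination of N tau
       and N with the real coefficients a and b. So the first-order terms cancel as well. *)
    have -> : dsymb 1 1 (uvec c d) w s = a * dsymb 1 1 (N%:R * tau) w s + b * dsymb 1 1 N%:R w s.
      by rewrite /dsymb cu uE; ring.
    by rewrite /V /comb1 -/a -/b -/w; ring.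
  apply: le_trans (nrmB _ _) _; rewrite mulrDl; apply: lerD; last first.
    by rewrite nrmM -mulrA ler_wpM2l ?nrm_ge0.
  apply: le_trans (nrmB _ _) _; rewrite mulrDl; apply: lerD => //.
  by rewrite nrmM -mulrA ler_wpM2l ?nrm_ge0.
have [G HG] := lattice_hol N0 ok.
have [g [gd gS gE]] := @hecke_valueP _ t N N0 1 isT c d.
have -> : eisG 1 N c d t = G 0.
  rewrite /eisG /= gE; apply/eqP; rewrite -subr_eq0; apply/eqP.
  apply: (@identity_halfplane _ (fun s => g s - G s) (-1 / 2) 1) => [z hz|z hz|].
  - have [l1 H1] := gd z; have [_ _ [l3 H3]] := HG z ltac:(lra).
    by exists (l1 - l3); exact: cderB.
  - have [_ h _] := HG z ltac:(lra); have h1 := gS z ltac:(lra).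
    have [S0 HS0] := lattice_hol N0 (symb_ok t N 1 1 0).
    have [_ h2 _] := HS0 z ltac:(lra).
    (* The sum over the lattice itself vanishes, the symbol being odd; by translation invariance so
       do the sums shifted by N tau and N. Hence the subtracted terms do not change the Hecke
       sum. *)
    have odd : S0 z = - S0 z.
      pose phi (p : int * int) := (- p.1, - p.2).
      have phiK : cancel phi phi by move=> [x y]; rewrite /phi /= !opprK.
      apply: (hasSum_unique h2); have := hasSumN (hasSum_reindexV phiK (fun j _ => phiK j) h2).
      apply: hasSum_ext => p; rewrite !addr0.
      have -> : lam (phi p) = - lam p by rewrite /lam /phi /= !intrN; ring.
      have cN : cj (- lam p) = - cj (lam p) by exact: rmorphN.
      by rewrite /symb !expr1 cN nrmN !invrN; ring.
    have S00 : S0 z = 0.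
      have : S0 z *+ 2 = 0 by rewrite mulr2n {1}odd addNr.
      by move/eqP; rewrite mulrn_eq0 => /eqP.
    rewrite S00 in h2.
    have h3 : hasSum (fun p => symb 1 1 (lam p + N%:R * tau) z) 0.
      have := hasSum_shift (f := fun w => symb 1 1 w z) 1 0 h2; apply: hasSum_ext => p.
      by rewrite addr0 mul1r addr0.
    have h4 : hasSum (fun p => symb 1 1 (lam p + N%:R) z) 0.
      have := hasSum_shift (f := fun w => symb 1 1 w z) 0 1 h2; apply: hasSum_ext => p.
      by rewrite addr0 mul0r add0r mulr1.
    have h5 : hasSum (fun p => symb 1 1 (lam p) z) 0.
      by apply: hasSum_ext h2 => p; rewrite addr0.
    have := hasSumB (hasSumB (hasSumB h1 (hasSumZ (1 - a - b) h5)) (hasSumZ a h3)) (hasSumZ b h4).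
    by rewrite !mulr0 !subr0 => h6; rewrite (hasSum_unique h h6) subrr.
  - by rewrite /=; lra.
have [|ha h _] := HG 0; first by rewrite mulr0 addr0; lra.
have E p : V p 0 = comb1 c d (fun w => w^-1) (lam p).
  by rewrite /V /comb1 !symb_s0 // !expr1.
split; first by apply: absum_le ha => p; rewrite E.
by apply: hasSum_ext h => p; rewrite E.
Qed.

End EisensteinSums.

(** * Cotangent series *)

Section RowSums.
Variable R : realType.
Local Notation C := (Cplx R).
Local Notation Re := complex.Re.
Local Notation Im := complex.Im.
Implicit Types (z w : C) (n : int) (k : nat).

Lemma cder_unique (f : C -> C) z l m : cder setT f z l -> cder setT f z m -> l = m.
Proof.
move=> Hl Hm; apply/eqP; rewrite -subr_eq0; apply/eqP/nrm_le0 => e e0.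
have [d1 d10 H1] := Hl (e / 2) ltac:(by rewrite divr_gt0).
have [d2 d20 H2] := Hm (e / 2) ltac:(by rewrite divr_gt0).
pose x := Order.min d1 d2 / 2; have m0 : 0 < Order.min d1 d2 by rewrite lt_min d10.
have x0 : 0 < x by rewrite divr_gt0.
have [x1 x2] : x < d1 /\ x < d2.
  have : Order.min d1 d2 <= d1 by rewrite ge_min lexx.
  have : Order.min d1 d2 <= d2 by rewrite ge_min lexx orbT.
  by rewrite /x in x0 *; split; lra.
have := H1 (z + x%:C) I; have := H2 (z + x%:C) I.
rewrite addrAC subrr add0r nrm_real gtr0_norm // => /(_ x2) h2 /(_ x1) h1.
rewrite -(ler_pM2r x0) -{1}(gtr0_norm x0) -nrm_real -nrmM mulrBl.
set u := l * _ in h1 *; set v := m * _ in h2 *; set s := f _ - f _ in h1 h2.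
have -> : u - v = (s - v) - (s - u) by ring.
have := nrmB (s - v) (s - u); lra.
Qed.

(** Termwise differentiation at one point from a summable bound on the second-order remainders;
    local uniform convergence need not be discussed. *)
Lemma hasSum_der (T : eqType) (f : T -> C -> C) (l : T -> C) (F : C -> C) z L (B : T -> R) (d : R) :
  0 < d -> (forall i, 0 <= B i) -> absum B ->
  (forall i h, nrm h < d -> nrm (f i (z + h) - f i z - l i * h) <= B i * nrm h ^+ 2) ->
  (forall y, nrm (y - z) < d -> hasSum (f^~ y) (F y)) -> hasSum l L -> cder setT F z L.
Proof.
move=> d0 B0 [M HM] Hf HF HL e e0.
have M0 : 0 <= M by have := HM [::] isT; rewrite big_nil.
exists (Order.min d (e / (M + 1))); first by rewrite lt_min d0 divr_gt0 // ltr_wpDl.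
move=> y _; rewrite lt_min => /andP[yd ye].
have zz : nrm (z - z) < d by rewrite subrr nrm0.
have S := hasSumB (hasSumB (HF y yd) (HF z zz)) (hasSumZ (y - z) HL).
rewrite [l in _ - l](_ : _ = (y - z) * L); last by rewrite mulrC.
have := @hasSum_bound _ _ _ _ (M * nrm (y - z) ^+ 2) S.
move=> /(_ _) H; apply: le_trans (H _) _.
  move=> A uA; apply: le_trans (_ : \sum_(i <- A) B i * nrm (y - z) ^+ 2 <= _).
    apply: ler_sum => i _; have := Hf i (y - z) yd.
    by rewrite [z + _]addrC subrK [_ * l i]mulrC.
  by rewrite -mulr_suml ler_wpM2r ?exprn_ge0 ?nrm_ge0 ?HM.
rewrite expr2 mulrA ler_wpM2r ?nrm_ge0 //.
move: ye; rewrite ltr_pdivlMr ?ltr_wpDl //; have := nrm_ge0 (y - z); clear - M0; nra.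
Qed.

Definition nz (n : int) : R := `|n|%N.+1%:R.

Lemma nz_gt0 n : 0 < nz n. Proof. exact: ltr0Sn. Qed.
Lemma nz_ge1 n : 1 <= nz n. Proof. by rewrite ler1n. Qed.

Lemma nzE n : nz n = `|n|%:~R + 1.
Proof. by rewrite /nz -natr1 natr_absz. Qed.

Lemma nz_absum : absum (fun n => (nz n)^-1 ^+ 2).
Proof.
have h := absum_int (fun n : nat => expR_ge0 _) (@absum_power R 2 ltac:(lra)).
apply: absum_le h => n; rewrite mulNr expRN exprVn.
by rewrite expRM_natl lnK ?posrE ?ltr0Sn.
Qed.

Definition big_list (x : R) : seq int :=
  let M := Num.bound x in [seq i%:Z - M%:Z | i <- iota 0 M.*2.+1].

Lemma big_listP (x : R) n : n \notin big_list x -> 0 <= x -> x <= `|n|%:~R.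
Proof.
rewrite /big_list; set M := Num.bound x => nM x0.
have HM : x < M%:R by rewrite archi_boundP.
have : (M < `|n|)%N.
  rewrite ltnNge; apply: contra nM => le; apply/mapP; exists (absz (n + M%:Z)); last by lia.
  by rewrite mem_iota; lia.
move=> h; apply: le_trans (ltW HM) _; rewrite -natr_absz ler_nat; exact: ltnW.
Qed.

Lemma row_far z n : 2 * nrm z + 1 <= `|n|%:~R -> nz n / 4 <= nrm (z + n%:~R).
Proof.
move=> h; have := nrmB_ge (n%:~R : C) (- z); rewrite opprK nrmN [n%:~R + z]addrC nrm_int nzE.
have := nrm_ge0 z; lra.
Qed.

Lemma row_lower z : (forall n, z != n%:~R) ->
  exists2 kap : R, 0 < kap & forall n, kap * nz n <= nrm (z + n%:~R).
Proof.
move=> zn; have x0 : 0 <= 2 * nrm z + 1 by have := nrm_ge0 z; lra.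
have [kap kap0 Hk] : exists2 kap : R, 0 < kap & forall n, n \in big_list (2 * nrm z + 1) -> kap * nz n <= nrm (z + n%:~R).
  elim: (big_list _) => [|m A [kap kap0 ih]]; first by exists 1.
  have m0 : 0 < nrm (z + m%:~R) / nz m.
    rewrite divr_gt0 ?nz_gt0 // nrm_gt0; apply: contra (zn (- m)) => /eqP h.
    by rewrite intrN -subr_eq0 opprK h.
  exists (Order.min kap (nrm (z + m%:~R) / nz m)); first by rewrite lt_min kap0 m0.
  move=> n; rewrite inE => /predU1P[->|/ih h].
    by rewrite -ler_pdivlMr ?nz_gt0 // ge_min lexx orbT.
  by apply: le_trans h; rewrite ler_wpM2r ?(ltW (nz_gt0 _)) // ge_min lexx.
exists (Order.min kap (1 / 4)); first by rewrite lt_min kap0 divr_gt0.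
move=> n; have [nA|nA] := boolP (n \in big_list (2 * nrm z + 1)).
  by apply: le_trans (Hk n nA); rewrite ler_wpM2r ?(ltW (nz_gt0 _)) // ge_min lexx.
apply: le_trans (row_far (big_listP nA x0)); rewrite mulrC ler_wpM2l ?(ltW (nz_gt0 _)) //.
by rewrite ge_min div1r lexx orbT.
Qed.

(* Weight one rows converge only after subtracting 1/n; recall 1/0 = 0. *)
Definition rowterm k z n : C := (z + n%:~R)^-1 ^+ k - (if k == 1%N then (n%:~R)^-1 else 0).

Lemma rowterm_abs k z : (0 < k)%N -> absum (fun n => nrm (rowterm k z n)).
Proof.
move=> k0; have x0 : 0 <= 2 * nrm z + 1 by have := nrm_ge0 z; lra.
apply: (@absum_cofin _ _ _ (fun n => (4 ^+ k + nrm z * 8) * (nz n)^-1 ^+ 2) (big_list (2 * nrm z + 1))).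
- by move=> n; rewrite mulr_ge0 ?exprn_ge0 ?invr_ge0 ?(ltW (nz_gt0 _)) // addr_ge0 // mulr_ge0 // nrm_ge0.
- move=> n nA; have := big_listP nA x0 => nb; have far := row_far nb.
  have n1 : 1 <= `|n|%:~R :> R by have := nrm_ge0 z; lra.
  have z0 : 0 < nrm (z + n%:~R) by apply: lt_le_trans far; rewrite divr_gt0 ?nz_gt0.
  have inv : (nrm (z + n%:~R))^-1 <= 4 * (nz n)^-1.
    have -> : 4 * (nz n)^-1 = (nz n / 4)^-1 by rewrite invf_div.
    by rewrite lef_pV2 ?posrE // divr_gt0 ?nz_gt0.
  have nzi : 0 <= (nz n)^-1 by rewrite invr_ge0 ltW ?nz_gt0.
  have nz1 : (nz n)^-1 <= 1 by rewrite invf_le1 ?nz_ge1 ?nz_gt0.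
  rewrite mulrDl; case: (ltngtP k 1) k0 => // [k1 _|-> _]; last first.
    rewrite /rowterm eqxx expr1.
    have nn0 : (n%:~R : C) != 0.
      by rewrite -nrm_gt0 nrm_int; exact: lt_le_trans n1.
    have -> : (z + n%:~R)^-1 - n%:~R^-1 = - z * ((z + n%:~R)^-1 * n%:~R^-1).
      by field; rewrite nn0 -nrm_gt0 z0.
    rewrite nrmM nrmN nrmM !nrmV.
    have inv2 : (nrm (n%:~R : C))^-1 <= 2 * (nz n)^-1.
      have -> : 2 * (nz n)^-1 = (nz n / 2)^-1 by rewrite invf_div.
      rewrite lef_pV2 ?posrE ?divr_gt0 ?nz_gt0 ?nrm_int ?nzE //; first by lra.
      exact: lt_le_trans n1.
    apply: le_trans (_ : nrm z * (4 * (nz n)^-1 * (2 * (nz n)^-1)) <= _).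
      by rewrite ler_wpM2l ?nrm_ge0 // ler_pM // invr_ge0 ?nrm_ge0 // ltW.
    have -> : nrm z * (4 * (nz n)^-1 * (2 * (nz n)^-1)) = nrm z * 8 * (nz n)^-1 ^+ 2 by ring.
    by rewrite lerDr mulr_ge0 ?exprn_ge0.
  rewrite /rowterm (gtn_eqF k1) subr0 nrmX nrmV.
  apply: (@le_trans _ _ (4 ^+ k * (nz n)^-1 ^+ 2)); last first.
    by rewrite lerDl !mulr_ge0 ?nrm_ge0 ?exprn_ge0.
  apply: (@le_trans _ _ ((4 * (nz n)^-1) ^+ k)).
    by rewrite lerXn2r ?nnegrE ?invr_ge0 ?nrm_ge0 ?mulr_ge0.
  rewrite exprMn ler_wpM2l ?exprn_ge0 //.
  by rewrite -(subnK k1) exprD ler_piMl ?exprn_ge0 ?exprn_ile1.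
- apply: absumZ nz_absum; by rewrite addr_ge0 ?exprn_ge0 // mulr_ge0 // nrm_ge0.
Qed.

Definition row k z : C := locked (xget 0 [set l | hasSum (rowterm k z) l]).

Lemma rowP k z : (0 < k)%N -> hasSum (rowterm k z) (row k z).
Proof.
move=> k0; have [l Hl] := absum_hasSum (rowterm_abs z k0).
by rewrite /row -lock; apply: (@xgetPex _ 0 [set l | hasSum (rowterm k z) l]); exists l.
Qed.

Lemma rowE k z l : (0 < k)%N -> hasSum (rowterm k z) l -> row k z = l.
Proof. by move=> k0; apply: hasSum_unique (rowP _ k0). Qed.

(** Symmetric partial sums collapse to two boundary terms, which tend to 0. This gives the
    periodicity of [row 1]: the corrections 1/n cancel in the difference. *)
Lemma telescope z l : hasSum (fun n => (z + 1 + n%:~R)^-1 - (z + n%:~R)^-1) l -> l = 0.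
Proof.
move=> H; pose E M := [seq i%:Z - M%:Z | i <- iota 0 M.*2.+1].
have uE M : uniq (E M) by rewrite map_inj_uniq ?iota_uniq // => x y; lia.
have cE n : exists m0 : nat, forall M, (m0 <= M)%N -> n \in E M.
  exists `|n|%N => M le; apply/mapP; exists (absz (n + M%:Z)); last by lia.
  by rewrite mem_iota; lia.
have sE M : \sum_(n <- E M) ((z + 1 + n%:~R)^-1 - (z + n%:~R)^-1) =
   (z + (M.+1%:Z)%:~R)^-1 - (z + (- M%:Z)%:~R)^-1.
  rewrite /E big_map -[iota 0 _]/(index_iota 0 M.*2.+1).
  rewrite (eq_bigr (fun i : nat => (z + (i.+1%:Z - M%:Z)%:~R)^-1 - (z + (i%:Z - M%:Z)%:~R)^-1)) => [|i _].
    rewrite telescope_sumr // sub0r; congr (_^-1 - _); congr (_ + _%:~R); lia.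
  congr (_^-1 - _); rewrite -addrA; congr (_ + _).
  by rewrite !intrB -!pmulrn -natr1; ring.
apply: (scvg_uniq (hasSum_exhaust uE cE H)) => e e0.
exists (Num.bound (nrm z + 2 / e)) => M le; rewrite subr0 sE.
have b0 : nrm z + 2 / e < M%:R.
  apply: lt_le_trans (_ : (Num.bound (nrm z + 2 / e))%:R <= _); last by rewrite ler_nat.
  by rewrite archi_boundP // addr_ge0 ?nrm_ge0 // divr_ge0 // ltW.
have e2 : 0 < 2 / e by rewrite divr_gt0.
have bd n : M%:R <= `|n|%:~R :> R -> nrm ((z + n%:~R)^-1) < e / 2.
  move=> h; have h2 : 2 / e < nrm (z + n%:~R).
    by have := nrmB_ge (n%:~R : C) (- z); rewrite opprK nrmN [n%:~R + z]addrC nrm_int; lra.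
  rewrite nrmV -[e / 2]invrK invf_div ltf_pV2 ?posrE //; exact: lt_trans h2.
have := bd M.+1%:Z; have := bd (- M%:Z); rewrite -!natr_absz !ler_nat => h1 h2.
have i1 := h1 ltac:(lia); have i2 := h2 ltac:(lia).
apply: le_lt_trans (nrmB _ _) _; lra.
Qed.

Lemma rowD1 k z : (0 < k)%N -> row k (z + 1) = row k z.
Proof.
move=> k0; have [k1|k1] := ltnP 1 k; last first.
  have kE : k = 1%N by apply/eqP; rewrite eqn_leq k1 k0.
  rewrite kE in k0 *; apply/eqP; rewrite -subr_eq0; apply/eqP; apply: (@telescope z).
  apply: hasSum_ext (hasSumB (rowP (z + 1) k0) (rowP z k0)) => n.
  by rewrite /rowterm eqxx !expr1; ring.
apply: (rowE k0); pose phi n := n + 1; pose psi n := n - 1.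
have phiK : cancel phi psi by move=> x; rewrite /phi /psi addrK.
have psiK : cancel psi phi by move=> x; rewrite /phi /psi subrK.
have := hasSum_reindexV phiK (fun j _ => psiK j) (rowP z k0); apply: hasSum_ext => n.
by rewrite /rowterm (gtn_eqF k1) /phi intrD -addrA [1 + _]addrC.
Qed.

Lemma rowDn k z n : (0 < k)%N -> row k (z + n%:~R) = row k z.
Proof.
move=> k0; have nat_case m y : row k (y + m%:R) = row k y.
  elim: m => [|m ih]; first by rewrite addr0.
  by rewrite -natr1 addrA (rowD1 _ k0); exact: ih.
case: n => m; first by rewrite -pmulrn nat_case.
by rewrite NegzE -[in RHS](subrK (m.+1%:R) z) nat_case intrN -pmulrn.
Qed.

Lemma rowN k z : (0 < k)%N -> row k (- z) = (-1) ^+ k * row k z.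
Proof.
move=> k0; apply: (rowE k0); pose phi n : int := - n.
have phiK : cancel phi phi by move=> x; rewrite /phi opprK.
have := hasSumZ ((-1) ^+ k) (hasSum_reindexV phiK (fun j _ => phiK j) (rowP z k0)).
apply: hasSum_ext => n; rewrite /rowterm /phi intrN.
have -> : - z + n%:~R = - (z - n%:~R) by ring.
rewrite [(- (z - _))^-1]invrN [X in _ = X - _]exprNn mulrBr; congr (_ - _).
by case: eqP => [->|_]; rewrite ?mulr0 // expr1 invrN mulN1r opprK.
Qed.

End RowSums.

(** * Partial fractions of the cotangent *)

Section Cotangent.
Variable R : realType.
Local Notation C := (Cplx R).
Local Notation Re := complex.Re.
Local Notation Im := complex.Im.
Implicit Types (z w : C) (n : int) (k : nat).

Definition tpi : C := 2 * (pi : R)%:C * 'i.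
Definition ee z : C := cexp (tpi * z).

Lemma Re_tpi z : Re (tpi * z) = - (2 * pi * Im z).
Proof. by rewrite /tpi !ReImE /=; ring. Qed.
Lemma Im_tpi z : Im (tpi * z) = 2 * pi * Re z.
Proof. by rewrite /tpi !ReImE /=; ring. Qed.

Lemma tpi_neq0 : tpi != 0.
Proof.
rewrite /tpi !mulf_neq0 //; first by rewrite -nrm_gt0 nrm_real normr_gt0 gt_eqF ?pi_gt0.
by rewrite -nrm_gt0 nrm_i.
Qed.

Lemma eeD z w : ee (z + w) = ee z * ee w.
Proof. by rewrite /ee mulrDr cexpD. Qed.
Lemma eeN z : ee (- z) = (ee z)^-1. Proof. by rewrite /ee mulrN cexpN. Qed.
Lemma ee_neq0 z : ee z != 0. Proof. exact: cexp_neq0. Qed.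
Lemma nrm_ee z : nrm (ee z) = expR (- (2 * pi * Im z)).
Proof. by rewrite /ee nrm_cexp Re_tpi. Qed.

Lemma ee_half : ee (1 / 2) = -1.
Proof.
rewrite /ee /cexp Re_tpi Im_tpi.
have [-> ->] : Re (1 / 2 : C) = 1 / 2 /\ Im (1 / 2 : C) = 0.
  have -> : (1 / 2 : C) = (1 / 2 : R)%:C by rewrite rmorphM fmorphV rmorph_nat rmorph1.
  by [].
rewrite mulr0 oppr0 expR0 (_ : 2 * pi * (1 / 2) = pi); last by field.
by rewrite cospi sinpi; apply: cplxP; rewrite !ReImE /=; ring.
Qed.

Lemma ee1 : ee 1 = 1.
Proof.
by rewrite [X in ee X](_ : 1 = 1 / 2 + 1 / 2) ?eeD ?ee_half ?mulrNN ?mulr1 //; field.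
Qed.

Lemma ee_nat (m : nat) z : ee (m%:R * z) = ee z ^+ m.
Proof. by rewrite /ee mulrCA mulr_natl cexpMn. Qed.

Lemma ee_int n : ee n%:~R = 1.
Proof.
have nat_case m : ee m%:R = 1 by rewrite -[m%:R]mulr1 ee_nat ee1 expr1n.
case: n => m; first by rewrite -pmulrn nat_case.
by rewrite NegzE intrN -pmulrn eeN nat_case invr1.
Qed.

Lemma eeDn z n : ee (z + n%:~R) = ee z.
Proof. by rewrite eeD ee_int mulr1. Qed.

Definition nonint z := forall n, z != n%:~R.

Lemma nonint_shift z n : nonint z -> nonint (z + n%:~R).
Proof.
by move=> H m; rewrite -subr_eq0 -addrA -intrB -[_%:~R]opprK subr_eq0 -intrN; exact: H.
Qed.

(** The modulus forces z to be real. Its fractional part x would satisfy cos (2 pi x) = 1, whereas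
    sin (pi x) > 0 for 0 < x < 1. *)
Lemma ee_eq1 z : nonint z -> ee z != 1.
Proof.
move=> zn; apply/eqP => E.
have Iz : Im z = 0.
  have := congr1 (@nrm R) E; rewrite nrm_ee nrm1 -[RHS]expR0 => /expR_inj /eqP.
  by rewrite oppr_eq0 !mulf_eq0 pnatr_eq0 (gt_eqF (pi_gt0 R)) /= => /eqP.
pose m := Num.floor (Re z); pose x := Re z - m%:~R.
have x0 : 0 <= x by rewrite subr_ge0 floor_le_tmp.
have x1 : x < 1 by rewrite ltrBlDl -intrD1 floorD1_gt.
have E2 : ee x%:C = 1.
  have <- : z + (- m)%:~R = x%:C by apply: cplxP; rewrite !ReImE intrN !ReImE ?Re_int ?Im_int /= ?Iz ?oppr0 ?addr0.
  by rewrite eeDn.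
have x00 : 0 < x.
  rewrite lt0r x0 andbT; apply: contra (zn m) => /eqP xx; apply/eqP.
  apply: cplxP; rewrite ?Re_int ?Im_int //; move: xx; rewrite /x => /eqP.
  by rewrite subr_eq0 => /eqP.
have s0 : 0 < sin (pi * x).
  apply: sin_gt0_pi; rewrite mulr_gt0 ?pi_gt0 //=.
  by rewrite -[X in _ < X]mulr1 ltr_pM2l ?pi_gt0.
move: (congr1 (@complex.Re R) E2); rewrite /ee /cexp Re_tpi Im_tpi /= mulr0 oppr0 expR0 mul1r mul0r subr0.
have -> : 2 * pi * x = pi * x + pi * x by ring.
rewrite cosD => c1; have := cos2Dsin2 (pi * x).
have : 0 < sin (pi * x) ^+ 2 by rewrite exprn_gt0.
by move: c1; rewrite !expr2; lra.
Qed.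

(** Normalized so that 2 pi i times it is pi cot (pi z), and so that it is a rational function over
    Q of [ee z]. *)
Definition cotf z : C := (ee z + 1) / (2 * (ee z - 1)).

Lemma ee_der z : cder setT ee z (tpi * ee z).
Proof.
apply: cder_eq (cder_exp (cderZ tpi (cder_id setT z))) _.
by rewrite mulr1 mulrC.
Qed.

Lemma cotf_der z : nonint z -> cder setT cotf z (- tpi * (cotf z ^+ 2 - 1 / 4)).
Proof.
move=> /ee_eq1 e1; have e0 : ee z - 1 != 0 by rewrite subr_eq0.
have e2 : 2 * (ee z - 1) != 0 by rewrite mulf_neq0 // pnatr_eq0.
have D1 := cderD (ee_der z) (cder_cst setT 1 z).
have D2 := cderZ 2 (cderB (ee_der z) (cder_cst setT 1 z)).
have D3 := @cderV _ setT (fun y => 2 * (ee y - 1)) z _ e2 D2.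
by apply: cder_eq (cderM D1 D3) _; rewrite /cotf; field.
Qed.

Lemma nonint_nbhd z : nonint z -> exists2 d : R, 0 < d & forall y, nrm (y - z) < d -> nonint y.
Proof.
move=> zn; have [kap k0 Hk] := row_lower zn; exists kap => // y yz n; apply/eqP => yE.
have := Hk (- n); rewrite intrN -yE nrmC.
have : kap * 1 <= kap * nz R (- n) by rewrite ler_wpM2l ?nz_ge1 // ltW.
rewrite nrmC; move: yz; rewrite nrmC; lra.
Qed.

(** For |h| < kap/2 the points z + s h + n on the segment stay at distance at least (kap/2)(|n| + 1)
    from 0, so the second derivatives are bounded by a multiple of (|n| + 1)^-2. In weight one the
    subtracted 1/n is constant in z. *)
Lemma row_der k z : (0 < k)%N -> nonint z -> cder setT (row k) z (- k%:R * row k.+1 z).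
Proof.
move=> k0 zn; have [kap kap0 Hk] := row_lower zn.
pose c := k%:R * k.+1%:R * (2 / kap) ^+ k.+2.
have c0 : 0 <= c.
  by rewrite /c; apply: mulr_ge0; [rewrite mulr_ge0 ?ler0n | rewrite exprn_ge0 // divr_ge0 // ltW].
apply: (@hasSum_der _ _ (fun n y => rowterm k y n) (fun n => - k%:R * rowterm k.+1 z n) _ _ _
  (fun n => c * (nz R n)^-1 ^+ 2) (kap / 2)).
- by rewrite divr_gt0.
- by move=> n; rewrite mulr_ge0 ?exprn_ge0 ?invr_ge0 ?(ltW (nz_gt0 _ _)).
- exact: absumZ (nz_absum R).
- move=> n h hk.
  have far (s : R) : 0 <= s <= 1 -> kap / 2 * nz R n <= nrm (z + s%:C * h + n%:~R).
    move=> /andP[s0 s1]; have -> : z + s%:C * h + n%:~R = (z + n%:~R) - (- (s%:C * h)) by ring.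
    have := nrmB_ge (z + n%:~R) (- (s%:C * h)); rewrite nrmN nrmM nrm_real ger0_norm // => h1.
    have h2 : s * nrm h <= nrm h by rewrite ler_piMl ?nrm_ge0.
    have h3 : kap * 1 <= kap * nz R n by rewrite ler_wpM2l ?nz_ge1 // ltW.
    have := Hk n; lra.
  have fp : 0 < kap / 2 * nz R n by rewrite mulr_gt0 ?nz_gt0 // divr_gt0.
  have fn (s : R) : 0 <= s <= 1 -> z + s%:C * h + n%:~R != 0.
    by move=> /far hs; rewrite -nrm_gt0; exact: lt_le_trans fp hs.
  have D (j : nat) (y : C) : y + n%:~R != 0 -> cder setT (fun y => (y + n%:~R)^-1 ^+ j) y (- j%:R * (y + n%:~R)^-1 ^+ j.+1).
    move=> y0; have D0 := cderD (cder_id setT y) (cder_cst setT n%:~R y).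
    apply: cder_eq (@cderXV _ setT (fun y => y + n%:~R) y _ j y0 D0) _.
    by rewrite addr0 mulr1 exprS; ring.
  have := @cmvi2 _ (fun y => (y + n%:~R)^-1 ^+ k) (fun y => - k%:R * (y + n%:~R)^-1 ^+ k.+1)
    (fun y => - k%:R * (- k.+1%:R * (y + n%:~R)^-1 ^+ k.+2)) z h (c * (nz R n)^-1 ^+ 2).
  have kE : (k.+1 == 1)%N = false by rewrite eqSS (gtn_eqF k0).
  rewrite /rowterm kE subr0 => H.
  set e := if _ then _ else _.
  have -> : (z + h + n%:~R)^-1 ^+ k - e - ((z + n%:~R)^-1 ^+ k - e) = (z + h + n%:~R)^-1 ^+ k - (z + n%:~R)^-1 ^+ k by ring.
  apply: H => s hs.
  + exact: D (fn s hs).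
  + exact: cderZ (D _ _ (fn s hs)).
  + rewrite (nrmM (- k%:R)) (nrmM (- k.+1%:R)) !nrmN !nrm_nat nrmX nrmV.
    have -> : c * (nz R n)^-1 ^+ 2 = k%:R * (k.+1%:R * ((2 / kap) ^+ k.+2 * (nz R n)^-1 ^+ 2)).
      by rewrite /c; move: (_ ^+ k.+2) => Z; ring.
    rewrite !ler_wpM2l ?ler0n //.
    apply: (@le_trans _ _ (((kap / 2 * nz R n)^-1) ^+ k.+2)).
      rewrite lerXn2r ?nnegrE ?invr_ge0 ?nrm_ge0 ?(ltW fp) // lef_pV2 ?posrE ?far //.
      exact: lt_le_trans fp (far s hs).
    rewrite invfM invf_div exprMn ler_wpM2l ?exprn_ge0 ?divr_ge0 ?(ltW kap0) //.
    have nzi : 0 <= (nz R n)^-1 by rewrite invr_ge0 ltW ?nz_gt0.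
    rewrite -[k.+2]addn2 exprD ler_piMl ?exprn_ge0 // exprn_ile1 // invf_le1 ?nz_ge1 ?nz_gt0 //.
- by move=> y _; exact: rowP.
- exact: (hasSumZ (- k%:R) (rowP z (isT : (0 < k.+1)%N))).
Qed.

Lemma hasSum_evenodd (f : int -> C) l : hasSum f l ->
  hasSum (fun n => f (2 * n) + f (2 * n + 1)) l.
Proof.
move=> H; have := @hasSum_fiber _ _ _ f (fun m => (m %/ 2)%Z) (fun n => [:: 2 * n; 2 * n + 1]) l.
move=> /(_ _ _ H) K; have := K _ _; move=> {}K; apply: hasSum_ext (K _ _).
- by move=> n; rewrite !big_cons big_nil addr0.
- by move=> n /=; rewrite inE andbT; lia.
- by move=> i j; rewrite !inE; apply/idP/idP; lia.
Qed.

Lemma row1_half : row 1 (1 / 2 : C) = 0.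
Proof.
have h1 : row 1 (- (1 / 2) : C) = - row 1 (1 / 2) by rewrite rowN // expr1 mulN1r.
have h2 : row 1 (- (1 / 2) + 1 : C) = row 1 (- (1 / 2)) by rewrite rowD1.
have e : - (1 / 2) + 1 = 1 / 2 :> C by field.
rewrite e h1 in h2; have : row 1 (1 / 2 : C) *+ 2 = 0 by rewrite mulr2n {1}h2 addNr.
by move/eqP; rewrite mulrn_eq0 => /eqP.
Qed.

Lemma two_neq0 : (2 : C) != 0. Proof. by rewrite pnatr_eq0. Qed.

(** Splitting into even and odd n, the corrections 1/n do not quite match: the discrepancy is the
    series of [row 1 (1 / 2)], which vanishes by oddness and periodicity. *)
Lemma row1_double z : row 1 (z / 2) + row 1 ((z + 1) / 2) = 2 * row 1 z.
Proof.
have H := hasSum_evenodd (rowP z (isT : (0 < 1)%N)).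
have P (y : C) : hasSum (rowterm 1 y) (row 1 y) by exact: rowP.
have H2 := hasSumB (hasSumD (P (z / 2)) (P ((z + 1) / 2))) (hasSumZ 2 H).
apply/eqP; rewrite -subr_eq0 -row1_half; apply/eqP/(hasSum_unique H2).
apply: hasSum_ext (P (1 / 2)) => n; rewrite /rowterm /= !expr1.
have -> : z / 2 + n%:~R = (z + (2 * n)%:~R) / 2 by rewrite intrM; field.
have -> : (z + 1) / 2 + n%:~R = (z + (2 * n + 1)%:~R) / 2 by rewrite intrD intrM; field.
have -> : 1 / 2 + n%:~R = (2 * n + 1)%:~R / 2 :> C by rewrite intrD intrM; field.
have -> : (2 * n)%:~R^-1 = n%:~R^-1 / 2 :> C by rewrite intrM invfM mulrC.
rewrite !invfM !invrK.
move: (z + (2 * n)%:~R)^-1 (z + (2 * n + 1)%:~R)^-1 (2 * n + 1)%:~R^-1 n%:~R^-1 => A B D E.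
by field.
Qed.

Lemma cotf_double z : nonint z -> cotf (z / 2) + cotf ((z + 1) / 2) = 2 * cotf z.
Proof.
move=> zn; have zE : ee z = ee (z / 2) ^+ 2 by rewrite expr2 -eeD; congr ee; field.
have eh : ee ((z + 1) / 2) = - ee (z / 2).
  by rewrite mulrDl eeD ee_half mulrN1.
have := ee_eq1 zn; rewrite /cotf eh zE; set Y := ee (z / 2) => Y1.
have n1 : Y - 1 != 0 by apply: contra Y1; rewrite subr_eq0 => /eqP ->; rewrite expr1n.
have n2 : - Y - 1 != 0.
  apply: contra Y1; rewrite subr_eq0 => /eqP E; by rewrite -[Y]opprK E sqrrN expr1n.
have n3 : Y ^+ 2 - 1 != 0 by rewrite subr_eq0.
by field; rewrite n1 n2 n3.
Qed.

Lemma row1_near : exists2 K : R, 0 <= K & forall z, z != 0 -> nrm z < 1 / 2 ->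
  nrm (row 1 z - z^-1) <= K * nrm z.
Proof.
have [M HM] := nz_absum R; have M0 : 0 <= M by have := HM [::] isT; rewrite big_nil.
exists (8 * M) => [|z z0 zh]; first by rewrite mulr_ge0.
have P : hasSum (rowterm 1 z) (row 1 z) by exact: rowP.
pose g n := if n == 0 then z^-1 else 0.
have G : hasSum g z^-1.
  have -> : z^-1 = \sum_(n <- [:: 0 : int]) g n by rewrite big_seq1 /g eqxx.
  by apply: hasSum_fin => // n; rewrite inE /g => /negPf ->.
have := @hasSum_bound _ _ _ _ (8 * M * nrm z) (hasSumB P G); apply=> B uB.
apply: (@le_trans _ _ (\sum_(n <- B) (8 * nrm z * (nz R n)^-1 ^+ 2))); last first.
  have -> : 8 * M * nrm z = 8 * nrm z * M by ring.
  by rewrite -mulr_sumr ler_wpM2l ?HM ?mulr_ge0 ?nrm_ge0.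
apply: ler_sum => n _; rewrite /rowterm /g /= expr1; have [->|n0] := eqVneq n 0.
  by rewrite addr0 invr0 subr0 subrr nrm0 !mulr_ge0 ?nrm_ge0 ?exprn_ge0 ?invr_ge0 ?(ltW (nz_gt0 _ _)).
have n1 : 1 <= `|n|%:~R :> R by rewrite (_ : 1 = 1%:~R) // ler_int; lia.
have nn0 : (n%:~R : C) != 0 by rewrite intr_eq0.
have zn : nz R n / 4 <= nrm (z + n%:~R).
  by have := nrmB_ge (n%:~R : C) (- z); rewrite opprK nrmN [n%:~R + z]addrC nrm_int nzE; lra.
have z4 : 0 < nz R n / 4 by rewrite divr_gt0 ?nz_gt0.
have zn0 : z + n%:~R != 0 by rewrite -nrm_gt0; exact: lt_le_trans z4 zn.
rewrite subr0; have -> : (z + n%:~R)^-1 - n%:~R^-1 = - z * ((z + n%:~R)^-1 * n%:~R^-1).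
  by field; rewrite nn0 zn0.
rewrite nrmM nrmN nrmM !nrmV.
have -> : 8 * nrm z * (nz R n)^-1 ^+ 2 = nrm z * ((nz R n / 4)^-1 * (nz R n / 2)^-1).
  by field; rewrite gt_eqF ?nz_gt0.
rewrite ler_wpM2l ?nrm_ge0 // ler_pM ?invr_ge0 ?nrm_ge0 //.
  by rewrite lef_pV2 ?posrE //; exact: lt_le_trans z4 zn.
rewrite lef_pV2 ?posrE ?divr_gt0 ?nz_gt0 ?nrm_gt0 // nrm_int nzE; lra.
Qed.

(** With u = 2 pi i z this is the numerator of 2 pi i cotf z - 1/z. Its value and first derivative
    at 0 vanish, and its second derivative u exp(u) / 2 is again of order u, which yields the
    cube. *)
Lemma cexp_cubic (u : C) : nrm u <= 1 ->
  nrm (u / 2 * (cexp u + 1) - (cexp u - 1)) <= expR 1 * nrm u ^+ 3.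
Proof.
move=> u1; pose N (y : C) : C := y / 2 * (cexp y + 1) - (cexp y - 1).
pose N1 (y : C) : C := y / 2 * cexp y - cexp y / 2 + 1 / 2.
pose N2 (y : C) : C := y / 2 * cexp y.
have Dh y : cder setT (fun y : C => y / 2) y (1 / 2).
  by apply: cder_eq (cderM (cder_id _ _) (cder_cst _ _ _)) _; rewrite mulr0 addr0.
have D1 y : cder setT N y (N1 y).
  apply: cder_eq (cderB (cderM (Dh y) (cderD (cder_cexp y) (cder_cst _ 1 _))) (cderB (cder_cexp y) (cder_cst _ 1 _))) _.
  by rewrite /N1; field.
have D2 y : cder setT N1 y (N2 y).
  apply: cder_eq (cderD (cderB (cderM (Dh y) (cder_cexp y)) (cderM (cder_cexp y) (cder_cst _ _ _))) (cder_cst _ _ _)) _.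
  by rewrite /N2; field.
have := @cmvi2 _ N N1 N2 0 u (expR 1 * nrm u) (fun s _ => D1 _) (fun s _ => D2 _).
have -> : N (0 + u) - N 0 - N1 0 * u = u / 2 * (cexp u + 1) - (cexp u - 1).
  by rewrite add0r /N /N1 cexp0; field.
have -> : expR 1 * nrm u * nrm u ^+ 2 = expR 1 * nrm u ^+ 3 by ring.
apply=> s /andP[s0 s1]; rewrite add0r /N2 nrmM nrmM nrmV nrm_nat nrmM nrm_real ger0_norm // nrm_cexp.
rewrite mulrC; apply: ler_pM; rewrite ?expR_ge0 ?mulr_ge0 ?nrm_ge0 //.
  rewrite ler_expR; apply: le_trans (ler_norm _) (le_trans (nrm_Re _) _).
  rewrite nrmM nrm_real ger0_norm //; have := nrm_ge0 u; nra.
have h : s * nrm u <= nrm u by rewrite ler_piMl ?nrm_ge0.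
have h0 : 0 <= s * nrm u by rewrite mulr_ge0 ?nrm_ge0.
lra.
Qed.

Lemma cotf_near : exists K d : R, [/\ 0 <= K, 0 < d & forall z, z != 0 -> nrm z < d ->
  nrm (tpi * cotf z - z^-1) <= K * nrm z].
Proof.
have [d1 d10 H1] := @cder_cexp0 R (1 / 2) ltac:(lra).
have T0 : 0 < nrm tpi by rewrite nrm_gt0 tpi_neq0.
exists (2 * expR 1 * nrm tpi ^+ 2), (Order.min 1 d1 / nrm tpi).
have m0 : 0 < Order.min 1 d1 by rewrite lt_min ltr01.
split; [by rewrite !mulr_ge0 ?expR_ge0 ?exprn_ge0 ?nrm_ge0| by rewrite divr_gt0|].
move=> z z0; rewrite ltr_pdivlMr // lt_min => /andP[z1 z2].
pose u := tpi * z; have nu : nrm u = nrm z * nrm tpi by rewrite nrmM mulrC.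
have u0 : u != 0 by rewrite mulf_neq0 ?tpi_neq0.
have up : 0 < nrm u by rewrite nrm_gt0.
have X1 : nrm u / 2 <= nrm (cexp u - 1).
  have := H1 u I; rewrite subr0 cexp0 mul1r nu => /(_ z2) h.
  have := nrmB_ge u (- (cexp u - 1 - u)); rewrite nrmN opprK.
  have -> : u + (cexp u - 1 - u) = cexp u - 1 by ring.
  rewrite nu; lra.
have Xn : cexp u - 1 != 0 by rewrite -nrm_gt0; apply: lt_le_trans X1; rewrite divr_gt0.
have -> : tpi * cotf z - z^-1 = (u / 2 * (cexp u + 1) - (cexp u - 1)) / (z * (cexp u - 1)).
  by rewrite /cotf /ee -/u /u; field; rewrite z0 -/u Xn.
rewrite nrmM nrmV nrmM ler_pdivrMr ?mulr_gt0 ?nrm_gt0 //.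
have u1 : nrm u <= 1 by rewrite nu ltW.
apply: le_trans (cexp_cubic u1) _.
have -> : 2 * expR 1 * nrm tpi ^+ 2 * nrm z * (nrm z * nrm (cexp u - 1)) =
  expR 1 * (nrm u ^+ 2 * (2 * nrm (cexp u - 1))) by rewrite nu; ring.
rewrite ler_wpM2l ?expR_ge0 // exprSr ler_wpM2l ?exprn_ge0 ?nrm_ge0 //; lra.
Qed.

(* Herglotz' trick: h(z/2) + h((z+1)/2) = 2 h(z) and h(z) -> 0 as z -> 0, so the
   maximum of |h| on a square is 0. *)
Definition hdiff z : C := if `[< nonint z >] then row 1 z - tpi * cotf z else 0.

Lemma hdiffDn z n : hdiff (z + n%:~R) = hdiff z.
Proof.
rewrite /hdiff; have -> : `[< nonint (z + n%:~R) >] = `[< nonint z >].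
  apply/asboolP/asboolP => [/(@nonint_shift _ (- n))|]; last exact: nonint_shift.
  by rewrite intrN addrK.
by rewrite rowDn // /cotf eeDn.
Qed.

Lemma hdiff_lim0 (e : R) : 0 < e -> exists2 d : R, 0 < d & forall y, nrm y < d -> nrm (hdiff y) <= e.
Proof.
move=> e0; have [K K0 HK] := row1_near; have [K' [d [K'0 d0 HK']]] := cotf_near.
pose q := e / (K + K' + 1); have KK : 0 < K + K' + 1 by rewrite ltr_wpDl // addr_ge0.
have q0 : 0 < q by rewrite divr_gt0.
exists (Order.min (Order.min d (1 / 2)) q); first by rewrite !lt_min d0 q0 divr_gt0.
move=> y; rewrite !lt_min -andbA => /and3P[yd yh yq]; rewrite /hdiff.
case: asboolP => [yn|_]; last by rewrite nrm0 ltW.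
have y0 : y != 0 by have := yn 0.
have -> : row 1 y - tpi * cotf y = (row 1 y - y^-1) - (tpi * cotf y - y^-1) by ring.
have := nrmB (row 1 y - y^-1) (tpi * cotf y - y^-1); have := HK y y0 yh; have := HK' y y0 yd.
move: yq; rewrite ltr_pdivlMr //; have := nrm_ge0 y; clear - K0 K'0; nra.
Qed.

Lemma hdiff_cont z : ccont setT hdiff z.
Proof.
have [zn|zi] := pselect (nonint z).
  have [d d0 Hd] := nonint_nbhd zn.
  have D := cderB (row_der (isT : (0 < 1)%N) zn) (cderZ tpi (cotf_der zn)).
  apply: cder_cont (cder_ext d0 _ _ D) => [y _ /Hd yn|]; rewrite /hdiff; case: asboolP => //.
have [n zE] : exists n, z = n%:~R.
  apply: contrapT => H; apply: zi => n; apply/eqP => zE; apply: H; by exists n.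
move=> e e0; have [d d0 Hd] := hdiff_lim0 e0; exists d => // y _ yz.
have -> : hdiff z = 0 by rewrite /hdiff; case: asboolP.
have -> : hdiff y = hdiff (y - z) by rewrite zE -intrN hdiffDn.
by rewrite subr0; exact: Hd.
Qed.

Lemma nonint_half z : nonint z -> nonint (z / 2) /\ nonint ((z + 1) / 2).
Proof.
move=> zn; split=> n; apply/eqP => E.
  by have := zn (2 * n); rewrite intrM -E mulrC divfK ?two_neq0 // eqxx.
have := zn (2 * n - 1); rewrite intrB intrM -E mulrC divfK ?two_neq0 //.
by rewrite addrK eqxx.
Qed.

Lemma hdiff_double z : nrm (hdiff z) <= (nrm (hdiff (z / 2)) + nrm (hdiff ((z + 1) / 2))) / 2.
Proof.
rewrite {1}/hdiff; case: asboolP => [zn|_]; last by rewrite nrm0 divr_ge0 // addr_ge0 ?nrm_ge0.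
have [z1 z2] := nonint_half zn.
have -> : row 1 z - tpi * cotf z = (hdiff (z / 2) + hdiff ((z + 1) / 2)) / 2.
  rewrite /hdiff !asboolT // -[row 1 z](mulKf two_neq0) -row1_double.
  by rewrite -[cotf z](mulKf two_neq0) -cotf_double //; field.
by rewrite nrmM nrmV nrm_nat ler_wpM2r ?invr_ge0 // nrmD.
Qed.

Lemma hdiff_eq0 z : hdiff z = 0.
Proof.
(* Because r >= 1, the square of half side r around 0 is stable under y -> y/2 and y -> (y +
   1)/2. *)
pose r := nrm z + 1; have r1 : 1 <= r by rewrite lerDr nrm_ge0.
have r0 : 0 < r by lra.
have [M M0 HM] := @sq_bounded _ hdiff 0 r r0 (fun y _ => @hdiff_cont y).
pose S := [set x : R | exists2 y, sq 0 r y & x = nrm (hdiff y)].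
have S0 : S !=set0 by exists (nrm (hdiff 0)), 0 => //; apply: sq_nrm; rewrite subrr nrm0 ltW.
have Ss : has_sup S by split=> //; exists M => _ [y ys ->]; exact: HM.
have le y : sq 0 r y -> nrm (hdiff y) <= sup S by move=> ys; apply: (ub_le_sup Ss.2); exists y.
have half y : sq 0 r y -> sq 0 r (y / 2) /\ sq 0 r ((y + 1) / 2).
  rewrite !sqE !subr0 => /andP[h1 h2].
  have e2 w : Re (w / 2) = Re w / 2 /\ Im (w / 2) = Im w / 2.
    have -> : w / 2 = w * (2^-1 : R)%:C by rewrite fmorphV rmorph_nat.
    by rewrite !ReImE /= !mulr0 subr0 add0r.
  have [-> ->] := e2 y; have [-> ->] := e2 (y + 1); rewrite !ReImE /= addr0.
  move: h1 h2; rewrite !ler_norml => /andP[a1 a2] /andP[b1 b2].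
  by split; apply/andP; split; apply/andP; split; lra.
apply: nrm_le0 => e e0.
have [d d0 Hd] := hdiff_lim0 e0.
have [n Hn] : exists n : nat, 2 * r / 2 ^+ n < d.
  exists (Num.bound (2 * r / d)); set b := Num.bound _.
  have hb : 2 * r / d < b%:R by rewrite archi_boundP // divr_ge0 ?mulr_ge0 // ltW.
  rewrite ltr_pdivrMr ?exprn_gt0 // [X in _ < X]mulrC -ltr_pdivrMr //; apply: lt_trans hb _.
  by rewrite -natrX ltr_nat ltn_expl.
(* Only the branch y -> y/2 is iterated; the other one is bounded by the supremum. For large n this
   leads to sup S <= e, without a point where the maximum is attained. *)
have iter m y : sq 0 r y -> nrm (hdiff y) <= sup S * (1 - (2 ^+ m)^-1) + nrm (hdiff (y / 2 ^+ m)) / 2 ^+ m.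
  elim: m y => [|m ih] y ys; first by rewrite !expr0 invr1 subrr mulr0 add0r !divr1 mulr1.
  have [y1 y2] := half y ys; have := hdiff_double y; have := ih _ y1; have := le _ y2.
  have -> : y / 2 / 2 ^+ m = y / 2 ^+ m.+1 by rewrite exprS invfM mulrA.
  have -> : (2 ^+ m.+1)^-1 = (2 ^+ m)^-1 / 2 :> R by rewrite exprS invfM mulrC.
  by rewrite mulrA; lra.
have sle : sup S <= sup S * (1 - (2 ^+ n)^-1) + e / 2 ^+ n.
  apply: sup_le_ub => // _ [y ys ->]; apply: le_trans (iter n y ys) _; rewrite lerD2l.
  rewrite ler_wpM2r ?invr_ge0 ?exprn_ge0 //; apply: Hd; rewrite nrmM nrmV nrmX nrm_nat.
  apply: le_lt_trans Hn; rewrite ler_wpM2r ?invr_ge0 ?exprn_ge0 //.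
  move: ys; rewrite sqE subr0 => /andP[h1 h2]; apply: le_trans (nrm_ReIm _) _; lra.
have p0 : 0 < (2 ^+ n)^-1 :> R by rewrite invr_gt0 exprn_gt0.
apply: le_trans (le z _) _; first by apply: sq_nrm; rewrite subr0 lerDl.
rewrite -(ler_pM2r p0); lra.
Qed.

Lemma row1_cot z : nonint z -> row 1 z = tpi * cotf z.
Proof.
move=> zn; have := hdiff_eq0 z; rewrite /hdiff asboolT // => /eqP.
by rewrite subr_eq0 => /eqP.
Qed.

(** The recursion combines the derivative of [row k], which is -k [row k.+1], with that of [cotf],
    which is -2 pi i ([cotf]^2 - 1/4). *)
Fixpoint cotpoly (k : nat) : {poly rat} :=
  if k is k'.+1 then k%:R^-1 *: ((cotpoly k')^`() * ('X ^+ 2 - (1 / 4)%:P)) else 'X.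

Lemma row_cot k z : nonint z ->
  row k.+1 z = tpi ^+ k.+1 * (map_poly ratr (cotpoly k)).[cotf z].
Proof.
elim: k z => [|k ih] z zn; first by rewrite expr1 map_polyX hornerX row1_cot.
have [d d0 Hd] := nonint_nbhd zn.
have D1 := row_der (isT : (0 < k.+1)%N) zn.
pose p := map_poly (ratr : rat -> C) (cotpoly k).
have D2 := cderZ (tpi ^+ k.+1) (cder_comp (cotf_der zn) (cder_horner setT p (cotf z))).
have D3 : cder setT (row k.+1) z _ := cder_ext d0 (fun y _ yd => esym (ih y (Hd y yd))) (esym (ih z zn)) D2.
have := cder_unique D1 D3; rewrite /p deriv_map => E.
have k0 : (k.+1%:R : C) != 0 by rewrite pnatr_eq0.
apply: (mulfI (_ : - (k.+1%:R : C) != 0)); first by rewrite oppr_eq0.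
rewrite E /= linearZ /= rmorphM /= rmorphB /= map_polyC /= map_polyXn /=.
rewrite hornerZ hornerM hornerD hornerN hornerC hornerXn fmorphV !rmorph_nat fmorph_div !rmorph_nat rmorph1 /= !exprS.
by set y := horner _ _; field.
Qed.

(** At z = 0 the term n = 0 is 0, since 0^-1 = 0. Even n reproduce 2^-k times the same sum and odd n
    give 2^-k times the sum at 1/2, so the value at an integer is reduced to one at a
    non-integer. *)
Lemma row_zero k : (1 < k)%N -> row k (0 : C) = row k (1 / 2) / (2 ^+ k - 1).
Proof.
move=> k1; have k0 : (0 < k)%N by exact: ltnW.
have P (y : C) : hasSum (rowterm k y) (row k y) by exact: rowP.
have H := hasSum_evenodd (P 0).
have H2 := hasSumZ (2^-1 ^+ k) (hasSumD (P 0) (P (1 / 2))).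
have E : row k (0 : C) = 2^-1 ^+ k * (row k 0 + row k (1 / 2)).
  apply: (hasSum_unique H); apply: hasSum_ext H2 => n.
  rewrite /rowterm (gtn_eqF k1) !subr0 !add0r.
  have -> : 1 / 2 + n%:~R = (2 * n + 1)%:~R / 2 :> C by rewrite intrD intrM; field.
  have -> : (2 * n)%:~R = n%:~R * 2 :> C by rewrite intrM mulrC.
  rewrite !invfM invrK !exprMn mulrDr mulrC; congr (_ + _).
  by rewrite mulrCA -exprMn mulVf ?two_neq0 // expr1n mulr1.
have p2 : (2 ^+ k - 1 : C) != 0.
  by rewrite subr_eq0 -natrX (_ : 1 = 1%:R) // eqr_nat; case: k k1 {k0 P H H2 E} => // k _; rewrite expnS; have := expn_gt0 2 k; lia.
have p0 : (2 ^+ k : C) != 0 by rewrite expf_neq0 ?two_neq0.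
rewrite exprVn in E; move: (row k 0) (row k (1 / 2)) E => a b E.
have E2 : a * 2 ^+ k = a + b by rewrite {1}E mulrAC mulVf // mul1r.
by apply: (mulIf p2); rewrite divfK // mulrBr mulr1 E2 addrAC subrr add0r.
Qed.

End Cotangent.

(** * Expansions of Eisenstein series *)

Section PowerSeries.
Variable R : realType.
Local Notation C := (Cplx R).
Local Notation Re := complex.Re.
Local Notation Im := complex.Im.

(** Finite sums away from A0 are bounded by 2. Selecting the terms with positive, respectively
    negative, real or imaginary part bounds the absolute values of these parts, hence the norms. *)
Lemma hasSum_absum (I : eqType) (f : I -> C) l : hasSum f l -> absum (fun i => nrm (f i)).
Proof.
move=> H; have [A0 HA] := H 1 ltr01; pose A := undup A0.
have disj D : uniq D -> (forall i, i \in D -> i \notin A0) -> nrm (\sum_(i <- D) f i) <= 2.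
  move=> uD dD; have u1 : uniq (A ++ D).
    rewrite cat_uniq undup_uniq uD andbT /=; apply/hasPn => i /dD; by rewrite /= mem_undup.
  have s1 : {subset A0 <= A} by move=> i; rewrite /A mem_undup.
  have s2 : {subset A0 <= A ++ D} by move=> i /s1; rewrite mem_cat => ->.
  have := HA _ (undup_uniq _) s1; have := HA _ u1 s2; rewrite big_cat /=.
  set a := \sum_(i <- A) _; set b := \sum_(i <- D) _ => h1 h2.
  have -> : b = (a + b - l) - (a - l) by ring.
  by apply: le_trans (nrmB _ _) _; lra.
have part (g : I -> R) : (forall D, `|\sum_(i <- D) g i| <= nrm (\sum_(i <- D) f i)) ->
  forall D, uniq D -> (forall i, i \in D -> i \notin A0) -> \sum_(i <- D) `|g i| <= 4.
  move=> gf D uD dD; rewrite (bigID (fun i => 0 <= g i)) /=.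
  have e1 : \sum_(i <- D | 0 <= g i) `|g i| = \sum_(i <- [seq i <- D | 0 <= g i]) g i.
    by rewrite big_filter; apply: eq_bigr => i /ger0_norm.
  have e2 : \sum_(i <- D | ~~ (0 <= g i)) `|g i| = - \sum_(i <- [seq i <- D | ~~ (0 <= g i)]) g i.
    by rewrite big_filter -sumrN; apply: eq_bigr => i; rewrite -ltNge => /ltr0_norm.
  have sub P : `|\sum_(i <- [seq i <- D | P i]) g i| <= 2.
    apply: le_trans (gf _) _.
    by apply: disj; [exact: filter_uniq|move=> i; rewrite mem_filter => /andP[_ /dD]].
  rewrite e1 e2; have := sub (fun i => 0 <= g i); have := sub (fun i => ~~ (0 <= g i)).
  by rewrite !ler_norml => /andP[h1 h2] /andP[h3 h4]; lra.
have ReS D : Re (\sum_(i <- D) f i) = \sum_(i <- D) Re (f i).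
  by elim: D => [|i D ih]; rewrite ?big_nil ?big_cons //= ReImE ih.
have ImS D : Im (\sum_(i <- D) f i) = \sum_(i <- D) Im (f i).
  by elim: D => [|i D ih]; rewrite ?big_nil ?big_cons //= ReImE ih.
exists (\sum_(i <- A) nrm (f i) + 8) => B uB; rewrite (bigID (mem A)) /=; apply: lerD.
  rewrite -big_filter (big_subset _ _ (undup_uniq A0 : uniq A) (A := [seq i <- B | i \in A])) ?filter_uniq //.
    by rewrite lerDl sumr_ge0 // => i _; exact: nrm_ge0.
  by move=> i; rewrite mem_filter => /andP[].
rewrite -big_filter; set D := [seq _ <- _ | _].
have uD : uniq D by exact: filter_uniq.
have dD i : i \in D -> i \notin A0 by rewrite mem_filter /A mem_undup => /andP[].
apply: (@le_trans _ _ (\sum_(i <- D) (`|Re (f i)| + `|Im (f i)|))).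
  by apply: ler_sum => i _; exact: nrm_ReIm.
have p1 := part (fun i => Re (f i)) (fun D => ltac:(rewrite -ReS; exact: nrm_Re)) D uD dD.
have p2 := part (fun i => Im (f i)) (fun D => ltac:(rewrite -ImS; exact: nrm_Im)) D uD dD.
by rewrite big_split /=; lra.
Qed.

Lemma hasSum_succ (f : nat -> C) l : hasSum f l -> hasSum (fun n => f n.+1) (l - f 0%N).
Proof.
move=> H; pose g n := if n == 0%N then f 0%N else 0.
have G : hasSum g (f 0%N).
  have -> : f 0%N = \sum_(n <- [:: 0%N]) g n by rewrite big_seq1.
  by apply: hasSum_fin => // n; rewrite inE /g => /negPf ->.
have H2 := hasSumB H G.
have phiK : cancel S predn by [].
have := @hasSum_reindexV _ _ _ S predn phiK _ _ _ H2.
move=> K; apply: hasSum_ext (K _) => [n|[|n]] //=; first by rewrite /g subr0.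
by rewrite /g /= subrr eqxx.
Qed.

Section Coefficients.
Variable K : C -> Prop.

(** A subfield of C containing all roots of unity, which are the numbers e(q) with q rational. It is
    a parameter, so that one computation serves both Q^ab and C. *)
Definition Kfield := [/\ forall x y, K x -> K y -> K (x + y), forall x y, K x -> K y -> K (x * y),
  forall x, K x -> K x^-1, forall q : rat, K (ratr q) & forall q : rat, K (ee (ratr q))].
Hypothesis HK : Kfield.

Lemma KD x y : K x -> K y -> K (x + y). Proof. by case: HK => h *; apply: h. Qed.
Lemma KM x y : K x -> K y -> K (x * y). Proof. by case: HK => _ h *; apply: h. Qed.
Lemma KV x : K x -> K x^-1. Proof. by case: HK => _ _ h *; apply: h. Qed.
Lemma Kint (n : int) : K n%:~R.
Proof. by case: HK => _ _ _ h _; have := h n%:~R; rewrite rmorph_int. Qed.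
Lemma Knat (n : nat) : K n%:R. Proof. by have := Kint n; rewrite -pmulrn. Qed.
Lemma K0 : K 0. Proof. exact: (Knat 0). Qed.
Lemma K1 : K 1. Proof. exact: (Knat 1). Qed.
Lemma KN x : K x -> K (- x).
Proof. by move=> h; rewrite -mulN1r; apply: KM => //; have := Kint (-1); rewrite intrN. Qed.
Lemma KX x n : K x -> K (x ^+ n).
Proof. by move=> h; elim: n => [|n ih]; [exact: K1|rewrite exprS; exact: KM]. Qed.
Lemma Ksum (J : eqType) (r : seq J) (F : J -> C) : (forall j, K (F j)) -> K (\sum_(j <- r) F j).
Proof. by move=> h; elim/big_ind: _ => [|x y|//]; [exact: K0|exact: KD]. Qed.
Lemma Kratr (q : rat) : K (ratr q). Proof. by case: HK => _ _ _ h _; exact: h. Qed.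
Lemma Kee (q : rat) : K (ee (ratr q)). Proof. by case: HK => _ _ _ _ h; exact: h. Qed.
Lemma Khorner (p : {poly rat}) x : K x -> K (map_poly ratr p).[x].
Proof.
move=> hx; elim/poly_ind: p => [|p c ih]; first by rewrite rmorph0 horner0; exact: K0.
rewrite rmorphD rmorphM /= map_polyX map_polyC /= hornerMXaddC.
by apply: KD; [exact: KM|exact: Kratr].
Qed.

Section Series.
Variables (T : Type) (x : T -> C).
Implicit Types F G : T -> C.

Definition ps F := exists2 a : nat -> C, (forall n, K (a n)) &
  forall t, hasSum (fun n => a n * x t ^+ n) (F t).

Lemma ps_ext F G : (forall t, F t = G t) -> ps F -> ps G.
Proof. by move=> /funext ->. Qed.

Lemma ps_cst c : K c -> ps (fun _ => c).
Proof.
move=> hc; exists (fun n => if n == 0%N then c else 0) => [n|t].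
  by case: ifP => // _; exact: K0.
rewrite [c in hasSum _ c](_ : c = \sum_(n <- [:: 0%N]) ((if n == 0%N then c else 0) * x t ^+ n)).
  by apply: hasSum_fin => // n; rewrite inE => /negPf ->; rewrite mul0r.
by rewrite big_seq1 /= expr0 mulr1.
Qed.

Lemma psD F G : ps F -> ps G -> ps (fun t => F t + G t).
Proof.
move=> [a Ka Ha] [b Kb Hb]; exists (fun n => a n + b n) => [n|t]; first exact: KD.
by apply: hasSum_ext (hasSumD (Ha t) (Hb t)) => n; rewrite mulrDl.
Qed.

Lemma psM F G : ps F -> ps G -> ps (fun t => F t * G t).
Proof.
move=> [a Ka Ha] [b Kb Hb].
exists (fun n => \sum_(i <- iota 0 n.+1) a i * b (n - i)%N) => [n|t].
  by apply: Ksum => i; exact: KM.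
have H := hasSum_mul (hasSum_absum (Ha t)) (hasSum_absum (Hb t)) (Ha t) (Hb t).
have := @hasSum_fiber _ _ _ _ (fun p : nat * nat => (p.1 + p.2)%N)
  (fun n => [seq (i, (n - i)%N) | i <- iota 0 n.+1]) _ _ _ H.
move=> h; apply: hasSum_ext (h _ _) => [n|n|[i j] n].
- rewrite big_map mulr_suml !big_seq; apply: eq_bigr => i; rewrite mem_iota add0n ltnS /= => ile.
  by rewrite -[in RHS](subnKC ile) exprD addKn; ring.
- by rewrite map_inj_uniq ?iota_uniq // => i j [].
- apply/mapP/eqP => [[i']|<-]; first by rewrite mem_iota add0n ltnS /= => h' [-> ->]; rewrite subnKC.
  by exists i => /=; [rewrite -[_ :: _]/(iota 0 (i + j).+1) mem_iota; lia|rewrite addKn].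
Qed.

Lemma psZ c F : K c -> ps F -> ps (fun t => c * F t).
Proof. by move=> hc; apply: psM (ps_cst hc). Qed.

Lemma ps_sum (J : eqType) (r : seq J) (F : J -> T -> C) : (forall j, ps (F j)) ->
  ps (fun t => \sum_(j <- r) F j t).
Proof.
move=> h; elim: r => [|j r ih].
  by apply: ps_ext (ps_cst K0) => t; rewrite big_nil.
by apply: ps_ext (psD (h j) ih) => t; rewrite big_cons.
Qed.

Lemma ps_geo : (forall t, nrm (x t) < 1) -> ps (fun t => (1 - x t)^-1).
Proof.
move=> x1; exists (fun _ => 1) => [_|t]; first exact: K1.
have [l Hl] : exists l, hasSum (fun n => x t ^+ n) l.
  apply: absum_hasSum; apply: absum_le (absum_geo (x := nrm (x t)) _) => [n|]; first by rewrite nrmX.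
  by rewrite nrm_ge0 x1.
have H1 := hasSum_succ Hl; have H2 := hasSumZ (x t) Hl.
have E : l - 1 = x t * l by apply: (hasSum_unique H1); apply: hasSum_ext H2 => n; rewrite exprS.
have n0 : 1 - x t != 0.
  apply/eqP => /eqP; rewrite subr_eq0 => /eqP e; have := x1 t; rewrite -e nrm1; lra.
have -> : (1 - x t)^-1 = l.
  apply: (mulfI n0); rewrite divff // mulrBl mul1r -E; ring.
by apply: hasSum_ext Hl => n; rewrite mul1r.
Qed.

Lemma ps_horner (p : {poly rat}) F : ps F -> ps (fun t => (map_poly ratr p).[F t]).
Proof.
move=> hF; elim/poly_ind: p => [|p c ih].
  by apply: ps_ext (ps_cst K0) => t; rewrite rmorph0 horner0.
apply: ps_ext (psD (psM ih hF) (ps_cst (Kratr c))) => t.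
by rewrite rmorphD rmorphM /= map_polyX map_polyC /= hornerMXaddC.
Qed.

End Series.

Definition cotX (X : C) : C := (X + 1) / (2 * (X - 1)).

Lemma cot_series k : exists2 al : nat -> C, (forall n, K (al n)) &
  forall X, nrm X < 1 -> hasSum (fun n => al n * X ^+ n) (map_poly ratr (cotpoly k)).[cotX X].
Proof.
(* [ps] asks for convergence at every parameter, so the variable is replaced by 0 outside the unit
   disc. *)
pose x (X : C) : C := if nrm X < 1 then X else 0.
have x1 X : nrm (x X) < 1 by rewrite /x; case: ifP => // _; rewrite nrm0.
have h : ps x (fun X => cotX (x X)).
  apply: ps_ext (psD (ps_cst _ (KV (Knat 2))) (psZ (KN K1) (ps_geo x1))) => X.
  have n0 : x X - 1 != 0.
    apply/eqP => /eqP; rewrite subr_eq0 => /eqP e; have := x1 X; rewrite e nrm1; lra.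
  have n1 : 1 - x X != 0 by rewrite -oppr_eq0 opprB.
  by rewrite /cotX; field; rewrite n0 n1.
have [al Ka Ha] := ps_horner (cotpoly k) h.
by exists al => // X X1; have := Ha X; rewrite /x X1.
Qed.

(** At a non-integer the row is a rational polynomial in [cotf q], which is rational in a root of
    unity. Integers reduce to 0 by periodicity; there weight one gives 0 by oddness, and higher
    weight reduces to 1/2 by [row_zero]. *)
Lemma Krow k (q : rat) : (0 < k)%N -> K (row k (ratr q) / (tpi R) ^+ k).
Proof.
case: k => // k _; have T0 : tpi R ^+ k.+1 != 0 by rewrite expf_neq0 ?tpi_neq0.
have noni (r : rat) : nonint (ratr r : C) -> K (row k.+1 (ratr r) / (tpi R) ^+ k.+1).
  move=> rn; rewrite (row_cot k rn) mulrAC divff // mul1r; apply: Khorner; rewrite /cotf.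
  apply: KM; first by apply: KD; [exact: Kee|exact: K1].
  apply/KV/KM; first exact: Knat.
  by apply: KD; [exact: Kee|exact: KN K1].
have [[n nE]|h] := pselect (exists n : int, (ratr q : C) = n%:~R); last first.
  by apply: noni => n; apply/eqP => e; apply: h; exists n.
have -> : row k.+1 (ratr q : C) = row k.+1 0.
  by rewrite nE -[n%:~R in LHS]add0r; apply: rowDn.
have [k0|k0] := posnP k.
  have e : row 1 (0 : C) = 0.
    have := @rowN R 1 0 isT; rewrite oppr0 expr1 mulN1r; move: (row 1 0) => a e.
    have : a *+ 2 = 0 by rewrite mulr2n {1}e addNr.
    by move/eqP; rewrite mulrn_eq0 => /eqP.
  by rewrite k0 e mul0r; exact: K0.
rewrite row_zero // mulrAC; apply: KM; last first.
  by apply/KV/KD; [apply/KX/Knat|exact: KN K1].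
have e : 1 / 2 = ratr (1 / 2) :> C by rewrite fmorph_div rmorph1 rmorph_nat.
rewrite e; apply: noni => m; rewrite -e; apply/eqP => e2.
have : (2 * m)%:~R = 1%:~R :> C by rewrite intrM -e2; field.
by move/eqP; rewrite eqr_int; lia.
Qed.

(** The constant term of the cotangent series in weight k: -1/2 is the value of [cotX] at 0. *)
Definition al0 k : C := (map_poly ratr (cotpoly k.-1)).[- (1 / 2)].

(** For k > 1 the cotangent polynomial has the factor X^2 - 1/4, which vanishes at -1/2. *)
Lemma al0_0 k : (1 < k)%N -> al0 k = 0.
Proof.
case: k => [|[|k]] // _; rewrite /al0 /= linearZ /= rmorphM /= rmorphB /= map_polyC /= map_polyXn /=.
rewrite hornerZ hornerM hornerD hornerN hornerC hornerXn fmorph_div rmorph1 rmorph_nat.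
by set y := horner _ _; set z := ratr _; field.
Qed.

Definition irange L : seq int := [seq i%:Z - L%:Z | i <- iota 0 L.*2.+1].
Lemma mem_irange L m : (m \in irange L) = (`|m| <= L)%N.
Proof.
apply/mapP/idP => [[i0]|h]; first by rewrite mem_iota => h ->; lia.
by exists (absz (m + L%:Z)); [rewrite mem_iota; lia|lia].
Qed.
Lemma irange_uniq L : uniq (irange L).
Proof. by rewrite map_inj_uniq ?iota_uniq // => i j; lia. Qed.

Lemma ee_absz (j : int) (w : C) : 0 <= j -> ee (j%:~R * w) = ee w ^+ `|j|%N.
Proof. by case: j => // n _; rewrite -pmulrn ee_nat. Qed.

Section Rows.
Variables (N : nat).
Hypothesis N0 : (0 < N)%N.

Definition xq (t : upper R) : C := ee (val t / N%:R).

Lemma nrm_xq t : 0 < nrm (xq t) < 1.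
Proof.
have t0 : 0 < Im (val t) by case: t.
rewrite nrm_ee expR_gt0 /= -expR0 ltr_expR oppr_lt0 !mulr_gt0 ?pi_gt0 //.
have -> : val t / N%:R = (N%:R^-1 : R)%:C * val t by rewrite mulrC fmorphV rmorph_nat.
by rewrite !ReImE /= mul0r addr0 mulr_gt0 // invr_gt0 ltr0n.
Qed.

(** The point N (m tau + n) + c tau + d of the lattice coset is N times [zrow] + n. *)
Definition zrow (c d : int) (t : upper R) (m : int) : C :=
  ((N%:Z * m + c)%:~R * val t + d%:~R) / N%:R.

(* [con m] is the constant term of row m: it vanishes for k > 1 unless
   N m + c = 0, and for k = 1 it is -1/2 times the sign of N m + c otherwise. *)
Lemma rows_expansion k (c d : int) : (0 < k)%N -> exists (con : int -> C) (A : upper R -> C),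
  [/\ forall m, K (con m), ps xq A,
      forall m, N%:Z * m + c > 0 -> con m = al0 k,
      forall m, N%:Z * m + c < 0 -> con m = (-1) ^+ k * al0 k &
      forall t, hasSum (fun m => row k (zrow c d t m) / tpi R ^+ k - con m) (A t)].
Proof.
case: k => // k _; have [al Kal Hal] := cot_series k.
have al00 : al 0%N = al0 k.+1.
  have := hasSum_succ (Hal 0 _); rewrite nrm0 ltr01 => /(_ isT).
  have := @hasSum0 R nat; move=> h0 h1.
  have : (map_poly ratr (cotpoly k)).[cotX 0] - al 0%N * 0 ^+ 0 = 0.
    by apply: (hasSum_unique h1); apply: hasSum_ext h0 => n; rewrite expr0n mulr0.
  rewrite expr0 mulr1 => /eqP; rewrite subr_eq0 => /eqP <-; rewrite /al0 /cotX; congr horner.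
  by field.
pose e m : int := N%:Z * m + c.
pose zeta : C := ee (d%:~R / N%:R).
have dNE : d%:~R / N%:R = ratr (d%:~R / N%:R : rat) :> C by rewrite fmorph_div rmorph_int rmorph_nat.
have Kz : K zeta by rewrite /zeta dNE; exact: Kee.
have z1 : nrm zeta = 1.
  have -> : zeta = ee (d%:~R / N%:R : R)%:C by rewrite /zeta fmorph_div rmorph_int rmorph_nat.
  by rewrite nrm_ee /= mulr0 oppr0 expR0.
(* A row with e m < 0 lies in the lower half plane. Replacing z by -z costs the sign s m and inverts
   zeta, and brings the variable e(y) into the unit disc. *)
pose s m : C := if 0 < e m then 1 else (-1) ^+ k.+1.
pose zm m : C := if 0 < e m then zeta else zeta^-1.
have Ks m : K (s m) by rewrite /s; case: ifP => _; [exact: K1|exact/KX/KN/K1].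
have Kzm m : K (zm m) by rewrite /zm; case: ifP => _; [|exact: KV].
have s1 m : nrm (s m) = 1 by rewrite /s; case: ifP => _; rewrite ?nrmX ?nrmN nrm1 ?expr1n.
have zm1 m : nrm (zm m) = 1 by rewrite /zm; case: ifP => _; rewrite ?nrmV z1 ?invr1.
pose cf (p : int * nat) : C := if e p.1 == 0 then 0 else s p.1 * al p.2.+1 * zm p.1 ^+ p.2.+1.
pose tm t (p : int * nat) : C := cf p * xq t ^+ (`|e p.1| * p.2.+1).
have Kcf p : K (cf p).
  by rewrite /cf; case: ifP => _; [exact: K0|apply: KM; [exact: KM|exact: KX]].
pose con m : C := if e m == 0 then row k.+1 (d%:~R / N%:R) / tpi R ^+ k.+1 else s m * al 0%N.
have T0 : tpi R ^+ k.+1 != 0 by rewrite expf_neq0 ?tpi_neq0.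
have N00 : (N%:R : C) != 0 by rewrite pnatr_eq0 -lt0n.
have inner t m : hasSum (fun n => tm t (m, n)) (row k.+1 (zrow c d t m) / tpi R ^+ k.+1 - con m).
  have t0 : 0 < Im (val t) by case: t.
  rewrite /tm /cf /con /=; have [em|em] := eqVneq (e m) 0.
    rewrite /zrow -/(e m) em mul0r add0r subrr.
    by apply: (@hasSum_ext _ _ (fun _ : nat => 0)) => [n|]; [rewrite mul0r|exact: hasSum0].
  have [y [yE ye y0]] : exists y : C, [/\ row k.+1 (zrow c d t m) = s m * row k.+1 y,
      ee y = zm m * xq t ^+ `|e m| & 0 < Im y].
    have zE : zrow c d t m = d%:~R / N%:R + (e m)%:~R * (val t / N%:R).
      by rewrite /zrow -/(e m); field.
    have ImE (j : int) : Im (d%:~R / N%:R + j%:~R * (val t / N%:R)) = j%:~R * (Im (val t) / N%:R).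
      have -> : d%:~R / N%:R + j%:~R * (val t / N%:R) =
        (d%:~R / N%:R : R)%:C + (j%:~R / N%:R : R)%:C * val t :> C.
        rewrite !fmorph_div !rmorph_int !rmorph_nat; field; exact: N00.
      by rewrite !ReImE /=; field; rewrite pnatr_eq0 -lt0n.
    have It : 0 < Im (val t) / N%:R by rewrite divr_gt0 ?ltr0n.
    rewrite /s /zm; case: ifP => e0.
      exists (zrow c d t m); split; first by rewrite mul1r.
        by rewrite zE eeD (ee_absz _ (ltW e0)) /zeta /xq; reflexivity.
      by rewrite zE ImE mulr_gt0 // ltr0z.
    have e1 : e m < 0 by rewrite lt_neqAle em leNgt e0.
    exists (- zrow c d t m); split.
    - rewrite rowN // mulrA -exprMn mulrNN mulr1 expr1n mul1r //.
    - have e2 : 0 <= - e m by rewrite oppr_ge0 ltW.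
      have -> : - zrow c d t m = - (d%:~R / N%:R) + (- e m)%:~R * (val t / N%:R) by rewrite zE intrN; ring.
      by rewrite eeD eeN (ee_absz _ e2) abszN /zeta /xq; reflexivity.
    - have -> : Im (- zrow c d t m) = - Im (zrow c d t m) by rewrite !ReImE.
      by rewrite zE ImE oppr_gt0 pmulr_llt0 // ltrz0.
  have y1 : nrm (ee y) < 1.
    by rewrite nrm_ee -expR0 ltr_expR oppr_lt0 !mulr_gt0 ?pi_gt0.
  have ny : nonint y by move=> n; apply/eqP => yn; move: y0; rewrite yn Im_int ltxx.
  have -> : row k.+1 (zrow c d t m) / tpi R ^+ k.+1 - s m * al 0%N =
    s m * ((map_poly ratr (cotpoly k)).[cotX (ee y)] - al 0%N * ee y ^+ 0).
    rewrite yE (row_cot k ny) expr0 mulr1 -/(cotX (ee y)).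
    by move: (horner _ _) (al 0%N) (s m) T0 => h a b; move: (tpi R ^+ k.+1) => T T0; field.
  apply: hasSum_ext (hasSumZ (s m) (hasSum_succ (Hal _ y1))) => n.
  by rewrite ye exprMn -exprM; ring.
have phiK : cancel e (fun j => ((j - c) %/ N%:Z)%Z).
  by move=> j; rewrite /e addrK mulKz //; lia.
have abs t : absum (fun p => nrm (tm t p)).
  (* Since |e m| (n + 1) >= |e m| + n for e m nonzero, the double series is dominated by the product
     of r^|e m| and |al (n+1)| r^n. *)
  have /andP[r0 r1] := nrm_xq t; set r := nrm (xq t) in r0 r1.
  have r1' : r <= 1 by exact: ltW.
  have r0' : 0 <= r by exact: ltW.
  have B1 : absum (fun m : int => r ^+ `|e m|%N).
    apply: (@absum_reindex _ _ _ _ _ phiK (fun j => r ^+ `|j|%N)).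
    apply: (@absum_int _ (fun n => r ^+ n)) => [n|]; first by rewrite exprn_ge0.
    by apply: absum_geo; rewrite r0'.
  have B2 : absum (fun n => r^-1 * nrm (al n.+1 * (r%:C) ^+ n.+1)).
    apply: absumZ; first by rewrite invr_ge0.
    apply: hasSum_absum (hasSum_succ (Hal _ _)).
    by rewrite nrm_real ger0_norm.
  apply: absum_le (absum_prod _ _ B1 B2) => [[m n]|m|n] /=; last 2 first.
  - by rewrite exprn_ge0.
  - by rewrite mulr_ge0 ?invr_ge0 ?nrm_ge0.
  have -> : r^-1 * nrm (al n.+1 * r%:C ^+ n.+1) = nrm (al n.+1) * r ^+ n.
    rewrite nrmM nrmX nrm_real ger0_norm // exprS; field; exact: lt0r_neq0.
  rewrite /tm /cf /=; have [em|em] := eqVneq (e m) 0.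
    by rewrite mul0r nrm0 !mulr_ge0 ?exprn_ge0 ?nrm_ge0.
  rewrite nrmM nrmM nrmM s1 mul1r !nrmX zm1 expr1n mulr1 -/r mulrCA ler_wpM2l ?nrm_ge0 //.
  move: em; rewrite -absz_gt0; move: (absz (e m)) => a a0.
  by rewrite -exprD ler_wiXn2l //; clear - a0; nia.
pose A t : C := xget 0 [set l | hasSum (tm t) l].
have HA t : hasSum (tm t) (A t).
  by have [l Hl] := absum_hasSum (abs t); apply: (@xgetPex _ 0 [set l | hasSum (tm t) l]); exists l.
exists con, A; split.
- move=> m; rewrite /con; case: ifP => _; last exact: KM.
  by rewrite dNE; exact: Krow.
(* The exponent of the term indexed by p. When e m = 0 the coefficient is 0, and the value n merely
   keeps the fibres finite. On the fibre of j one has N |m| <= j + |c|, whence the range of m. *)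
- pose phi (p : int * nat) : nat := if e p.1 == 0 then p.2 else (`|e p.1| * p.2.+1)%N.
  pose F j : seq (int * nat) :=
    [seq p <- [seq (m, n) | m <- irange (j + absz c), n <- iota 0 j.+1] | phi p == j].
  exists (fun j => \sum_(p <- F j) cf p) => [j|t]; first exact: Ksum.
  have := @hasSum_fiber _ _ _ (tm t) phi F _ _ _ (HA t).
  move=> h; apply: hasSum_ext (h _ _) => [j|j|[m n] j].
  + rewrite mulr_suml !big_seq; apply: eq_bigr => p; rewrite mem_filter /phi => /andP[pj _].
    rewrite /tm /cf; case: ifP pj => [_ _|_ /eqP <- //]; by rewrite !mul0r.
  + apply: filter_uniq; apply: allpairs_uniq; rewrite ?irange_uniq ?iota_uniq //.
    by move=> [? ?] [? ?] _ _ [-> ->].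
  + rewrite mem_filter; case: (boolP (phi (m, n) == j)) => [/eqP|_]; last by [].
    rewrite andTb /phi [(m, n).1]/= [(m, n).2]/= => pj.
    apply/allpairsP; exists (m, n); split; last by [].
      by rewrite mem_irange [(m, n).1]/=; move: pj; rewrite /e; case: eqP; clear - N0; nia.
    by rewrite mem_iota add0n ltnS leq0n [(m, n).2]/=; move: pj; case: eqP => [_ ->|em <-] //; nia.
- by move=> m m0; rewrite /con /s -/(e m) in m0 *; rewrite gt_eqF ?m0 // mul1r.
- by move=> m m0; rewrite /con /s -/(e m) in m0 *; rewrite lt_eqF // ltNge ltW //= al00.
- by move=> t; apply: hasSum_sigma (inner t) (HA t).
Qed.

End Rows.
End Coefficients.
End PowerSeries.

(** * Power series expansions of Eisenstein series in all weights *)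

Section EisensteinExpansion.
Variable R : realType.
Local Notation C := (Cplx R).
Variable K : C -> Prop.
Hypothesis HK : Kfield K.
Variable N : nat.
Hypothesis N0 : (0 < N)%N.

Lemma N0C : (N%:R : C) != 0. Proof. by rewrite pnatr_eq0 -lt0n. Qed.

Lemma lam_zrow (c d : int) (t : upper R) m n : lam t N (m, n) + uvec t c d = N%:R * (zrow N c d t m + n%:~R).
Proof.
rewrite /lam /uvec /zrow [(m, n).1]/= [(m, n).2]/= intrD intrM -pmulrn; field; exact: N0C.
Qed.

Lemma hasSum_lrow k (c d : int) (t : upper R) m : (1 < k)%N ->
  hasSum (fun n => (lam t N (m, n) + uvec t c d)^-1 ^+ k) (N%:R^-1 ^+ k * row k (zrow N c d t m)).
Proof.
move=> k1; apply: hasSum_ext (hasSumZ _ (rowP (zrow N c d t m) (ltnW k1))) => n.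
by rewrite lam_zrow invfM exprMn /rowterm (gtn_eqF k1) subr0.
Qed.

(** For k > 1 the constants [con] are nonzero in finitely many rows only, so their sum can be added
    back to the series. *)
Lemma rows_sum k (c d : int) : (1 < k)%N -> exists2 A : upper R -> C, ps K (xq N) A &
  forall t, hasSum (fun m => N%:R^-1 ^+ k * row k (zrow N c d t m)) (tpi R ^+ k * A t).
Proof.
move=> k1; have [con [A [Kc pA p1 p2 HA]]] := rows_expansion HK N0 c d (ltnW k1).
pose kap := \sum_(m <- irange `|c|) con m.
have T0 : tpi R ^+ k != 0 by rewrite expf_neq0 ?tpi_neq0.
exists (fun t => N%:R^-1 ^+ k * (A t + kap)).
  apply: (psZ HK); first by apply/(KX HK)/(KV HK)/(Knat HK).
  by apply: (psD HK pA); apply: (ps_cst HK); exact: Ksum.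
move=> t; have Hk : hasSum con kap.
  apply: hasSum_fin; first exact: irange_uniq.
  move=> m; rewrite mem_irange -ltnNge => hm.
  have [e|e|e] := ltrgtP (N%:Z * m + c) 0; last by move: e hm; clear - N0; nia.
  - by rewrite p2 // al0_0 // mulr0.
  - by rewrite p1 // al0_0.
have := hasSumZ (N%:R^-1 ^+ k * tpi R ^+ k) (hasSumD (HA t) Hk).
rewrite [N%:R^-1 ^+ k * tpi R ^+ k]mulrC -mulrA; apply: hasSum_ext => m.
by rewrite subrK -mulrA mulrCA; congr (_ * _); rewrite mulrC divfK.
Qed.

Lemma eisG_expansion k (c d : int) : (0 < k)%N -> ps K (xq N) (fun t => eisG k N c d t / tpi R ^+ k).
Proof.
move=> k0; have T0 j : tpi R ^+ j != 0 by rewrite expf_neq0 ?tpi_neq0.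
have [k3|k3] := ltnP 2 k.
  have [A pA HA] := rows_sum c d (ltnW k3); apply: ps_ext pA => t.
  have [_ H] := eisG_sum3 t N0 c d k3.
  have H2 := hasSum_sigma (fun m => hasSum_lrow c d t m (ltnW k3)) H.
  by rewrite (hasSum_unique H2 (HA t)) mulrC mulKf.
have [k2|k2] := eqVneq k 2%N.
  rewrite k2; have [A pA HA] := rows_sum c d (isT : (1 < 2)%N).
  have [B pB HB] := rows_sum 0 0 (isT : (1 < 2)%N).
  apply: ps_ext (psD HK pA (psZ HK (KN HK (K1 HK)) pB)) => t.
  have [_ H] := eisG_sum2 t N0 c d.
  have H2 : hasSum (fun m => N%:R^-1 ^+ 2 * row 2 (zrow N c d t m) - N%:R^-1 ^+ 2 * row 2 (zrow N 0 0 t m)) (eisG 2 N c d t).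
    apply: hasSum_sigma H => m.
    apply: hasSum_ext (hasSumB (hasSum_lrow c d t m (isT : (1 < 2)%N)) (hasSum_lrow 0 0 t m (isT : (1 < 2)%N))) => n.
    by rewrite uvec00 addr0.
  rewrite (hasSum_unique H2 (hasSumB (HA t) (HB t))) -mulrBr mulN1r [RHS]mulrC mulKf //.
have {k0 k2 k3}-> : k = 1%N by lia.
pose a := frac R N c; pose b := frac R N d.
have Kf e : K (frac R N e).
  rewrite /frac fmorph_div rmorph_int rmorph_nat; apply: (KM HK); first exact: Kint.
  by apply/(KV HK)/(Knat HK).
have Kab : K (1 - a - b) by do ![exact: K1|exact: Kf|apply: KN|apply: KD].
pose X e f := rows_expansion HK N0 e f (isT : (0 < 1)%N).
have [c1 [A1 [Kc1 pA1 p1 q1 H1]]] := X c d.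
have [c2 [A2 [Kc2 pA2 p2 q2 H2]]] := X 0 0.
have [c3 [A3 [Kc3 pA3 p3 q3 H3]]] := X N%:Z 0.
have [c4 [A4 [Kc4 pA4 p4 q4 H4]]] := X 0 N%:Z.
pose con m := c1 m - (1 - a - b) * c2 m - a * c3 m - b * c4 m.
pose kap := \sum_(m <- irange (`|c| + 1)) con m.
have psB F G : ps K (xq N) F -> ps K (xq N) G -> ps K (xq N) (fun t => F t - G t).
  by move=> hF hG; apply: ps_ext (psD HK hF (psZ HK (KN HK (K1 HK)) hG)) => t; rewrite mulN1r.
pose A t := A1 t - (1 - a - b) * A2 t - a * A3 t - b * A4 t.
have pA : ps K (xq N) A.
  exact (psB _ _ (psB _ _ (psB _ _ pA1 (psZ HK Kab pA2)) (psZ HK (Kf c) pA3)) (psZ HK (Kf d) pA4)).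
have KB x y : K x -> K y -> K (x - y) by move=> hx hy; apply: KD => //; exact: KN.
have Kcon m : K (con m).
  exact (KB _ _ (KB _ _ (KB _ _ (Kc1 m) (KM HK Kab (Kc2 m))) (KM HK (Kf c) (Kc3 m))) (KM HK (Kf d) (Kc4 m))).
(* Outside a finite range the four rows have the same sign, so their constant terms are equal; the
   weights 1, -(1 - a - b), -a, -b add up to 0. *)
have Hk : hasSum con kap.
  apply: hasSum_fin; first exact: irange_uniq.
  move=> m; rewrite mem_irange -ltnNge => hm; rewrite /con; have [m0|m0] := ltP 0 m.
    by rewrite p1 ?p2 ?p3 ?p4; [ring|move: hm m0; clear - N0; nia ..].
  by rewrite q1 ?q2 ?q3 ?q4; [ring|move: hm m0; clear - N0; nia ..].
have pF : ps K (xq N) (fun t => N%:R^-1 * (A t + kap)).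
  apply: (psZ HK); first by apply/(KV HK)/(Knat HK).
  by apply: (psD HK pA); apply: (ps_cst HK); exact: Ksum.
apply: ps_ext pF => t.
have [_ H] := eisG_sum1 t N0 c d.
pose r e f m : C := row 1 (zrow N e f t m).
have HS : hasSum (fun m => N%:R^-1 * (r c d m - (1 - a - b) * r 0 0 m - a * r N%:Z 0 m - b * r 0 N%:Z m)) (eisG 1 N c d t).
  apply: hasSum_sigma H => m; have P e f : hasSum (rowterm 1 (zrow N e f t m)) (r e f m) by exact: rowP.
  apply: hasSum_ext (hasSumZ N%:R^-1 (hasSumB (hasSumB (hasSumB (P c d) (hasSumZ (1 - a - b) (P 0 0)))
    (hasSumZ a (P N%:Z 0))) (hasSumZ b (P 0 N%:Z)))) => n.
  rewrite /comb1 -/a -/b.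
  have -> : lam t N (m, n) + N%:R * val t = lam t N (m, n) + uvec t N%:Z 0 by rewrite /uvec addr0 -pmulrn.
  have -> : lam t N (m, n) + N%:R = lam t N (m, n) + uvec t 0 N%:Z by rewrite /uvec mul0r add0r -pmulrn.
  rewrite -[X in (1 - a - b) * X^-1](addr0 (lam t N (m, n))) -(uvec00 t) !lam_zrow !invfM /rowterm /= !expr1.
  move: (zrow N c d t m + n%:~R)^-1 (zrow N 0 0 t m + n%:~R)^-1 (zrow N N%:Z 0 t m + n%:~R)^-1 (zrow N 0 N%:Z t m + n%:~R)^-1 n%:~R^-1 N%:R^-1 => x1 x2 x3 x4 x5 x6.
  ring.
have HT := hasSumZ (N%:R^-1 * tpi R) (hasSumD (hasSumB (hasSumB (hasSumB (H1 t) (hasSumZ (1 - a - b) (H2 t))) (hasSumZ a (H3 t))) (hasSumZ b (H4 t))) Hk).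
have -> : eisG 1 N c d t = N%:R^-1 * tpi R * (A t + kap).
  apply: (hasSum_unique HS); apply: hasSum_ext HT => m.
  rewrite /con -/(r c d m) -/(r 0 0 m) -/(r N%:Z 0 m) -/(r 0 N%:Z m) expr1.
  move: (r c d m) (r 0 0 m) (r N%:Z 0 m) (r 0 N%:Z m) => x1 x2 x3 x4.
  move: (c1 m) (c2 m) (c3 m) (c4 m) (tpi R) (tpi_neq0 R) N%:R N0C => y1 y2 y3 y4 T Tn M Mn.
  by clearbody a b; field; rewrite ?Mn ?Tn.
by move: (A t + kap) (tpi R) (tpi_neq0 R) => x T Tn; rewrite expr1 -!mulrA [x / T]mulrC mulVKf.
Qed.

End EisensteinExpansion.

(** * Roots of unity in the maximal abelian extension *)

Section CyclotomicNumbers.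
Variable R : realType.
Local Notation C := (Cplx R).

Lemma minimal_poly_exists (z : C) (p : {poly rat}) : p != 0 -> root (map_poly ratr p) z ->
  exists2 q : {poly rat}, irreducible_poly q & root (map_poly ratr q) z.
Proof.
move=> p0 pz; pose P n := `[< exists q : {poly rat}, [/\ q != 0, root (map_poly ratr q) z & size q = n] >].
have ex : exists n, P n by exists (size p); apply/asboolP; exists p.
case: (ex_minnP ex) => n /asboolP[q [q0 qz <-]] min; exists q => //.
apply/(subfx_irreducibleP qz q0) => r rz r0; apply: min; apply/asboolP; by exists r.
Qed.

(** The field Q(z), built from an irreducible polynomial with root z, is generated by z and splits
    X^m - 1, where m is the order of z. An automorphism maps z to a power of z, and taking powers
    commutes, so the Galois group is abelian. *)
Lemma Qab_unity_root (z : C) n : (0 < n)%N -> z ^+ n = 1 -> Qab z.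
Proof.
move=> n0 zn; have [m zm _] := prim_order_exists n0 zn.
have m0 : (0 < m)%N := prim_order_gt0 zm.
have [p irr pz] : exists2 q : {poly rat}, irreducible_poly q & root (map_poly ratr q) z.
  apply: (@minimal_poly_exists z ('X^m - 1)); first by rewrite -size_poly_eq0 size_XnsubC.
  by rewrite rmorphB /= map_polyXn rmorph1 /root !hornerE (prim_expr_order zm) subrr.
have nzp : p != 0 by exact: irredp_neq0.
pose L0 : fieldExtType rat := SubFieldExtType pz irr.
pose w : L0 := subfx_root ratr z p.
pose inj : {rmorphism L0 -> C} := @subfx_inj _ _ ratr z p.
have injw : inj w = z by exact: subfx_inj_root.
have wm : m.-primitive_root w by rewrite -(fmorph_primitive_root inj) injw.
have gen (x : L0) : exists q : {poly rat}, x = (map_poly (in_alg L0) q).[w].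
  by have [q ->] := subfxEroot pz nzp x; exists q.
have spl : splitting_field_axiom L0.
  exists ('X^m - 1); first by rewrite rpredB ?rpredX ?polyOverX ?rpred1.
  exists [seq w ^+ i | i <- iota 0 m].
    rewrite -(factor_Xn_sub_1 wm) big_map.
    by rewrite /index_iota subn0 eqpxx.
  apply/vspaceP => x; rewrite memvf; have [q ->] := gen x.
  have win : w \in <<1 & [seq (w ^+ i)%R | i <- iota 0 m]>>%VS.
    have [m1|m1] := ltnP 1 m.
      apply: seqv_sub_adjoin; apply/mapP; exists 1%N; rewrite ?expr1 // mem_iota; lia.
    have := prim_expr_order wm; have -> : m = 1%N by lia.
    by rewrite expr1 => ->; exact: rpred1.
  apply: rpred_horner => //; apply/polyOverP => i; rewrite coef_map /=.
  by apply: memvZ; exact: rpred1.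
pose L : splittingFieldType rat := HB.pack L0 (FieldExt_isSplittingField.Build rat L0 spl).
exists L, inj; split; last by exists w.
have galw (s : gal_of {:L}) : exists i : nat, s (w : L) = w ^+ i.
  have h : s (w : L) ^+ m = 1.
    by rewrite -rmorphXn (prim_expr_order (wm : m.-primitive_root (w : L))) rmorph1.
  by have [i ->] := prim_rootP (wm : m.-primitive_root (w : L)) h; exists i.
apply/centsP => s _ t _; apply/eqP/gal_eqP => a _; rewrite !galM ?memvf //.
have [q ->] := gen a.
have mapg (u : gal_of {:L}) (y : L) : u ((map_poly (in_alg L) q).[y]) = (map_poly (in_alg L) q).[u y].
  rewrite -horner_map -map_poly_comp; congr horner; apply: eq_map_poly => c /=.
  by rewrite linearZ /= rmorph1.
have -> : (map_poly (in_alg L0) q).[w] = (map_poly (in_alg L) q).[w : L] by [].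
rewrite !mapg; have [i si] := galw s; have [j tj] := galw t.
by rewrite si tj !rmorphXn /= si tj -!exprM mulnC.
Qed.

Lemma Qab_inv (x : C) : Qab x -> Qab x^-1.
Proof.
by move=> [L [phi [ab [y <-]]]]; exists L, phi; split=> //; exists y^-1; rewrite fmorphV.
Qed.

Lemma Qab_ratr (q : rat) : Qab (ratr q : C).
Proof.
have [L [phi [ab _]]] := Qab_unity_root (isT : (0 < 1)%N) (expr1n C 1).
by exists L, phi; split=> //; exists (ratr q); rewrite fmorph_rat.
Qed.

Lemma Qab_ee (q : rat) : Qab (ee (ratr q) : C).
Proof.
have d0 : (0 < `|denq q|)%N by rewrite absz_gt0 denq_eq0.
apply: (@Qab_unity_root _ `|denq q|%N) => //; rewrite -ee_nat.
rewrite -[RHS](ee_int R (numq q)); congr ee.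
have -> : ratr q = (numq q)%:~R / (denq q)%:~R :> C by rewrite -{1}(divq_num_den q) fmorph_div !rmorph_int.
have -> : (`|denq q|%N)%:R = (denq q)%:~R :> C by rewrite -[in RHS](absz_denq q) -pmulrn.
by rewrite mulrC divfK // intr_eq0 denq_eq0.
Qed.

(** Sums and products of elements of two abelian extensions lie in their compositum. Here closure is
    assumed; it is derived in the final proof from the stability of V0 under Q^ab. *)
Lemma Qab_Kfield : (forall x y : C, Qab x -> Qab y -> Qab (x + y)) ->
  (forall x y : C, Qab x -> Qab y -> Qab (x * y)) -> Kfield (@Qab R).
Proof. by move=> hD hM; split=> //; [exact: Qab_inv|exact: Qab_ratr|exact: Qab_ee]. Qed.

End CyclotomicNumbers.

(** * Linear algebra over a subfield *)

Section ReducedEchelonForm.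
Variable F : fieldType.

(** Induction on the rank. A row u with entry 1 in the first nonzero column j is split off; clearing
    column j with u lowers the rank by one, because u meets the remaining row space trivially. The
    entries of u in the later pivot columns are then removed with the rows obtained by induction. *)
Lemma rref_exists r m n (A : 'M[F]_(m, n)) : \rank A = r ->
  exists E : 'M[F]_(r, n), is_rref E /\ (E == A)%MS.
Proof.
elim: r m A => [|r IH] m A rA.
  exists 0; split; last by rewrite sub0mx; have /eqP := rA; rewrite mxrank_eq0 => /eqP ->; rewrite sub0mx.
  have no (i : 'I_0) : False by case: i => i0; rewrite ltn0.
  by exists (fun i => False_rect _ (no i)); split=> i; case: (no i).
have [j [i Aij] jmin] : exists2 j : 'I_n, exists i, A i j != 0 & forall j' : 'I_n, (j' < j)%N -> forall i, A i j' = 0.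
  have [j0 Pj0] : exists j : 'I_n, [exists i, A i j != 0].
    have : A != 0 by rewrite -mxrank_eq0 rA.
    move=> /matrix0Pn[i [j ij]]; exists j; by apply/existsP; exists i.
  case: (arg_minnP (P := fun j : 'I_n => [exists i, A i j != 0]) (fun j : 'I_n => nat_of_ord j) Pj0) => j /existsP[i ij] jm; exists j; first by exists i.
  move=> j' j'j i'; apply/eqP/negP => /negP h.
  by have := jm j' _; rewrite leqNgt j'j => H; apply: notF; apply: H; apply/existsP; exists i'.
pose u : 'rV[F]_n := (A i j)^-1 *: matrix.row i A.
have uj : u 0 j = 1 by rewrite !mxE mulVf.
have uz (b : 'I_n) : (b < j)%N -> u 0 b = 0 by move=> h; rewrite !mxE (jmin b h) mulr0.
have uA : (u <= A)%MS by rewrite scalemx_sub // row_sub.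
clearbody u.
pose A1 := A - col j A *m u.
have A1j a : A1 a j = 0 by rewrite /A1 !mxE big_ord1 uj !mxE mulr1 subrr.
have A1A : (A1 <= A)%MS by rewrite addmx_sub // eqmx_opp (submx_trans (submxMl _ _)).
have AE : (A <= u + A1)%MS.
  rewrite -[X in (X <= _)%MS](subrK (col j A *m u)) -/A1 addmx_sub ?addsmxSr //.
  by apply: (submx_trans (submxMl _ _)); exact: addsmxSl.
have cap0 : (u :&: A1 = 0)%MS.
  apply/eqP/rowV0P => w; rewrite sub_capmx => /andP[/sub_rVP[a ->] /submxP[D wD]].
  have := congr1 (fun M : 'rV[F]_n => M 0 j) wD; rewrite [LHS]mxE uj mulr1 mxE => ->.
  by rewrite big1 ?scale0r // => b _; rewrite A1j mulr0.
have rA1 : \rank A1 = r.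
  have u1 : \rank u = 1%N.
    by rewrite rank_rV; case: eqP => // u0; move: uj; rewrite u0 mxE => /esym/eqP; rewrite oner_eq0.
  have : \rank (u + A1)%MS = \rank A.
    by apply/eqP; rewrite eqn_leq !mxrankS // addsmx_sub uA.
  by rewrite (mxrank_disjoint_sum cap0) u1 rA add1n => -[].
have [E1 [[p [p1 p2 p3]] eE1]] := IH _ A1 rA1.
have /andP[E1A AE1] := eE1.
have E1z (a : 'I_r) (b : 'I_n) : (b <= j)%N -> E1 a b = 0.
  move=> bj; have /submxP[D DE] : (matrix.row a E1 <= A1)%MS by rewrite (submx_trans (row_sub _ _)).
  have := congr1 (fun M : 'rV[F]_n => M 0 b) DE; rewrite [in LHS]mxE => ->.
  rewrite mxE big1 // => a' _; move: bj; rewrite leq_eqVlt => /orP[/eqP/val_inj ->|bj]; first by rewrite A1j mulr0.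
  by rewrite !mxE big_ord1 (jmin b bj) (uz b bj) !mulr0 oppr0 addr0 mulr0.
have jp a : (j < p a)%N.
  by rewrite ltnNge; apply/negP => /(E1z a); rewrite p3 eqxx => /eqP; rewrite oner_eq0.
pose u' := u - (\row_a u 0 (p a)) *m E1.
have u'p a : u' 0 (p a) = 0.
  rewrite !mxE (bigD1 a) //= big1 => [|b ba]; first by rewrite !mxE p3 eqxx mulr1 addr0 subrr.
  by rewrite p3 (negPf ba) mulr0.
have u'z (b : 'I_n) : (b <= j)%N -> u' 0 b = u 0 b.
  by move=> bj; rewrite mxE [X in _ + X]mxE mxE big1 ?subr0 // => a _; rewrite (E1z a b bj) mulr0.
have Hr : @is_rref F (1 + r) n (col_mx u' E1).
  pose q (a : 'I_(1 + r)) := match fintype.split a with inl _ => j | inr b => p b end.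
  have ql (a : 'I_1) : q (lshift r a) = j by rewrite /q (unsplitK (inl a)).
  have qr a : q (rshift 1 a) = p a by rewrite /q (unsplitK (inr a)).
  have spl (a : 'I_(1 + r)) : (exists a', a = lshift r a') \/ exists a', a = rshift 1 a'.
    by case: (fintype.split_ordP a) => a' ->; [left|right]; exists a'.
  exists q; split.
  - move=> a b; have [[a' ->]|[a' ->]] := spl a; have [[b' ->]|[b' ->]] := spl b.
    + by rewrite !ord1 ltnn.
    + by rewrite ql qr.
    + by rewrite !ord1.
    + by rewrite !qr /= ltn_add2l; exact: p1.
  - move=> a b; have [[a' ->]|[a' ->]] := spl a; rewrite ?ql ?qr ?col_mxEu ?col_mxEd => h; last exact: p2 h.
    by rewrite ord1 u'z ?(ltnW h) // uz.
  - move=> a b; have [[a' ->]|[a' ->]] := spl a; have [[b' ->]|[b' ->]] := spl b; rewrite ?ql ?qr ?col_mxEu ?col_mxEd ?ord1.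
    + by rewrite u'z // uj eqxx.
    + by rewrite E1z // eq_rlshift.
    + by rewrite u'p eq_lrshift.
    + by rewrite p3 eq_rshift.
have E1A' : (E1 <= A)%MS by exact: submx_trans A1A.
pose E' : 'M[F]_(1 + r, n) := col_mx u' E1.
have He : (E' <= A)%MS && (A <= E')%MS.
  apply/andP; split.
    rewrite col_mx_sub E1A' andbT addmx_sub // eqmx_opp; exact: (submx_trans (submxMl _ _)).
  apply: (submx_trans AE); rewrite addsmx_sub; apply/andP; split; last first.
    by apply: (submx_trans AE1); rewrite -addsmxE addsmxSr.
  rewrite -[X in (X <= _)%MS](subrK ((\row_a u 0 (p a)) *m E1)) -/u' addmx_sub //.
    by rewrite -addsmxE addsmxSl.
  by apply: (submx_trans (submxMl _ _)); rewrite -addsmxE addsmxSr.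
by exists E'; split; [exact: Hr|exact: He].
Qed.

Lemma rrefP m n (A : 'M[F]_(m, n)) : is_rref (rref A) /\ (rref A == A)%MS.
Proof.
apply: (@xgetPex _ 0 [set E : 'M[F]_(\rank A, n) | is_rref E /\ (E == A)%MS]).
by have [E HE] := @rref_exists (\rank A) m n A erefl; exists E.
Qed.

Lemma rref_row_free r n (E : 'M[F]_(r, n)) : is_rref E -> row_free E.
Proof.
move=> [p [_ _ p3]]; apply/row_freeP.
exists (\matrix_(a, b) (a == p b)%:R); apply/matrixP => a b; rewrite !mxE (bigD1 (p b)) //= big1.
  by rewrite !mxE eqxx mulr1 addr0 p3.
by move=> c /negPf cp; rewrite mxE cp mulr0.
Qed.

End ReducedEchelonForm.

(** * Rationality of reduced echelon forms over a subfield *)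

Section RationalLinearAlgebra.
Variable R : realType.
Local Notation C := (Cplx R).
Variable K : C -> Prop.
Hypothesis HK : Kfield K.

(** The basis vector 1 is kept in first place, so that the first coordinate is a K-linear map
    restricting to the identity on K. [rref_K] applies it entrywise. *)
Lemma K_basis (s : seq C) : exists e : seq C, [/\ (0 < size e)%N, e`_0 = 1,
  forall a : nat -> C, (forall i, K (a i)) -> \sum_(i < size e) a i * e`_i = 0 ->
    forall i : 'I_(size e), a i = 0 &
  forall x, x \in s -> exists2 a : nat -> C, (forall i, K (a i)) & x = \sum_(i < size e) a i * e`_i].
Proof.
elim: s => [|x s [e [e0 e1 ind span]]].
  exists [:: 1]; split=> // a Ka; rewrite big_ord1 mulr1 => a0 i; by rewrite ord1.
have [[a Ka xE]|nx] := pselect (exists2 a : nat -> C, (forall i, K (a i)) & x = \sum_(i < size e) a i * e`_i).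
  exists e; split=> // y; rewrite inE => /orP[/eqP ->|]; last exact: span.
  by exists a.
have rc (i : 'I_(size e)) : (rcons e x)`_i = e`_i by rewrite nth_rcons ltn_ord.
have rl : (rcons e x)`_(size e) = x by rewrite nth_rcons ltnn eqxx.
have sE (a : nat -> C) : \sum_(i < (size e).+1) a i * (rcons e x)`_i =
    \sum_(i < size e) a i * e`_i + a (size e) * x.
  rewrite big_ord_recr /= rl; congr (_ + _); by apply: eq_bigr => i _; rewrite rc.
exists (rcons e x); split; rewrite ?size_rcons //.
- by rewrite nth_rcons e0.
- move=> a Ka; rewrite sE => h.
  have az : a (size e) = 0.
    apply/eqP/negP => /negP an; apply: nx; exists (fun i => - (a (size e))^-1 * a i).
      by move=> i; apply: KM => //; apply: KN => //; exact: KV.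
    apply: (mulfI an); rewrite -[LHS](addrK (\sum_(i < size e) a i * e`_i)) [_ + \sum_(_ < _) _]addrC h sub0r mulr_sumr -sumrN.
    by apply: eq_bigr => i _; field.
  rewrite az mul0r addr0 in h; move=> i; have [il|il] := ltnP i (size e).
    by have := ind a Ka h (Ordinal il).
  have -> : nat_of_ord i = size e by apply/eqP; rewrite eqn_leq il -ltnS ltn_ord.
  exact: az.
- move=> y; rewrite inE => /orP[/eqP ->|/span[a Ka yE]].
    exists (fun i => if i == size e then 1 else 0) => [i|]; first by case: ifP => _; [exact: K1|exact: K0].
    rewrite (sE (fun i => if i == size e then 1 else 0)) eqxx mul1r big1 ?add0r // => i _; by rewrite ltn_eqF ?mul0r.
  exists (fun i => if i == size e then 0 else a i) => [i|]; first by case: ifP => _ //; exact: K0.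
  rewrite (sE (fun i => if i == size e then 0 else a i)) eqxx mul0r addr0 yE; apply: eq_bigr => i _.
  by rewrite ltn_eqF.
Qed.

Lemma K_decompose (I : eqType) (r : seq I) (f : I -> C) : exists (e : seq C) (a : nat -> I -> C),
  [/\ (0 < size e)%N, e`_0 = 1,
    forall b : nat -> C, (forall i, K (b i)) -> \sum_(i < size e) b i * e`_i = 0 ->
      forall i : 'I_(size e), b i = 0,
    forall n i, K (a n i) & forall i, i \in r -> f i = \sum_(n < size e) a n i * e`_n].
Proof.
have [e [e0 e1 ind span]] := K_basis [seq f i | i <- r].
have ex i : exists a : nat -> C, (forall n, K (a n)) /\ (i \in r -> f i = \sum_(n < size e) a n * e`_n).
  have [ir|ir] := boolP (i \in r); last by exists (fun _ => 0); split=> // _; exact: K0.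
  by have [a Ka aE] := span _ (map_f f ir); exists a.
pose a n i := sval (cid (ex i)) n.
exists e, a; split=> // [n i|i ir]; first by have [h _] := svalP (cid (ex i)); exact: h.
by have [_ ->] := svalP (cid (ex i)).
Qed.

(* Expanding the transition matrix over K, its component along e_0 = 1 already
   has the right pivot columns, hence reproduces E. *)
Lemma rref_K r m n (E : 'M[C]_(r, n)) (A : 'M[C]_(m, n)) : is_rref E -> (E == A)%MS ->
  (forall i j, K (A i j)) -> forall i j, K (E i j).
Proof.
move=> [p [_ _ p3]] /andP[/submxP[X EX] AE] KA.
have [e [a [e0 e1 ind Ka aE]]] := K_decompose (enum [set: 'I_r * 'I_m]) (fun ij => X ij.1 ij.2).
pose X0 := \matrix_(i, j) a 0%N (i, j) : 'M[C]_(r, m).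
have piv i k : (X0 *m A) k (p i) = (k == i)%:R.
  pose b n := \sum_j a n (k, j) * A j (p i) - (if n == 0%N then (k == i)%:R else 0).
  have Kb n' : K (b n').
    apply: KD => //; first by apply: Ksum => // j; exact: KM.
    by apply: KN => //; case: ifP => _; [exact: Knat|exact: K0].
  have := ind b Kb _ (Ordinal e0); rewrite /b /= => H.
  rewrite !mxE; apply/eqP; rewrite -subr_eq0; apply/eqP.
  under eq_bigr => j _ do rewrite mxE.
  apply: H; have := p3 i k; rewrite EX mxE => pE.
  under eq_bigr => n' _ do rewrite mulrBl mulr_suml.
  rewrite sumrB exchange_big /=.
  under eq_bigr => j _.
    under eq_bigr => n' _ do rewrite mulrAC.
    rewrite -mulr_suml -(aE (k, j)) ?mem_enum ?inE //=.
  over.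
  rewrite pE (bigD1 (Ordinal e0)) //= big1 => [|n' nn]; first by rewrite e1 mulr1 addr0 subrr.
  case: ifP => [/eqP h|_]; last by rewrite mul0r.
  by case/eqP: nn; apply: val_inj.
(* Both X0 A = Y E and E are the identity in the pivot columns, which forces Y = 1. *)
have /submxP[Y YE] : (X0 *m A <= E)%MS by exact: (submx_trans (submxMl _ _)).
have Y1 : Y = 1%:M.
  apply/matrixP => k i; rewrite [RHS]mxE -(piv i k) YE mxE (bigD1 i) //= big1 => [|b bi].
    by rewrite p3 eqxx mulr1 addr0.
  by rewrite p3 (negPf bi) mulr0.
rewrite Y1 mul1mx in YE; move=> i j; rewrite -YE mxE; apply: Ksum => // c; rewrite mxE; exact: KM.
Qed.

End RationalLinearAlgebra.

(** * Fourier expansions *)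

Section FourierUniqueness.
Variable R : realType.
Local Notation C := (Cplx R).
Local Notation Re := complex.Re.
Local Notation Im := complex.Im.
Implicit Types (t : upper R) (M m n j : nat) (r : rat).

Lemma Im_upper t : 0 < Im (val t). Proof. by case: t. Qed.

Lemma qpowE r t : qpow r t = ee (ratr r * val t).
Proof. by rewrite /qpow /ee /tpi [in RHS]mulrA. Qed.

Lemma qpowD r s t : qpow (r + s) t = qpow r t * qpow s t.
Proof. by rewrite !qpowE rmorphD mulrDl eeD. Qed.

Lemma qpow_neq0 r t : qpow r t != 0. Proof. by rewrite qpowE ee_neq0. Qed.

Lemma qpow_xq M n t : qpow (n%:R / M%:R) t = xq M t ^+ n.
Proof.
rewrite qpowE /xq -ee_nat fmorph_div !rmorph_nat; congr ee.
by rewrite mulrAC mulrA.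
Qed.

Lemma nrm_xqE M t : nrm (xq M t) = expR (- (2 * pi * (Im (val t) / M%:R))).
Proof.
rewrite nrm_ee; have -> : val t / M%:R = (M%:R^-1 : R)%:C * val t by rewrite mulrC fmorphV rmorph_nat.
by rewrite !ReImE /= mul0r addr0 [M%:R^-1 * _]mulrC.
Qed.

Lemma upper_exists (x y : R) : 0 < y -> exists t : upper R, val t = (x +i* y : C).
Proof. by move=> y0; exists (exist _ (x +i* y : C) y0). Qed.

Lemma xq_norm_surj M (eps : R) : (0 < M)%N -> 0 < eps < 1 -> exists t, nrm (xq M t) = eps.
Proof.
move=> M0 /andP[e0 e1].
have p0 : 0 < pi :> R by exact: pi_gt0.
have M0' : 0 < M%:R :> R by rewrite ltr0n.
have [|t tE] := @upper_exists 0 (- ln eps * M%:R / (2 * pi)).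
  by rewrite divr_gt0 ?mulr_gt0 // oppr_gt0 ln_lt0 // e0.
exists t; rewrite nrm_xqE tE /=.
have -> : - (2 * pi * (- ln eps * M%:R / (2 * pi) / M%:R)) = ln eps.
  move: (pi : R) (ln eps) (M%:R : R) p0 M0' => p l m p0 m0.
  by field; rewrite !lt0r_neq0.
by rewrite lnK // posrE.
Qed.

Lemma xq_norm_lt1 M t : (0 < M)%N -> 0 < nrm (xq M t) < 1.
Proof. by move=> M0; exact: nrm_xq. Qed.

Lemma nrm_term (a x : C) j : nrm (a * x ^+ j) = nrm a * nrm x ^+ j.
Proof. by rewrite nrmM nrmX. Qed.

(** Abel's lemma. At the point t' with half the imaginary part, |X'|^2 = |X|, and the terms there
    are bounded by convergence; hence the terms at t are dominated by a geometric series in |X'|. *)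
Lemma hasSum_series (b : nat -> C) M (f : upper R -> C) : (0 < M)%N ->
  (forall t, scvg (fun J => \sum_(j < J) b j * xq M t ^+ j) (f t)) ->
  forall t, hasSum (fun j => b j * xq M t ^+ j) (f t).
Proof.
move=> M0 H t.
have [t' t'E] := @upper_exists 0 (Im (val t) / 2) ltac:(by rewrite divr_gt0 ?Im_upper).
have [X' [r0 r1 rE] S'] : exists2 X' : C, [/\ 0 < nrm X', nrm X' < 1 & nrm (xq M t) = nrm X' ^+ 2] &
    scvg (fun J => \sum_(j < J) b j * X' ^+ j) (f t').
  exists (xq M t'); last exact: H.
  have /andP[h0 h1] := xq_norm_lt1 t' M0; split=> //.
  rewrite !nrm_xqE t'E /= expr2 -expRD; congr expR; field.
  by rewrite pnatr_eq0 -lt0n.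
have [J HJ] := S' 1 ltr01.
pose B := 2 + \sum_(j < J) nrm (b j * X' ^+ j).
have S0 : 0 <= \sum_(j < J) nrm (b j * X' ^+ j) by apply: sumr_ge0 => j _; exact: nrm_ge0.
have HB n : nrm (b n * X' ^+ n) <= B.
  have [nJ|nJ] := ltnP n J.
    rewrite /B (bigD1 (Ordinal nJ)) //=.
    have : 0 <= \sum_(i < J | i != Ordinal nJ) nrm (b i * X' ^+ i) by apply: sumr_ge0 => j _; exact: nrm_ge0.
    lra.
  have h1 := HJ n nJ; have h2 := HJ n.+1 (leqW nJ).
  rewrite big_ord_recr /= in h2.
  move: h1 h2; set a := \sum_(_ < _) _; set c := b n * _ => h1 h2.
  have -> : c = (a + c - f t') - (a - f t') by ring.
  apply: le_trans (nrmB _ _) _; rewrite /B; lra.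
have ab : absum (fun j => nrm (b j * xq M t ^+ j)).
  apply: (@absum_le _ _ _ (fun j => B * nrm X' ^+ j)) => [j|].
    have := HB j; rewrite !nrm_term rE -exprM mulnC exprM expr2 mulrA => h.
    by rewrite ler_wpM2r ?exprn_ge0 // ltW.
  by apply: absumZ; [rewrite /B; lra|apply: absum_geo; rewrite ltW].
have [l Hl] := absum_hasSum ab.
by rewrite (scvg_uniq (H t) (hasSum_nat Hl)).
Qed.

(** By strong induction the lower coefficients vanish. After division by X^n the tail at |X| = eps
    is at most 2 eps times the sum of norms at a reference point with |X1| = 1/2, so b n is
    arbitrarily small. *)
Lemma series_uniq (b : nat -> C) M : (0 < M)%N ->
  (forall t, hasSum (fun j => b j * xq M t ^+ j) 0) -> forall n, b n = 0.
Proof.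
move=> M0 H; elim/ltn_ind => n IH.
have H1 t : hasSum (fun j => b (n + j.+1)%N * xq M t ^+ j.+1) (- b n).
  have phiK : cancel (addn n) (subn^~ n) by move=> j; rewrite addKn.
  have X0 : xq M t ^+ n != 0 by rewrite expf_neq0 // /xq ee_neq0.
  have H2 : hasSum (fun j => b (n + j)%N * xq M t ^+ j) 0.
    rewrite -(mulr0 (xq M t ^+ n)^-1).
    have := hasSum_reindexV phiK _ (H t); move=> h.
    apply: hasSum_ext (hasSumZ (xq M t ^+ n)^-1 (h _)) => [j|j].
      by rewrite exprD mulrCA mulKf.
    have [jn|jn] := ltnP j n; first by rewrite IH // mul0r eqxx.
    by rewrite subnKC.
  by have := hasSum_succ H2; rewrite addn0 expr0 mulr1 sub0r.
have [t1 t1E] := @xq_norm_surj M (1 / 2) M0 ltac:(lra).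
have := H1 t1; move: (xq M t1) t1E => X1 X1E H1t.
have [B HB] := hasSum_absum H1t; have B0 : 0 <= B by have := HB [::] isT; rewrite big_nil.
apply: nrm_le0 => e e0.
pose eps := Order.min (1 / 4) (e / (2 * (B + 1))).
have eps0 : 0 < eps by rewrite lt_min divr_gt0 //= divr_gt0 // mulr_gt0 //; lra.
have eps1 : eps <= 1 / 4 by rewrite ge_min lexx.
have eps2 : eps * (2 * (B + 1)) <= e by rewrite -ler_pdivlMr ?ge_min ?lexx ?orbT // mulr_gt0 //; lra.
have [t tE] := @xq_norm_surj M eps M0 ltac:(rewrite eps0 /=; lra).
have := H1 t; move: (xq M t) tE => X XE Ht.
rewrite -[b n]opprK nrmN; apply: (@le_trans _ _ (2 * eps * B)); last first.
  have : 0 <= eps * 2 by rewrite mulr_ge0 // ltW.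
  lra.
apply: (hasSum_bound Ht) => A uA.
apply: (@le_trans _ _ (2 * eps * \sum_(j <- A) nrm (b (n + j.+1)%N * X1 ^+ j.+1))); last first.
  by rewrite ler_wpM2l ?HB // mulr_ge0 // ltW.
rewrite mulr_sumr; apply: ler_sum => j _.
rewrite !nrm_term XE X1E [X in _ <= X]mulrCA; apply: ler_wpM2l; first exact: nrm_ge0.
have -> : eps ^+ j.+1 = (2 * eps) ^+ j.+1 * (1 / 2) ^+ j.+1 by rewrite -exprMn; congr (_ ^+ _); field.
rewrite ler_wpM2r ?exprn_ge0 //.
rewrite exprS ler_piMr ?exprn_ile1 //; lra.
Qed.

Definition gphi M m j : rat := j%:R / M%:R - m%:R.
Definition gpsi M m r : nat := absz (numq ((r + m%:R) * M%:R)).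

Lemma gphiK M m : (0 < M)%N -> cancel (gphi M m) (gpsi M m).
Proof.
move=> M0 j; rewrite /gphi /gpsi subrK divfK ?pnatr_eq0 -?lt0n //.
by rewrite pmulrn numq_int.
Qed.

Lemma qpow_gphi M m j t : qpow (m%:R) t * qpow (gphi M m j) t = xq M t ^+ j.
Proof. by rewrite -qpowD /gphi addrC subrK qpow_xq. Qed.

Lemma rat_series_uniq (D : rat -> C) M m : (0 < M)%N ->
  (forall r, D r != 0 -> exists j, r = gphi M m j) ->
  (forall t, hasSum (fun r => D r * qpow r t) 0) -> forall r, D r = 0.
Proof.
move=> M0 sup H r; apply/eqP/negP => /negP Dr; have [j rE] := sup r Dr.
move/eqP: Dr; apply; rewrite rE; apply: (@series_uniq (fun j => D (gphi M m j)) M) => // t.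
rewrite -(mulr0 (qpow m%:R t)).
have := hasSum_reindexV (gphiK m M0) _ (H t); move=> h.
apply: hasSum_ext (hasSumZ _ (h _)) => [i|s]; first by rewrite mulrCA qpow_gphi.
by rewrite mulf_eq0 negb_or => /andP[/sup[i ->] _]; rewrite gphiK.
Qed.

Lemma scvgZ (a : C) (u : nat -> C) l : scvg u l -> scvg (fun n => a * u n) (a * l).
Proof.
move=> H e e0; have a0 : 0 < nrm a + 1 by have := nrm_ge0 a; lra.
have [n Hn] := H (e / (nrm a + 1)) (divr_gt0 e0 a0); exists n => j nj.
have h := Hn j nj; rewrite -mulrBr nrmM.
have : nrm (u j - l) * (nrm a + 1) < e by rewrite -ltr_pdivlMr.
have := nrm_ge0 (u j - l); lra.
Qed.

Variable d : nat.
Local Notation V := 'cV[C]_d.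
Implicit Types (f : upper R -> V) (c : rat -> V).

(** Stricter than [is_fourier]: no polar terms, and an unordered sum over all rational exponents.
    The sum does not refer to M, so expansions with different denominators can be compared. *)
Definition expands M f c := [/\ (0 < M)%N, forall r, c r != 0 -> exists j : nat, r = j%:R / M%:R &
  forall t i, hasSum (fun r => c r i 0 * qpow r t) (f t i 0)].

Lemma entry_neq0 (w : V) i : w i 0 != 0 -> w != 0.
Proof. by apply: contra => /eqP ->; rewrite mxE. Qed.

(** [fe f] is some expansion, possibly with another denominator M' and a polar part of order m'. The
    difference of the two expansions sums to 0 and is supported on the grid of denominator M M'
    starting at -m', so it vanishes. *)
Lemma expands_fe M f c : expands M f c -> fe f = c.
Proof.
move=> [M0 sup H].
have fc : is_fourier f c.
  exists M, 0%N; split; first by split=> // r /sup[j ->]; exists j; rewrite subr0.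
  move=> t i; apply/scvgP.
  have := hasSum_reindexV (gphiK 0 M0) _ (H t i); move=> h; apply: hasSum_nat (h _) => r.
  rewrite mulf_eq0 negb_or => /andP[/entry_neq0/sup[j ->] _].
  have -> : j%:R / M%:R = gphi M 0 j by rewrite /gphi subr0.
  by rewrite gphiK.
have /= [M' [m' [[M0' sup'] H']]] : is_fourier f (fe f) by apply: (@xgetPex _ 0 (is_fourier f)); exists c.
apply/funext => r; apply/matrixP => i o; rewrite ord1 {o}; apply/esym/eqP; rewrite -subr_eq0; apply/eqP.
have Hs : forall t, hasSum (fun r => fe f r i 0 * qpow r t) (f t i 0).
  move=> t; have S t' : scvg (fun J => \sum_(j < J) fe f (gphi M' m' j) i 0 * xq M' t' ^+ j) (qpow m'%:R t' * f t' i 0).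
    have /scvgP := H' t' i => /(scvgZ (qpow m'%:R t')); rewrite /scvg => S e e0.
    have [n Hn] := S e e0; exists n => J /Hn; rewrite mulr_sumr.
    suff -> : \sum_(j < J) fe f (gphi M' m' j) i 0 * xq M' t' ^+ j =
      \sum_(j < J) qpow m'%:R t' * (fe f (j%:R / M'%:R - m'%:R) i 0 * qpow (j%:R / M'%:R - m'%:R) t') by [].
    by apply: eq_bigr => j _; rewrite mulrCA qpow_gphi.
  have HS := @hasSum_series (fun j => fe f (gphi M' m' j) i 0) M' _ M0' S t.
  have := hasSumZ (qpow m'%:R t)^-1 HS; rewrite mulKf ?qpow_neq0 // => HZ.
  apply: (hasSum_reindex (gphiK m' M0')) => [s|].
    by rewrite mulf_eq0 negb_or => /andP[/entry_neq0/sup'[j ->] _]; rewrite gphiK.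
  by apply: hasSum_ext HZ => j; rewrite -(qpow_gphi M' m' j t) mulrCA mulKf ?qpow_neq0.
apply: (@rat_series_uniq (fun r => c r i 0 - fe f r i 0) (M * M') m').
- by rewrite muln_gt0 M0.
- move=> s; have n1 : (M%:R : rat) != 0 by rewrite pnatr_eq0 -lt0n.
  have n2 : (M'%:R : rat) != 0 by rewrite pnatr_eq0 -lt0n.
  have [E1|/entry_neq0/sup[j ->] _] := eqVneq (c s i 0) 0; last first.
    by exists (j * M' + m' * (M * M'))%N; rewrite /gphi natrD !natrM; field; rewrite n1 n2.
  rewrite E1 sub0r oppr_eq0 => /entry_neq0/sup'[j ->].
  by exists (j * M)%N; rewrite /gphi !natrM; field; rewrite n1 n2.
- move=> t; have := hasSumB (H t i) (Hs t); rewrite subrr; apply: hasSum_ext => s.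
  by rewrite mulrBl.
Qed.

Lemma expandsD M f g c c' : expands M f c -> expands M g c' ->
  expands M (fun t => f t + g t) (fun r => c r + c' r).
Proof.
move=> [M0 s1 H1] [_ s2 H2]; split=> // [r|t i].
  have [->|/s1 //] := eqVneq (c r) 0; by rewrite add0r => /s2.
by rewrite mxE; apply: hasSum_ext (hasSumD (H1 t i) (H2 t i)) => r; rewrite mxE mulrDl.
Qed.

Lemma expandsZ M f c (a : C) : expands M f c -> expands M (fun t => a *: f t) (fun r => a *: c r).
Proof.
move=> [M0 s1 H1]; split=> // [r|t i].
  by have [->|/s1 //] := eqVneq (c r) 0; rewrite scaler0 eqxx.
by rewrite mxE; apply: hasSum_ext (hasSumZ a (H1 t i)) => r; rewrite mxE mulrA.
Qed.

Lemma expands_series M f (a : nat -> V) : (0 < M)%N ->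
  (forall t i, hasSum (fun n => a n i 0 * xq M t ^+ n) (f t i 0)) ->
  exists2 c, expands M f c & forall n, c (n%:R / M%:R) = a n.
Proof.
move=> M0 H; pose c r := if r == gphi M 0 (gpsi M 0 r) then a (gpsi M 0 r) else 0.
have cE n : c (gphi M 0 n) = a n by rewrite /c gphiK // eqxx.
exists c; last by move=> n; rewrite -cE /gphi subr0.
split=> // [r|t i].
  have [e _|e] := eqVneq r (gphi M 0 (gpsi M 0 r)); last by rewrite /c (negPf e) eqxx.
  by exists (gpsi M 0 r); rewrite {1}e /gphi subr0.
apply: (hasSum_reindex (gphiK 0 M0)) => [r|].
  have [e //|e] := eqVneq r (gphi M 0 (gpsi M 0 r)).
  by rewrite /c (negPf e) mxE mul0r eqxx.
apply: hasSum_ext (H t i) => n; rewrite cE /gphi subr0 qpow_xq //.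
Qed.

(** Translation by N multiplies the coefficient at r by e(rN). By uniqueness of expansions this
    factor is 1 wherever the coefficient is nonzero, so that rN is an integer. *)
Lemma expands_periodic M N f c : (0 < N)%N -> expands M f c ->
  (forall t t', val t' = val t + N%:R -> f t' = f t) ->
  forall r, c r != 0 -> exists n : nat, r = n%:R / N%:R.
Proof.
move=> N0 Ex per r cr; have [M0 sup H] := Ex.
have Ex' : expands M f (fun r => ee (ratr r * N%:R) *: c r).
  split=> // [s|t i]; first by have [->|/sup //] := eqVneq (c s) 0; rewrite scaler0 eqxx.
  have [t' t'E] : exists t' : upper R, val t' = val t + N%:R.
    have p : 0 < Im (val t + N%:R) by rewrite !ReImE Im_nat addr0 Im_upper.
    by exists (exist (fun z : C => 0 < Im z) _ p).
  rewrite -(per t t' t'E); apply: hasSum_ext (H t' i) => s.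
  by rewrite !qpowE t'E mulrDr eeD mxE; ring.
have := congr1 (fun g => g r) (etrans (esym (expands_fe Ex')) (expands_fe Ex)) => /= E.
have e1 : ee (ratr r * N%:R : C) = 1.
  apply/eqP; rewrite -subr_eq0; have : (ee (ratr r * N%:R) - 1) *: c r = 0 by rewrite scalerBl E scale1r subrr.
  by move/eqP; rewrite scaler_eq0 (negPf cr) orbF.
have [n nE] : exists n : int, (ratr r * N%:R : C) = n%:~R.
  apply/not_existsP => h; have := @ee_eq1 R (ratr r * N%:R); rewrite e1 eqxx.
  by move=> /(_ _)/negP; case=> // n; apply/eqP => e; apply: (h n).
have rN : r * N%:R = n%:~R.
  by apply: (fmorph_inj (ratr : {rmorphism rat -> C})); rewrite rmorphM /= rmorph_nat rmorph_int.
have N00 : (N%:R : rat) != 0 by rewrite pnatr_eq0 -lt0n.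
have [j rj] := sup r cr.
have n0 : 0 <= n by rewrite -(ler0z rat) -rN rj mulr_ge0 ?divr_ge0.
exists (absz n); have -> : (`|n|%N)%:R = n%:~R :> rat by rewrite -[in RHS](gez0_abs n0) -pmulrn.
by rewrite -rN mulfK.
Qed.

End FourierUniqueness.

(** * Invariants *)

Section Cosets.

Lemma SL2Z_unit (g : 'M[int]_2) : SL2Z g -> g \in unitmx.
Proof. by rewrite /SL2Z /= unitmxE => ->; exact: unitr1. Qed.

Lemma SL2Z_inv (g : 'M[int]_2) : SL2Z g -> SL2Z (invmx g).
Proof. by move=> gS; rewrite /SL2Z /= det_inv gS invr1. Qed.

Lemma ltrans_congr (M : nat) (g h D : 'M[int]_2) : SL2Z g -> SL2Z h -> g = h + M%:Z *: D ->
  ltrans g (Gamma_1 M) `<=` ltrans h (Gamma_1 M).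
Proof.
move=> gS hS gE _ [c [cS [c1 c2 c3]] <-].
have hu := SL2Z_unit hS; pose X := invmx h *m (g *m c).
have XE i j : X i j = (invmx h *m (D *m c)) i j * M%:Z + c i j.
  by rewrite /X gE mulmxDl mulmxDr mulKmx // -scalemxAl -scalemxAr !mxE addrC mulrC.
exists X; last by rewrite /X mulmxA mulmxV // mul1mx.
split; first by rewrite /X /SL2Z /= !det_mulmx (SL2Z_inv hS) gS cS !mul1r.
by split; rewrite XE modzMDl.
Qed.

(** By [ltrans_congr] a coset of Gamma_1(M) depends only on the residues modulo M of a
    representative, and these range over a finite set. *)
Lemma lcosets_finite (M : nat) : (0 < M)%N -> finite_set (Defs.lcosets (Gamma_1 M)).
Proof.
move=> M0; pose red (g : 'M[int]_2) : {ffun 'I_2 * 'I_2 -> 'I_M.+1} :=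
  [ffun ij => inord (absz (g ij.1 ij.2 %% M%:Z)%Z)].
pose F (m : {ffun 'I_2 * 'I_2 -> 'I_M.+1}) :=
  ltrans (xget 1%:M [set g | SL2Z g /\ red g = m]) (Gamma_1 M).
apply: (@sub_finite_set _ _ (F @` setT)); last exact/finite_image/finite_finset.
have M0' : M%:Z != 0 by lia.
move=> _ [g gS <-]; exists (red g) => //; rewrite /F; set h := xget _ _.
have [hS hE] : SL2Z h /\ red h = red g.
  by apply: (@xgetPex _ 1%:M [set h | SL2Z h /\ red h = red g]); exists g.
have congr (a b : 'M[int]_2) : red a = red b ->
    a = b + M%:Z *: (\matrix_(i, j) ((a i j %/ M%:Z)%Z - (b i j %/ M%:Z)%Z)).
  move=> ab; apply/matrixP => i j; rewrite !mxE.
  have := congr1 (fun f : {ffun _ -> _} => nat_of_ord (f (i, j))) ab; rewrite !ffunE /=.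
  have a1 := divz_eq (a i j) M%:Z; have b1 := divz_eq (b i j) M%:Z.
  have a2 := modz_ge0 (a i j) M0'; have b2 := modz_ge0 (b i j) M0'.
  have a3 : (a i j %% M%:Z)%Z < M%:Z by apply: ltz_pmod; lia.
  have b3 : (b i j %% M%:Z)%Z < M%:Z by apply: ltz_pmod; lia.
  rewrite !inordK; [|by lia ..] => e; rewrite {1}a1 {1}b1; nia.
by apply/seteqP; split; [apply: ltrans_congr (congr _ _ hE)|apply: ltrans_congr (congr _ _ (esym hE))].
Qed.

End Cosets.

(** * Coordinates in a rational basis, and descent of invariants *)

Section Coordinates.
Variables (R : realType) (d : nat).
Local Notation C := (Cplx R).
Local Notation V := 'cV[C]_d.
Variable v : d.-tuple V.
Let Vm : 'M[C]_d := \matrix_(i, j) tnth v j i 0.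
Hypothesis Vu : Vm \in unitmx.
Local Notation co w j := (coords v w j 0).

Lemma mulVm (a : V) : Vm *m a = \sum_j a j 0 *: tnth v j.
Proof.
apply/matrixP => i o; rewrite ord1 mxE summxE; apply: eq_bigr => j _.
by rewrite !mxE mulrC.
Qed.

Lemma coordsE w : w = \sum_j co w j *: tnth v j.
Proof. by rewrite -mulVm /coords mulKVmx. Qed.

Lemma coords_comb (a : 'I_d -> C) j : co (\sum_i a i *: tnth v i) j = a j.
Proof.
have -> : \sum_i a i *: tnth v i = Vm *m \col_i a i.
  by rewrite mulVm; apply: eq_bigr => i _; rewrite mxE.
by rewrite /coords mulKmx // mxE.
Qed.

Lemma coordsD u w j : co (u + w) j = co u j + co w j.
Proof. by rewrite /coords mulmxDr mxE. Qed.
Lemma coordsZ (a : C) w j : co (a *: w) j = a * co w j.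
Proof. by rewrite /coords -scalemxAr mxE. Qed.
Lemma coords0 j : co 0 j = 0. Proof. by rewrite /coords mulmx0 mxE. Qed.
Lemma coords_sum (J : Type) (r : seq J) (F : J -> V) j :
  co (\sum_(i <- r) F i) j = \sum_(i <- r) co (F i) j.
Proof. by rewrite /coords mulmx_sumr summxE. Qed.
Lemma coords_inj u w : (forall j, co u j = co w j) -> u = w.
Proof. by move=> e; rewrite [u]coordsE [w]coordsE; apply: eq_bigr => j _; rewrite e. Qed.

Section Expansion.
Variable K : C -> Prop.
Hypothesis HK : Kfield K.

Lemma ps_dvd (N N0 : nat) F : (0 < N0)%N -> (N %| N0)%N -> ps K (@xq R N) F -> ps K (@xq R N0) F.
Proof.
move=> N00 /dvdnP[e eE] [a Ka Ha].
have [e0 Np] : (0 < e)%N /\ (0 < N)%N by move: N00; rewrite eE muln_gt0 => /andP[].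
exists (fun n => if (e %| n)%N then a (n %/ e)%N else 0) => [n|t].
  by case: ifP => // _; exact: K0.
have phiK : cancel (muln^~ e) (divn^~ e) by move=> n; rewrite mulnK.
apply: (hasSum_reindex phiK) => [n|].
  by case: ifP => [/divnK|]; rewrite ?mul0r ?eqxx.
apply: hasSum_ext (Ha t) => n; rewrite dvdn_mull // mulnK // mulnC exprM; congr (_ * _ ^+ _).
rewrite /xq -ee_nat; congr ee; rewrite eE natrM.
by field; rewrite !pnatr_eq0 -!lt0n e0 Np.
Qed.

Lemma ps_expands M (f : upper R -> V) (T : C) : (0 < M)%N -> T != 0 ->
  (forall j, ps K (@xq R M) (fun t => co (f t) j / T)) ->
  exists c, expands M f c /\ forall r j, K (co (c r) j / T).
Proof.
move=> M0 T0 H.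
have ex j : exists a : nat -> C, (forall n, K (a n)) /\
    forall t, hasSum (fun n => a n * xq M t ^+ n) (co (f t) j / T).
  by have [a ? ?] := H j; exists a.
pose al j := sval (cid (ex j)); have alP j := svalP (cid (ex j)).
pose a n : V := T *: (\sum_j al j n *: tnth v j).
have HS t i : hasSum (fun n => a n i 0 * xq M t ^+ n) (f t i 0).
  have -> : f t i 0 = \sum_j (T * tnth v j i 0) * (co (f t) j / T).
    rewrite {1}[f t]coordsE summxE; apply: eq_bigr => j _; rewrite mxE mulrC [RHS]mulrC.
    by rewrite -mulrA mulKf // mulrC.
  have := @hasSum_sum R _ _ (index_enum 'I_d) (fun j n => (T * tnth v j i 0) * (al j n * xq M t ^+ n)) _
    (fun j => hasSumZ (T * tnth v j i 0) ((alP j).2 t)).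
  apply: hasSum_ext => n; rewrite /a mxE summxE mulr_sumr mulr_suml; apply: eq_bigr => j _.
  by rewrite mxE; ring.
have [c Ec cE] := expands_series M0 HS; exists c; split=> // r j.
have [_ sup _] := Ec; have [->|/sup[n ->]] := eqVneq (c r) 0.
  by rewrite coords0 mul0r; exact: K0.
rewrite cE /a coordsZ coords_comb mulrC mulKf //; exact: (alP j).1.
Qed.

Lemma Phi_expands (k l N N0 : nat) (x : tensor1 R d) (y : tensor2 R d) :
  (0 < N)%N -> (0 < N0)%N -> (N %| N0)%N -> (1 < k)%N -> (0 < l < k)%N ->
  (forall S j, K (co (x S) j)) -> (forall S j, K (co (y S) j)) ->
  exists c, expands N0 (Phi k l N N0 (x, y)) c /\ forall r j, K (co (c r) j / tpi R ^+ k).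
Proof.
move=> Np N0p dv k1 /andP[l0 lk] Kx Ky; have T0 n : tpi R ^+ n != 0 by rewrite expf_neq0 ?tpi_neq0.
apply: ps_expands => // j.
have fN := lcosets_finite Np; have fN0 := lcosets_finite N0p.
pose s1 := finmap.enum_fset (fset_set (Defs.lcosets (Gamma_1 N))).
pose s2 := finmap.enum_fset (fset_set (Defs.lcosets (Gamma_1 N0) `*` Defs.lcosets (Gamma_1 N0))).
have P1 : ps K (@xq R N0) (fun t => \sum_(S <- s1) co (x S) j * (eisG k N (brow S).1 (brow S).2 t / tpi R ^+ k)).
  apply: (ps_sum HK) => S; apply: (psZ HK) => //.
  by apply: (ps_dvd N0p dv); apply: eisG_expansion => //; exact: ltnW.
have P2 : ps K (@xq R N0) (fun t => \sum_(S <- s2) co (y S) j *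
    ((eisG l N0 (brow S.1).1 (brow S.1).2 t / tpi R ^+ l) *
     (eisG (k - l) N0 (brow S.2).1 (brow S.2).2 t / tpi R ^+ (k - l)))).
  apply: (ps_sum HK) => S; apply: (psZ HK) => //; apply: (psM HK); apply: eisG_expansion => //.
  by rewrite subn_gt0.
apply: ps_ext (psD HK P1 P2) => t.
have -> : Phi k l N N0 (x, y) t = Phi1 k N x t + Phi2 k l N0 y t by [].
rewrite coordsD mulrDl; congr (_ + _).
  rewrite /Phi1 fsbig_finite // coords_sum mulr_suml; apply: eq_bigr => S _.
  by rewrite coordsZ mulrC mulrAC.
rewrite /Phi2 fsbig_finite; last exact: finite_setX.
rewrite coords_sum mulr_suml; apply: eq_bigr => S _; rewrite coordsZ.
have -> : tpi R ^+ k = tpi R ^+ l * tpi R ^+ (k - l) by rewrite -exprD subnKC // ltnW.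
rewrite invfM; move: (tpi R ^+ l)^-1 (tpi R ^+ (k - l))^-1 => A B.
move: (eisG l N0 (brow S.1).1 (brow S.1).2 t) (eisG (k - l) N0 (brow S.2).1 (brow S.2).2 t) (co (y S) j) => p q z.
by ring.
Qed.

End Expansion.

Section Descent.
Variable K : C -> Prop.
Hypothesis HK : Kfield K.
Variables (Gam : set 'M[int]_2) (rho : 'M[int]_2 -> 'M[C]_d) (V0 : set V).
Hypothesis V0E : forall w, V0 w <-> forall j, K (co w j).
Hypothesis V0rho : forall g w, Gam g -> V0 w -> V0 (rho g *m w).

Lemma V0B u w : V0 u -> V0 w -> V0 (u - w).
Proof.
move=> /V0E hu /V0E hw; apply/V0E => j; rewrite -scaleN1r coordsD coordsZ mulN1r.
by apply: KD => //; exact: KN.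
Qed.

(* Expand the coordinates of x over a K-basis of their K-span: since rho preserves
   V0, invariance holds for each component. *)
Lemma descent (T : eqType) (L : seq T) (x : T -> V) : (forall S, S \notin L -> x S = 0) ->
  exists (e : seq C) (xs : nat -> T -> V), [/\ forall n S, V0 (xs n S),
    forall n S, S \notin L -> xs n S = 0, forall S, x S = \sum_(n < size e) e`_n *: xs n S &
    forall g (al : T -> T), Gam g -> (forall S, rho g *m x (al S) = x S) ->
      forall (n : 'I_(size e)) S, rho g *m xs n (al S) = xs n S].
Proof.
move=> x0; have [e [a [_ _ ind Ka aE]]] := K_decompose HK
  [seq (s, j) | s <- L, j <- enum 'I_d] (fun p : T * 'I_d => co (x p.1) p.2).
pose xs n S : V := if S \in L then \sum_j a n (S, j) *: tnth v j else 0.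
have V0xs n S : V0 (xs n S).
  apply/V0E => j; rewrite /xs; case: ifP => _; first by rewrite coords_comb.
  by rewrite coords0; exact: K0.
have xE S : x S = \sum_(n < size e) e`_n *: xs n S.
  have [SL|SL] := boolP (S \in L); last first.
    by rewrite x0 // big1 // => n _; rewrite /xs (negPf SL) scaler0.
  apply: coords_inj => j; rewrite coords_sum (aE (S, j)); last first.
    by apply/allpairsP; exists (S, j); rewrite mem_enum.
  by apply: eq_bigr => n _; rewrite /xs SL coordsZ coords_comb mulrC.
exists e, xs; split=> // [n S SL|g al gG inv n S]; first by rewrite /xs (negPf SL).
apply/eqP; rewrite -subr_eq0; apply/eqP/coords_inj => j; rewrite coords0.
apply: (ind (fun m => co (rho g *m xs m (al S) - xs m S) j)) => [m|].
  by apply: (V0E _).1; apply: V0B => //; exact: V0rho.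
have := inv S; rewrite {1}xE [in RHS]xE mulmx_sumr => /eqP; rewrite -subr_eq0 -sumrB => /eqP h.
transitivity (co (\sum_(i < size e) (rho g *m (e`_i *: xs i (al S)) - e`_i *: xs i S)) j); last by rewrite h coords0.
rewrite coords_sum; apply: eq_bigr => m _.
by rewrite -scalemxAr -scalerBr coordsZ mulrC.
Qed.

End Descent.
End Coordinates.

(** * Correctness of the algorithm *)

Section BasisFamilies.
Variable R : realType.
Local Notation C := (Cplx R).

Lemma basis_over_fam (W : lmodType C) (S : set W) r (F : 'I_r -> W) : (forall i, S (F i)) ->
  (forall w, S w -> exists a : 'I_r -> C, w = \sum_i a i *: F i) ->
  (forall a : 'I_r -> C, \sum_i a i *: F i = 0 -> forall i, a i = 0) ->
  basis_over setT S [seq F i | i <- enum 'I_r].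
Proof.
set s := [seq _ | _ <- _]; have sz : size s = r by rewrite size_map size_enum_ord.
have nthE (i : 'I_r) : s`_i = F i by rewrite (nth_map i) ?size_enum_ord // nth_ord_enum.
clearbody s; case: _ / sz F nthE => F nthE h1 h2 h3.
have sE (a : 'I_(size s) -> C) : \sum_(i < size s) a i *: s`_i = \sum_i a i *: F i.
  by apply: eq_bigr => i _; rewrite nthE.
split=> [i|w /h2[a ->]|a _]; first by rewrite nthE.
  by exists a; rewrite ?sE.
by rewrite sE => /h3.
Qed.

Lemma setT_Kfield : Kfield (fun _ : C => True). Proof. by []. Qed.

End BasisFamilies.

Section AlgorithmCorrectness.
Variable R : realType.
Local Notation C := (Cplx R).
Variable K : C -> Prop.
Hypothesis HK : Kfield K.
Variable k : nat.
Hypothesis hk : (2 <= k)%N.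
Variables (Gam : set 'M[int]_2) (d : nat) (rho : 'M[int]_2 -> 'M[C]_d) (N : nat).
Hypothesis hN : is_level Gam rho N.
Local Notation V := 'cV[C]_d.
Variables (V0 : set V) (v : d.-tuple V).
Hypothesis Vu : (\matrix_(i, j) tnth v j i 0 : 'M[C]_d) \in unitmx.
Hypothesis V0E : forall w, V0 w <-> forall j, K (coords v w j 0).
Hypothesis V0rho : forall g w, Gam g -> V0 w -> V0 (rho g *m w).
Variable P : rat.
Hypothesis hP : forall f g, Mk Gam rho k f -> Mk Gam rho k g -> fe_trunc P f = fe_trunc P g -> f = g.
Variable l : nat.
Hypothesis hl : (1 <= l <= k - 1)%N.
Variable N0 : nat.
Hypothesis hN0 : (0 < N0)%N.
Hypothesis hdvd : (N %| N0)%N.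
Hypothesis hspan : Mk Gam rho k =
     [set Phi1 k N x + Phi2 k l N0 y | x in H0_1 Gam rho N setT & y in H0_2 Gam rho N0 setT].
Local Notation co w j := (coords v w j 0).
Local Notation TT := (tensor1 R d * tensor2 R d)%type.
Local Notation HT := (H0sum Gam rho N N0 setT).
Local Notation Ph := (Phi k l N N0).
Local Notation Mkk := (Mk Gam rho k).
Local Notation nx := (nexp N P).
Local Notation RE := (@row_expansion R d N P v).

Lemma Np : (0 < N)%N. Proof. by case: hN. Qed.

Lemma MkP f : Mkk f <-> exists2 b : TT, HT b & f = Ph b.
Proof.
rewrite hspan; split=> [[x xH [y yH <-]]|[[x y] [xH yH] ->]]; first by exists (x, y).
by exists x => //; exists y.
Qed.

Lemma PhD (b b' : TT) : Ph (b + b') = fun t => Ph b t + Ph b' t.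
Proof.
have fN := lcosets_finite Np; have fN0 := finite_setX (lcosets_finite hN0) (lcosets_finite hN0).
apply/funext => t; have E (c : TT) : Ph c t = Phi1 k N c.1 t + Phi2 k l N0 c.2 t by [].
rewrite !E /Phi1 /Phi2 !fsbig_finite // addrACA -!big_split /=.
by congr (_ + _); apply: eq_bigr => s _; rewrite -scalerDr.
Qed.

Lemma PhZ (a : C) (b : TT) : Ph (a *: b) = fun t => a *: Ph b t.
Proof.
have fN := lcosets_finite Np; have fN0 := finite_setX (lcosets_finite hN0) (lcosets_finite hN0).
apply/funext => t; have E (c : TT) : Ph c t = Phi1 k N c.1 t + Phi2 k l N0 c.2 t by [].
rewrite !E /Phi1 /Phi2 !fsbig_finite // scalerDr !scaler_sumr.
by congr (_ + _); apply: eq_bigr => s _; rewrite !scalerA mulrC -scalerA scalerA [a * _]mulrC -scalerA.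
Qed.

Lemma HTD b b' : HT b -> HT b' -> HT (b + b').
Proof.
move: b b' => [x y] [x' y'] [[h1 _ h3] [g1 _ g3]] [[h1' _ h3'] [g1' _ g3']]; split; split=> //=.
- by move=> s sn; have := h1 s sn; have := h1' s sn => /= e e'; rewrite -[LHS]/(x s + x' s) e e' addr0.
- move=> g gG; apply/funext => s; have := congr1 (fun f => f s) (h3 g gG); have := congr1 (fun f => f s) (h3' g gG) => /= e e'.
  by rewrite -[RHS]/(x s + x' s) -e -e' -mulmxDr.
- by move=> s sn; have := g1 s sn; have := g1' s sn => /= e e'; rewrite -[LHS]/(y s + y' s) e e' addr0.
- move=> g gG; apply/funext => s; have := congr1 (fun f => f s) (g3 g gG); have := congr1 (fun f => f s) (g3' g gG) => /= e e'.
  by rewrite -[RHS]/(y s + y' s) -e -e' -mulmxDr.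
Qed.

Lemma HTZ (a : C) b : HT b -> HT (a *: b).
Proof.
move: b => [x y] [[h1 _ h3] [g1 _ g3]]; split; split=> //=.
- by move=> s sn; have := h1 s sn => /= e; rewrite -[LHS]/(a *: x s) e scaler0.
- move=> g gG; apply/funext => s; have := congr1 (fun f => f s) (h3 g gG) => /= e.
  by rewrite -[RHS]/(a *: x s) -e scalemxAr.
- by move=> s sn; have := g1 s sn => /= e; rewrite -[LHS]/(a *: y s) e scaler0.
- move=> g gG; apply/funext => s; have := congr1 (fun f => f s) (g3 g gG) => /= e.
  by rewrite -[RHS]/(a *: y s) -e scalemxAr.
Qed.

Lemma HT0 : HT 0.
Proof.
split; split=> //=.
- by move=> g gG; apply/funext => s; rewrite -[LHS]/(rho g *m 0) mulmx0.
- by move=> g gG; apply/funext => s; rewrite -[LHS]/(rho g *m 0) mulmx0.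
Qed.

Lemma lk : (0 < l < k)%N. Proof. by move: hl hk; lia. Qed.

Lemma Ph_expands (b : TT) : HT b -> expands N0 (Ph b) (fe (Ph b)).
Proof.
case: b => x y _.
have [c [Ec _]] := Phi_expands Vu (setT_Kfield R) Np hN0 hdvd hk lk (fun _ _ => I : True) (fun _ _ => I : True) (x := x) (y := y).
by rewrite (expands_fe Ec).
Qed.

Lemma Ph_fe_K (b : TT) r j : H0sum Gam rho N N0 V0 b -> K (co (fe (Ph b) r) j / tpi R ^+ k).
Proof.
case: b => x y [[_ /= hx _] [_ /= hy _]].
have [c [Ec Kc]] := Phi_expands Vu HK Np hN0 hdvd hk lk (fun s => (V0E _).1 (hx s)) (fun s => (V0E _).1 (hy s)).
by rewrite (expands_fe Ec).
Qed.

Lemma Mk_periodic f t t' : Mkk f -> val t' = val t + N%:R -> f t' = f t.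
Proof.
(* The translation by N, which belongs to Gamma(N) and so acts trivially through rho. *)
move=> [_ _ inv] tt'; pose g : 'M[int]_2 := 1%:M + N%:Z *: delta_mx 0 1.
have g00 : g 0 0 = 1 by rewrite !mxE /= mulr0 addr0.
have g01 : g 0 1 = N%:Z by rewrite !mxE /= mulr1 add0r.
have g10 : g 1 0 = 0 by rewrite !mxE /= mulr0.
have g11 : g 1 1 = 1 by rewrite !mxE /= mulr0 addr0.
have gN : Gamma_pr N g.
  split.
    rewrite /SL2Z /= -det_tr det_trig.
      rewrite big1 // => i _; rewrite !mxE eqxx (_ : (i == 0) && (i == 1) = false) ?mulr0 ?addr0 //.
      by case: i => [[|[|]]].
    apply/is_trig_mxP => i j ij; rewrite !mxE -[j == i]val_eqE (gtn_eqF ij) add0r.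
    by rewrite -[j == 0]val_eqE (gtn_eqF (leq_ltn_trans (leq0n i) ij)) mulr0.
  by move=> i j; rewrite !mxE addrC mulrC modzMDl.
have [_ triv _] := hN; have [gG rg] := triv g gN.
have jE : jfac g t = 1 by rewrite /jfac g10 g11 mul0r add0r.
have := inv g gG t; rewrite jE rg expr1n invr1 scale1r invmx1 mul1mx.
suff -> : mobius g t = t' by [].
apply: val_inj; rewrite /mobius val_insubd jE g00 g01 divr1 mul1r -pmulrn -tt'.
by case: t' tt' => w hw _ /=; rewrite hw.
Qed.

Lemma Mk_expands f : Mkk f -> expands N0 f (fe f).
Proof. by move=> /MkP[b bH ->]; exact: Ph_expands. Qed.

Lemma Mk_fe_support f r : Mkk f -> fe f r != 0 -> exists n : nat, r = n%:R / N%:R.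
Proof.
move=> fM; apply: (expands_periodic Np (Mk_expands fM)) => t t'; exact: Mk_periodic.
Qed.

Lemma N0Q : 0 < N%:R :> rat. Proof. by rewrite ltr0n Np. Qed.

Lemma nexpP n : (n < nx)%N = (n%:R / N%:R < P).
Proof.
rewrite ltr_pdivrMr ?N0Q // /nexp -[n%:R]/(n%:Z%:~R) -ceil_gt_int.
by move: (Num.ceil _) => c; apply/idP/idP; lia.
Qed.

Lemma roundP_lt n : (n%:R / N%:R < roundP N P) = (n < nx)%N.
Proof.
rewrite nexpP /roundP ltr_pM2r ?invr_gt0 ?N0Q // ltr_pdivrMr ?N0Q //.
by rewrite -[n%:R]/(n%:Z%:~R) ltr_int ceil_gt_int.
Qed.

Definition crow (f : upper R -> V) : 'rV[C]_(nx * d) :=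
  mxvec (\matrix_(n < nx, j < d) co (fe f (n%:R / N%:R)) j).

Lemma coef_row_crow b : coef_row k l N N0 P v b = crow (Ph b).
Proof.
rewrite /coef_row /crow; congr mxvec; apply/matrixP => n j; rewrite !mxE /fe_trunc.
by rewrite roundP_lt ltn_ord.
Qed.

Lemma row_expansion_D u w : RE (u + w) = RE u + RE w.
Proof.
apply/funext => r; rewrite /row_expansion -[RHS]/(_ + _) -big_split /=; apply: eq_bigr => n _.
by rewrite -big_split /=; apply: eq_bigr => j _; rewrite linearD mxE scalerDl.
Qed.

Lemma row_expansion_Z (a : C) u : RE (a *: u) = a *: RE u.
Proof.
apply/funext => r; rewrite /row_expansion -[RHS]/(a *: _) scaler_sumr; apply: eq_bigr => n _.
by rewrite scaler_sumr; apply: eq_bigr => j _; rewrite linearZ mxE scalerA.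
Qed.

Lemma row_expansion_sum r (a : 'I_r -> C) (u : 'I_r -> 'rV[C]_(nx * d)) :
  RE (\sum_i a i *: u i) = \sum_i a i *: RE (u i).
Proof.
rewrite (big_morph (RE) row_expansion_D (id1 := 0)).
  by apply: eq_bigr => i _; rewrite row_expansion_Z.
by rewrite -(scale0r (0 : 'rV[C]_(nx * d))) row_expansion_Z scale0r.
Qed.

Lemma row_expansion_at u (n : 'I_nx) :
  RE u (n%:R / N%:R) = \sum_j vec_mx u n j *: tnth v j.
Proof.
rewrite /row_expansion (bigD1 n) //= [X in _ + X]big1 ?addr0 // => m /andP[/eqP mn /eqP h]; case: h.
apply: val_inj; have := congr1 (fun x => x * N%:R) mn; rewrite !divfK ?lt0r_neq0 ?N0Q // => /eqP.
by rewrite eqr_nat => /eqP.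
Qed.

Lemma row_expansion_off u r : (forall n : 'I_nx, r != n%:R / N%:R) -> RE u r = 0.
Proof. by move=> h; rewrite /row_expansion big1 // => n /eqP e; move: (h n); rewrite e eqxx. Qed.

Lemma row_expansion_inj u : RE u = 0 -> u = 0.
Proof.
move=> h; rewrite -[u]vec_mxK -[RHS](linear0 (@mxvec _ _ _)); congr mxvec; apply/matrixP => n j; rewrite [RHS]mxE.
by rewrite -(coords_comb Vu (fun j => vec_mx u n j)) -row_expansion_at h coords0.
Qed.

(** No coefficient is lost: by [Mk_fe_support] the exponents of a form are among the n/N, and by
    [nexpP] those below P are the ones recorded. *)
Lemma row_expansion_crow f : Mkk f -> RE (crow f) = fe_trunc P f.
Proof.
move=> fM; apply/funext => r; rewrite /fe_trunc.
have [[n rE]|no] := pselect (exists n : 'I_nx, r = n%:R / N%:R).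
  rewrite rE row_expansion_at -nexpP ltn_ord mxvecK [RHS](coordsE Vu).
  by apply: eq_bigr => j _; rewrite mxE.
rewrite row_expansion_off; last by move=> n; apply/eqP => e; apply: no; exists n.
case: ifP => // rP; apply/esym/eqP/negP => /negP /(Mk_fe_support fM)[n rE]; apply: no.
by have h : (n < nx)%N by [rewrite nexpP -rE]; exists (Ordinal h).
Qed.

Lemma crow_inj f g : Mkk f -> Mkk g -> crow f = crow g -> f = g.
Proof. 
move=> fM gM e; apply: (hP fM gM).
exact: (etrans (esym (row_expansion_crow fM)) (etrans (congr1 _ e) (row_expansion_crow gM))). Qed.

Lemma crow_lin (a : C) f g : Mkk f -> Mkk g -> crow (fun t => a *: f t + g t) = a *: crow f + crow g.
Proof.
move=> fM gM; rewrite /crow (expands_fe (expandsD (expandsZ a (Mk_expands fM)) (Mk_expands gM))).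
apply/matrix.rowP => c; case/mxvec_indexP: c => n j; rewrite mxvecE mxE coordsD coordsZ [RHS]mxE; congr (_ + _).
  by rewrite [RHS]mxE mxvecE [in RHS]mxE.
by rewrite mxvecE [in RHS]mxE.
Qed.

Lemma Ph_Mk b : HT b -> Mkk (Ph b). Proof. by move=> h; apply/MkP; exists b. Qed.

Lemma crow_Ph_sum (J : Type) (s : seq J) (a : J -> C) (b : J -> TT) : (forall j, HT (b j)) ->
  HT (\sum_(j <- s) a j *: b j) /\ crow (Ph (\sum_(j <- s) a j *: b j)) = \sum_(j <- s) a j *: crow (Ph (b j)).
Proof.
move=> h; elim: s => [|j s [ih1 ih2]].
  rewrite !big_nil; split; first exact: HT0.
  (* Writing the image of 0 as minus itself plus itself lets [crow_lin] show that its row is 0. *)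
  have e : Ph (0 : TT) = fun t => (-1) *: Ph (0 : TT) t + Ph (0 : TT) t.
    by apply/funext => t; rewrite scaleN1r addNr -(scale0r (0 : TT)) PhZ scale0r.
  by rewrite e crow_lin ?scaleN1r ?addNr //; apply: Ph_Mk; exact: HT0.
rewrite !big_cons; split; first by apply: HTD => //; exact: HTZ.
by rewrite PhD PhZ crow_lin ?ih2 //; exact: Ph_Mk.
Qed.

Section Basis.
Variable bs : seq TT.
Hypothesis hbasis : basis_over K (H0sum Gam rho N N0 V0) bs.

Let A : 'M[C]_(size bs, nx * d) := \matrix_(i < size bs) crow (Ph bs`_i).

Lemma H0sum_setT b : H0sum Gam rho N N0 V0 b -> HT b.
Proof. by move=> [[? _ ?] [? _ ?]]. Qed.

Lemma bsHT (i : 'I_(size bs)) : HT bs`_i.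
Proof. by apply: H0sum_setT; case: hbasis. Qed.

Lemma crow_V0_sub b : H0sum Gam rho N N0 V0 b -> (crow (Ph b) <= A)%MS.
Proof.
case: hbasis => _ sp _ /sp[a _ ->]; have [_ ->] := crow_Ph_sum (index_enum 'I_(size bs)) a bsHT.
apply: summx_sub => i _; apply: scalemx_sub.
by have := row_sub i A; rewrite rowK.
Qed.

(** [descent] writes a complex invariant as a complex combination of invariants with values in V0,
    and these are combinations of the given basis. Finiteness of the coset sets provides the finite
    support that [descent] requires. *)
Lemma crow_sub f : Mkk f -> (crow f <= A)%MS.
Proof.
move=> /MkP[[x y] [[x0 _ xi] [y0 _ yi]] ->].
have fN := lcosets_finite Np; have fN0 := finite_setX (lcosets_finite hN0) (lcosets_finite hN0).
pose L1 := finmap.enum_fset (fset_set (Defs.lcosets (Gamma_1 N))).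
pose L2 := finmap.enum_fset (fset_set (Defs.lcosets (Gamma_1 N0) `*` Defs.lcosets (Gamma_1 N0))).
have L1P s : s \notin L1 <-> ~ Defs.lcosets (Gamma_1 N) s.
  have -> : (s \in L1) = (s \in Defs.lcosets (Gamma_1 N)) by exact: (in_fset_set fN s).
  split=> [/negP h h'|h]; first by apply/h/mem_set.
  by apply/negP => /set_mem.
have L2P s : s \notin L2 <-> ~ (Defs.lcosets (Gamma_1 N0) `*` Defs.lcosets (Gamma_1 N0)) s.
  have -> : (s \in L2) = (s \in Defs.lcosets (Gamma_1 N0) `*` Defs.lcosets (Gamma_1 N0)) by exact: (in_fset_set fN0 s).
  split=> [/negP h h'|h]; first by apply/h/mem_set.
  by apply/negP => /set_mem.
have [e [xs [xV xz xE xinv]]] := descent Vu HK V0E V0rho (fun s h => x0 s ((L1P s).1 h)).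
have [e' [ys [yV yz yE yinv]]] := descent Vu HK V0E V0rho (fun s h => y0 s ((L2P s).1 h)).
have Hx (n : 'I_(size e)) : H0sum Gam rho N N0 V0 (xs n, 0).
  split; split=> //=.
  - by move=> s /L1P/xz.
  - move=> g gG; apply/funext => s; apply: (xinv g (ltrans (invmx g))) => // s'.
    by have := congr1 (fun f => f s') (xi g gG).
  - by move=> s; apply/V0E => j; rewrite coords0; exact: K0.
  - by move=> g gG; apply/funext => s; rewrite -[LHS]/(rho g *m 0) mulmx0.
have Hy (n : 'I_(size e')) : H0sum Gam rho N N0 V0 (0, ys n).
  split; split=> //=.
  - by move=> s; apply/V0E => j; rewrite coords0; exact: K0.
  - by move=> g gG; apply/funext => s; rewrite -[LHS]/(rho g *m 0) mulmx0.
  - by move=> s /L2P/yz.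
  - move=> g gG; apply/funext => s; apply: (yinv g (fun s => (ltrans (invmx g) s.1, ltrans (invmx g) s.2))) => // s'.
    by have := congr1 (fun f => f s') (yi g gG).
pose b (i : 'I_(size e) + 'I_(size e')) : TT := match i with inl n => (xs n, 0) | inr n => (0, ys n) end.
pose a (i : 'I_(size e) + 'I_(size e')) : C := match i with inl n => e`_n | inr n => e'`_n end.
have Hb i : H0sum Gam rho N N0 V0 (b i) by case: i.
have -> : (x, y) = \sum_i a i *: b i.
  rewrite big_sumType /=.
  have e1 (n : 'I_(size e)) : e`_n *: ((xs n, 0) : TT) = (e`_n *: (xs n : tensor1 R d), 0) by rewrite -[LHS]/(_, _) scaler0.
  have e2 (n : 'I_(size e')) : e'`_n *: ((0, ys n) : TT) = (0, e'`_n *: (ys n : tensor2 R d)) by rewrite -[LHS]/(_, _) scaler0.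
  rewrite (eq_bigr _ (fun n _ => e1 n)) (eq_bigr _ (fun n _ => e2 n)).
  have s1 (s : seq 'I_(size e)) : \sum_(n <- s) ((e`_n *: (xs n : tensor1 R d), 0) : TT) = (\sum_(n <- s) e`_n *: (xs n : tensor1 R d), 0).
    by elim: s => [|n s ih]; rewrite ?big_nil // !big_cons ih -[LHS]/(_, _) addr0.
  have s2 (s : seq 'I_(size e')) : \sum_(n <- s) ((0, e'`_n *: (ys n : tensor2 R d)) : TT) = (0, \sum_(n <- s) e'`_n *: (ys n : tensor2 R d)).
    by elim: s => [|n s ih]; rewrite ?big_nil // !big_cons ih -[LHS]/(_, _) addr0.
  rewrite s1 s2 -[RHS]/(_, _) addr0 add0r; congr (_, _); apply/funext => s.
    rewrite -[RHS]/((\sum_(n < size e) e`_n *: (xs n : tensor1 R d)) s) (xE s : x s = _).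
    by elim: (index_enum _) => [|n r ih]; rewrite ?big_nil // !big_cons ih.
  rewrite -[RHS]/((\sum_(n < size e') e'`_n *: (ys n : tensor2 R d)) s) (yE s : y s = _).
  by elim: (index_enum _) => [|n r ih]; rewrite ?big_nil // !big_cons ih.
have [_ ->] := crow_Ph_sum (index_enum _) a (fun i => H0sum_setT (Hb i)).
by apply: summx_sub => i _; apply: scalemx_sub; exact: crow_V0_sub.
Qed.

Lemma sub_crow (u : 'rV[C]_(nx * d)) : (u <= A)%MS -> exists2 f, Mkk f & crow f = u.
Proof.
move=> /submxP[a ->]; have [h1 h2] := crow_Ph_sum (index_enum 'I_(size bs)) (fun i => a 0 i) bsHT.
exists (Ph (\sum_i a 0 i *: bs`_i)); first exact: Ph_Mk.
by rewrite h2 mulmx_sum_row; apply: eq_bigr => i _; rewrite rowK.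
Qed.

Lemma crow_sum (J : Type) (s : seq J) (a : J -> C) (f : J -> upper R -> V) : (forall j, Mkk (f j)) ->
  Mkk (\sum_(j <- s) a j *: f j) /\ crow (\sum_(j <- s) a j *: f j) = \sum_(j <- s) a j *: crow (f j).
Proof.
move=> h; have ex j : exists b : TT, HT b /\ f j = Ph b by have /MkP[b] := h j; exists b.
pose b j := sval (cid (ex j)); have bP j := svalP (cid (ex j)).
have [h1 h2] := crow_Ph_sum s a (fun j => (bP j).1).
have -> : \sum_(j <- s) a j *: f j = Ph (\sum_(j <- s) a j *: b j).
  elim: s {h1 h2} => [|j s ih].
    rewrite !big_nil; apply/funext => t; by rewrite -(scale0r (0 : TT)) PhZ scale0r.
  by rewrite !big_cons ih PhD PhZ (bP j).2.
split; first exact: Ph_Mk.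
by rewrite h2; apply: eq_bigr => j _; rewrite -(bP j).2.
Qed.

Lemma Mk0 : Mkk 0.
Proof. by have [h _] := @crow_sum void [::] (fun _ => 0) (fun _ => 0) ltac:(by case); rewrite big_nil in h. Qed.

Lemma crow0 : crow 0 = 0.
Proof. by have [_ h] := @crow_sum void [::] (fun _ => 0) (fun _ => 0) ltac:(by case); rewrite !big_nil in h. Qed.

(** [crow] maps M_k linearly and bijectively onto the row space of A. Since [dimension] is the
    length of some chosen basis, a basis of length rank A is exhibited, and then the chosen one is
    shown to have the same length. *)
Lemma Mk_dimension : dimension Mkk = \rank A.
Proof.
rewrite /dimension; set Q := [set n | _].
have Qex : Q (\rank A).
  have ex (i : 'I_(\rank A)) : exists f, Mkk f /\ crow f = matrix.row i (row_base A).
    have [|f fM fE] := @sub_crow (matrix.row i (row_base A)); last by exists f.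
    by rewrite (submx_trans (row_sub _ _)) // eq_row_base.
  pose F i := sval (cid (ex i)); have FP i := svalP (cid (ex i)).
  have cF (a : 'I_(\rank A) -> C) : crow (\sum_i a i *: F i) = (\row_i a i) *m row_base A.
    have [_ ->] := crow_sum (index_enum _) a (fun i => (FP i).1).
    by rewrite mulmx_sum_row; apply: eq_bigr => i _; rewrite mxE (FP i).2.
  have MF a : Mkk (\sum_i a i *: F i) by have [] := crow_sum (index_enum _) a (fun i => (FP i).1).
  exists [seq F i | i <- enum 'I_(\rank A)]; last by rewrite size_map size_enum_ord.
  apply: basis_over_fam => [i|f fM|a a0 i]; first exact: (FP i).1.
    have := crow_sub fM; rewrite -(eq_row_base A) => /submxP[D DE].
    exists (fun i => D 0 i); apply: (crow_inj fM (MF _)); rewrite cF DE.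
    by have -> : \row_i D 0 i = D by [apply/matrix.rowP => i; rewrite mxE].
  have := cF a; rewrite a0 crow0 => /esym e.
  have : (\row_i a i) = 0.
    by apply/eqP; rewrite -(mulmx_free_eq0 _ (row_base_free A)) e.
  by move/matrix.rowP/(_ i); rewrite !mxE.
have [b [b1 b2 b3] <-] : Q (xget 0%N Q) by apply: xgetPex; exists (\rank A).
pose B := \matrix_(i < size b) crow b`_i.
have cB (a : 'I_(size b) -> C) : crow (\sum_i a i *: b`_i) = (\row_i a i) *m B.
  have [_ ->] := crow_sum (index_enum _) a b1.
  by rewrite mulmx_sum_row; apply: eq_bigr => i _; rewrite mxE rowK.
have Bf : row_free B.
  apply/inj_row_free => w w0; have h : \sum_(i < size b) w 0 i *: b`_i = 0.
    apply: crow_inj; [by have [] := crow_sum (index_enum _) (fun i => w 0 i) b1|exact: Mk0|].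
    by rewrite cB crow0 -w0; have -> : \row_i w 0 i = w by [apply/matrix.rowP => i; rewrite mxE].
  by apply/matrix.rowP => i; rewrite [RHS]mxE; apply: b3 h i.
rewrite -(eqP Bf); apply/eqP; rewrite eqn_leq; apply/andP; split; apply: mxrankS; apply/row_subP => i.
  by rewrite rowK; apply: crow_sub.
rewrite rowK; have [a _ ->] := b2 _ (Ph_Mk (bsHT i)).
by rewrite cB submxMl.
Qed.

Local Notation cr b := (coef_row k l N N0 P v b).

(** Loop invariant: M lies in the row space of A and, with the remaining blocks, spans it. By
    [Mk_dimension] the test compares ranks inside the row space of A, so success means equality;
    after the last block the invariant itself yields equality. There must be a block because the
    test is only made after one. *)
Lemma main_loop_correct (Bs : seq (seq TT)) m (M : 'M[C]_(m, nx * d)) : (0 < size Bs)%N ->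
  (M <= A)%MS -> (forall b, b \in flatten Bs -> (cr b <= A)%MS) ->
  (forall p (X : 'M[C]_(p, nx * d)), (M <= X)%MS ->
     (forall b, b \in flatten Bs -> (cr b <= X)%MS) -> (A <= X)%MS) ->
  exists r (E : 'M[C]_(r, nx * d)), [/\ is_rref E, (E == A)%MS &
    main_loop Gam rho k l N0 v M Bs = Some [seq RE (matrix.row i E) | i <- enum 'I_r]].
Proof.
elim: Bs m M => // B Bs IH m M _ MA BA AX.
pose X := col_mx M (\matrix_(i < size B) cr B`_i).
have [rr /andP[rX Xr]] := rrefP X.
have XA : (X <= A)%MS.
  rewrite col_mx_sub MA; apply/row_subP => i; rewrite rowK; apply: BA.
  by rewrite /= mem_cat mem_nth.
have BX b : b \in B -> (cr b <= X)%MS.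
  move=> bB; have ib : (index b B < size B)%N by rewrite index_mem.
  apply: (submx_trans _ (_ : (\matrix_(i < size B) cr B`_i <= X)%MS)); last by rewrite -addsmxE addsmxSr.
  have := row_sub (Ordinal ib) (\matrix_(i < size B) cr B`_i); by rewrite rowK /= nth_index.
have MX : (M <= X)%MS by rewrite -addsmxE addsmxSl.
have rA : (rref X <= A)%MS by exact: submx_trans XA.
rewrite [main_loop _ _ _ _ _ _ _ _]/= -/X Mk_dimension.
case: ifP => rk.
  exists (\rank X), (rref X); split=> //; rewrite rA /=.
  by have [_ <-] := mxrank_leqif_sup rA.
case: Bs IH BA AX => [|B' Bs] IH BA AX.
  have AX' : (A <= rref X)%MS.
    apply: AX => [|b]; first exact: submx_trans Xr.
    by rewrite /= cats0 => /BX h; exact: submx_trans Xr.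
  by move: rk; have [_ ->] := mxrank_leqif_sup rA; rewrite AX'.
apply: IH => // [b bB|p Y rY hY]; first by apply: BA; rewrite /= mem_cat bB orbT.
apply: AX => [|b]; first exact: (submx_trans MX (submx_trans Xr rY)).
rewrite [flatten _]/= mem_cat => /orP[/BX h|]; last exact: hY.
exact: (submx_trans h (submx_trans Xr rY)).
Qed.

Lemma rref_entries_K r (E : 'M[C]_(r, nx * d)) : is_rref E -> (E == A)%MS -> forall i j, K (E i j).
Proof.
move=> hE EA; have T0 : (tpi R ^+ k)^-1 != 0 by rewrite invr_eq0 expf_neq0 ?tpi_neq0.
apply: (rref_K HK (A := (tpi R ^+ k)^-1 *: A)) => //.
  have h := eqmx_scale A T0; by rewrite /eqmx /= !h.
move=> i c; rewrite mxE mxE; case/mxvec_indexP: c => n j; rewrite mxvecE mxE mulrC.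
by apply: Ph_fe_K; case: hbasis.
Qed.

End Basis.

Lemma algorithm_correct (Bs : seq (seq TT)) : (0 < size Bs)%N ->
  basis_over K (H0sum Gam rho N N0 V0) (flatten Bs) ->
  exists out : seq (rat -> V),
    [/\ algorithm Gam rho k l N N0 P v Bs = Some out,
        basis_over setT [set fe_trunc P f | f in Mkk] out &
        forall i : 'I_(size out), FE_trunc P V0 out`_i].
Proof.
move=> hBs hb; pose A := \matrix_(i < size (flatten Bs)) crow (Ph (flatten Bs)`_i).
have bA b : b \in flatten Bs -> (coef_row k l N N0 P v b <= A)%MS.
  move=> bB; have ib : (index b (flatten Bs) < size (flatten Bs))%N by rewrite index_mem.
  by have := row_sub (Ordinal ib) A; rewrite rowK /= nth_index // coef_row_crow.
have AX p (X : 'M[C]_(p, nx * d)) : ((0 : 'M[C]_(0, nx * d)) <= X)%MS ->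
    (forall b, b \in flatten Bs -> (coef_row k l N N0 P v b <= X)%MS) -> (A <= X)%MS.
  by move=> _ hX; apply/row_subP => i; rewrite rowK -coef_row_crow; apply: hX; rewrite mem_nth.
have [r [E [hE EA]]] := main_loop_correct hb hBs (sub0mx _ _) bA AX.
rewrite /algorithm => ->.
have /andP[EA1 EA2] := EA.
exists [seq RE (matrix.row i E) | i <- enum 'I_r]; split=> //.
  have rE i : exists2 f, Mkk f & crow f = matrix.row i E.
    by apply: (sub_crow hb); exact: submx_trans (row_sub _ _) EA1.
  apply: basis_over_fam => [i|_ [f fM <-]|a a0 i].
  - by have [f fM fE] := rE i; exists f => //; rewrite -fE row_expansion_crow.
  - have /submxP[D DE] : (crow f <= E)%MS by exact: submx_trans (crow_sub hb fM) EA2.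
    exists (fun i => D 0 i); rewrite -row_expansion_crow // DE mulmx_sum_row.
    by rewrite row_expansion_sum.
  - move: a0; rewrite -row_expansion_sum => /row_expansion_inj a0.
    have e : (\row_i a i) *m E = 0.
      by rewrite mulmx_sum_row -[RHS]a0; apply: eq_bigr => j _; rewrite mxE.
    have : \row_i a i = 0 by apply/eqP; rewrite -(mulmx_free_eq0 _ (rref_row_free hE)) e.
    by move/matrix.rowP/(_ i); rewrite !mxE.
have Fp (i : 'I_r) : FE_trunc P V0 (RE (matrix.row i E)).
  split.
  - exists N, 0%N; split; first exact: Np.
    move=> q qn; have [[n qE]|no] := pselect (exists n : 'I_nx, q = n%:R / N%:R); first by exists n; rewrite subr0.
    move: qn; rewrite row_expansion_off ?eqxx // => n; apply/eqP => e; apply: no; by exists n.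
  - move=> q; apply/V0E => j; rewrite /row_expansion big_mkcond coords_sum; apply: (Ksum HK) => n.
    case: ifP => _; last by rewrite coords0; exact: K0.
    by rewrite (coords_comb Vu) !mxE; apply: (rref_entries_K hb hE EA).
  - move=> q Pq; apply: row_expansion_off => n; apply/eqP => qE.
    by have := ltn_ord n; rewrite nexpP -qE ltNge Pq.
by move=> i; have /mapP[j _ ->] := mem_nth 0 (ltn_ord i).
Qed.

End AlgorithmCorrectness.

Section TupleBases.
Variables (R : realType) (d : nat).
Local Notation C := (Cplx R).
Local Notation V := 'cV[C]_d.

Lemma basis_over_tuple (K : set C) (S : set V) (v : d.-tuple V) : basis_over K S v ->
  (forall j, S (tnth v j)) /\
  forall w, S w -> exists2 a : 'I_d -> C, (forall j, K (a j)) & w = \sum_j a j *: tnth v j.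
Proof.
move=> [h1 h2 _]; have sz : d = size v by rewrite size_tuple.
have vE j : tnth v j = v`_(cast_ord sz j) by rewrite (tnth_nth 0).
split=> [j|w /h2[a Ka ->]]; first by rewrite vE; exact: h1.
exists (fun j => a (cast_ord sz j)) => //.
rewrite (reindex (cast_ord sz)) /=; last by exists (cast_ord (esym sz)) => i _; rewrite ?cast_ordK ?cast_ordKV.
by apply: eq_bigr => j _; rewrite vE.
Qed.

Lemma spanning_unitmx (v : d.-tuple V) :
  (forall w : V, exists a : 'I_d -> C, w = \sum_j a j *: tnth v j) ->
  (\matrix_(i, j) tnth v j i 0 : 'M[C]_d) \in unitmx.
Proof.
move=> sp; pose a i := sval (cid (sp (delta_mx i 0))); have aP i := svalP (cid (sp (delta_mx i 0))).
suff /mulmx1_unit[] : (\matrix_(i, j) tnth v j i 0 : 'M[C]_d) *m (\matrix_(j, i) a i j) = 1%:M by [].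
apply/matrixP => r i; have := congr1 (fun w : V => w r 0) (aP i); rewrite mxE eqxx andbT => e.
rewrite [RHS]mxE [LHS]mxE e summxE; apply: eq_bigr => j _; rewrite !mxE mulrC //.
Qed.

End TupleBases.

Theorem theorem2p2 (R : realType) (k : nat) (hk : (2 <= k)%N)
  (Gam : set 'M[int]_2) (hGam : is_subgroup Gam) (hfin : finite_index Gam)
  (d : nat) (rho : 'M[int]_2 -> 'M[Cplx R]_d) (hrho : is_repr Gam rho)
  (N : nat) (hN : is_level Gam rho N)
  (V0 : set 'cV[Cplx R]_d) (hV0 : Qab_structure Gam rho V0)
  (P : rat)
  (hP : forall f g, Mk Gam rho k f -> Mk Gam rho k g ->
          fe_trunc P f = fe_trunc P g -> f = g)
  (l : nat) (hl : (1 <= l <= k - 1)%N)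
  (N0 : nat) (hN0 : (0 < N0)%N) (hdvd : (N %| N0)%N)
  (hspan : Mk Gam rho k =
     [set Phi1 k N x + Phi2 k l N0 y | x in H0_1 Gam rho N setT
                                     & y in H0_2 Gam rho N0 setT])
  (v : d.-tuple 'cV[Cplx R]_d) (hv : basis_over (@Qab R) V0 v)
  (* the blocks B_1, ..., B_I of the partition of the basis flatten Bs *)
  (Bs : seq (seq (tensor1 R d * tensor2 R d))) (hBs : (0 < size Bs)%N)
  (hbasis : basis_over (@Qab R) (H0sum Gam rho N N0 V0) (flatten Bs)) :
  exists out : seq (rat -> 'cV[Cplx R]_d),
    [/\ algorithm Gam rho k l N N0 P v Bs = Some out,
        basis_over setT [set fe_trunc P f | f in Mk Gam rho k] out &
        forall i : 'I_(size out), FE_trunc P V0 out`_i].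
Proof.
have [[V00 V0D V0Z] V0rho [b bK bC]] := hV0.
have [v0 vsp] := basis_over_tuple hv.
(* The vectors of b span C^d and, lying in V0, are combinations of v. So the d vectors of v span C^d
   and form an invertible matrix. *)
have Vu : (\matrix_(i, j) tnth v j i 0 : 'M[Cplx R]_d) \in unitmx.
  apply: spanning_unitmx => w; have [b0 _ _] := bK; have [_ bs _] := bC.
  have [c _ ->] := bs w I.
  have ex (i : 'I_(size b)) : exists a : 'I_d -> Cplx R, b`_i = \sum_j a j *: tnth v j.
    by have [a _ ->] := vsp _ (b0 i); exists a.
  pose a i := sval (cid (ex i)); have aP i := svalP (cid (ex i)).
  exists (fun j => \sum_i c i * a i j).
  under [RHS]eq_bigr => j _ do rewrite scaler_suml.
  rewrite exchange_big; apply: eq_bigr => i _; rewrite [in LHS]aP scaler_sumr.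
  by apply: eq_bigr => j _; rewrite scalerA.
have V0co w j : V0 w -> Qab (coords v w j 0).
  by move=> /vsp[a Ka ->]; rewrite coords_comb.
case: (posnP d) => [d0|dp].
  (* Here V0 says nothing about Q^ab, but any coefficient field will do. *)
  have all0 (w : 'cV[Cplx R]_d) : w = 0 by apply/matrixP => i; have := ltn_ord i; rewrite [X in (_ < X)%N]d0.
  apply: (algorithm_correct (setT_Kfield R) hk hN Vu _ V0rho hP hl hN0 hdvd hspan hBs) => [w|].
    by rewrite (all0 w).
  (* All tensors are 0 here, so independence over Q^ab forces the basis to be empty, and
     independence over C follows. *)
  case: hbasis => h1 h2 h3; split=> // [w /h2[a _ ->]|a _ _ i]; first by exists a.
  have Q1 : Qab (1 : Cplx R) by have := @Qab_ratr R 1; rewrite rmorph1.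
  have : \sum_(j < size (flatten Bs)) (1 : Cplx R) *: (flatten Bs)`_j = 0.
    apply: big1 => j _; case: (_ *: _) => x y; congr (_, _); apply/funext => s; exact: all0.
  by move=> /(h3 (fun _ => 1) (fun _ => Q1))/(_ i)/eqP; rewrite oner_eq0.
(* That Q^ab is closed under sums and products is read off from its action on V0. *)
have V0scale (x : Cplx R) : V0 (x *: tnth v (Ordinal dp)) -> Qab x.
  move=> /(V0co _ (Ordinal dp)); rewrite coordsZ.
  have -> : tnth v (Ordinal dp) = \sum_j (j == Ordinal dp)%:R *: tnth v j.
    by rewrite (bigD1 (Ordinal dp)) //= ?eqxx scale1r big1 ?addr0 // => j /negPf ->; rewrite scale0r.
  by rewrite coords_comb // eqxx mulr1.
have HK : Kfield (@Qab R).
  apply: Qab_Kfield => x y hx hy; apply: V0scale.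
    by rewrite scalerDl; apply: V0D; exact: V0Z.
  by rewrite -scalerA; exact: (V0Z _ _ hx (V0Z _ _ hy (v0 _))).
apply: (algorithm_correct HK hk hN Vu _ V0rho hP hl hN0 hdvd hspan hBs hbasis) => w.
split=> [h j|h]; first exact: V0co.
by rewrite [w](coordsE Vu); elim/big_ind: _ => // j _; exact: V0Z.
Qed.
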